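(* Let $N'\ge2$, $\mathcal{M}^{(D)}=\mathbb{R}^{N'+1}\times\mathbb{R}_{>0}^{N'+1}$ with Poisson structure $J^{(D)}$, Casimirs $E_1,E_2$ and Hamiltonian $H^{(D)}$ as in the context, and let $\mathcal{P}^{(D)}=\mathbb{R}^{2N'}\times\mathbb{R}\times\mathbb{R}_{>0}$ with the Poisson structure $J^{(D)}_0$ whose symplectic leaves are $\mathbb{R}^{2N'}\times\{\delta\}\times\{\gamma\}$ with the canonical symplectic structure. There exists a map \[ \Phi^{(D)}:(\mathcal{M}^{(D)},J^{(D)})\to(\mathcal{P}^{(D)},J^{(D)}_0),\quad (d,c)\mapsto((x_n,y_n)_{1\le n\le N'},E_1,E_2) \] such that: $\Phi^{(D)}$ is a real analytic diffeomorphism; $\Phi^{(D)}$ is canonical, i.e. preserves Poisson brackets (in particular the symplectic foliation of $\mathcal{M}^{(D)}$ by the level sets $\{(E_1,E_2)=(\delta,\gamma)\}$ is trivial); and $H^{(D)}\circ(\Phi^{(D)})^{-1}$ is a function of the actions $(x_n^2+y_n^2)/2$ ($1\le n\le N'$) and of $E_1,E_2$ alone.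
   Context: Points of $\mathcal{M}^{(D)}$ are $(d,c)=(d_n,c_n)_{0\le n\le N'}$. The Poisson structure is $J^{(D)}=\begin{pmatrix}0&A^{(D)}\\-(A^{(D)})^T&0\end{pmatrix}$, i.e. $\{F,G\}=\langle\nabla_dF,A^{(D)}\nabla_cG\rangle-\langle\nabla_cF,(A^{(D)})^T\nabla_dG\rangle$, where $A^{(D)}$ is the $(N'+1)\times(N'+1)$ matrix (rows/columns indexed $0,\dots,N'$) with zero first row and, for $1\le n\le N'$, row $n$ having entry $-c_{n-1}/2$ in column $n-1$, entry $c_n/2$ in column $n$, and zeros elsewhere. Casimirs: $E_1=d_0$, $E_2=(\prod_{n=0}^{N'}c_n)^{1/(N'+1)}$. Hamiltonian: $H^{(D)}=\frac12\sum_{n=1}^{N'}d_n^2+\sum_{n=0}^{N'}c_n^2$. (These are Flaschka variables $d_n=-p_n$, $c_n=\gamma e^{(q_n-q_{n+1})/2}$ for the Toda lattice with $N'$ particles and Dirichlet boundary conditions.) *)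

(* Defs.v *)
From HB Require Import structures.
From mathcomp Require Import all_boot all_order all_algebra.
From mathcomp Require Import all_classical all_reals all_analysis.
Set Implicit Arguments. Unset Strict Implicit. Unset Printing Implicit Defensive.
Import Order.TTheory GRing.Theory Num.Theory.
Import numFieldNormedType.Exports.
Local Open Scope classical_set_scope.
Local Open Scope ring_scope.

Section Defs.
Variable R : realType.

Definition boxsum (m K : nat) (g : {ffun 'I_m -> nat} -> R) : R :=
  \sum_(al : {ffun 'I_m -> 'I_K.+1}) g [ffun i => nat_of_ord (al i)].

Definition monom (m : nat) (y x : 'rV[R]_m) (al : {ffun 'I_m -> nat}) : R :=
  \prod_(i < m) (y ord0 i - x ord0 i) ^+ al i.

Definition analytic_at (m : nat) (f : 'rV[R]_m -> R) (x : 'rV[R]_m) : Prop :=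
  exists r : R, 0 < r /\
  exists a : {ffun 'I_m -> nat} -> R,
    forall y : 'rV[R]_m, (forall i, `|y ord0 i - x ord0 i| < r) ->
      (exists B : R, forall K, boxsum K (fun al => `|a al * monom y x al|) <= B) /\
      ((fun K => boxsum K (fun al => a al * monom y x al)) @ \oo --> f y).

Definition analytic_on (m k : nat) (U : set 'rV[R]_m) (F : 'rV[R]_m -> 'rV[R]_k) : Prop :=
  forall x, U x -> forall j : 'I_k, analytic_at (fun z => F z ord0 j) x.

Definition pd (m : nat) (f : 'rV[R]_m -> R) (x : 'rV[R]_m) (i : 'I_m) : R :=
  derive f x (delta_mx ord0 i).

Definition dco (n : nat) (k : 'I_n.+1) : 'I_(n.+1 + n.+1) := lshift n.+1 k.
Definition cco (n : nat) (k : 'I_n.+1) : 'I_(n.+1 + n.+1) := rshift n.+1 k.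
Definition dv (n : nat) (z : 'rV[R]_(n.+1 + n.+1)) (k : 'I_n.+1) : R := z ord0 (dco k).
Definition cv (n : nat) (z : 'rV[R]_(n.+1 + n.+1)) (k : 'I_n.+1) : R := z ord0 (cco k).

Definition MD (n : nat) : set 'rV[R]_(n.+1 + n.+1) :=
  [set z | forall k : 'I_n.+1, 0 < cv z k].

Definition AD (n : nat) (z : 'rV[R]_(n.+1 + n.+1)) : 'M[R]_n.+1 :=
  \matrix_(i < n.+1, j < n.+1)
    if (i == 0 :> nat) then 0
    else if (j == i.-1 :> nat) then - (cv z j) / 2
    else if (j == i :> nat) then cv z j / 2
    else 0.

Definition bracketD (n : nat) (F G : 'rV[R]_(n.+1 + n.+1) -> R) (z : 'rV[R]_(n.+1 + n.+1)) : R :=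
  \sum_(i < n.+1) \sum_(j < n.+1) pd F z (dco i) * AD z i j * pd G z (cco j)
  - \sum_(i < n.+1) \sum_(j < n.+1) pd F z (cco i) * AD z j i * pd G z (dco j).

Definition E1 (n : nat) (z : 'rV[R]_(n.+1 + n.+1)) : R := dv z ord0.
Definition E2 (n : nat) (z : 'rV[R]_(n.+1 + n.+1)) : R :=
  (\prod_(k < n.+1) cv z k) `^ (n.+1%:R)^-1.

Definition HD (n : nat) (z : 'rV[R]_(n.+1 + n.+1)) : R :=
  2^-1 * (\sum_(k < n.+1 | k != ord0) dv z k ^+ 2) + \sum_(k < n.+1) cv z k ^+ 2.

(* a point is q : 'rV_((N'+N')+2); x_{k+1} = q(lshift(lshift k)), y_{k+1} = q(lshift(rshift k)),
   delta = q(rshift 0), gamma = q(rshift 1) *)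
Definition xco (n : nat) (k : 'I_n) : 'I_(n + n + 2) := lshift 2 (lshift n k).
Definition yco (n : nat) (k : 'I_n) : 'I_(n + n + 2) := lshift 2 (rshift n k).
Definition deltaco (n : nat) : 'I_(n + n + 2) := rshift (n + n) (0 : 'I_2).
Definition gammaco (n : nat) : 'I_(n + n + 2) := rshift (n + n) (1 : 'I_2).

Definition PD (n : nat) : set 'rV[R]_(n + n + 2) :=
  [set q | 0 < q ord0 (gammaco n)].

Definition bracket0 (n : nat) (F G : 'rV[R]_(n + n + 2) -> R) (q : 'rV[R]_(n + n + 2)) : R :=
  \sum_(k < n) (pd F q (xco k) * pd G q (yco k) - pd F q (yco k) * pd G q (xco k)).

Definition action (n : nat) (q : 'rV[R]_(n + n + 2)) (k : 'I_n) : R :=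
  (q ord0 (xco k) ^+ 2 + q ord0 (yco k) ^+ 2) / 2.

End Defs.

(* Main.v *)
(* With [gamma = E_2], the rescaled variables [q_k = -2 \sum_(j < k) ln (c_j / gamma)],
   [p_k = - d_k / gamma] reduce the problem to the canonical space of the [(q, p)],
   with [gamma = 1]. Follow the chain by a site at rest and by its mirror
   image: the first row [(a, b)] of its transfer matrix satisfies [a] odd and
   [x a(x) + b(x) + b(-x) = D(x^2)], where the coefficients of [D] are integrals in
   involution, one of them [- 2 H]. The positive roots [lam_k] of [a] and the
   [nu_k = ln |b(lam_k)|] are canonical by the r-matrix relation, and
   [D(lam_k^2) = +- 2 cosh nu_k].
   On the k-th gap of [D], between two consecutive roots, this reads
   [U_k^2 + V_k^2 = rho_k^2] with [V_k = sinh (nu_k / 2)] and with [U_k] an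
   analytic coordinate of [lam_k]. So rotating [(U_k, V_k)] yields a loop,
   which is constant but still well defined where [rho_k = 0]. The action [I_k] is the
   mean of [nu dlam] along the loop and the angle comes from an explicit
   generating function; then [(X_k, Y_k)], of square norm [2 I_k] and
   proportional to a rotation of [(V_k, U_k)], is canonical and analytic.
   The actions bound the lengths of the gaps, hence the energy, so the map is
   proper; it is a local diffeomorphism; and the origin has one preimage, since
   all actions vanish only at the equilibrium. Hence it is bijective. Finally [H]
   commutes with the actions, so in these coordinates it is invariant under the
   rotations of each plane. *)

(* The obstacle is the locus where some [rho_k] vanishes: the classical cycle shrinks to a point,
   the angle is undefined and the square root of the action is not smooth. So each loop is
   parametrized by a rotation angle over the fixed interval [[0, 2 pi]], inside an interval between
   roots of [D], which never closes. Then [I_k = rho_k^2 J_k] with [J_k > 0] analytic, and only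
   [sqrt (2 J_k)] enters the coordinates. If [nu dlam] is averaged along the loop with a weight that
   grows by [2 pi], integration by parts leaves [nu dlam] at the actual point plus a combination of
   the differentials of the coefficients of [D], which the invertible matrix [dI/dH] turns into
   differentials of actions. Hence [sum nu dlam - sum (X dY - Y dX) / 2] is exact on the whole phase
   space, and canonicity holds also where no angle exists. [D] is the trace of the monodromy of a
   periodic chain of [2 n + 2] sites: the doubled chain closed by one more site at rest. Analyticity
   is expressed by norm bounds on approximating polynomials, so that Picard iterates, Riemann sums
   and quotients are treated without touching coefficients. *)
Require Import Defs.
From HB Require Import structures.
From mathcomp Require Import all_boot all_order all_algebra.
From mathcomp Require Import all_classical all_reals all_analysis.
From mathcomp Require Import ring lra zify.
From mathcomp Require polyrcf.
Import Order.TTheory GRing.Theory Num.Theory.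
Import numFieldNormedType.Exports.
Local Open Scope classical_set_scope.
Local Open Scope ring_scope.
Set Implicit Arguments.
Unset Strict Implicit.
Unset Printing Implicit Defensive.

(** * Real analytic functions *)

Section PolynomialBounds.
Variables (R : realType).
Implicit Types (I J : finType).

(* [bpoly r C p]: [p] is a polynomial whose coefficients satisfy
   [\sum_al |p_al| r^al <= C]. *)
Inductive bpoly {I : finType} (r : I -> R) : R -> ((I -> R) -> R) -> Prop :=
| poly_const c : bpoly r `|c| (fun=> c)
| poly_var i : bpoly r (r i) (fun h => h i)
| poly_add C D p q : bpoly r C p -> bpoly r D q ->
    bpoly r (C + D) (fun h => p h + q h)
| poly_mul C D p q : bpoly r C p -> bpoly r D q ->
    bpoly r (C * D) (fun h => p h * q h).

Lemma eqW (a b : R) : a = b -> a <= b.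
Proof. by move=> ->. Qed.

Lemma poly_ext I (r : I -> R) C p q : bpoly r C p -> p =1 q -> bpoly r C q.
Proof. by move=> pp /funext <-. Qed.

Lemma poly_le I (r s : I -> R) C p : (forall i, 0 <= s i <= r i) ->
  bpoly r C p -> exists2 C', 0 <= C' <= C & bpoly s C' p.
Proof.
move=> sr; elim=> [c|i|{}C D {}p q _ [C' C'C pp] _ [D' D'D pq]
  |{}C D {}p q _ [C' C'C pp] _ [D' D'D pq]].
- by exists `|c|; [rewrite normr_ge0 lexx|exact: poly_const].
- by exists (s i); [|exact: poly_var].
- by exists (C' + D'); [move: C'C D'D => /andP[? ?] /andP[? ?]; lra|exact: poly_add].
- exists (C' * D'); last exact: poly_mul.
  by move: C'C D'D => /andP[? ?] /andP[? ?]; rewrite mulr_ge0//= ler_pM.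
Qed.

Lemma poly_ge0 I (r : I -> R) C p : (forall i, 0 <= r i) -> bpoly r C p -> 0 <= C.
Proof.
move=> r0 pp; have [|C' /andP[C'0 C'C] _] := @poly_le I r r C p _ pp; last exact: le_trans C'0 C'C.
by move=> i; rewrite r0 lexx.
Qed.

Lemma poly_bound I (r : I -> R) C p h : (forall i, `|h i| <= r i) ->
  bpoly r C p -> `|p h| <= C.
Proof.
move=> hr; elim=> [c|i|{}C D {}p q _ IHp _ IHq|{}C D {}p q _ IHp _ IHq] //.
- by rewrite (le_trans (ler_normD _ _))// lerD.
- by rewrite normrM ler_pM.
Qed.

Lemma poly_cont I (r : I -> R) C p h e : bpoly r C p -> 0 < e ->
  exists2 d, 0 < d & forall h', (forall i, `|h' i - h i| <= d) -> `|p h' - p h| <= e.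
Proof.
move=> pp; elim: pp e => [c|i|{}C D {}p q _ IHp _ IHq|{}C D {}p q _ IHp _ IHq] e e0.
- by exists 1 => // h' _; rewrite subrr normr0 ltW.
- by exists e => // h' /(_ i).
- have e2 : 0 < e / 2 by lra.
  have [d1 d10 H1] := IHp _ e2; have [d2 d20 H2] := IHq _ e2.
  exists (Num.min d1 d2); first by rewrite lt_min d10.
  move=> h' hh'; rewrite opprD addrACA (le_trans (ler_normD _ _))//.
  rewrite [leRHS](splitr e) lerD//; [apply: H1|apply: H2] => i;
  by rewrite (le_trans (hh' i))// ge_min lexx ?orbT.
- have P0 : 0 < `|q h| + 1 by rewrite ltr_wpDl.
  have Q0 : 0 < `|p h| + 1 by rewrite ltr_wpDl.
  have e1 : 0 < Num.min 1 (e / 2 / (`|q h| + 1)).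
    by rewrite lt_min ltr01 !divr_gt0.
  have e2 : 0 < Num.min 1 (e / 2 / (`|p h| + 1)).
    by rewrite lt_min ltr01 !divr_gt0.
  have [d1 d10 H1] := IHp _ e1; have [d2 d20 H2] := IHq _ e2.
  exists (Num.min d1 d2); first by rewrite lt_min d10.
  move=> h' hh'.
  have {}H1 : `|p h' - p h| <= Num.min 1 (e / 2 / (`|q h| + 1)).
    by apply: H1 => i; rewrite (le_trans (hh' i))// ge_min lexx.
  have {}H2 : `|q h' - q h| <= Num.min 1 (e / 2 / (`|p h| + 1)).
    by apply: H2 => i; rewrite (le_trans (hh' i))// ge_min lexx orbT.
  have {IHp IHq hh'} -> : p h' * q h' - p h * q h = (p h' - p h) * q h' + p h * (q h' - q h).
    by ring.
  rewrite (le_trans (ler_normD _ _))// !normrM [leRHS](splitr e) lerD//.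
    move: H1; rewrite le_min => /andP[_]; rewrite ler_pdivlMr// => H1.
    rewrite (le_trans _ H1)// ler_wpM2l//.
    move: H2; rewrite le_min => /andP[H2 _].
    by rewrite -[q h'](subrK (q h)) (le_trans (ler_normD _ _))// addrC lerD.
  move: H2; rewrite le_min => /andP[_]; rewrite ler_pdivlMr// => H2.
  by rewrite mulrC (le_trans _ H2)// ler_wpM2l// lerDl.
Qed.

Lemma poly_subst I J (s : J -> R) (r : I -> R) C p (D : J -> R) g :
  (forall i, 0 <= r i) -> (forall j, 0 <= D j <= s j) ->
  (forall j, bpoly r (D j) (g j)) -> bpoly s C p ->
  exists2 C', C' <= C & bpoly r C' (fun h => p (fun j => g j h)).
Proof.
move=> r0 Ds pg; elim=> [c|j|{}C E {}p q _ [C' C'C pp] _ [D' D'D pq]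
  |{}C E {}p q _ [C' C'C pp] _ [D' D'D pq]].
- by exists `|c| => //; exact: poly_const.
- by exists (D j); [case/andP: (Ds j)|exact: pg].
- by exists (C' + D'); [rewrite lerD|exact: poly_add].
- by exists (C' * D'); [apply: ler_pM => //; [exact: poly_ge0 r0 pp|exact: poly_ge0 r0 pq]|exact: poly_mul].
Qed.

(** A Schwarz lemma: without its constant term every monomial carries at least one factor [t].
    Subtracting [|p 0|] inside the bound is what lets the product case close, since [(C - |p 0|) D +
    |p 0| (D - |q 0|) = C D - |p 0| |q 0|]. *)
Lemma poly_shrink I (r : I -> R) C p t : (forall i, 0 <= r i) -> 0 <= t <= 1 ->
  bpoly r C p ->
  exists2 C', 0 <= C' <= t * (C - `|p (fun=> 0)|) &
    bpoly (fun i => t * r i) C' (fun h => p h - p (fun=> 0)).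
Proof.
move=> r0 t01.
have tr i : 0 <= t * r i <= r i.
  by case/andP: t01 => ? ?; rewrite mulr_ge0//= ler_piMl.
have [t0 t1] := andP t01.
elim=> [c|i|{}C D {}p q pp [C' /andP[C'0 C'C] pp'] pq [D' /andP[D'0 D'D] pq']
  |{}C D {}p q pp [C' /andP[C'0 C'C] pp'] pq [D' /andP[D'0 D'D] pq']].
- exists 0; first by rewrite /= subrr mulr0 lexx.
  have := poly_const (fun i => t * r i) 0; rewrite normr0 => H.
  by apply: poly_ext H _ => h; rewrite /= subrr.
- exists (t * r i); first by rewrite /= normr0 subr0 lexx andbT mulr_ge0.
  apply: poly_ext (poly_var _ i) _ => h; by rewrite subr0.
- exists (C' + D'); last by apply: poly_ext (poly_add pp' pq') _ => h; ring.
  rewrite addr_ge0//= (le_trans (lerD C'C D'D))// -mulrDr ler_wpM2l//.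
  have := ler_normD (p (fun=> 0)) (q (fun=> 0)); lra.
- have [D1 /andP[D10 D1D] pq1] := poly_le tr pq.
  exists (C' * D1 + `|p (fun=> 0)| * D'); last first.
    apply: poly_ext (poly_add (poly_mul pp' pq1)
      (poly_mul (poly_const _ (p (fun=> 0))) pq')) _ => h; ring.
  rewrite addr_ge0 ?mulr_ge0//= normrM.
  have H1 : C' * D1 <= t * (C - `|p (fun=> 0)|) * D by rewrite ler_pM.
  have H2 : `|p (fun=> 0)| * D' <= `|p (fun=> 0)| * (t * (D - `|q (fun=> 0)|)).
    by rewrite ler_wpM2l.
  apply: le_trans (lerD H1 H2) _; nra.
Qed.

Definition upd (I : finType) (h : I -> R) (i : I) (t : R) : I -> R :=
  fun k => if k == i then t else h k.

(** Division by a variable without loss in the norm: [c0 + r i * c1 <= C] yields [c1 <= C / r i],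
    the bound that survives in [An_div]. *)
Lemma poly_div I (r : I -> R) C p i : (forall i, 0 <= r i) -> bpoly r C p ->
  exists p0 q c0 c1, [/\ bpoly r c0 p0, bpoly r c1 q, c0 + r i * c1 <= C,
   (forall h, p0 h = p (upd h i 0)) & (forall h, p h = p0 h + h i * q h)].
Proof.
move=> r0; elim=> [c|k|{}C D {}p q _ [p0 [p1 [c0 [c1 [P0 P1 cC E0 E1]]]]]
     _ [q0 [q1 [d0 [d1 [Q0 Q1 dD F0 F1]]]]]
  |{}C D {}p q pp [p0 [p1 [c0 [c1 [P0 P1 cC E0 E1]]]]]
     pq [q0 [q1 [d0 [d1 [Q0 Q1 dD F0 F1]]]]]].
- exists (fun=> c), (fun=> 0), `|c|, `|0 : R|; split; [exact: poly_const|exact: poly_const| | |].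
  + by rewrite normr0 mulr0 addr0.
  + by [].
  + by move=> h; rewrite mulr0 addr0.
- have [->|ki] := eqVneq k i.
    exists (fun=> 0), (fun=> 1), `|0 : R|, `|1 : R|; split; [exact: poly_const|exact: poly_const| | |].
    + by rewrite normr0 normr1 mulr1 add0r.
    + by move=> h; rewrite /upd eqxx.
    + by move=> h; rewrite mulr1 add0r.
  exists (fun h => h k), (fun=> 0), (r k), `|0 : R|; split; [exact: poly_var|exact: poly_const| | |].
  + by rewrite normr0 mulr0 addr0.
  + by move=> h; rewrite /upd (negbTE ki).
  + by move=> h; rewrite mulr0 addr0.
- exists (fun h => p0 h + q0 h), (fun h => p1 h + q1 h), (c0 + d0), (c1 + d1).
  split; [exact: poly_add|exact: poly_add| | |].
  + by rewrite mulrDr addrACA lerD.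
  + by move=> h; rewrite E0 F0.
  + by move=> h; rewrite E1 F1; ring.
- exists (fun h => p0 h * q0 h), (fun h => p1 h * q h + p0 h * q1 h), (c0 * d0), (c1 * D + c0 * d1).
  split.
  + exact: poly_mul.
  + by apply: poly_add; apply: poly_mul.
  + have c00 := poly_ge0 r0 P0; have c10 := poly_ge0 r0 P1.
    have D0 := poly_ge0 r0 pq.
    have H1 : c0 * (d0 + r i * d1) <= c0 * D by rewrite ler_wpM2l.
    have H2 : (c0 + r i * c1) * D <= C * D by rewrite ler_wpM2r.
    by apply: le_trans H2; rewrite mulrDl; apply: le_trans (lerD H1 (lexx _)); rewrite le_eqVlt; apply/orP; left; apply/eqP; ring.
  + by move=> h; rewrite E0 F0.
  + by move=> h; rewrite E1 mulrDl mulrDr F1; ring.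
Qed.

Lemma poly_sum I (r : I -> R) (K : Type) (s : seq K) (P : pred K) (C : K -> R) p :
  (forall k, bpoly r (C k) (p k)) ->
  bpoly r (\sum_(k <- s | P k) C k) (fun h => \sum_(k <- s | P k) p k h).
Proof.
move=> pp; elim: s => [|k s IH].
  have := poly_const r 0; rewrite normr0 big_nil => H.
  by apply: poly_ext H _ => h; rewrite big_nil.
rewrite big_cons; case: ifPn => Pk.
  apply: poly_ext (poly_add (pp k) IH) _ => h.
  by rewrite big_cons Pk.
by apply: poly_ext IH _ => h; rewrite big_cons (negbTE Pk).
Qed.

Lemma poly_prod I (r : I -> R) (K : Type) (s : seq K) (P : pred K) (C : K -> R) p :
  (forall k, bpoly r (C k) (p k)) ->
  bpoly r (\prod_(k <- s | P k) C k) (fun h => \prod_(k <- s | P k) p k h).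
Proof.
move=> pp; elim: s => [|k s IH].
  have := poly_const r 1; rewrite normr1 big_nil => H.
  by apply: poly_ext H _ => h; rewrite big_nil.
rewrite big_cons; case: ifPn => Pk.
  apply: poly_ext (poly_mul (pp k) IH) _ => h.
  by rewrite big_cons Pk.
by apply: poly_ext IH _ => h; rewrite big_cons (negbTE Pk).
Qed.

Lemma poly_exp I (r : I -> R) C p n :
  bpoly r C p -> bpoly r (C ^+ n) (fun h => p h ^+ n).
Proof.
move=> pp; elim: n => [|n IH].
  by have := poly_const r 1; rewrite normr1.
by rewrite exprS; apply: poly_ext (poly_mul pp IH) _ => h; rewrite exprS.
Qed.

Definition mon (I : finType) (h : I -> R) (al : {ffun I -> nat}) : R := \prod_i h i ^+ al i.

Lemma poly_mon I (r : I -> R) c al :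
  bpoly r (`|c| * mon r al) (fun h => c * mon h al).
Proof.
apply: (@poly_mul _ _ _ _ (fun=> c) _); first exact: poly_const.
by apply: poly_prod => i; apply: poly_exp; exact: poly_var.
Qed.

Lemma monD I (h : I -> R) (al be : {ffun I -> nat}) :
  mon h [ffun i => (al i + be i)%N] = mon h al * mon h be.
Proof. by rewrite /mon -big_split/=; apply: eq_bigr => i _; rewrite ffunE exprD. Qed.

(** A multi-index may occur several times in the list; collecting equal ones later with [cof] can
    only decrease the norm. *)
Lemma poly_terms I (r : I -> R) C p : (forall i, 0 <= r i) -> bpoly r C p ->
  exists s : seq (R * {ffun I -> nat}),
    \sum_(t <- s) `|t.1| * mon r t.2 <= C /\
    forall h, p h = \sum_(t <- s) t.1 * mon h t.2.
Proof.
move=> r0; elim=> [c|i|{}C D {}p q _ [s [sC ps]] _ [t [tD qt]]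
  |{}C D {}p q _ [s [sC ps]] _ [t [tD qt]]].
- exists [:: (c, [ffun=> 0%N])]; rewrite big_seq1/=.
  have E h : mon h [ffun=> 0%N] = 1.
    by rewrite /mon big1// => i _; rewrite ffunE expr0.
  by split=> [|h]; rewrite ?big_seq1/= E mulr1.
- exists [:: (1, [ffun j => (j == i) : nat])]; rewrite big_seq1/=.
  have E h : mon h [ffun j => (j == i) : nat] = h i.
    rewrite /mon (bigD1 i)//= ffunE eqxx expr1 big1 ?mulr1// => j ji.
    by rewrite ffunE (negbTE ji) expr0.
  by split=> [|h]; rewrite ?big_seq1/= E ?normr1 mul1r.
- exists (s ++ t); rewrite big_cat/= lerD//; split=> // h.
  by rewrite big_cat/= ps qt.
- exists [seq (x.1 * y.1, [ffun i => (x.2 i + y.2 i)%N]) |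
    x : R * {ffun I -> nat} <- s, y : R * {ffun I -> nat} <- t].
  have M0 (be : {ffun I -> nat}) : 0 <= mon r be by apply: prodr_ge0 => i _; exact: exprn_ge0.
  split=> [|h]; rewrite big_allpairs_dep/=.
    have -> : \sum_(i <- s) \sum_(j <- t) `|i.1 * j.1| * mon r [ffun k => (i.2 k + j.2 k)%N] =
       (\sum_(t <- s) `|t.1| * mon r t.2) * (\sum_(t <- t) `|t.1| * mon r t.2).
      rewrite mulr_suml; apply: eq_bigr => x _; rewrite mulr_sumr; apply: eq_bigr => y _.
      by rewrite monD normrM; ring.
    by rewrite ler_pM// sumr_ge0// => x _; rewrite mulr_ge0.
  rewrite ps qt mulr_suml; apply: eq_bigr => x _; rewrite mulr_sumr; apply: eq_bigr => y _.
  by rewrite monD; ring.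
Qed.

End PolynomialBounds.

Section PowerSeries.
Variables (R : realType).
Implicit Types (I J : finType).

Definition shf (I : finType) (x y : I -> R) : I -> R := fun i => y i - x i.

Definition box (I : finType) (x r y : I -> R) := forall i, `|y i - x i| <= r i.

(* [f] is, on [Y], a pointwise limit of polynomials in [y - x] of norm at most
   [C]; for [Y = box x r] this amounts to [f] being the sum of a power series
   with [\sum_al |a_al| r^al <= C] (see [apx_series]), but is a much more
   convenient form: it is stable under pointwise limits. *)
Definition apx (I : finType) (Y : (I -> R) -> Prop) (x r : I -> R) C
    (f : (I -> R) -> R) :=
  forall (ys : seq (I -> R)) (e : R), 0 < e -> (forall y : I -> R, y \in ys -> Y y) ->
  exists p C', [/\ C' <= C, bpoly r C' p &
    forall y : I -> R, y \in ys -> `|p (shf x y) - f y| <= e].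

Definition bs (I : finType) (K : nat) (g : {ffun I -> nat} -> R) : R :=
  \sum_(al : {ffun I -> 'I_K.+1}) g [ffun i => nat_of_ord (al i)].

Definition cof (I : finType) (l : seq (R * {ffun I -> nat})) (al : {ffun I -> nat}) : R :=
  \sum_(t <- l | t.2 == al) t.1.

Lemma bs_pick I K (be : {ffun I -> nat}) (c : R) :
  bs K (fun al => if be == al then c else 0) = if [forall i, (be i <= K)%N] then c else 0.
Proof.
rewrite /bs; case: ifPn => [/forallP bK|].
  pose al0 : {ffun I -> 'I_K.+1} := [ffun i => inord (be i)].
  have E : be = [ffun i => nat_of_ord (al0 i)].
    by apply/ffunP => i; rewrite !ffunE inordK// ltnS.
  rewrite (bigD1 al0)//= -E eqxx big1 ?addr0// => al aln.
  case: eqP => // Eal; case/eqP: aln; apply/ffunP => i.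
  by apply: val_inj; rewrite /= ffunE Eal ffunE inordK.
rewrite negb_forall => /existsP[i bi]; apply: big1 => al _.
by case: eqP => // E; move: bi; rewrite E ffunE -ltnNge ltnNge -ltnS ltn_ord.
Qed.

Lemma bs_cof I K (l : seq (R * {ffun I -> nat})) (h : {ffun I -> nat} -> R) :
  bs K (fun al => cof l al * h al) =
  \sum_(t <- l | [forall i, (t.2 i <= K)%N]) t.1 * h t.2.
Proof.
rewrite /bs [RHS]big_mkcond/=.
transitivity (\sum_(t <- l) \sum_(al : {ffun I -> 'I_K.+1})
   (if t.2 == [ffun i => nat_of_ord (al i)] then t.1 * h t.2 else 0)).
  rewrite exchange_big/=; apply: eq_bigr => al _.
  rewrite /cof mulr_suml [LHS]big_mkcond/=; apply: eq_bigr => t _.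
  by case: eqP => // ->.
by apply: eq_bigr => t _; rewrite -(bs_pick K t.2 (t.1 * h t.2)).
Qed.

Lemma bs_ge0 I K (g : {ffun I -> nat} -> R) : (forall al, 0 <= g al) -> 0 <= bs K g.
Proof. by move=> g0; apply: sumr_ge0 => *. Qed.

Lemma bs_le I K (g g' : {ffun I -> nat} -> R) : (forall al, g al <= g' al) -> bs K g <= bs K g'.
Proof. by move=> g0; apply: ler_sum => *. Qed.

Lemma bsD I K (g g' : {ffun I -> nat} -> R) : bs K (fun al => g al + g' al) = bs K g + bs K g'.
Proof. exact: big_split. Qed.

Lemma bsB I K (g g' : {ffun I -> nat} -> R) : bs K (fun al => g al - g' al) = bs K g - bs K g'.
Proof. by rewrite bsD; congr (_ + _); rewrite -sumrN. Qed.

Lemma bsZ I K c (g : {ffun I -> nat} -> R) : bs K (fun al => c * g al) = c * bs K g.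
Proof. by rewrite /bs mulr_sumr. Qed.

Lemma bs_norm I K (g : {ffun I -> nat} -> R) : `|bs K g| <= bs K (fun al => `|g al|).
Proof. exact: ler_norm_sum. Qed.

Lemma mon_ge0 I (r : I -> R) al : (forall i, 0 <= r i) -> 0 <= mon r al.
Proof. by move=> r0; apply: prodr_ge0 => i _; exact: exprn_ge0. Qed.

Lemma mon_norm I (h : I -> R) al : `|mon h al| = mon (fun i => `|h i|) al.
Proof. by rewrite /mon normr_prod; apply: eq_bigr => i _; rewrite normrX. Qed.

Lemma mon_le I (r s : I -> R) al : (forall i, 0 <= r i <= s i) -> mon r al <= mon s al.
Proof.
move=> rs; apply: ler_prod => i _; case/andP: (rs i) => r0 rsi.
by rewrite exprn_ge0//= lerXn2r// nnegrE// (le_trans r0).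
Qed.

Lemma mon_scale I t (r : I -> R) al : mon (fun i => t * r i) al = t ^+ (\sum_i al i) * mon r al.
Proof.
rewrite /mon expr_sum -big_split/=; apply: eq_bigr => i _; exact: exprMn.
Qed.

Lemma mon_theta I (t : R) (r h : I -> R) al : (forall i, 0 <= r i) ->
  (forall i, `|h i| <= t * r i) -> `|mon h al| <= t ^+ (\sum_i al i) * mon r al.
Proof.
by move=> r0 hr; rewrite mon_norm -mon_scale; apply: mon_le => i; rewrite normr_ge0/=.
Qed.

Lemma bs_cof_norm I K (r : I -> R) (l : seq (R * {ffun I -> nat})) : (forall i, 0 <= r i) ->
  bs K (fun al => `|cof l al| * mon r al) <= \sum_(t <- l) `|t.1| * mon r t.2.
Proof.
move=> r0.
pose l' := [seq (`|t.1|, t.2) | t <- l].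
apply: (@le_trans _ _ (bs K (fun al => cof l' al * mon r al))).
  apply: bs_le => al; rewrite ler_wpM2r ?mon_ge0// /cof big_map/=.
  exact: ler_norm_sum.
rewrite bs_cof big_map/= big_mkcond/=; apply: ler_sum => t _.
by case: ifP => // _; rewrite mulr_ge0 ?mon_ge0.
Qed.

(** A monomial outside the box of multi-indices has total degree above [K], so on the domain shrunk
    by [t] it is at most [t ^+ K.+1] times its norm. *)
Lemma bs_cof_val I K (t : R) (r h : I -> R) (l : seq (R * {ffun I -> nat})) :
  (forall i, 0 <= r i) -> 0 <= t <= 1 -> (forall i, `|h i| <= t * r i) ->
  `|bs K (fun al => cof l al * mon h al) - \sum_(s <- l) s.1 * mon h s.2| <=
  t ^+ K.+1 * \sum_(t <- l) `|t.1| * mon r t.2.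
Proof.
move=> r0 /andP[t0 t1] hr.
rewrite bs_cof (bigID (fun t : R * {ffun I -> nat} => [forall i, (t.2 i <= K)%N]) xpredT)/=.
rewrite opprD addrA subrr add0r normrN.
apply: le_trans (ler_norm_sum _ _ _) _.
rewrite mulr_sumr big_mkcond/=; apply: ler_sum => s _.
case: ifPn => [|_]; last by rewrite !mulr_ge0 ?exprn_ge0 ?mon_ge0.
rewrite negb_forall => /existsP[i]; rewrite -ltnNge => Ki.
rewrite normrM mulrCA ler_wpM2l// (le_trans (mon_theta _ r0 hr))// ler_wpM2r ?mon_ge0//.
apply: ler_wiXn2l => //.
by rewrite (leq_trans Ki)// (bigD1 i)//= leq_addr.
Qed.

Lemma le_eps (a b c : R) : (forall e, 0 < e -> a <= b + c * e) -> a <= b.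
Proof.
move=> H; apply/ler_addgt0Pr => e e0.
have [c0|c0] := leP c 0.
  by apply: le_trans (H _ e0) _; rewrite lerD2l; nra.
by have := H (e / c) (divr_gt0 e0 c0); rewrite mulrCA divff ?gt_eqF// mulr1.
Qed.

Lemma nbhs_ptws (T : eqType) I (f : I -> T) (a : prod_topology (fun _ : T => R)) (d : R) : 0<d -> nbhs a [set c : prod_topology (fun _ : T => R) | forall al : I, `|a (f al) - c (f al)| <= d].
Proof.
move=> d0.
have H (al : I) : nbhs a [set c : prod_topology (fun _ : T => R) | `|a (f al) - c (f al)| <= d].
  have HB : nbhs (a (f al)) [set u : R | `|a (f al) - u| <= d].
    apply/nbhs_ballP; exists d => //= u; rewrite /ball/= => /ltW; exact.
  exact: (@proj_continuous T (fun=> R : topologicalType) (f al) a _ HB).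
exact: (@filter_forall _ I (fun al c => `|a (f al) - c (f al)| <= d) (nbhs a) (nbhs_filter a) H).
Qed.

(** Weak compactness: the coefficients at [al] of all approximants lie in one compact interval, so
    by Tychonoff the families of coefficients have a cluster point. The truncation error
    [t ^+ K.+1 * C] is the same for all approximants, hence passes to the limit and identifies the
    sum of the limit series with [f]. *)
Lemma apx_series I (Y : (I -> R) -> Prop) (x r : I -> R) C f :
  (forall i, 0 < r i) -> apx Y x r C f ->
  exists a : {ffun I -> nat} -> R,
    (forall K, bs K (fun al => `|a al| * mon r al) <= C) /\
    (forall y t, Y y -> 0 <= t <= 1 -> (forall i, `|y i - x i| <= t * r i) -> forall K,
      `|bs K (fun al => a al * mon (shf x y) al) - f y| <= t ^+ K.+1 * C).
Proof.
move=> r0 fY; have r0' i : 0 <= r i by exact: ltW.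
(* A filter base indexed by a finite set of sample points and a tolerance; its members are the
   coefficient families of the admissible approximants. *)
pose E (q : seq (I -> R) * R) : set ({ffun I -> nat} -> R) := [set c | exists l : seq (R * {ffun I -> nat}),
  [/\ \sum_(t <- l) `|t.1| * mon r t.2 <= C, c = cof l &
    forall y, y \in q.1 -> `|\sum_(t <- l) t.1 * mon (shf x y) t.2 - f y| <= q.2]].
pose D : set (seq (I -> R) * R) := fun q => 0 < q.2 /\ forall y : I -> R, y \in q.1 -> Y y.
have E0 q : D q -> E q !=set0.
  move=> [q0 qY]; have [p [C' [C'C pp H]]] := fY q.1 q.2 q0 qY.
  have [l [lC pl]] := poly_terms r0' pp.
  exists (cof l), l; split=> //; first exact: le_trans C'C.
  by move=> y yq; rewrite -pl; exact: H.
pose F := filter_from D E.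
have FF : ProperFilter F.
  apply: filter_from_proper => //; apply: filter_from_filter.
    by exists ([::], 1); split=> //=.
  move=> q1 q2 [q10 q1Y] [q20 q2Y]; exists (q1.1 ++ q2.1, Num.min q1.2 q2.2).
    split=> /= [|y]; first by rewrite lt_min q10.
    by rewrite mem_cat => /orP[/q1Y|/q2Y].
  move=> c [l [lC cl Hl]]; split; exists l; split=> // y yq.
    by apply: le_trans (Hl y _) _; rewrite ?mem_cat ?yq// ge_min lexx.
  by apply: le_trans (Hl y _) _; rewrite ?mem_cat ?yq ?orbT// ge_min lexx orbT.
pose A (al : {ffun I -> nat}) : set R := `[- (C / mon r al), C / mon r al]%classic.
have cA := @tychonoff {ffun I -> nat} (fun=> R : topologicalType) A
  (fun al => @segment_compact R _ _).
have mr al : 0 < mon r al by apply: prodr_gt0 => i _; exact: exprn_gt0.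
have FA : F [set c | forall al, A al (c al)].
  exists ([::], 1); first by split.
  move=> c [l [lC -> _]] al; rewrite /A/= in_itv/= -ler_norml ler_pdivlMr//.
  apply: le_trans lC; rewrite /cof.
  apply: le_trans (ler_wpM2r (ltW (mr al)) (ler_norm_sum _ _ _)) _.
  rewrite mulr_suml big_mkcond/=; apply: ler_sum => t _.
  case: eqP => [->//|_]; by rewrite mulr_ge0 ?mon_ge0.
have [a [_ clF]] := cA F FF FA.
(* A neighbourhood in the product topology controls finitely many coefficients at a time, hence the
   fixed [K]. *)
have key K q d : D q -> 0 < d -> exists l : seq (R * {ffun I -> nat}),
  [/\ \sum_(t <- l) `|t.1| * mon r t.2 <= C,
    (forall al : {ffun I -> 'I_K.+1}, `|a [ffun i => nat_of_ord (al i)] - cof l [ffun i => nat_of_ord (al i)]| <= d) &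
    forall y, y \in q.1 -> `|\sum_(t <- l) t.1 * mon (shf x y) t.2 - f y| <= q.2].
  move=> Dq d0.
  have N := nbhs_ptws (fun al : {ffun I -> 'I_K.+1} => [ffun i => nat_of_ord (al i)]) a d0.
  have FE : F (E q) by exists q.
  have [c [[l [lC -> Hl]] Hc]] := clF _ _ FE N.
  by exists l.
exists a; split=> [K|y t Yy t01 yt K].
  pose M := bs K (fun al => mon r al).
  apply: (@le_eps _ _ M) => e e0.
  have D0 : D ([::], 1) by split.
  have [l [lC al _]] := key K _ e D0 e0.
  apply: (@le_trans _ _ (bs K (fun al => `|cof l al| * mon r al) + M * e)).
    rewrite mulrC -bsZ -bsD; apply: ler_sum => b _; rewrite -mulrDl ler_wpM2r ?mon_ge0//.
    by have := al b; set u := a _; set v := cof l _ => H; have := ler_normD (u - v) v; rewrite subrK; lra.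
  by rewrite lerD2r (le_trans (bs_cof_norm _ _ _)).
pose M := bs K (fun al => mon r al).
apply: (@le_eps _ _ (M + 1)) => e e0.
have D0 : D ([:: y], e).
  by split=> //= z; rewrite inE => /eqP ->.
have [l [lC al Hl]] := key K _ e D0 e0.
have {}Hl : `|\sum_(t <- l) t.1 * mon (shf x y) t.2 - f y| <= e by apply: Hl; rewrite /= inE.
have H1 := @bs_cof_val I K t r (shf x y) l r0' t01 yt.
have H2 : `|bs K (fun al => a al * mon (shf x y) al) - bs K (fun al => cof l al * mon (shf x y) al)| <= M * e.
  rewrite -bsB; apply: le_trans (bs_norm _ _) _; rewrite mulrC -bsZ.
  apply: ler_sum => b _; rewrite -mulrBl normrM ler_pM//.
  rewrite mon_norm; apply: mon_le => i; rewrite normr_ge0/= (le_trans (yt i))//.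
  by rewrite ler_piMl//; case/andP: t01.
have H3 : t ^+ K.+1 * (\sum_(s <- l) `|s.1| * mon r s.2) <= t ^+ K.+1 * C.
  by rewrite ler_wpM2l// exprn_ge0//; case/andP: t01.
move: H1 H2 H3 Hl; set a1 := bs K _; set a2 := bs K _; set a3 := \sum_(s <- l) _; set a4 := \sum_(s <- l) _ => H1 H2 H3 Hl.
have -> : a2 - f y = (a2 - a1) + ((a1 - a3) + (a3 - f y)) by ring.
apply: le_trans (ler_normD _ _) _; apply: le_trans (lerD (lexx _) (ler_normD _ _)) _.
by lra.
Qed.

End PowerSeries.

Section AnalyticBounds.
Variables (R : realType).
Implicit Types (I J : finType).

Definition An (I : finType) (x r : I -> R) C f := apx (box x r) x r C f.

Lemma apx_le I (Y Y' : (I -> R) -> Prop) (x r r' : I -> R) C C' f g :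
  (forall i, 0 <= r' i <= r i) -> C <= C' -> (forall y, Y' y -> Y y) ->
  (forall y, Y' y -> f y = g y) ->
  apx Y x r C f -> apx Y' x r' C' g.
Proof.
move=> rr CC YY fg Hf ys e e0 ysY.
have [y /ysY/YY//|p [D [DC pp H]]] := Hf ys e e0.
have [D' /andP[_ D'D] pp'] := poly_le rr pp.
exists p, D'; split=> //; first by rewrite (le_trans D'D)// (le_trans DC).
by move=> y yys; rewrite -fg; [exact: H|exact: ysY].
Qed.

Lemma box_center I (x r : I -> R) : (forall i, 0 <= r i) -> box x r x.
Proof. by move=> r0 i; rewrite subrr normr0. Qed.

Lemma An_bound I (x r : I -> R) C f y : An x r C f -> box x r y -> `|f y| <= C.
Proof.
move=> Hf yx; apply: (@le_eps _ _ _ 1) => e e0.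
have [z|p [D [DC pp H]]] := Hf [:: y] e e0; first by rewrite inE => /eqP ->.
have := H y; rewrite inE eqxx => /(_ isT) H1.
have H2 := poly_bound yx pp.
have := ler_normD (p (shf x y)) (f y - p (shf x y)).
by rewrite addrC subrK distrC mul1r; move: H1 H2; rewrite /shf; lra.
Qed.

Lemma An_ge0 I (x r : I -> R) C f : (forall i, 0 <= r i) -> An x r C f -> 0 <= C.
Proof. by move=> r0 /An_bound => /(_ _ (box_center x r0)); apply: le_trans. Qed.

Lemma An_const I (x r : I -> R) c : An x r `|c| (fun=> c).
Proof.
move=> ys e e0 _; exists (fun=> c), `|c|; split=> //; first exact: poly_const.
by move=> y _; rewrite subrr normr0 ltW.
Qed.

Lemma An_coord I (x r : I -> R) i : An x r (r i) (fun y => y i - x i).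
Proof.
move=> ys e e0 _; exists (fun h => h i), (r i); split=> //; first exact: poly_var.
by move=> y _; rewrite subrr normr0 ltW.
Qed.

Lemma AnD I (x r : I -> R) C D f g : An x r C f -> An x r D g ->
  An x r (C + D) (fun y => f y + g y).
Proof.
move=> Hf Hg ys e e0 ysY.
have e2 : 0 < e / 2 by lra.
have [p [C' [C'C pp H]]] := Hf ys _ e2 ysY.
have [q [D' [D'D pq H']]] := Hg ys _ e2 ysY.
exists (fun h => p h + q h), (C' + D'); split; [by rewrite lerD|exact: poly_add|].
move=> y yys; rewrite opprD addrACA (splitr e) (le_trans (ler_normD _ _))//.
by rewrite lerD ?H ?H'.
Qed.

Lemma AnM I (x r : I -> R) C D f g : (forall i, 0 <= r i) -> An x r C f -> An x r D g ->
  An x r (C * D) (fun y => f y * g y).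
Proof.
move=> r0 Hf Hg ys e e0 ysY.
have C0 := An_ge0 r0 Hf; have D0 := An_ge0 r0 Hg.
pose e' := e / (C + D + 1).
have CD : 0 < C + D + 1 by lra.
have e'0 : 0 < e' by rewrite divr_gt0.
have [p [C' [C'C pp H]]] := Hf ys e' e'0 ysY.
have [q [D' [D'D pq H']]] := Hg ys e' e'0 ysY.
exists (fun h => p h * q h), (C' * D'); split.
- by apply: ler_pM => //; [exact: poly_ge0 r0 pp|exact: poly_ge0 r0 pq].
- exact: poly_mul.
move=> y yys; set u := shf x y.
have -> : p u * q u - f y * g y = p u * (q u - g y) + (p u - f y) * g y by ring.
rewrite (le_trans (ler_normD _ _))// !normrM.
have H1 : `|p u| <= C by rewrite (le_trans (poly_bound _ pp))//; exact: ysY.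
have H2 : `|g y| <= D by apply: An_bound Hg _; exact: ysY.
have -> : e = (C + D + 1) * e' by rewrite /e' mulrCA divff ?mulr1// gt_eqF.
have H3 := H y yys; have H4 := H' y yys.
have H5 : `|p u| * `|q u - g y| <= C * e' by apply: ler_pM.
have H6 : `|p u - f y| * `|g y| <= e' * D by apply: ler_pM.
nra.
Qed.

Lemma An_lim I (x r : I -> R) C f :
  (forall (ys : seq (I -> R)) (e : R), 0 < e -> (forall y : I -> R, y \in ys -> box x r y) ->
     exists2 g, An x r C g & forall y : I -> R, y \in ys -> `|g y - f y| <= e) ->
  An x r C f.
Proof.
move=> Hf ys e e0 ysY.
have e2 : 0 < e / 2 by lra.
have [g Hg gf] := Hf ys _ e2 ysY.
have [p [C' [C'C pp H]]] := Hg ys _ e2 ysY.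
exists p, C'; split=> // y yys.
rewrite -(subrK (g y) (p _)) -addrA (splitr e) (le_trans (ler_normD _ _))//.
by rewrite lerD ?gf ?H.
Qed.

Lemma An_comp I J (x r : I -> R) (z s : J -> R) C f g :
  (forall i, 0 <= r i) -> (forall j, 0 <= s j) ->
  An z s C f -> (forall j, An x r (s j) (fun y => g j y - z j)) ->
  An x r C (fun y => f (fun j => g j y)).
Proof.
move=> r0 s0 Hf Hg ys e e0 ysY.
have e2 : 0 < e / 2 by lra.
have [u|p [C' [C'C pp H]]] := Hf [seq (fun j => g j y) | y <- ys] (e / 2) e2.
  by move=> /mapP[y yys ->] j; apply: An_bound (Hg j) _; exact: ysY.
(* The continuity of the outer polynomial at the finitely many image points fixes the precision
   needed for the inner functions. *)
have [d d0 Hd] : exists2 d, 0 < d & forall y : I -> R, y \in ys -> forall h' : J -> R,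
    (forall j, `|h' j - (g j y - z j)| <= d) -> `|p h' - p (fun j => g j y - z j)| <= e / 2.
  clear -pp e2; elim: ys => [|y ys [d d0 IH]]; first by exists 1.
  have [d' d'0 Hd'] := poly_cont (fun j => g j y - z j) pp e2.
  exists (Num.min d d'); first by rewrite lt_min d0.
  move=> v; rewrite inE => /predU1P[->|vys] h' hh'.
    by apply: Hd' => j; rewrite (le_trans (hh' j))// ge_min lexx orbT.
  by apply: IH vys _ _ => j; rewrite (le_trans (hh' j))// ge_min lexx.
have /choice [q Hq] : forall j, exists q, exists D, [/\ D <= s j, bpoly r D q &
    forall y : I -> R, y \in ys -> `|q (shf x y) - (g j y - z j)| <= d].
  by move=> j; exact: Hg.
have /choice [D HD] : forall j, exists D, [/\ D <= s j, bpoly r D (q j) &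
    forall y : I -> R, y \in ys -> `|q j (shf x y) - (g j y - z j)| <= d].
  exact: Hq.
have [|j|C2 C2C' pp2] := @poly_subst R I J s r C' p D q r0 _ _ pp.
- by move=> j; case: (HD j) => -> /(poly_ge0 r0) ->.
- by case: (HD j).
exists (fun h => p (fun j => q j h)), C2; split=> //; first exact: le_trans C2C' C'C.
move=> y yys.
rewrite -(subrK (p (fun j => g j y - z j)) (p _)) -addrA (splitr e) (le_trans (ler_normD _ _))//.
rewrite lerD//.
  by apply: (Hd y yys) => j; case: (HD j) => _ _; exact.
by apply: H; apply/mapP; exists y.
Qed.

Lemma An_eq I (x r : I -> R) C f g : f =1 g -> An x r C f -> An x r C g.
Proof. by move=> /funext ->. Qed.

Lemma An_rebase I (x r x' r' : I -> R) C f : (forall i, 0 <= r' i) ->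
  (forall i, `|x' i - x i| + r' i <= r i) -> An x r C f -> An x' r' C f.
Proof.
move=> r0 xr Hf ys e e0 ysY.
have [y yys i|p [C' [C'C pp H]]] := Hf ys e e0.
  apply: le_trans (xr i); rewrite -[y i](subrK (x' i)) -addrA addrC.
  by rewrite (le_trans (ler_normD _ _))// lerD//; exact: ysY.
have [|j|C2 C2C' pp2] := @poly_subst R I I r r' C' p (fun i => r' i + `|x' i - x i|)
   (fun i h => h i + (x' i - x i)) r0 _ _ pp.
- by move=> i; rewrite addr_ge0//= addrC xr.
- by apply: poly_add; [exact: poly_var|exact: (poly_const _ (x' j - x j))].
exists (fun h => p (fun i => h i + (x' i - x i))), C2; split=> //; first exact: le_trans C2C' C'C.
move=> y yys; have := H y yys; congr (`|p _ - _| <= _).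
by apply/funext => i; rewrite /shf addrA subrK.
Qed.

Lemma An_mono I (x r r' : I -> R) C C' f g : (forall i, 0 <= r' i <= r i) -> C <= C' ->
  (forall y, box x r' y -> f y = g y) ->
  An x r C f -> An x r' C' g.
Proof.
move=> rr CC fg; apply: apx_le => // y yx i.
by apply: le_trans (yx i) _; case/andP: (rr i).
Qed.

(** The Schwarz lemma for limits of polynomials; read at a single point it becomes the Lipschitz
    estimate [An_cont]. The center [x] is added to the sample points so that [f x] is approximated
    too. *)
Lemma An_shrink I (x r : I -> R) C f t : (forall i, 0 <= r i) -> 0 <= t <= 1 ->
  An x r C f -> An x (fun i => t * r i) (t * C) (fun y => f y - f x).
Proof.
move=> r0 t01 Hf ys e e0 ysY; have e2 : 0 < e / 2 by lra.
have [t0 t1] := andP t01.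
have tr i : 0 <= t * r i <= r i by rewrite mulr_ge0//= ler_piMl.
have [y|p [C' [C'C pp H]]] := Hf (x :: ys) (e / 2) e2.
  rewrite inE => /predU1P[->|/ysY yx] i; first by rewrite subrr normr0.
  by apply: le_trans (yx i) _; case/andP: (tr i).
have [C2 /andP[_ C2C'] pp2] := poly_shrink r0 t01 pp.
exists (fun h => p h - p (fun=> 0)), C2; split=> //.
  apply: le_trans C2C' _; rewrite ler_wpM2l//.
  by rewrite (le_trans _ C'C)// gerBl.
move=> y yys.
have H1 := H y; rewrite inE yys orbT in H1; have {}H1 := H1 isT.
have H2 := H x; rewrite inE eqxx in H2; have {}H2 := H2 isT.
have E : shf x x = fun=> 0 by apply/funext => i; rewrite /shf subrr.
rewrite E in H2.
have -> : p (shf x y) - p (fun=> 0) - (f y - f x) = (p (shf x y) - f y) - (p (fun=> 0) - f x) by ring.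
by rewrite (splitr e) (le_trans (ler_normB _ _))// lerD.
Qed.

Lemma An_cont I (x r : I -> R) C f t y : (forall i, 0 <= r i) -> 0 <= t <= 1 ->
  An x r C f -> (forall i, `|y i - x i| <= t * r i) -> `|f y - f x| <= t * C.
Proof. by move=> r0 t01 /(An_shrink r0 t01) H yx; apply: An_bound H _. Qed.

Definition e1 (I : finType) (i : I) : {ffun I -> nat} := [ffun k => (k == i) : nat].

Lemma mon_0 I (h : I -> R) : mon h [ffun=> 0%N] = 1.
Proof. by rewrite /mon big1// => i _; rewrite ffunE. Qed.

Lemma mon_e1 I (h : I -> R) i : mon h (e1 i) = h i.
Proof.
rewrite /mon (bigD1 i)//= ffunE eqxx big1 ?mulr1// => k ki.
by rewrite ffunE (negbTE ki).
Qed.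

Lemma deg1 I (al : {ffun I -> nat}) : al != [ffun=> 0%N] -> (forall i, al != e1 i) ->
  (2 <= \sum_i al i)%N.
Proof.
move=> a0 a1; case S : (\sum_i al i)%N => [|[|k]] //.
  case/negP: a0; apply/eqP/ffunP => i; rewrite ffunE.
  by apply/eqP; move/eqP: S; rewrite sum_nat_eq0 => /forallP/(_ i).
have [i ai] : exists i, al i != 0%N.
  apply/existsP; rewrite -negb_forall; apply/negP => /forallP H.
  by move: S; rewrite big1// => i _; exact/eqP.
have := a1 i; case/negP; apply/eqP/ffunP => k; rewrite ffunE.
have ai1 : al i = 1%N by move: S; rewrite (bigD1 i)//=; lia.
case: eqP => [->//|/eqP ki].
have : (\sum_(j | j != i) al j = 0)%N by move: S; rewrite (bigD1 i)//=; lia.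
by move/eqP; rewrite sum_nat_eq0 => /forallP/(_ k); rewrite ki/= => /eqP.
Qed.

Lemma bs_split I K (g : {ffun I -> nat} -> R) : (0 < K)%N ->
  bs K g = g [ffun=> 0%N] + (\sum_i g (e1 i) +
    bs K (fun al => if (al == [ffun=> 0%N]) || [exists i, al == e1 i] then 0 else g al)).
Proof.
move=> K0.
have E (al : {ffun I -> nat}) : g al = (if [ffun=> 0%N] == al then g [ffun=> 0%N] else 0) +
   (\sum_i (if e1 i == al then g (e1 i) else 0) +
   (if (al == [ffun=> 0%N]) || [exists i, al == e1 i] then 0 else g al)).
  have [->|a0] := eqVneq al [ffun=> 0%N].
    rewrite orTb/= addr0 big1 ?addr0// => i _.
    by case: eqP => // /ffunP/(_ i); rewrite !ffunE eqxx.
  rewrite /= add0r; case: existsP => [[i /eqP ->]|H].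
    rewrite (bigD1 i)//= eqxx big1 ?addr0// => k ki.
    by case: eqP => // /ffunP/(_ k); rewrite !ffunE eqxx (negbTE ki).
  rewrite big1 ?add0r// => i _; case: eqP => // Ei; case: H; exists i; exact/eqP.
rewrite {1}/bs; under eq_bigr => al _ do rewrite (E [ffun i => nat_of_ord (al i)]).
rewrite !big_split/=; congr (_ + (_ + _)).
  rewrite -[LHS]/(bs K (fun al => if [ffun=> 0%N] == al then g [ffun=> 0%N] else 0)) bs_pick.
  by case: ifPn => // /negP[]; apply/forallP => i; rewrite ffunE.
rewrite exchange_big/=; apply: eq_bigr => i _.
rewrite -[LHS]/(bs K (fun al => if e1 i == al then g (e1 i) else 0)) bs_pick.
by case: ifPn => // /negP[]; apply/forallP => k; rewrite ffunE; case: eqP.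
Qed.

Lemma exp_cvg0 (t C e : R) : 0 <= t < 1 -> 0 < e -> exists K, forall k, (K <= k)%N -> t ^+ k * C <= e.
Proof.
move=> /andP[t0 t1] e0.
have H : (fun k => t ^+ k * C) @ \oo --> (0 * C : R).
  by apply: cvgMl; apply: cvg_expr; rewrite ger0_norm.
rewrite mul0r in H.
move/cvgrPdist_le : H => /(_ e e0) [K _ HK]; exists K => k Kk.
have := HK k Kk; rewrite sub0r normrN; exact: le_trans (ler_norm _).
Qed.

(** After removal of the constant and linear terms every remaining monomial carries at least two
    factors [t]. The linear coefficients [d] turn out to be the partial derivatives in
    [ana_taylor]. *)
Lemma An_taylor I (x r : I -> R) C f : (forall i, 0 < r i) -> An x r C f ->
  exists d : I -> R, \sum_i `|d i| * r i <= C /\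
    forall t, 0 <= t < 1 -> An x (fun i => t * r i) (t ^+ 2 * C)
      (fun y => f y - f x - \sum_i d i * (y i - x i)).
Proof.
move=> r0 Hf; have r0' i : 0 <= r i by exact: ltW.
have [a [aC Ha]] := apx_series r0 Hf.
exists (fun i => a (e1 i)); split.
  apply: le_trans (aC 1%N); rewrite bs_split// addrCA -[leLHS]addr0 lerD//.
    by rewrite ler_sum// => i _; rewrite mon_e1.
  rewrite addr_ge0 ?mulr_ge0 ?mon_ge0//; apply: bs_ge0 => al.
  by case: ifP => // _; rewrite mulr_ge0 ?mon_ge0.
move=> t /andP[t0 t1].
have fx : f x = a [ffun=> 0%N].
  have := Ha x 0 (box_center x r0') _ _ 1%N.
  rewrite lexx ler01 expr0n/= mul0r => /(_ isT) H.
  have {H} : `|bs 1 (fun al => a al * mon (shf x x) al) - f x| <= 0.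
    by apply: H => i; rewrite subrr normr0 mul0r.
  rewrite normr_le0 subr_eq0 => /eqP <-.
  have E : shf x x = fun=> 0 by apply/funext => i; rewrite /shf subrr.
  rewrite E bs_split// mon_0 mulr1 big1 ?add0r; last by move=> i _; rewrite mon_e1 mulr0.
  rewrite /bs big1 ?addr0// => al _; case: ifPn => // /norP[/deg1 + /existsPn H].
  set b := [ffun i => _] in H *; move=> /(_ H) H2.
  suff -> : mon (fun=> 0) b = 0 :> R by rewrite mulr0.
  have [i bi] : exists i, b i != 0%N.
    apply/existsP; rewrite -negb_forall; apply/negP => /forallP H3.
    by move: H2; rewrite big1// => i _; exact/eqP.
  by rewrite /mon (bigD1 i)//= expr0n (negbTE bi) mul0r.
move=> ys e e0 ysY.
have [K HK] : exists K, forall k, (K <= k)%N -> t ^+ k * C <= e.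
  by apply: exp_cvg0 => //; rewrite t0.
pose g (al : {ffun I -> nat}) h := if (al == [ffun=> 0%N]) || [exists i, al == e1 i] then 0 else a al * mon h al.
exists (fun h => bs K.+1 (fun al => g al h)),
  (bs K.+1 (fun al => if (al == [ffun=> 0%N]) || [exists i, al == e1 i] then 0 else
     `|a al| * mon (fun i => t * r i) al)); split.
- apply: (@le_trans _ _ (t ^+ 2 * bs K.+1 (fun al => `|a al| * mon r al))); last first.
    by rewrite ler_wpM2l// exprn_ge0.
  rewrite -bsZ; apply: bs_le => al; case: ifPn => [_|/norP[/deg1 + /existsPn H]].
    by rewrite !mulr_ge0 ?exprn_ge0 ?mon_ge0.
  move=> /(_ H) H2; rewrite mon_scale mulrCA ler_wpM2r//.
    by rewrite mulr_ge0 ?mon_ge0.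
  by apply: ler_wiXn2l => //; exact: ltW.
- apply: poly_sum => al; rewrite /g; case: ifP => _; last exact: poly_mon.
  by have := poly_const (fun i => t * r i) 0; rewrite normr0.
move=> y yys.
have yt i : `|y i - x i| <= t * r i by exact: ysY.
have yb : box x r y by move=> i; rewrite (le_trans (yt i))// ler_piMl// ltW.
have := Ha y t yb _ yt K.+1; rewrite t0 (ltW t1) => /(_ isT) H.
have := le_trans H (HK _ _) => /(_ (leqW (leqnSn _))).
rewrite bs_split// mon_0 mulr1 -fx.
have -> : \sum_i a (e1 i) * mon (shf x y) (e1 i) = \sum_i a (e1 i) * (y i - x i).
  by apply: eq_bigr => i _; rewrite mon_e1.
rewrite -/(bs _ (fun al => g al (shf x y))).
by congr (`|_| <= _); ring.
Qed.

End AnalyticBounds.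

Section Analytic.
Variables (R : realType).
Implicit Types (I J : finType).

Definition ana (I : finType) (f : (I -> R) -> R) (x : I -> R) :=
  exists r C, 0 < r /\ An x (fun=> r) C f.

Definition nearby (I : finType) (x : I -> R) (P : (I -> R) -> Prop) :=
  exists2 d : R, 0 < d & forall y, box x (fun=> d) y -> P y.

Lemma nearbyS I (x : I -> R) (P Q : (I -> R) -> Prop) :
  (forall y, P y -> Q y) -> nearby x P -> nearby x Q.
Proof. by move=> PQ [d d0 H]; exists d => // y /H/PQ. Qed.

Lemma nearbyI I (x : I -> R) (P Q : (I -> R) -> Prop) :
  nearby x P -> nearby x Q -> nearby x (fun y => P y /\ Q y).
Proof.
move=> [d d0 H] [d' d'0 H']; exists (Num.min d d'); first by rewrite lt_min d0.
move=> y yx; split; [apply: H|apply: H'] => i;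
by rewrite (le_trans (yx i))// ge_min lexx ?orbT.
Qed.

Lemma nearby_box I (x r : I -> R) : (forall i, 0 < r i) -> nearby x (box x r).
Proof.
move=> r0; pose d := \big[Num.min/1]_i r i.
exists d; first by apply/bigmin_gtP; split.
by move=> y yx i; rewrite (le_trans (yx i))//; exact: bigmin_le_cond.
Qed.

Lemma nearby_all I (K : finType) (x : I -> R) (P : K -> (I -> R) -> Prop) :
  (forall k, nearby x (P k)) -> nearby x (fun y => forall k, P k y).
Proof.
move=> H; have {}H k : exists d : R, 0 < d /\ forall y, box x (fun=> d) y -> P k y.
  by have [d d0 Hd] := H k; exists d.
move/choice : H => [d Hd]; exists (\big[Num.min/1]_k d k).
  by apply/bigmin_gtP; split=> // k _; case: (Hd k).
move=> y yx k; case: (Hd k) => _; apply => i.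
by rewrite (le_trans (yx i))//; exact: bigmin_le_cond.
Qed.

Lemma fin_radius (J : finType) (P : J -> R -> Prop) :
  (forall j, exists2 d, 0 < d & forall r, 0 < r <= d -> P j r) ->
  exists2 d, 0 < d & forall r, 0 < r <= d -> forall j, P j r.
Proof.
move=> H; have {}H j : exists d : R, 0 < d /\ forall r, 0 < r <= d -> P j r.
  by have [d d0 Hd] := H j; exists d.
move/choice : H => [d Hd]; exists (\big[Num.min/1]_k d k).
  by apply/bigmin_gtP; split=> // k _; case: (Hd k).
move=> r /andP[r0 rd] k; case: (Hd k) => _; apply; rewrite r0 (le_trans rd)//.
exact: bigmin_le_cond.
Qed.

Lemma ana_near I f g (x : I -> R) : ana f x -> nearby x (fun y => f y = g y) -> ana g x.
Proof.
move=> [r [C [r0 Hf]]] [d d0 fg]; exists (Num.min r d), C.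
split; first by rewrite lt_min r0.
apply: An_mono Hf => // [i|y yx]; first by rewrite le_min ltW//= ?ge_min ?lexx// ltW.
by apply: fg => i; rewrite (le_trans (yx i))// ge_min lexx orbT.
Qed.

Lemma ana_ext I f g (x : I -> R) : f =1 g -> ana f x -> ana g x.
Proof. by move=> /funext ->. Qed.

Lemma ana_An I f (x : I -> R) : ana f x ->
  exists2 C, 0 <= C & exists2 d, 0 < d & forall r, 0 < r <= d -> An x (fun=> r) C f.
Proof.
move=> [r [C [r0 Hf]]]; exists C; first by apply: An_ge0 Hf => _; exact: ltW.
exists r => // s /andP[s0 sr]; apply: An_mono Hf => // _; by rewrite sr ltW.
Qed.

Lemma ana_small I f (x : I -> R) e : ana f x -> 0 < e ->
  exists2 d, 0 < d & forall r, 0 < r <= d -> An x (fun=> r) e (fun y => f y - f x).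
Proof.
move=> [r [C [r0 Hf]]] e0; have C0 : 0 <= C by apply: An_ge0 Hf => _; exact: ltW.
pose t := Num.min 1 (e / (C + 1)).
have t0 : 0 < t by rewrite lt_min ltr01 divr_gt0// ltr_wpDl.
exists (t * r); first exact: mulr_gt0.
move=> s /andP[s0 st].
have t01 : 0 <= t <= 1 by rewrite ltW//= ge_min lexx.
have H := @An_shrink R I x (fun=> r) C f t (fun=> ltW r0) t01 Hf.
apply: An_mono H => // [_|]; first by rewrite st ltW.
have : t <= e / (C + 1) by rewrite ge_min lexx orbT.
by rewrite ler_pdivlMr ?ltr_wpDl// => H; rewrite (le_trans _ H)// ler_wpM2l ?lerDl// ltW.
Qed.

Lemma ana_cts I f (x : I -> R) e : ana f x -> 0 < e ->
  nearby x (fun y => `|f y - f x| <= e).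
Proof.
move=> Hf e0; have [d d0 H] := ana_small Hf e0; exists d => // y yx.
by apply: An_bound (H d _) yx; rewrite d0 lexx.
Qed.

Lemma ana_gt0 I f (x : I -> R) : ana f x -> 0 < f x -> nearby x (fun y => 0 < f y).
Proof.
move=> Hf fx0; have e0 : 0 < f x / 2 by lra.
by apply: nearbyS (ana_cts Hf e0) => y; rewrite ler_norml => /andP[? _]; lra.
Qed.

Lemma ana_const I c (x : I -> R) : ana (fun=> c) x.
Proof. by exists 1, `|c|; split=> //; exact: An_const. Qed.

Lemma anaD I f g (x : I -> R) : ana f x -> ana g x -> ana (fun y => f y + g y) x.
Proof.
move=> /ana_An[C C0 [d d0 Hf]] /ana_An[C' C'0 [d' d'0 Hg]].
exists (Num.min d d'), (C + C'); have m0 : 0 < Num.min d d' by rewrite lt_min d0.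
by split=> //; apply: AnD; [apply: Hf|apply: Hg]; rewrite m0 ge_min lexx ?orbT.
Qed.

Lemma anaM I f g (x : I -> R) : ana f x -> ana g x -> ana (fun y => f y * g y) x.
Proof.
move=> /ana_An[C C0 [d d0 Hf]] /ana_An[C' C'0 [d' d'0 Hg]].
exists (Num.min d d'), (C * C'); have m0 : 0 < Num.min d d' by rewrite lt_min d0.
by split=> //; apply: AnM => [_||]; [exact: ltW|apply: Hf|apply: Hg]; rewrite m0 ge_min lexx ?orbT.
Qed.

Lemma ana_coord I i (x : I -> R) : ana (fun y => y i) x.
Proof.
apply: ana_ext (anaD (_ : ana (fun y => y i - x i) x) (ana_const (x i) x)).
  by move=> y; rewrite subrK.
by exists 1, 1; split; [exact: ltr01|exact: (@An_coord R I x (fun=> 1) i)].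
Qed.

Lemma anaZ I c f (x : I -> R) : ana f x -> ana (fun y => c * f y) x.
Proof. exact: anaM (ana_const c x). Qed.

Lemma anaN I f (x : I -> R) : ana f x -> ana (fun y => - f y) x.
Proof. by move=> /(anaZ (-1)); apply: ana_ext => y; rewrite mulN1r. Qed.

Lemma anaB I f g (x : I -> R) : ana f x -> ana g x -> ana (fun y => f y - g y) x.
Proof. by move=> Hf /anaN; exact: anaD. Qed.

Lemma ana_sum I (K : Type) (s : seq K) (P : pred K) (f : K -> (I -> R) -> R) (x : I -> R) :
  (forall k, P k -> ana (f k) x) -> ana (fun y => \sum_(k <- s | P k) f k y) x.
Proof.
move=> H; elim: s => [|k s IH].
  by apply: ana_ext (ana_const 0 x) => y; rewrite big_nil.
case Pk : (P k); last by apply: ana_ext IH => y; rewrite big_cons Pk.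
by apply: ana_ext (anaD (H k Pk) IH) => y; rewrite big_cons Pk.
Qed.

Lemma ana_prod I (K : Type) (s : seq K) (P : pred K) (f : K -> (I -> R) -> R) (x : I -> R) :
  (forall k, P k -> ana (f k) x) -> ana (fun y => \prod_(k <- s | P k) f k y) x.
Proof.
move=> H; elim: s => [|k s IH].
  by apply: ana_ext (ana_const 1 x) => y; rewrite big_nil.
case Pk : (P k); last by apply: ana_ext IH => y; rewrite big_cons Pk.
by apply: ana_ext (anaM (H k Pk) IH) => y; rewrite big_cons Pk.
Qed.

Lemma anaX I f n (x : I -> R) : ana f x -> ana (fun y => f y ^+ n) x.
Proof.
move=> Hf; elim: n => [|n IH]; first exact: ana_const.
by apply: ana_ext (anaM Hf IH) => y; rewrite exprS.
Qed.

Lemma ana_comp I J f (g : J -> (I -> R) -> R) (x : I -> R) :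
  ana f (fun j => g j x) -> (forall j, ana (g j) x) ->
  ana (fun y => f (fun j => g j y)) x.
Proof.
move=> [r [C [r0 Hf]]] Hg.
have [d d0 H] : exists2 d, 0 < d & forall s, 0 < s <= d -> forall j,
    An x (fun=> s) r (fun y => g j y - g j x).
  by apply: fin_radius => j; exact: ana_small.
exists d, C; split=> //; apply: (An_comp (s := fun=> r)) Hf _ => [_|_|j]; [exact: ltW..|].
by apply: H; rewrite d0 lexx.
Qed.

Lemma ana_open I f (x : I -> R) : ana f x -> nearby x (ana f).
Proof.
move=> [r [C [r0 Hf]]]; have r2 : 0 < r / 2 by lra.
exists (r / 2) => // y yx; exists (r / 2), C; split=> //.
apply: An_rebase Hf => [_|i]; first exact: ltW.
have := yx i; lra.
Qed.

(** The bridge from norm estimates to derivatives: quadratic remainders are what [An_taylor]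
    delivers. *)
Lemma is_derive_sq (f : R -> R) a d K e : 0 < e ->
  (forall h, `|h| <= e -> `|f (a + h) - f a - d * h| <= K * h ^+ 2) ->
  is_derive a 1 f d.
Proof.
move=> e0 Hf.
have K0 : 0 <= K.
  have := Hf e; rewrite ger0_norm ?lexx// ?(ltW e0)// => /(_ isT) H.
  have := le_trans (normr_ge0 _) H; by rewrite pmulr_lge0// exprn_gt0.
have H : (fun h => h^-1 *: (f (h *: 1 + a) - f a)) @ 0^' --> d.
  apply/cvgrPdist_le => eps eps0; near=> h.
  have h0 : h != 0 by near: h; exact: nbhs_dnbhs_neq.
  have he : `|h| <= e.
    near: h; apply: nbhs_dnbhs; apply/nbhs_ballP; exists e => //= z.
    by rewrite /ball/= sub0r normrN => /ltW.
  have hK : `|h| <= eps / (K + 1).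
    near: h; apply: nbhs_dnbhs; apply/nbhs_ballP; exists (eps / (K + 1)).
      by rewrite /= divr_gt0// ltr_wpDl.
    by move=> z; rewrite /ball/= sub0r normrN => /ltW.
  rewrite /GRing.scale/= mulr1 [h + a]addrC.
  have -> : d - h^-1 * (f (a + h) - f a) = - (h^-1 * (f (a + h) - f a - d * h)).
    by field.
  rewrite normrN normrM normfV.
  have hp : 0 < `|h| by rewrite normr_gt0.
  rewrite ler_pdivrMl// (le_trans (Hf h he))// -(real_normK (num_real h)).
  move: hK; rewrite ler_pdivlMr ?ltr_wpDl// => hK.
  nra.
apply: DeriveDef; first by apply/cvg_ex; exists d.
exact: cvg_lim.
Unshelve. all: by end_near. Qed.

Definition shl (I : finType) (x : I -> R) i (t : R) : I -> R :=
  fun k => x k + t * (k == i)%:R.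

Definition pdr (I : finType) (i : I) (f : (I -> R) -> R) (x : I -> R) : R :=
  'D_1 (fun t : R => f (shl x i t)) 0.

Lemma shl0 I (x : I -> R) i : shl x i 0 = x.
Proof. by apply/funext => k; rewrite /shl mul0r addr0. Qed.

Lemma box_shl I (x : I -> R) i t d : `|t| <= d -> box x (fun=> d) (shl x i t).
Proof.
move=> td k; rewrite /shl addrC addKr; case: eqP => _.
  by rewrite mulr1.
by rewrite mulr0 normr0 (le_trans _ td).
Qed.

Lemma ana_taylor I f (x : I -> R) : ana f x ->
  exists r C, [/\ 0 < r, 0 <= C &
   forall t, 0 <= t < 1 -> An x (fun i => t * r) (t ^+ 2 * C)
      (fun y => f y - f x - \sum_i pdr i f x * (y i - x i))] /\
  forall i, is_derive (0 : R) 1 (fun t : R => f (shl x i t)) (pdr i f x).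
Proof.
move=> [r [C [r0 Hf]]].
have C0 : 0 <= C by apply: An_ge0 Hf => _; exact: ltW.
have [d [_ H]] := @An_taylor R I x (fun=> r) C f (fun=> r0) Hf.
have D i : is_derive (0 : R) 1 (fun t : R => f (shl x i t)) (d i).
  apply: (@is_derive_sq _ _ _ (C / r ^+ 2) (r / 2)); first by lra.
  move=> h hr; rewrite add0r shl0.
  pose t := `|h| / r.
  have t01 : 0 <= t < 1.
    by rewrite /t divr_ge0// ?(ltW r0)//= ltr_pdivrMr//; lra.
  have := An_bound (H t t01) (_ : box x _ (shl x i h)) => /(_ _)/wrap[].
    move=> k; have := @box_shl I x i h `|h| (lexx _) k; by rewrite /t divfK// gt_eqF.
  have -> : \sum_k d k * (shl x i h k - x k) = d i * h.
    rewrite (bigD1 i)//= big1 ?addr0 => [|k ki]; rewrite /shl.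
      by rewrite eqxx mulr1 addrAC subrr add0r.
    by rewrite (negbTE ki) mulr0 addr0 subrr mulr0.
  move/le_trans; apply; rewrite /t expr_div_n real_normK ?num_real//.
  by apply: eqW; ring.
have E i : pdr i f x = d i by exact: derive_val.
exists r, C; split; last by move=> i; rewrite E.
split=> // t t01; apply: An_mono (H t t01) => // [i|y _].
  by rewrite lexx andbT mulr_ge0// ?(ltW r0)//; case/andP: t01.
by congr (_ - _); apply: eq_bigr => i _; rewrite E.
Qed.

End Analytic.

Section AnalyticCalculus.
Variables (R : realType).
Implicit Types (I J : finType).

Lemma normB_le2 (a b e : R) : `|a| <= e -> `|b| <= e -> `|a - b| <= 2 * e.
Proof. by move=> ae be; rewrite (le_trans (ler_normB _ _))//; lra. Qed.

Lemma ana_derive I f (x : I -> R) i : ana f x ->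
  is_derive (0 : R) 1 (fun t : R => f (shl x i t)) (pdr i f x).
Proof. by move=> /ana_taylor[r [C [_ H]]]. Qed.

Lemma ana_diff I f (x : I -> R) : ana f x -> exists d K : R, 0 < d /\
  forall e y, 0 <= e <= d -> box x (fun=> e) y ->
    `|f y - f x - \sum_i pdr i f x * (y i - x i)| <= K * e ^+ 2.
Proof.
move=> /ana_taylor[r [C [[r0 C0 H] _]]]; exists (r / 2), (C / r ^+ 2).
split=> [|e y /andP[e0 er] yx]; first by lra.
pose t := e / r.
have t01 : 0 <= t < 1 by rewrite /t divr_ge0// ?(ltW r0)//= ltr_pdivrMr//; lra.
have E : t * r = e by rewrite /t divfK// gt_eqF.
have yx' : box x (fun=> t * r) y by move=> i; rewrite E; exact: yx.
have := An_bound (H t t01) yx'; move/le_trans; apply.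
by rewrite /t expr_div_n; apply: eqW; ring.
Qed.

Lemma is_derive_lip (f : R -> R) (a d : R) : is_derive a 1 f d ->
  exists2 e, 0 < e & forall h, `|h| <= e -> `|f (a + h) - f a| <= (`|d| + 1) * `|h|.
Proof.
move=> df.
have /cvg_lim : (fun h => h^-1 *: (f (h *: 1 + a) - f a)) @ 0^' --> d.
  rewrite -(@derive_val _ _ _ _ _ _ _ df); exact: (@ex_derive _ _ _ _ _ _ _ df).
move=> _.
have : (fun h => h^-1 *: (f (h *: 1 + a) - f a)) @ 0^' --> d.
  rewrite -(@derive_val _ _ _ _ _ _ _ df); exact: (@ex_derive _ _ _ _ _ _ _ df).
move/cvgrPdist_le => /(_ 1 ltr01).
rewrite near_withinE => /nbhs_ballP[e /= e0 He].
exists (e / 2); first by lra.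
move=> h he; have [->|h0] := eqVneq h 0; first by rewrite addr0 subrr !normr0 mulr0.
have hb : ball 0 e h by rewrite /ball/= sub0r normrN; lra.
have := He h hb h0; rewrite /GRing.scale/= mulr1 [h + a]addrC => H.
have H2 : `|h^-1 * (f (a + h) - f a)| <= `|d| + 1.
  have := ler_normD d (h^-1 * (f (a + h) - f a) - d); rewrite addrC subrK distrC; lra.
by rewrite normrM normfV ler_pdivrMl ?normr_gt0// mulrC in H2.
Qed.

Lemma is_derive_bigsum (K : Type) (s : seq K) (P : pred K) (f : K -> R -> R) (a : R) (d : K -> R) :
  (forall k, is_derive a 1 (f k) (d k)) ->
  is_derive a 1 (fun h => \sum_(k <- s | P k) f k h) (\sum_(k <- s | P k) d k).
Proof.
move=> H; elim: s => [|k s IH].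
  rewrite big_nil; have -> : (fun h => \sum_(k <- [::] | P k) f k h) = cst 0.
    by apply/funext => h; rewrite big_nil.
  exact: is_derive_cst.
rewrite big_cons; case: ifPn => Pk.
  have -> : (fun h => \sum_(k <- k :: s | P k) f k h) = f k \+ (fun h => \sum_(k <- s | P k) f k h).
    by apply/funext => h; rewrite big_cons Pk.
  exact: is_deriveD.
have -> // : (fun h => \sum_(k <- k :: s | P k) f k h) = (fun h => \sum_(k <- s | P k) f k h).
by apply/funext => h; rewrite big_cons (negbTE Pk).
Qed.

(** The curve need only be differentiable at [a]: there it is Lipschitz at [a], which together with
    the quadratic remainder of [f] makes the nonlinear part of [f] have derivative 0 along the
    curve. *)
Lemma ana_curve I f (x : I -> R) (c : R -> I -> R) (a : R) (c' : I -> R) :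
  ana f x -> c a = x -> (forall i, is_derive a 1 (fun h => c h i) (c' i)) ->
  is_derive a 1 (fun h => f (c h)) (\sum_i pdr i f x * c' i).
Proof.
move=> fx ca dc.
have [d [K [d0 H]]] := ana_diff fx.
have D1 : is_derive a 1 (fun h => \sum_i pdr i f x * (c h i - x i)) (\sum_i pdr i f x * c' i).
  apply: is_derive_bigsum => i.
  have H1 : is_derive a 1 (fun h => c h i - x i) (c' i).
    by rewrite -[c' i]subr0; apply: is_deriveB.
  exact: (is_deriveZ (pdr i f x) H1).
have [e e0 He] : exists2 e, 0 < e & forall r, 0 < r <= e -> forall i, forall h, `|h| <= r ->
    `|c (a + h) i - c a i| <= (`|c' i| + 1) * `|h|.
  apply: fin_radius => i; have [e e0 He] := is_derive_lip (dc i).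
  by exists e => // r /andP[_ re] h hr; apply: He; apply: le_trans re.
pose M := \sum_i `|c' i| + 1.
have M0 : 0 < M by rewrite ltr_wpDl// sumr_ge0.
have cM i h : `|h| <= e -> `|c (a + h) i - x i| <= M * `|h|.
  move=> he; rewrite -ca (le_trans (He e _ i h he)) ?e0 ?lexx// ler_wpM2r// lerD2r.
  by rewrite (bigD1 i)//= lerDl sumr_ge0.
have D2 : is_derive a 1 (fun h => f (c h) - \sum_i pdr i f x * (c h i - x i)) 0.
  apply: (@is_derive_sq _ _ _ _ (K * M ^+ 2) (Num.min e (d / M))).
    by rewrite lt_min e0 divr_gt0.
  move=> h; rewrite le_min => /andP[he]; rewrite ler_pdivlMr// mulrC => hd.
  rewrite mul0r subr0 ca [X in _ - (_ - X)]big1 ?subr0; last by move=> i _; rewrite subrr mulr0.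
  have := H (M * `|h|) (c (a + h)).
  rewrite hd mulr_ge0 ?(ltW M0)// => /(_ isT) H1.
  have {}H1 := H1 (fun i => cM i h he).
  rewrite exprMn real_normK ?num_real// mulrA in H1.
  by rewrite addrAC.
have := is_deriveD D2 D1; rewrite add0r; congr is_derive.
by apply/funext => h /=; rewrite subrK.
Qed.

Lemma is_derive_shl I (x : I -> R) i k (s : R) :
  is_derive s 1 (fun t : R => shl x i t k) (k == i)%:R.
Proof.
rewrite /shl; have -> : (fun t : R => x k + t * (k == i)%:R) = cst (x k) + (fun t => (k == i)%:R *: t).
  by apply/funext => t; rewrite /= mulrC.
rewrite -[X in is_derive _ _ _ X]add0r; apply: is_deriveD.
rewrite -[X in is_derive _ _ _ X]mulr1; exact: is_deriveZ.
Qed.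

Lemma ana_derive_at I f (x : I -> R) i (s : R) : ana f (shl x i s) ->
  is_derive s 1 (fun t : R => f (shl x i t)) (pdr i f (shl x i s)).
Proof.
move=> fx; have := ana_curve fx (erefl : (fun t => shl x i t) s = _) (fun k => is_derive_shl x i k s).
rewrite (bigD1 i)//= eqxx mulr1 big1 ?addr0// => k ki; by rewrite (negbTE ki) mulr0.
Qed.

Lemma pdr_comp I J f (g : J -> (I -> R) -> R) (x : I -> R) i :
  ana f (fun j => g j x) -> (forall j, ana (g j) x) ->
  pdr i (fun y => f (fun j => g j y)) x = \sum_j pdr j f (fun j => g j x) * pdr i (g j) x.
Proof.
move=> fx gx; apply: derive_val.
apply: (@ana_curve J f (fun j => g j x) (fun t j => g j (shl x i t)) 0) => //.
  by rewrite shl0.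
by move=> j; exact: ana_derive.
Qed.

Lemma pdr_ext I f g (x : I -> R) i : f =1 g -> pdr i f x = pdr i g x.
Proof. by move=> /funext ->. Qed.

Lemma pdrD I f g (x : I -> R) i : ana f x -> ana g x ->
  pdr i (fun y => f y + g y) x = pdr i f x + pdr i g x.
Proof.
move=> /(ana_derive i) Hf /(ana_derive i) Hg; exact: derive_val.
Qed.

Lemma pdrM I f g (x : I -> R) i : ana f x -> ana g x ->
  pdr i (fun y => f y * g y) x = pdr i f x * g x + f x * pdr i g x.
Proof.
move=> /(ana_derive i) Hf /(ana_derive i) Hg; apply: derive_val.
have := is_deriveM Hf Hg; rewrite !shl0; congr is_derive.
by rewrite addrC /GRing.scale/= [g x * _]mulrC.
Qed.

Lemma pdr_cst I c (x : I -> R) i : pdr i (fun=> c) x = 0.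
Proof. by apply: derive_val; exact: is_derive_cst. Qed.

Lemma pdr_coord I (x : I -> R) i k : pdr i (fun y => y k) x = (k == i)%:R.
Proof. by apply: derive_val; exact: is_derive_shl. Qed.

Lemma pdrZ I c f (x : I -> R) i : ana f x -> pdr i (fun y => c * f y) x = c * pdr i f x.
Proof. by move=> fx; rewrite pdrM ?pdr_cst ?mul0r ?add0r//; exact: ana_const. Qed.

Lemma pdrN I f (x : I -> R) i : ana f x -> pdr i (fun y => - f y) x = - pdr i f x.
Proof.
by move=> fx; rewrite -mulN1r -pdrZ//; apply: pdr_ext => y; rewrite mulN1r.
Qed.

Lemma pdrB I f g (x : I -> R) i : ana f x -> ana g x ->
  pdr i (fun y => f y - g y) x = pdr i f x - pdr i g x.
Proof. by move=> fx gx; rewrite pdrD ?pdrN//; exact: anaN. Qed.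

Lemma pdr_sum I (K : Type) (s : seq K) (P : pred K) (f : K -> (I -> R) -> R) (x : I -> R) i :
  (forall k, P k -> ana (f k) x) ->
  pdr i (fun y => \sum_(k <- s | P k) f k y) x = \sum_(k <- s | P k) pdr i (f k) x.
Proof.
move=> H; elim: s => [|k s IH].
  by rewrite big_nil -[RHS](pdr_cst 0 x i); apply: pdr_ext => y; rewrite big_nil.
case Pk : (P k); rewrite big_cons Pk -IH.
  rewrite -(pdrD i (H k Pk) (ana_sum s H)).
  by apply: pdr_ext => y; rewrite big_cons Pk.
by apply: pdr_ext => y; rewrite big_cons Pk.
Qed.

Lemma pdr_near I f g (x : I -> R) i : ana f x -> nearby x (fun y => f y = g y) ->
  pdr i g x = pdr i f x.
Proof.
move=> fx [d d0 fg]; apply: derive_val.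
have D2 : is_derive (0 : R) 1 (fun t => g (shl x i t) - f (shl x i t)) 0.
  apply: (@is_derive_sq _ _ _ _ 0 d) => // h hd.
  rewrite add0r shl0 !fg ?subrr ?mul0r ?subr0 ?normr0//.
    by apply: box_center => _; exact: ltW.
  exact: box_shl.
have := is_deriveD D2 (ana_derive i fx); rewrite add0r; congr is_derive.
by apply/funext => t /=; rewrite subrK.
Qed.

Section series_sum.
Variables (I : finType) (x r : I -> R) (C : R) (a : {ffun I -> nat} -> R).
Hypothesis r0 : forall i, 0 < r i.
Hypothesis aC : forall K, bs K (fun al => `|a al| * mon r al) <= C.

Lemma bs_cauchy (h : I -> R) t K K' : 0 <= t <= 1 -> (forall i, `|h i| <= t * r i) ->
  (K <= K')%N ->
  `|bs K (fun al => a al * mon h al) - bs K' (fun al => a al * mon h al)| <= t ^+ K.+1 * C.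
Proof.
move=> t01 hr KK'; have r0' i : 0 <= r i by exact: ltW.
pose em (al : {ffun I -> 'I_K'.+1}) : {ffun I -> nat} := [ffun i => nat_of_ord (al i)].
pose l := [seq (a (em al), em al) | al <- enum {: {ffun I -> 'I_K'.+1}}].
have El (be : {ffun I -> nat}) : (forall i, (be i <= K')%N) -> cof l be = a be.
  move=> bK; rewrite /cof big_map/= big_enum_cond/=.
  pose b : {ffun I -> 'I_K'.+1} := [ffun i => inord (be i)].
  have E : em b = be by apply/ffunP => i; rewrite !ffunE inordK// ltnS.
  rewrite (big_pred1 b) ?E// => al /=; apply/eqP/eqP => [|->]; last by rewrite E.
  move=> /ffunP H; apply/ffunP => i; apply: val_inj => /=.
  by have := H i; rewrite !ffunE => <-; rewrite inord_val.
have H := @bs_cof_val R I K t r h l r0' t01 hr.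
have E1 : bs K (fun al => cof l al * mon h al) = bs K (fun al => a al * mon h al).
  apply: eq_bigr => al _; rewrite El// => i; rewrite ffunE.
  by rewrite (leq_trans _ KK')// -ltnS.
have E2 : \sum_(s <- l) s.1 * mon h s.2 = bs K' (fun al => a al * mon h al).
  by rewrite big_map big_enum.
have E3 : \sum_(s <- l) `|s.1| * mon r s.2 = bs K' (fun al => `|a al| * mon r al).
  by rewrite big_map big_enum.
rewrite E1 E2 E3 in H; apply: le_trans H _; rewrite ler_wpM2l// exprn_ge0//.
by case/andP: t01.
Qed.

(** Converse of [apx_series]. It is needed because coefficients found from samples in a subset [Y]
    have to be summed again on the full box. *)
Lemma series_sum : exists g : (I -> R) -> R, forall t, 0 <= t < 1 ->
  An x (fun i => t * r i) C g /\
  forall y, box x (fun i => t * r i) y -> forall K,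
   `|bs K (fun al => a al * mon (shf x y) al) - g y| <= t ^+ K.+1 * C.
Proof.
have r0' i : 0 <= r i by exact: ltW.
exists (fun y => lim ((fun K => bs K (fun al => a al * mon (shf x y) al)) @ \oo)).
move=> t t01; have [t0 t1] := andP t01.
have B y : box x (fun i => t * r i) y -> forall K,
   `|bs K (fun al => a al * mon (shf x y) al) - lim ((fun K => bs K (fun al => a al * mon (shf x y) al)) @ \oo)| <= t ^+ K.+1 * C.
  move=> yx K; set u := fun K => bs K _.
  have cu : cvg (u @ \oo).
    apply: cauchy_cvg; apply: cauchy_exP => e e0.
    have e2 : 0 < e / 2 by lra.
    have [k Hk] := exp_cvg0 C t01 e2.
    exists (u k); exists k => //= k' kk'.
    rewrite /ball/=; have := bs_cauchy (h := shf x y) (t := t) (_ : _) yx kk'.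
    rewrite t0 (ltW t1) => /(_ isT) H; apply: le_lt_trans H _.
    by apply: le_lt_trans (Hk _ (leqnSn k)) _; lra.
  apply: (@le_eps _ _ _ 1) => e e0; rewrite mul1r.
  move/cvgrPdist_le : cu => /(_ e e0)[k _ Hk].
  have := Hk (maxn k K) (leq_maxl _ _) => /= H1.
  have := bs_cauchy (h := shf x y) (t := t) (_ : _) yx (leq_maxr k K).
  rewrite t0 (ltW t1) => /(_ isT) H2.
  have -> : u K - lim (u @ \oo) = (u K - u (maxn k K)) + (u (maxn k K) - lim (u @ \oo)) by ring.
  by rewrite (le_trans (ler_normD _ _))// lerD// distrC.
split=> //; move=> ys e e0 ysY.
have [K HK] := exp_cvg0 C t01 e0.
exists (fun h => bs K (fun al => a al * mon h al)), (bs K (fun al => `|a al| * mon (fun i => t * r i) al)).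
split.
- apply: le_trans (aC K); apply: bs_le => al; rewrite ler_wpM2l//.
  by apply: mon_le => i; rewrite mulr_ge0//= ler_piMl// ltW.
- by apply: poly_sum => al; exact: poly_mon.
by move=> y yys; apply: le_trans (B y (ysY y yys) K) (HK _ (leqnSn K)).
Qed.

End series_sum.

(** The quotient is approximated only off the hyperplane [y i = x i], which is why [apx] has a
    separate set [Y] of sample points; the resulting power series extends the quotient across the
    hyperplane. *)
Lemma An_div I (x r : I -> R) C F i : (forall i, 0 < r i) -> An x r C F ->
  (forall y, box x r y -> y i = x i -> F y = 0) ->
  exists g, forall t, 0 <= t < 1 -> An x (fun i => t * r i) (C / r i) g /\
    forall y, box x (fun i => t * r i) y -> F y = (y i - x i) * g y.
Proof.
move=> r0 HF F0; have r0' k : 0 <= r k by exact: ltW.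
pose Y y := box x r y /\ y i != x i.
have aY : apx Y x r (C / r i) (fun y => F y / (y i - x i)).
  move=> ys e e0 ysY.
  have [m m0 Hm] : exists2 m, 0 < m & forall y : I -> R, y \in ys -> m <= `|y i - x i|.
    elim: ys ysY => [|y ys IH] ysY; first by exists 1.
    have [z zys|m m0 Hm] := IH; first by apply: ysY; rewrite inE zys orbT.
    exists (Num.min m `|y i - x i|).
      rewrite lt_min m0 normr_gt0 subr_eq0.
      by have [|_] := ysY y; rewrite ?inE ?eqxx.
    move=> z; rewrite inE => /predU1P[->|/Hm H]; first by rewrite ge_min lexx orbT.
    by rewrite ge_min H.
  have em : 0 < e * m / 2 by rewrite divr_gt0 ?mulr_gt0.
  (* Each sample point is accompanied by its projection to the hyperplane. There [F] vanishes, so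
     the part [p0] of the approximant free of the variable is small, and dividing by [y i - x i] is
     safe because of the lower bound [m]. *)
  have [y|p [C' [C'C pp H]]] := HF (ys ++ [seq upd y i (x i) | y <- ys]) _ em.
    rewrite mem_cat => /orP[/ysY[]//|/mapP[z /ysY[zx _] ->]] k.
    by rewrite /upd; case: eqP => [->|_]; rewrite ?subrr ?normr0.
  have [p0 [q [c0 [c1 [P0 Q c01 Ep0 Ep]]]]] := poly_div i r0' pp.
  have c00 := poly_ge0 r0' P0.
  exists q, c1; split=> //; first by rewrite ler_pdivlMr// mulrC; lra.
  move=> y yys; have [yx yi] := ysY y yys.
  have d0 : y i - x i != 0 by rewrite subr_eq0.
  have H1 := H y; rewrite mem_cat yys in H1; have {}H1 := H1 isT.
  have H2 := H (upd y i (x i)); rewrite mem_cat in H2.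
  have {}H2 := H2 (introT orP (or_intror (map_f _ yys))).
  rewrite (F0 (upd y i (x i))) ?subr0 in H2; last first.
  - by rewrite /upd eqxx.
  - by move=> k; rewrite /upd; case: eqP => [->|_]; rewrite ?subrr ?normr0.
  have E : shf x (upd y i (x i)) = upd (shf x y) i 0.
    by apply/funext => k; rewrite /shf /upd; case: eqP => [->|_]; rewrite ?subrr.
  rewrite E -Ep0 in H2; rewrite Ep in H1.
  have -> : q (shf x y) - F y / (y i - x i) = (p0 (shf x y) + shf x y i * q (shf x y) - F y - p0 (shf x y)) / (y i - x i).
    by rewrite /shf; field.
  rewrite normrM normfV ler_pdivrMr ?normr_gt0//.
  have H3 : e * m <= e * `|y i - x i| by rewrite ler_wpM2l ?(ltW e0)//; exact: Hm.
  by rewrite (le_trans (ler_normB _ _))//; lra.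
have [a [aC Ha]] := apx_series r0 aY.
have [g Hg] := series_sum x r0 aC.
exists g => t t01; have [H1 H2] := Hg t t01; split=> // y yx.
have [t0 t1] := andP t01.
have yr : box x r y by move=> k; rewrite (le_trans (yx k))// ler_piMl// ltW.
have [yi|yi] := eqVneq (y i) (x i); first by rewrite F0// yi subrr mul0r.
have d0 : y i - x i != 0 by rewrite subr_eq0.
suff <- : F y / (y i - x i) = g y by rewrite mulrC divfK.
apply/eqP; rewrite -subr_eq0 -normr_le0; apply: (@le_eps _ _ _ 2) => e e0; rewrite add0r.
have [K HK] := exp_cvg0 (C / r i) t01 e0.
have Yy : Y y by split.
have := Ha y t Yy _ yx K; rewrite t0 (ltW t1) => /(_ isT) A1.
have A2 := H2 y yx K; have A3 := HK _ (leqnSn K).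
set b := bs K _ in A1 A2.
have -> : F y / (y i - x i) - g y = (b - g y) - (b - F y / (y i - x i)) by ring.
rewrite (le_trans (ler_normB _ _))//; lra.
Qed.

Definition oext I (y : I -> R) (t : R) : option I -> R :=
  fun k => if k is Some i then y i else t.

Definition oproj I (z : option I -> R) : I -> R := fun i => z (Some i).

Lemma oextK I (z : option I -> R) : oext (oproj z) (z None) = z.
Proof. by apply/funext => -[]. Qed.

Lemma ana_oproj I f (z : option I -> R) : ana f (oproj z) -> ana (fun z => f (oproj z)) z.
Proof. by move=> fz; apply: ana_comp => // i; exact: (ana_coord (Some i)). Qed.

Lemma ana_quot I f (x : I -> R) i : ana f x ->
  exists2 g, ana g (oext x 0) & nearby (oext x 0) (fun z =>
    f (shl (oproj z) i (z None)) - f (oproj z) = z None * g z).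
Proof.
move=> [r [C [r0 Hf]]].
pose F z := f (shl (oproj z) i (z None)) - f (oproj z).
have r2 : 0 < r / 2 by lra.
have H1 : An (oext x 0) (fun=> r / 2) C (fun z => f (shl (oproj z) i (z None))).
  apply: (@An_comp _ _ _ _ _ x (fun=> r)) => //= [_|_|k].
  - exact: ltW.
  - exact: ltW.
  - have A1 := @An_coord R _ (oext x 0) (fun=> r / 2) (Some k).
    have A2 := @An_coord R _ (oext x 0) (fun=> r / 2) None.
    have A3 := AnM (fun=> ltW r2) A2 (@An_const R _ (oext x 0) (fun=> r / 2) (k == i)%:R).
    apply: An_mono (AnD A1 A3) => [_||z _].
    + by rewrite lexx ltW.
    + by case: eqP => _; rewrite ?normr1 ?normr0; lra.
    + by rewrite /shl /oproj/= subr0; ring.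
have H2 : An (oext x 0) (fun=> r / 2) C (fun z => f (oproj z)).
  apply: (@An_comp _ _ _ _ _ x (fun=> r)) => //= [_|_|k].
  - exact: ltW.
  - exact: ltW.
  - apply: An_mono (@An_coord R _ (oext x 0) (fun=> r / 2) (Some k)) => // [_|]; last by lra.
    by rewrite lexx ltW.
have H3 : An (oext x 0) (fun=> r / 2) (C + C) F.
  apply: An_mono (AnD H1 (AnM (fun=> ltW r2) (@An_const R _ (oext x 0) (fun=> r / 2) (-1)) H2)) => [_||z _].
  + by rewrite lexx ltW.
  + by rewrite normrN1 mul1r.
  + by rewrite mulN1r.
have [|g Hg] := An_div (i := None) (fun=> r2) H3.
  by move=> z _ /= z0; rewrite /F z0 shl0 subrr.
have t01 : 0 <= (1 / 2 : R) < 1 by apply/andP; split; lra.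
have [G1 G2] := Hg _ t01.
exists g.
  by exists (1 / 2 * (r / 2)), ((C + C) / (r / 2)); split=> //; rewrite mulr_gt0//; lra.
exists (1 / 2 * (r / 2)); first by rewrite mulr_gt0//; lra.
by move=> z zx; rewrite [LHS](G2 z zx)/= subr0.
Qed.

(** The extra coordinate [None] holds the increment. With the derivative as value at increment 0
    this quotient is analytic jointly in point and increment ([ana_dq]), from which analyticity of
    partial derivatives, their symmetry and differentiation under the integral are deduced. *)
Definition dq I i (f : (I -> R) -> R) (z : option I -> R) : R :=
  if z None == 0 then pdr i f (oproj z)
  else (f (shl (oproj z) i (z None)) - f (oproj z)) / z None.

Lemma dqE I i (f : (I -> R) -> R) (z : option I -> R) :
  f (shl (oproj z) i (z None)) - f (oproj z) = z None * dq i f z.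
Proof.
rewrite /dq; case: eqP => [->|/eqP z0]; first by rewrite shl0 subrr mul0r.
by rewrite mulrC divfK.
Qed.

Lemma ana_quot_pdr I f g (x : I -> R) i : ana g (oext x 0) ->
  nearby (oext x 0) (fun z =>
    f (shl (oproj z) i (z None)) - f (oproj z) = z None * g z) ->
  nearby x (fun y => g (oext y 0) = pdr i f y).
Proof.
move=> gx gE; have [d d0 Hd] := nearbyI (ana_open gx) gE.
exists (d / 2) => [|y yx]; first by lra.
have yb t : `|t| <= d / 2 -> box (oext x 0) (fun=> d) (oext y t).
  move=> td -[k|]/=; first by rewrite (le_trans (yx k))//; lra.
  by rewrite subr0; lra.
have [|gy _] := Hd (oext y 0); first by apply: yb; rewrite normr0; lra.
apply/esym/derive_val.
have [d' [K [d'0 HK]]] := ana_diff gy.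
pose K2 := `|pdr None g (oext y 0)| + `|K| * d'.
apply: (@is_derive_sq _ _ _ _ K2 (Num.min (d / 2) d')).
  by rewrite lt_min d'0 andbT; lra.
move=> h; rewrite le_min add0r shl0 => /andP[hd hd'].
have [_ /=] := Hd _ (yb h hd); rewrite -[oproj _]/y => ->.
have -> : h * g (oext y h) - g (oext y 0) * h = h * (g (oext y h) - g (oext y 0)) by ring.
have H := HK `|h| (oext y h); rewrite normr_ge0 hd' in H.
have : `|g (oext y h) - g (oext y 0) - \sum_k pdr k g (oext y 0) * (oext y h k - oext y 0 k)| <= K * `|h| ^+ 2.
  by apply: H => // -[k|]/=; rewrite ?subrr ?normr0// subr0.
rewrite (bigD1 None)//= subr0 big1 ?addr0; last by move=> [k|]//= _; rewrite subrr mulr0.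
move=> {}H.
have H1 : `|g (oext y h) - g (oext y 0)| <= K2 * `|h|.
  have := ler_normD (g (oext y h) - g (oext y 0) - pdr None g (oext y 0) * h) (pdr None g (oext y 0) * h).
  rewrite subrK normrM /K2 => H1.
  have : K * `|h| ^+ 2 <= `|K| * d' * `|h|.
    rewrite expr2 mulrA ler_wpM2r// (le_trans (ler_wpM2r _ (ler_norm K)))//.
    by rewrite ler_wpM2l.
  by rewrite mulrDl; lra.
rewrite normrM -(real_normK (num_real h)) expr2 mulrCA.
by rewrite ler_wpM2l.
Qed.

Lemma ana_dq I f (x : I -> R) i : ana f x -> ana (dq i f) (oext x 0).
Proof.
move=> fx; have [g gx gE] := ana_quot i fx; apply: ana_near (gx) _.
have [d d0 Hd] := ana_quot_pdr gx gE; have [d' d'0 Hd'] := gE.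
exists (Num.min d d') => [|z zx]; first by rewrite lt_min d0.
rewrite /dq; case: eqP => [z0|/eqP z0].
  rewrite -Hd ?[in RHS]z0; last first.
    by move=> i0; rewrite (le_trans (zx (Some i0)))// ge_min lexx.
  by congr g; rewrite -[LHS]oextK z0.
rewrite Hd'; first by rewrite mulrC mulKf.
by move=> k; rewrite (le_trans (zx k))// ge_min lexx orbT.
Qed.

Lemma dq0 I i (f : (I -> R) -> R) x : dq i f (oext x 0) = pdr i f x.
Proof. by rewrite /dq/= eqxx. Qed.

Lemma ana_pdr I f (x : I -> R) i : ana f x -> ana (pdr i f) x.
Proof.
move=> /(ana_dq i) fx; apply: ana_ext (_ : ana (fun y => dq i f (oext y 0)) x).
  by move=> y; exact: dq0.
by apply: (ana_comp (g := fun k y => oext y 0 k)) => // -[j|]/=; [exact: ana_coord|exact: ana_const].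
Qed.

Lemma pdr_oext I f (x : I -> R) s i : pdr i (fun y => f (oext y s)) x = pdr (Some i) f (oext x s).
Proof.
rewrite /pdr; congr (derive _ _ _); apply/funext => t; congr f.
by apply/funext => -[k|]//=; rewrite /shl/= mulr0 addr0.
Qed.

Lemma shlC I (x : I -> R) i j s t : shl (shl x i s) j t = shl (shl x j t) i s.
Proof. by apply/funext => k; rewrite /shl addrAC. Qed.

(** Both orders of differencing produce the same double difference, so the two iterated quotients
    agree at equal nonzero increments [h]; continuity carries the equality to [h = 0]. *)
Lemma pdrC I f (x : I -> R) i j : ana f x -> pdr i (pdr j f) x = pdr j (pdr i f) x.
Proof.
move=> fx.
have key (a b : I) : exists2 k, ana k (oext (oext x 0) 0) &
    k (oext (oext x 0) 0) = pdr b (pdr a f) x /\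
    exists2 d, 0 < d & forall s t, `|s| <= d -> `|t| <= d ->
      f (shl (shl x b t) a s) - f (shl x b t) - (f (shl x a s) - f x) =
      s * (t * k (oext (oext x s) t)).
  exists (dq (Some b) (dq a f)); first by do 2!apply: ana_dq.
  split.
    rewrite dq0 -pdr_oext; congr pdr; apply/funext => y; exact: dq0.
  exists 1 => // s t _ _.
  have E1 := dqE (Some b) (dq a f) (oext (oext x s) t); rewrite /= in E1.
  rewrite -E1 mulrBr -[oproj _]/(oext x s).
  have E : shl (oext x s) (Some b) t = oext (shl x b t) s.
    by apply/funext => -[k|]//=; rewrite /shl/= mulr0 addr0.
  rewrite E.
  have := dqE a f (oext (shl x b t) s); rewrite /= => <-.
  by have := dqE a f (oext x s); rewrite /= => <-.
have [k1 k1a [k1E [d1 d10 H1]]] := key i j.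
have [k2 k2a [k2E [d2 d20 H2]]] := key j i.
rewrite -k1E -k2E; apply/eqP; rewrite -subr_eq0 -normr_le0.
apply: (@le_eps _ _ _ 2) => e e0; rewrite add0r.
have [c1 c10 C1] := ana_cts k1a e0; have [c2 c20 C2] := ana_cts k2a e0.
pose h := Num.min (Num.min d1 d2) (Num.min c1 c2).
have h0 : 0 < h by rewrite !lt_min d10 d20 c10.
have [[hd1 hd2] [hc1 hc2]] : (h <= d1 /\ h <= d2) /\ (h <= c1 /\ h <= c2).
  by rewrite /h; split; split; rewrite !ge_min lexx ?orbT.
have nh : `|h| = h by rewrite ger0_norm// ltW.
have := H1 h h; have := H2 h h; rewrite nh => /(_ hd2 hd2) A2 /(_ hd1 hd1) A1.
rewrite shlC in A2.
have hb c : h <= c -> box (oext (oext x 0) 0) (fun=> c) (oext (oext x h) h).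
  by move=> hc [[k|]|]/=; rewrite ?subr0 ?nh// subrr normr0 (le_trans _ hc)// ltW.
have B1 := C1 _ (hb _ hc1); have B2 := C2 _ (hb _ hc2).
have E : k1 (oext (oext x h) h) = k2 (oext (oext x h) h).
  have : h * (h * k1 (oext (oext x h) h)) = h * (h * k2 (oext (oext x h) h)).
    rewrite -A1 -A2; ring.
  by move=> /(mulfI (lt0r_neq0 h0)) /(mulfI (lt0r_neq0 h0)).
set u := k2 (oext _ 0) in B2 *; set v := k1 (oext _ 0) in B1 *.
rewrite E in B1; set w := k2 _ in B1 B2.
have -> : u - v = (w - v) - (w - u) by ring.
exact: normB_le2.
Qed.

End AnalyticCalculus.

(** * Implicit functions by Picard iteration *)

Section ImplicitFunction.
Variables (R : realType).
Implicit Types (I J : finType).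

Definition sext I J (x : I -> R) (y : J -> R) : I + J -> R :=
  fun k => match k with inl i => x i | inr j => y j end.

Lemma sextE I J (z : I + J -> R) : sext (fun i => z (inl i)) (fun j => z (inr j)) = z.
Proof. by apply/funext => -[]. Qed.

Lemma geometric_cvg (u : nat -> R) K :
  (forall n, `|u n.+1 - u n| <= K * 2^-1 ^+ n) ->
  forall n, `|u n - lim (u @ \oo)| <= 2 * K * 2^-1 ^+ n.
Proof.
move=> H.
have K0 : 0 <= K by have := H 0%N; rewrite expr0 mulr1; exact: le_trans.
have half : 0 <= (2^-1 : R) < 1 by apply/andP; split; lra.
have A n m : `|u (n + m)%N - u n| <= 2 * K * 2^-1 ^+ n * (1 - 2^-1 ^+ m).
  elim: m => [|m IH]; first by rewrite addn0 !subrr normr0 mulr0.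
  rewrite addnS.
  have -> : u (n + m).+1 - u n = (u (n + m).+1 - u (n + m)%N) + (u (n + m)%N - u n) by ring.
  apply: le_trans (ler_normD _ _) _; apply: le_trans (lerD (H _) IH) _.
  by apply: eqW; rewrite exprD exprS; field.
have B n m : `|u (n + m)%N - u n| <= 2 * K * 2^-1 ^+ n.
  have h0 : 0 <= (2^-1 : R) by case/andP: half.
  apply: le_trans (A n m) _; apply: ler_piMr; first by rewrite !mulr_ge0// exprn_ge0.
  by rewrite gerBl exprn_ge0.
have cu : cvg (u @ \oo).
  apply: cauchy_cvg; apply: cauchy_exP => e e0.
  have e2 : 0 < e / 2 by lra.
  have [k Hk] := exp_cvg0 (2 * K) half e2.
  exists (u k); exists k => //= k' kk'.
  rewrite /ball/= distrC -(subnKC kk') (le_lt_trans (B _ _))// mulrC.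
  by apply: le_lt_trans (Hk _ (leqnn k)) _; lra.
move=> n; apply: (@le_eps _ _ _ 1) => e e0; rewrite mul1r.
move/cvgrPdist_le : cu => /(_ e e0)[k _ Hk].
have := Hk (n + k)%N (leq_addl _ _) => /= H1.
have -> : u n - lim (u @ \oo) = - (u (n + k)%N - u n) - (lim (u @ \oo) - u (n + k)%N) by ring.
by rewrite (le_trans (ler_normB _ _))// normrN lerD.
Qed.

(** Norm [rho / 8] on radius [rho] makes the map a contraction in [y] on the half box and keeps all
    iterates there. The iterates share the norm bound [rho / 2], so their pointwise limit is
    analytic by [An_lim]. *)
Lemma An_fix I J (x0 : I -> R) (y0 : J -> R) r rho (G : J -> (I + J -> R) -> R) :
  0 < r -> 0 < rho ->
  (forall j, An (sext x0 y0) (sext (fun=> r) (fun=> rho)) (rho / 8) (fun z => G j z - y0 j)) ->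
  exists Y : (I -> R) -> J -> R,
    (forall j, An x0 (fun=> r) (rho / 2) (fun x => Y x j - y0 j)) /\
    forall x, box x0 (fun=> r) x ->
      (forall j, G j (sext x (Y x)) = Y x j) /\
      forall y, box y0 (fun=> rho / 2) y -> (forall j, G j (sext x y) = y j) -> y = Y x.
Proof.
move=> r0 rho0 HG.
have rr k : 0 <= @sext I J (fun=> r) (fun=> rho) k by case: k => _ /=; exact: ltW.
have bx x y : box x0 (fun=> r) x -> box y0 (fun=> rho / 2) y ->
    box (sext x0 y0) (sext (fun=> r) (fun=> rho)) (sext x y).
  move=> xx yy [i|j] /=; first exact: xx.
  by rewrite (le_trans (yy j))//; lra.
have contr x y y' d : box x0 (fun=> r) x -> box y0 (fun=> rho / 2) y ->
    box y0 (fun=> rho / 2) y' -> (forall j, `|y j - y' j| <= d) -> 0 <= d ->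
    forall j, `|G j (sext x y) - G j (sext x y')| <= d / 2.
  move=> xx yy yy' yd d0 j.
  (* Points too far apart for the Schwarz lemma: then [d > rho / 2], and the plain bound [rho / 4]
     on the difference suffices. *)
  have [t1|t1] := leP (2 * d / rho) 1; last first.
    rewrite ltr_pdivlMr// mul1r in t1.
    have B1 := An_bound (HG j) (bx _ _ xx yy); have B2 := An_bound (HG j) (bx _ _ xx yy').
    have -> : G j (sext x y) - G j (sext x y') =
      (G j (sext x y) - y0 j) - (G j (sext x y') - y0 j) by ring.
    by rewrite (le_trans (ler_normB _ _))//; lra.
  have HG' : An (sext x y') (sext (fun=> 0) (fun=> rho / 2)) (rho / 8) (fun z => G j z - y0 j).
    apply: An_rebase (HG j) => [[i|k]|[i|k]] /=; [by []|by lra| |].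
      by rewrite addr0; exact: xx.
    by have := yy' k; lra.
  have t0 : 0 <= 2 * d / rho by rewrite divr_ge0 ?mulr_ge0 ?(ltW rho0).
  have rk k : 0 <= @sext I J (fun=> 0) (fun=> rho / 2) k.
    by case: k => _ //=; lra.
  have t01 : 0 <= 2 * d / rho <= 1 by rewrite t0.
  have H : forall k, `|sext x y k - sext x y' k| <= 2 * d / rho * sext (fun=> 0) (fun=> rho / 2) k.
    move=> [i|k] /=; first by rewrite subrr normr0 mulr0.
    have -> : 2 * d / rho * (rho / 2) = d by field; exact: lt0r_neq0.
    exact: yd.
  have := An_cont rk t01 HG' H.
  have -> : 2 * d / rho * (rho / 8) = d / 4 by field; exact: lt0r_neq0.
  have -> : G j (sext x y) - y0 j - (G j (sext x y') - y0 j) = G j (sext x y) - G j (sext x y') by ring.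
  by move/le_trans; apply; lra.
pose it := fix it n : (I -> R) -> J -> R :=
  if n is n'.+1 then fun x j => G j (sext x (it n' x)) else fun=> y0.
have itA n j : An x0 (fun=> r) (rho / 2) (fun x => it n x j - y0 j).
  elim: n j => [|n IH] j.
    apply: An_mono (@An_const R I x0 (fun=> r) 0) => // [_||y _] /=.
    - by rewrite lexx ltW.
    - by rewrite normr0; lra.
    - by rewrite subrr.
  have H : An x0 (fun=> r) (rho / 8) (fun x => G j (fun k => sext x (it n x) k) - y0 j).
    apply: (An_comp (g := fun k x => sext x (it n x) k)) (HG j) _ => //; first by move=> _; exact: ltW.
    move=> [i|k] /=; first exact: An_coord.
    by apply: An_mono (IH k) => [_||] //; [rewrite lexx ltW|lra].
  by apply: An_mono H => [_||y _] //; [rewrite lexx ltW|lra].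
have itb n x : box x0 (fun=> r) x -> box y0 (fun=> rho / 2) (it n x).
  by move=> xx j; exact: An_bound (itA n j) xx.
have step n x : box x0 (fun=> r) x -> forall j, `|it n.+1 x j - it n x j| <= rho / 2 * 2^-1 ^+ n.
  move=> xx; elim: n => [|n IH] j; first by rewrite expr0 mulr1; exact: (itb 1%N x xx j).
  have := contr x (it n.+1 x) (it n x) _ xx (itb _ _ xx) (itb _ _ xx) IH _ j.
  rewrite mulr_ge0 ?exprn_ge0//; [move=> /(_ isT)|lra].
  by move/le_trans; apply; apply: eqW; rewrite exprS; ring.
pose Y x j := lim ((fun n => it n x j) @ \oo).
have Yit n x : box x0 (fun=> r) x -> forall j, `|it n x j - Y x j| <= rho * 2^-1 ^+ n.
  move=> xx j; have := @geometric_cvg (fun n => it n x j) (rho / 2) (fun n => step n x xx j) n.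
  by move/le_trans; apply; apply: eqW; field.
have half : 0 <= (2^-1 : R) < 1 by apply/andP; split; lra.
have YA j : An x0 (fun=> r) (rho / 2) (fun x => Y x j - y0 j).
  apply: An_lim => ys e e0 ysY.
  have [n Hn] := exp_cvg0 rho half e0.
  exists (fun x => it n x j - y0 j); first exact: itA.
  move=> y yys; have -> : it n y j - y0 j - (Y y j - y0 j) = it n y j - Y y j by ring.
  apply: le_trans (Yit n y (ysY y yys) j) _; rewrite mulrC; exact: Hn.
have Yb x : box x0 (fun=> r) x -> box y0 (fun=> rho / 2) (Y x).
  by move=> xx j; exact: An_bound (YA j) xx.
exists Y; split=> // x xx; split=> [j|y yy Gy].
  apply/eqP; rewrite -subr_eq0 -normr_le0; apply: (@le_eps _ _ _ 2) => e e0; rewrite add0r.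
  have [n Hn] := exp_cvg0 rho half e0.
  have H n' : (n <= n')%N -> rho * 2^-1 ^+ n' <= e by rewrite mulrC; exact: Hn.
  have H1 := contr x (it n x) (Y x) _ xx (itb _ _ xx) (Yb _ xx) (Yit n x xx) _ j.
  rewrite mulr_ge0 ?exprn_ge0 ?(ltW rho0)// in H1; have {}H1 := H1 isT.
  have H2 := Yit n.+1 x xx j; rewrite /= in H2.
  have H3 := H _ (leqnn n); have H4 := H _ (leqnSn n).
  have -> : G j (sext x (Y x)) - Y x j = (G j (sext x (it n x)) - Y x j) - (G j (sext x (it n x)) - G j (sext x (Y x))) by ring.
  by rewrite (le_trans (ler_normB _ _))//; lra.
apply/funext => j; apply/eqP; rewrite -subr_eq0 -normr_le0.
have D n : forall j, `|y j - it n x j| <= rho * 2^-1 ^+ n.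
  elim: n => [|n IH] k; first by rewrite expr0 mulr1; have := yy k; rewrite /=; lra.
  rewrite -Gy /=; have := contr x y (it n x) _ xx yy (itb _ _ xx) IH _ k.
  rewrite mulr_ge0 ?exprn_ge0 ?(ltW rho0)// => /(_ isT).
  by move/le_trans; apply; apply: eqW; rewrite exprS; ring.
apply: (@le_eps _ _ _ 2) => e e0; rewrite add0r.
have [n Hn] := exp_cvg0 rho half e0.
have H1 := D n j; have H2 := Yit n x xx j; have := Hn n (leqnn n); rewrite mulrC => H3.
have -> : y j - Y x j = (y j - it n x j) + (it n x j - Y x j) by ring.
by rewrite (le_trans (ler_normD _ _))//; lra.
Qed.

Lemma An_sum I (x r : I -> R) (K : Type) (s : seq K) (P : pred K) (C : K -> R) f :
  (forall k, An x r (C k) (f k)) ->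
  An x r (\sum_(k <- s | P k) C k) (fun y => \sum_(k <- s | P k) f k y).
Proof.
move=> H; elim: s => [|k s IH].
  have H0 := @An_const R I x r 0; rewrite normr0 in H0; rewrite big_nil.
  by apply: An_eq H0 => y; rewrite big_nil.
rewrite big_cons; case: ifPn => Pk.
  by apply: An_eq (AnD (H k) IH) => y; rewrite big_cons Pk.
by apply: An_eq IH => y; rewrite big_cons (negbTE Pk).
Qed.

(** Newton's map [y - M F] has zero derivative in [y] at the base point. Its quadratic remainder is
    at most [rho / 16] for small [rho]; then its linear part in [x] is made at most [rho / 16] by
    shrinking the radius in [x]. Together they give the [rho / 8] of [An_fix]. *)
Theorem implicit_function I J (F : J -> (I + J -> R) -> R) (x0 : I -> R) (y0 : J -> R)
    (M : J -> J -> R) :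
  (forall j, ana (F j) (sext x0 y0)) -> (forall j, F j (sext x0 y0) = 0) ->
  (forall j k, \sum_l M j l * pdr (inr k) (F l) (sext x0 y0) = (j == k)%:R) ->
  (forall j k, \sum_l pdr (inr l) (F j) (sext x0 y0) * M l k = (j == k)%:R) ->
  exists Y : (I -> R) -> J -> R, [/\ forall j, ana (fun x => Y x j) x0, Y x0 = y0,
    nearby x0 (fun x => forall j, F j (sext x (Y x)) = 0) &
    nearby (sext x0 y0) (fun z => (forall j, F j z = 0) ->
      (fun j => z (inr j)) = Y (fun i => z (inl i)))].
Proof.
move=> Fa F0 MF FM; set z0 := sext x0 y0.
pose G j (z : I + J -> R) := z (inr j) - \sum_l M j l * F l z.
have Ga j : ana (fun z => G j z - y0 j) z0.
  apply: anaB; last exact: ana_const.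
  apply: anaB; first exact: ana_coord.
  by apply: ana_sum => l _; apply: anaZ; exact: Fa.
have Gp j k : pdr (inr k) (fun z => G j z - y0 j) z0 = 0.
  rewrite pdrB; [|by apply: anaB; [exact: ana_coord|apply: ana_sum => l _; apply: anaZ; exact: Fa]|exact: ana_const].
  rewrite pdrB; [|exact: ana_coord|by apply: ana_sum => l _; apply: anaZ; exact: Fa].
  rewrite pdr_cst subr0 pdr_coord pdr_sum; last by move=> l _; apply: anaZ; exact: Fa.
  rewrite (eq_bigr (fun l => M j l * pdr (inr k) (F l) z0)); last first.
    by move=> l _; rewrite pdrZ//; exact: Fa.
  by rewrite MF subrr.
have G0 j : G j z0 = y0 j.
  by rewrite /G big1 ?subr0// => l _; rewrite F0 mulr0.
have [d d0 H1] : exists2 d, 0 < d & forall rho, 0 < rho <= d -> forall j,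
   An z0 (fun=> rho) (rho / 16) (fun z => G j z - y0 j -
     \sum_i pdr (inl i) (fun z => G j z - y0 j) z0 * (z (inl i) - x0 i)).
  apply: fin_radius => j; have [r [C [[r0 C0 H] _]]] := ana_taylor (Ga j).
  pose d := Num.min (r / 2) (r ^+ 2 / (16 * (C + 1))).
  have C1 : 0 < C + 1 by lra.
  have d0 : 0 < d by rewrite lt_min divr_gt0//= divr_gt0 ?exprn_gt0// mulr_gt0.
  exists d => // rho /andP[rho0 rhod].
  have [dr dC] : d <= r / 2 /\ d <= r ^+ 2 / (16 * (C + 1)).
    by rewrite /d; split; rewrite ge_min lexx ?orbT.
  have t01 : 0 <= rho / r < 1.
    by rewrite divr_ge0 ?(ltW r0) ?(ltW rho0)//= ltr_pdivrMr//; lra.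
  apply: An_mono (H _ t01) => [_||y _].
  - by rewrite divfK ?gt_eqF// lexx ltW.
  - rewrite expr_div_n.
    have : rho <= r ^+ 2 / (16 * (C + 1)) by exact: le_trans dC.
    rewrite ler_pdivlMr ?mulr_gt0// => H2.
    rewrite mulrAC ler_pdivrMr ?exprn_gt0//.
    have : rho * (rho * (16 * (C + 1))) <= rho * r ^+ 2 by rewrite ler_wpM2l// ltW.
    have : 0 <= rho ^+ 2 by exact: sqr_ge0.
    by rewrite !expr2; nra.
  - rewrite G0 subrr subr0 big_sumType/= [X in _ - (_ + X)]big1 ?addr0// => k _.
    by rewrite Gp mul0r.
pose rho := d.
have [s s0 H2] : exists2 s, 0 < s & forall s', 0 < s' <= s -> forall j,
    \sum_i `|pdr (inl i) (fun z => G j z - y0 j) z0| * s' <= rho / 16.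
  apply: fin_radius => j; pose S := \sum_i `|pdr (inl i) (fun z => G j z - y0 j) z0|.
  have S0 : 0 <= S by exact: sumr_ge0.
  exists (rho / 16 / (S + 1)); first by rewrite divr_gt0 ?ltr_wpDl// divr_gt0.
  move=> s' /andP[s'0]; rewrite ler_pdivlMr ?ltr_wpDl// => H2.
  by rewrite -mulr_suml -/S; lra.
pose r := Num.min s rho.
have r0 : 0 < r by rewrite lt_min s0.
have HG j : An z0 (sext (fun=> r) (fun=> rho)) (rho / 8) (fun z => G j z - y0 j).
  pose L (z : I + J -> R) := \sum_i pdr (inl i) (fun z => G j z - y0 j) z0 * (z (inl i) - x0 i).
  have HL : An z0 (sext (fun=> r) (fun=> rho)) (\sum_i `|pdr (inl i) (fun z => G j z - y0 j) z0| * r) L.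
    apply: An_sum => i; apply: AnM; first by case => _ /=; exact: ltW.
      exact: An_const.
    exact: (@An_coord R _ z0 (sext (fun=> r) (fun=> rho)) (inl i)).
  have HR : An z0 (sext (fun=> r) (fun=> rho)) (rho / 16) (fun z => G j z - y0 j - L z).
    apply: An_mono (H1 rho _ j) => //; last by rewrite d0 lexx.
    by case=> _ /=; rewrite ?lexx ?(ltW d0)//= ?(ltW r0)// ge_min lexx orbT.
  apply: An_mono (AnD HR HL) => [[i|k]||z _] //=; rewrite ?lexx ?(ltW r0) ?(ltW d0)//.
    by have := H2 r _ j; rewrite r0 ge_min lexx => /(_ isT); lra.
  by rewrite subrK.
have [Y [YA YG]] := An_fix r0 d0 HG.
have d2 : 0 < rho / 2 by rewrite /rho; lra.
have FY z : (forall j, G j z = z (inr j)) -> forall j, F j z = 0.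
  move=> Gz j.
  have S0 l : \sum_k M l k * F k z = 0.
    by have := Gz l; rewrite /G => /eqP; rewrite -subr_eq0 addrAC subrr add0r oppr_eq0 => /eqP.
  have -> : F j z = \sum_k (j == k)%:R * F k z.
    rewrite (bigD1 j)//= eqxx mul1r big1 ?addr0// => k kj.
    by rewrite eq_sym (negbTE kj) mul0r.
  under eq_bigr => k _ do rewrite -FM mulr_suml.
  rewrite exchange_big big1//= => l _.
  by under eq_bigr => k _ do rewrite -mulrA; rewrite -mulr_sumr S0 mulr0.
have Y0 : Y x0 = y0.
  have [|_ U] := YG x0; first by apply: box_center => _; exact: ltW.
  by apply/esym/U => //; apply: box_center => _; exact: ltW.
exists Y; split=> //.
- move=> j; apply: ana_ext (anaD (_ : ana (fun x => Y x j - y0 j) x0) (ana_const (y0 j) x0)).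
    by move=> x; rewrite subrK.
  by exists r, (rho / 2).
- exists r => // x xx; have [GY _] := YG x xx; apply: FY => j; exact: GY.
- have := @nearby_box R (I + J)%type z0 (sext (fun=> r) (fun=> rho / 2)).
  move=> /(_ _)/wrap[]; first by case.
  apply: nearbyS => z zz Fz.
  have [|_ U] := YG (fun i => z (inl i)); first by move=> i; exact: (zz (inl i)).
  apply: U; first by move=> j; exact: (zz (inr j)).
  move=> j; rewrite sextE /G big1 ?subr0// => l _; by rewrite Fz mulr0.
Qed.

Lemma implicit_function1 I (f : (option I -> R) -> R) (x0 : I -> R) (y0 : R) :
  ana f (oext x0 y0) -> f (oext x0 y0) = 0 -> pdr None f (oext x0 y0) != 0 ->
  exists Y : (I -> R) -> R, [/\ ana Y x0, Y x0 = y0,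
    nearby x0 (fun x => f (oext x (Y x)) = 0) &
    nearby (oext x0 y0) (fun z => f z = 0 -> z None = Y (oproj z))].
Proof.
move=> fa f0 fd.
pose F (_ : unit) (z : I + unit -> R) := f (oext (fun i => z (inl i)) (z (inr tt))).
have E x y : oext (fun i => @sext I unit x (fun=> y) (inl i)) (@sext I unit x (fun=> y) (inr tt)) = oext x y.
  by apply/funext => -[].
have Fp j k : pdr (inr k) (F j) (sext x0 (fun=> y0)) = pdr None f (oext x0 y0).
  rewrite /pdr; congr (derive _ _ _); apply/funext => t; congr f.
  by apply/funext => -[i|]; rewrite /shl/= ?mulr0 ?addr0//; case: k.
have [||j k|j k|Y [Ya Y0 Yz Yu]] := @implicit_function I unit F x0 (fun=> y0)
   (fun _ _ => (pdr None f (oext x0 y0))^-1).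
- move=> j; apply: (ana_comp (g := fun k z => oext (fun i => z (inl i)) (z (inr tt)) k)).
    by rewrite E.
  by move=> [i|]; exact: ana_coord.
- by move=> j; rewrite /F E.
- rewrite (bigD1 tt)//= big1 ?addr0 => [|[]//].
  by rewrite Fp mulVf//; case: j k => -[].
- rewrite (bigD1 tt)//= big1 ?addr0 => [|[]//].
  by rewrite Fp divff//; case: j k => -[].
exists (fun x => Y x tt); split.
- exact: Ya.
- by rewrite Y0.
- apply: nearbyS Yz => x /(_ tt); rewrite /F -[in LHS](E x).
  by congr (f _ = _); apply/funext => -[].
- have [d d0 H] := Yu; exists d => // z zx fz.
  have := H (fun k => match k with inl i => z (Some i) | inr _ => z None end) _ _.
  move=> /(_ _ _)/wrap[].
    by move=> [i|j] /=; [exact: (zx (Some i))|exact: (zx None)].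
  have Fz (j : unit) : F j (fun k => match k with inl i => z (Some i) | inr _ => z None end) = 0.
    by rewrite /F/= -[RHS]fz; congr f; exact: (oextK z).
    exact: Fz.
  by move=> /(congr1 (fun g => g tt)) /=.
Qed.

End ImplicitFunction.

Section OneVariable.
Variables (R : realType).
Implicit Types (I J : finType).

Definition ana1 (f : R -> R) (a : R) := ana (fun z : unit -> R => f (z tt)) (fun=> a).

Lemma ana_comp1 I f g (x : I -> R) : ana1 f (g x) -> ana g x -> ana (fun y => f (g y)) x.
Proof. by move=> fg gx; exact: (ana_comp (g := fun _ : unit => g) fg). Qed.

Lemma ana1_is_derive f a : ana1 f a -> is_derive a 1 f ('D_1 f a).
Proof.
move=> /(ana_derive tt) H.
have : is_derive (a : R) 1 (fun t => f (t - a + a)) (pdr tt (fun z : unit -> R => f (z tt)) (fun=> a)).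
  have D : is_derive (a : R) 1 (fun t => t - a) (1 - 0) by apply: is_deriveB.
  rewrite subr0 in D.
  have H' : is_derive ((fun t => t - a) a : R) 1 (fun t : R => f (shl (fun=> a) tt t tt)) (pdr tt (fun z : unit -> R => f (z tt)) (fun=> a)).
    by rewrite subrr.
  have := @is_derive1_comp R (fun t : R => f (shl (fun=> a) tt t tt)) (fun t => t - a) a _ _ H' D.
  rewrite mulr1; congr is_derive.
  by apply/funext => t; rewrite /= /shl/= mulr1 addrC.
have -> : (fun t : R => f (t - a + a)) = f by apply/funext => t; rewrite subrK.
move=> D; by rewrite derive_val.
Qed.

Lemma pdr_comp1 I (f : R -> R) (g : (I -> R) -> R) (x : I -> R) i (d : R) : is_derive (g x) 1 f d -> ana g x ->
  pdr i (fun y => f (g y)) x = d * pdr i g x.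
Proof.
move=> Df /(ana_derive i) Dg; apply: derive_val.
apply: (@is_derive1_comp _ f (fun t => g (shl x i t))) => //.
by rewrite shl0.
Qed.

Lemma is_derive_continuous (f : R -> R) a d : is_derive (a : R) 1 f d -> {for a, continuous f}.
Proof.
move=> [df _]; apply: differentiable_continuous; exact/derivable1_diffP.
Qed.

(** On radius 1 all partial sums have norm at most [expR 1], so pointwise convergence suffices.
    Exponential, sine and cosine reach other base points through their addition formulas. *)
Lemma entire_ana1 (c : nat -> R) (f : R -> R) :
  (forall k, `|c k| <= (k`!%:R)^-1) ->
  (forall x, (fun n => \sum_(0 <= k < n) c k * x ^+ k) @ \oo --> f x) -> ana1 f 0.
Proof.
move=> Hc Hf; exists 1, (expR 1); split=> //.
apply: An_lim => ys e e0 ysY.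
have bnd n : \sum_(0 <= k < n) `|c k| * 1 ^+ k <= expR 1.
  apply: (@le_trans _ _ (series (exp_coeff 1) n)).
    by apply: ler_sum => k _; rewrite /exp_coeff/= !expr1n mulr1 mul1r.
  apply: nondecreasing_cvgn_le; last exact: is_cvg_series_exp_coeff.
  apply/nondecreasing_seqP => k; rewrite /series/= big_nat_recr//= lerDl.
  by rewrite /exp_coeff/= expr1n divr_ge0.
have [n Hn] : exists n, forall y : unit -> R, y \in ys ->
    `|\sum_(0 <= k < n) c k * y tt ^+ k - f (y tt)| <= e.
  suff [n Hn] : exists n, forall m, (n <= m)%N -> forall y : unit -> R, y \in ys ->
    `|\sum_(0 <= k < m) c k * y tt ^+ k - f (y tt)| <= e by exists n; exact: Hn.
  clear ysY; elim: ys => [|y ys [n IH]]; first by exists 0%N.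
  have /cvgrPdist_le/(_ e e0)[m _ Hm] := Hf (y tt).
  exists (maxn n m) => k; rewrite geq_max => /andP[nk mk] z; rewrite inE => /predU1P[->|zys].
    by rewrite distrC; exact: Hm.
  exact: IH.
exists (fun y => \sum_(0 <= k < n) c k * y tt ^+ k); last exact: Hn.
move=> zs e' e'0 _.
exists (fun h : unit -> R => \sum_(0 <= k < n) c k * h tt ^+ k), (\sum_(0 <= k < n) `|c k| * 1 ^+ k).
split=> //.
- apply: poly_sum => k; apply: (@poly_mul _ _ _ _ _ (fun=> c k)); first exact: poly_const.
  apply: poly_exp; exact: (@poly_var R unit (fun=> 1) tt).
- by move=> y _; rewrite /shf subr0 subrr normr0 ltW.
Qed.

Lemma ana1_shift f g a (b : R) : ana1 g (b - a) -> (forall x, f x = g (x - a)) -> ana1 f b.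
Proof.
move=> Hg E; rewrite /ana1.
apply: ana_ext (_ : ana (fun z : unit -> R => g (z tt - a)) _); first by move=> z; rewrite E.
apply: ana_comp1 => //; apply: anaB; [exact: ana_coord|exact: ana_const].
Qed.

Lemma ana1D f g (a : R) : ana1 f a -> ana1 g a -> ana1 (fun x => f x + g x) a.
Proof. exact: anaD. Qed.

Lemma ana1Z c f (a : R) : ana1 f a -> ana1 (fun x => c * f x) a.
Proof. exact: anaZ. Qed.

Lemma ana1_expR (a : R) : ana1 expR a.
Proof.
have H0 : ana1 (expR : R -> R) 0.
  apply: (@entire_ana1 (fun k => (k`!%:R)^-1)) => [k|x]; first by rewrite ger0_norm// invr_ge0.
  have -> : (fun n => \sum_(0 <= k < n) (k`!%:R)^-1 * x ^+ k) = series (exp_coeff x).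
    by apply/funext => n; apply: eq_bigr => k _; rewrite mulrC.
  exact: is_cvg_series_exp_coeff.
apply: (@ana1_shift _ (fun x => expR a * expR x) a); first by rewrite subrr; exact: ana1Z.
by move=> x; rewrite -expRD addrC subrK.
Qed.

Lemma ana1_sin0 : ana1 (sin : R -> R) 0.
Proof.
apply: (@entire_ana1 (fun n => (odd n)%:R * (-1) ^+ n.-1./2 / n`!%:R)) => [k|x].
  rewrite normrM normrM normrX normrN1 expr1n mulr1 normfV [`|k`!%:R|]ger0_norm//.
  rewrite ler_piMl ?invr_ge0//; by case: odd; rewrite ?normr1 ?normr0.
have -> : (fun n => \sum_(0 <= k < n) (odd k)%:R * (-1) ^+ k.-1./2 / k`!%:R * x ^+ k) = series (sin_coeff x).
  by apply/funext => n; apply: eq_bigr => k _; rewrite /sin_coeff/=; ring.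
rewrite unlock; exact: is_cvg_series_sin_coeff.
Qed.

Lemma ana1_cos0 : ana1 (cos : R -> R) 0.
Proof.
apply: (@entire_ana1 (fun n => (~~ odd n)%:R * (-1) ^+ n./2 / n`!%:R)) => [k|x].
  rewrite normrM normrM normrX normrN1 expr1n mulr1 normfV [`|k`!%:R|]ger0_norm//.
  rewrite ler_piMl ?invr_ge0//; by case: odd; rewrite ?normr1 ?normr0.
have -> : (fun n => \sum_(0 <= k < n) (~~ odd k)%:R * (-1) ^+ k./2 / k`!%:R * x ^+ k) = series (cos_coeff x).
  by apply/funext => n; apply: eq_bigr => k _; rewrite /cos_coeff/= mulrAC.
rewrite unlock; exact: is_cvg_series_cos_coeff.
Qed.

Lemma ana1_sin (a : R) : ana1 sin a.
Proof.
apply: (@ana1_shift _ (fun x => cos a * sin x + sin a * cos x) a).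
  by rewrite subrr; apply: ana1D; apply: ana1Z; [exact: ana1_sin0|exact: ana1_cos0].
by move=> x; rewrite addrC [_ * sin _]mulrC [_ * cos _]mulrC -[LHS](congr1 sin (subrK a x)) sinD; ring.
Qed.

Lemma ana1_cos (a : R) : ana1 cos a.
Proof.
apply: (@ana1_shift _ (fun x => cos a * cos x + (- sin a) * sin x) a).
  by rewrite subrr; apply: ana1D; apply: ana1Z; [exact: ana1_cos0|exact: ana1_sin0].
by move=> x; rewrite -[LHS](congr1 cos (subrK a x)) cosD; ring.
Qed.

(** Inverse, square root and logarithm are obtained as implicit solutions of [x y = 1], [y^2 = x]
    and [e^y = x], not from their series. *)
Lemma anaV I f (x : I -> R) : ana f x -> f x != 0 -> ana (fun y => (f y)^-1) x.
Proof.
move=> fx f0.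
apply: (@ana_comp1 _ (fun t => t^-1) f) => //.
set a := f x in f0 *.
pose h (z : option unit -> R) := z (Some tt) * z None - 1.
have hD : is_derive (0 : R) 1 (fun t => h (shl (oext (fun=> a) a^-1) None t)) (a * 1).
  have -> : (fun t => h (shl (oext (fun=> a) a^-1) None t)) = (fun t => a * t).
    by apply/funext => t; rewrite /h /shl/= mulr0 addr0 mulr1 mulrDr divff// addrC addKr.
  by apply: (@is_deriveZ _ _ _ id).
have [||| Y [Ya Y0 [d d0 H] _]] := @implicit_function1 R unit h (fun=> a) a^-1.
- by apply: anaB; [apply: anaM; exact: ana_coord|exact: ana_const].
- by rewrite /h/= divff// subrr.
- by rewrite /pdr (@derive_val _ _ _ _ _ _ _ hD) mulr1.
apply: ana_near (Ya) _; exists d => // y yx.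
have := H y yx; rewrite /h/= => /eqP; rewrite subr_eq0 => /eqP E.
have y0 : y tt != 0 by apply/eqP => y0; move: E; rewrite y0 mul0r => /eqP; rewrite eq_sym oner_eq0.
by apply: (mulfI y0); rewrite E divff.
Qed.

Lemma ana_sqrt I f (x : I -> R) : ana f x -> 0 < f x -> ana (fun y => Num.sqrt (f y)) x.
Proof.
move=> fx f0; apply: (@ana_comp1 _ Num.sqrt f) => //.
set a := f x in f0 *; have s0 : 0 < Num.sqrt a by rewrite sqrtr_gt0.
pose h (z : option unit -> R) := z None * z None - z (Some tt).
have hp : pdr None h (oext (fun=> a) (Num.sqrt a)) = 2 * Num.sqrt a.
  rewrite pdrB; [|by apply: anaM; exact: ana_coord|exact: ana_coord].
  rewrite pdrM; [|exact: ana_coord..].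
  by rewrite !pdr_coord/=; ring.
have [||| Y [Ya Y0 Yz _]] := @implicit_function1 R unit h (fun=> a) (Num.sqrt a).
- by apply: anaB; [apply: anaM; exact: ana_coord|exact: ana_coord].
- by rewrite /h/= -expr2 sqr_sqrtr ?subrr// ltW.
- by rewrite hp mulf_neq0// ?pnatr_eq0// gt_eqF.
apply: ana_near (Ya) _.
have Yp : nearby (fun=> a) (fun y => 0 < Y y) by apply: ana_gt0 => //; rewrite Y0.
apply: nearbyS (nearbyI Yz Yp) => y [].
rewrite /h/= => /eqP; rewrite subr_eq0 => /eqP <- Y0'.
by rewrite -expr2 sqrtr_sqr ger0_norm// ltW.
Qed.

Lemma ana_ln I f (x : I -> R) : ana f x -> 0 < f x -> ana (fun y => ln (f y)) x.
Proof.
move=> fx f0; apply: (@ana_comp1 _ (@ln R) f) => //.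
set a := f x in f0 *.
pose h (z : option unit -> R) := expR (z None) - z (Some tt).
have ha z : ana h z.
  apply: anaB; last exact: ana_coord.
  by apply: (@ana_comp1 _ expR); [exact: ana1_expR|exact: ana_coord].
have hp : pdr None h (oext (fun=> a) (ln a)) = a.
  rewrite pdrB; [|by apply: (@ana_comp1 _ expR); [exact: ana1_expR|exact: ana_coord]|exact: ana_coord].
  rewrite (@pdr_comp1 _ expR _ _ _ _ (is_derive_expR _)); last exact: ana_coord.
  by rewrite !pdr_coord/= subr0 mulr1 lnK.
have [||| Y [Ya Y0 Yz _]] := @implicit_function1 R unit h (fun=> a) (ln a).
- exact: ha.
- by rewrite /h/= lnK// subrr.
- by rewrite hp gt_eqF.
apply: ana_near (Ya) _; apply: nearbyS Yz => y.
rewrite /h/= => /eqP; rewrite subr_eq0 => /eqP <-; by rewrite expRK.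
Qed.

Lemma ana_expR I f (x : I -> R) : ana f x -> ana (fun y => expR (f y)) x.
Proof. by apply: ana_comp1; exact: ana1_expR. Qed.

Lemma ana_sin I f (x : I -> R) : ana f x -> ana (fun y => sin (f y)) x.
Proof. by apply: ana_comp1; exact: ana1_sin. Qed.

Lemma ana_cos I f (x : I -> R) : ana f x -> ana (fun y => cos (f y)) x.
Proof. by apply: ana_comp1; exact: ana1_cos. Qed.

Lemma ana_div I f g (x : I -> R) : ana f x -> ana g x -> g x != 0 -> ana (fun y => f y / g y) x.
Proof. by move=> fx gx g0; apply: anaM => //; exact: anaV. Qed.

End OneVariable.

(** * Integrals *)

Section Integral.
Variables (R : realType).
Implicit Types (I J : finType).

(** The derivative is two-sided also at the end points, so a primitive has to live beyond
    [[a, b]]. *)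
Definition prim_on (a b : R) (f P : R -> R) :=
  forall t, a <= t <= b -> is_derive (t : R) 1 P (f t).

Definition cton (a b : R) (f : R -> R) := forall t, a <= t <= b -> {for t, continuous f}.

(* Integrals are increments of primitives, with the junk value [0] if there is
   no primitive. *)
Definition NI (a b : R) (f : R -> R) : R :=
  xget 0 [set v | exists P, prim_on a b f P /\ v = P b - P a].

Lemma prim_MVT (a b : R) f P : a < b -> prim_on a b f P ->
  exists2 c, a < c < b & P b - P a = f c * (b - a).
Proof.
move=> ab HP; have [||c] := @MVT R P f a b ab.
- move=> x; rewrite in_itv/= => /andP[ax xb]; apply: HP; by rewrite !ltW.
- apply: derivable_within_continuous => x; rewrite in_itv/= => xab.
  by have [] := HP x xab.
by rewrite in_itv/= => cab E; exists c.
Qed.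

Lemma NIE (a b : R) f P : a < b -> prim_on a b f P -> NI a b f = P b - P a.
Proof.
move=> ab HP; rewrite /NI; case: xgetP => [_ -> [Q [HQ ->]]|/(_ (P b - P a))[]]; last by exists P.
have H : prim_on a b (fun=> 0) (fun t => Q t - P t).
  by move=> t tab; rewrite -(subrr (f t)); apply: is_deriveB; [exact: HQ|exact: HP].
have [c _] := prim_MVT ab H; rewrite mul0r => /eqP; rewrite subr_eq0 => /eqP; lra.
Qed.

Lemma prim_ex (a b : R) f : a < b -> cton a b f -> exists P, prim_on a b f P.
Proof.
move=> ab cf.
(* Clamping makes the integrand continuous on the whole line without changing it on [[a, b]]. The
   integral starts at [a - 1] and is considered up to [b + 1], so that both end points are
   interior. *)
pose cl (t : R) := Num.max a (Num.min b t).
have clab t : a <= cl t <= b.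
  by rewrite /cl le_max lexx/= ge_max (ltW ab) ge_min lexx.
pose g t := f (cl t).
have cg : continuous g.
  move=> t; apply: (@continuous_comp _ _ _ cl f); last exact: cf.
  apply: continuous_max; first exact: cvg_cst.
  apply: continuous_min; first exact: cvg_cst.
  exact: cvg_id.
pose P x := \int[lebesgue_measure]_(t in [set` Interval (BLeft (a - 1)) (BRight x)]) g t.
exists P => t tab.
have tb : t < b + 1 by case/andP: tab => _ ?; lra.
have [|||d e] := @continuous_FTC1_closed R g (a - 1) t (b + 1) tb.
- apply: continuous_compact_integrable; first exact: segment_compact.
  exact: continuous_subspaceT.
- by case/andP: tab => ? _; lra.
- exact: cg.
have -> : f t = g t by rewrite /g /cl; congr f; move: tab => /andP[? ?]; rewrite min_r// max_r.
move: d e; rewrite -/P; move: P => P d e.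
by apply: DeriveDef; [exact: d|rewrite -derive1E; exact: e].
Qed.

Lemma NI_eq (a b : R) f g : (forall t, a <= t <= b -> f t = g t) -> NI a b f = NI a b g.
Proof.
move=> fg; congr (xget 0); apply/seteqP; split=> v [P [HP ->]]; exists P; split=> // t tab.
  by rewrite -fg//; exact: HP.
by rewrite fg//; exact: HP.
Qed.

Lemma NID (a b : R) f g : a < b -> cton a b f -> cton a b g ->
  NI a b (fun t => f t + g t) = NI a b f + NI a b g.
Proof.
move=> ab /(prim_ex ab)[P HP] /(prim_ex ab)[Q HQ].
rewrite (NIE ab HP) (NIE ab HQ) (@NIE _ _ _ (fun t => P t + Q t))//; first by ring.
by move=> t tab; apply: is_deriveD; [exact: HP|exact: HQ].
Qed.

Lemma NIZ (a b : R) c f : a < b -> cton a b f ->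
  NI a b (fun t => c * f t) = c * NI a b f.
Proof.
move=> ab /(prim_ex ab)[P HP].
rewrite (NIE ab HP) (@NIE _ _ _ (fun t => c * P t))//; first by ring.
by move=> t tab; apply: is_deriveZ; exact: HP.
Qed.

Lemma cton_const (a b : R) c : cton a b (fun=> c).
Proof. by move=> t _; exact: cvg_cst. Qed.

Lemma cton_derive (a b : R) f df : (forall t, a <= t <= b -> is_derive (t : R) 1 f (df t)) -> cton a b f.
Proof. by move=> H t /H; exact: is_derive_continuous. Qed.

Lemma ctonD (a b : R) f g : cton a b f -> cton a b g -> cton a b (fun t => f t + g t).
Proof. by move=> cf cg t tab; apply: continuousD; [exact: cf|exact: cg]. Qed.

Lemma ctonM (a b : R) f g : cton a b f -> cton a b g -> cton a b (fun t => f t * g t).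
Proof. by move=> cf cg t tab; apply: continuousM; [exact: cf|exact: cg]. Qed.

Lemma NI_MVT (a b : R) f : a < b -> cton a b f ->
  exists2 c, a < c < b & NI a b f = f c * (b - a).
Proof. by move=> ab /(prim_ex ab)[P HP]; rewrite (NIE ab HP); exact: prim_MVT. Qed.

Lemma NI0 (a b : R) : a < b -> NI a b (fun=> 0) = 0.
Proof. by move=> ab; have [c _ ->] := NI_MVT ab (@cton_const a b 0); rewrite mul0r. Qed.

Lemma NI_sum (a b : R) (K : Type) (s : seq K) (P : pred K) (f : K -> R -> R) :
  a < b -> (forall k, cton a b (f k)) ->
  NI a b (fun t => \sum_(k <- s | P k) f k t) = \sum_(k <- s | P k) NI a b (f k) /\
  cton a b (fun t => \sum_(k <- s | P k) f k t).
Proof.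
move=> ab cf; elim: s => [|k s [IH1 IH2]].
  rewrite big_nil; have -> : (fun t => \sum_(k <- [::] | P k) f k t) = fun=> 0.
    by apply/funext => t; rewrite big_nil.
  by rewrite NI0//; split=> //; exact: cton_const.
rewrite big_cons; case: ifPn => Pk.
  have -> : (fun t => \sum_(k <- k :: s | P k) f k t) = fun t => f k t + \sum_(k <- s | P k) f k t.
    by apply/funext => t; rewrite big_cons Pk.
  by rewrite NID// IH1; split=> //; exact: ctonD.
have -> // : (fun t => \sum_(k <- k :: s | P k) f k t) = fun t => \sum_(k <- s | P k) f k t.
by apply/funext => t; rewrite big_cons (negbTE Pk).
Qed.

Lemma compact_uniform (a b : R) (Q : R -> R -> Prop) :
  (forall d d' s, 0 < d' <= d -> Q d s -> Q d' s) ->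
  (forall s, a <= s <= b -> exists2 d, 0 < d & forall s', `|s' - s| <= d -> Q d s') ->
  exists2 d, 0 < d & forall s, a <= s <= b -> Q d s.
Proof.
move=> Qmono H.
have /compact_near_coveringP/(_ nat \oo (fun n s => Q (n.+1%:R^-1) s)) := @segment_compact R a b.
move=> /(_ _ _)/wrap[].
  move=> s; rewrite /= in_itv/= => /H[d d0 Hd].
  have [N _ HN] := near_infty_natSinv_lt (PosNum d0).
  exists ([set s' | `|s' - s| <= d], [set n | (N <= n)%N]).
    split; last by exists N.
    by apply/nbhs_ballP; exists d => //= s'; rewrite /ball/= distrC => /ltW.
  move=> [s' n] /= [s'd Nn]; apply: Qmono (Hd s' s'd).
  by rewrite invr_gt0 ltr0Sn/= ltW//; exact: HN.
move=> [N _ HN]; exists (N.+1%:R^-1); first by rewrite invr_gt0.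
by move=> s sab; apply: (HN N (leqnn N)); rewrite /= in_itv.
Qed.

Lemma cton_unif (a b : R) f e : cton a b f -> 0 < e ->
  exists2 d, 0 < d & forall s t, a <= s <= b -> a <= t <= b -> `|t - s| <= d -> `|f t - f s| <= e.
Proof.
move=> cf e0.
have [d d0 Hd] : exists2 d, 0 < d & forall s, a <= s <= b ->
    forall t, a <= t <= b -> `|t - s| <= d -> `|f t - f s| <= e.
  apply: compact_uniform => [d d' s /andP[_ dd] H t tab ts|s sab].
    by apply: H => //; apply: le_trans dd.
  have e2 : 0 < e / 2 by lra.
  have /cvgrPdist_le/(_ _ e2) := cf s sab.
  rewrite nearE => /nbhs_ballP[d /= d0 Hd]; exists (d / 4); first by lra.
  move=> s' s's t tab ts'.
  have B1 : ball s d s' by rewrite /ball/= distrC; lra.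
  have B2 : ball s d t.
    rewrite /ball/= distrC; have := ler_normD (t - s') (s' - s); rewrite addrA subrK; lra.
  have := Hd _ B1; have := Hd _ B2 => /= H1 H2.
  have -> : f t - f s' = (f s - f s') - (f s - f t) by ring.
  by rewrite (le_trans (ler_normB _ _))//; lra.
by exists d => // s t sab tab; exact: Hd.
Qed.

(** Riemann sums have norm at most [(b - a) * C], and on finitely many parameters at once a fine
    subdivision approximates the integral; [An_lim] concludes. *)
Lemma An_NI I (x r : I -> R) C (a b : R) (F : (I -> R) -> R -> R) : a < b -> (forall i, 0 <= r i) ->
  (forall s, a <= s <= b -> An x r C (fun y => F y s)) ->
  (forall y, box x r y -> cton a b (F y)) ->
  An x r ((b - a) * C) (fun y => NI a b (F y)).
Proof.
move=> ab r0 FA Fc; apply: An_lim => ys e e0 ysY.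
pose e' := e / (b - a).
have ba : 0 < b - a by lra.
have e'0 : 0 < e' by rewrite divr_gt0.
have [d d0 Hd] : exists2 d, 0 < d & forall y : I -> R, y \in ys -> forall s t, a <= s <= b -> a <= t <= b ->
    `|t - s| <= d -> `|F y t - F y s| <= e'.
  elim: ys ysY => [|y ys IH] ysY; first by exists 1.
  have [z zys|d d0 Hd] := IH; first by apply: ysY; rewrite inE zys orbT.
  have [|d' d'0 Hd'] := cton_unif (Fc y _) e'0; first by apply: ysY; rewrite inE eqxx.
  exists (Num.min d d'); first by rewrite lt_min d0.
  move=> z; rewrite inE => /predU1P[->|zys] s t sab tab; rewrite le_min => /andP[sd sd'].
    exact: Hd'.
  exact: Hd zys _ _ _ _ _.
have [N [N0 HN]] : exists N : nat, (0 < N)%N /\ (b - a) / N%:R <= d.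
  have [N _ HN] := near_infty_natSinv_lt (PosNum (divr_gt0 d0 ba)).
  exists N.+1; split=> //; have := HN N (leqnn N) => /= H.
  by rewrite mulrC -ler_pdivlMr// ltW.
have NR : 0 < N%:R :> R by rewrite ltr0n.
pose h := (b - a) / N%:R.
have h0 : 0 < h by rewrite divr_gt0.
pose sk (k : nat) := a + k%:R * h.
have skb k : (k <= N)%N -> a <= sk k <= b.
  move=> kN; rewrite /sk lerDl mulr_ge0 ?(ltW h0)//=.
  have : k%:R * h <= N%:R * h by rewrite ler_wpM2r ?(ltW h0)// ler_nat.
  by rewrite /h [N%:R * _]mulrC divfK ?gt_eqF//; lra.
exists (fun y => \sum_(0 <= k < N) h * F y (sk k)).
  have H : An x r (\sum_(0 <= k < N) (if (k < N)%N then h * C else 0)) (fun y => \sum_(0 <= k < N) (if (k < N)%N then h * F y (sk k) else 0)).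
    apply: An_sum => k; case: ifPn => kN; last by have := @An_const R I x r 0; rewrite normr0.
    apply: AnM => //; last by apply: FA; exact/skb/ltnW.
    by rewrite -[X in An _ _ X](ger0_norm (ltW h0)); exact: An_const.
  apply: An_mono H => [i||y _]; first by rewrite r0 lexx.
    rewrite (eq_big_nat _ _ (F2 := fun=> h * C)); last by move=> k /andP[_ ->].
    rewrite sumr_const_nat subn0 -mulr_natr /h mulrAC divfK ?gt_eqF//.
  by apply: eq_big_nat => k /andP[_ ->].
move=> y yys; have Hc := Fc y (ysY y yys).
have [P HP] := prim_ex ab Hc.
rewrite (NIE ab HP).
have Pb : P b = P (sk N) by rewrite /sk /h mulrC divfK ?gt_eqF// addrC subrK.
have Pa : P a = P (sk 0%N) by rewrite /sk mul0r addr0.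
rewrite Pb Pa -(telescope_sumr (fun k => P (sk k)))// -sumrB.
apply: le_trans (ler_norm_sum _ _ _) _.
have -> : e = \sum_(0 <= k < N) h * e'.
  rewrite sumr_const_nat subn0 -mulr_natr /h /e'; field.
  by rewrite !gt_eqF.
rewrite !big_nat; apply: ler_sum => k /andP[_ kN].
have sS : sk k.+1 = sk k + h by rewrite /sk -addn1 natrD mulrDl mul1r addrA.
have lt_s : sk k < sk k.+1 by rewrite sS ltrDl.
have [|c /andP[c1 c2] ->] := prim_MVT (P := P) (f := F y) lt_s.
  move=> t /andP[t1 t2]; apply: HP; have /andP[B1 _] := skb k (ltnW kN).
  by have /andP[_ B2] := skb k.+1 kN; rewrite (le_trans B1 t1) (le_trans t2 B2).
have -> : sk k.+1 - sk k = h by rewrite sS addrC addKr.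
rewrite [F y c * h]mulrC -mulrBr normrM (ger0_norm (ltW h0)) ler_wpM2l ?(ltW h0)//.
rewrite distrC; apply: (Hd y yys); [exact/skb/ltnW| |].
  have /andP[B1 _] := skb k (ltnW kN); have /andP[_ B2] := skb k.+1 kN.
  by rewrite (le_trans B1 (ltW c1)) (le_trans (ltW c2) B2).
apply: le_trans HN; rewrite -/h; rewrite sS in c2; rewrite ger0_norm; lra.
Qed.

End Integral.

Section ParametricIntegral.
Variables (R : realType) (I : finType) (a b : R).
Hypothesis ab : a < b.
Implicit Types (x : I -> R) (F : (option I -> R) -> R).

Lemma ana_slice F x (s : R) : ana F (oext x s) ->
  is_derive s 1 (fun s => F (oext x s)) (pdr None F (oext x s)).
Proof.
move=> Fa; have := @ana_curve R _ F (oext x s) (fun h => oext x h) s (fun k => (k == None)%:R) Fa erefl.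
move=> /(_ _)/wrap[].
  by move=> [i|] /=; [exact: is_derive_cst|exact: is_derive_id].
rewrite (bigD1 None)//= mulr1 big1 ?addr0// => -[i|]// _; by rewrite mulr0.
Qed.

Definition tube F x := forall s, a <= s <= b -> ana F (oext x s).

Lemma tube_cton F x : tube F x -> cton a b (fun s => F (oext x s)).
Proof. by move=> Fa; apply: cton_derive => t /Fa/ana_slice; exact. Qed.

(** The number [d] serves both as radius and, inverted, as norm bound, because [compact_uniform]
    wants a property monotone in a single parameter. *)
Lemma tube_An F x : tube F x -> exists2 d, 0 < d & forall s, a <= s <= b ->
  An x (fun=> d) d^-1 (fun y => F (oext y s)) /\
  forall y, box x (fun=> d) y -> ana F (oext y s).
Proof.
move=> Fa; apply: compact_uniform => [d d' s /andP[d'0 dd] [H1 H2]|s sab].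
  split; last by move=> y yx; apply: H2 => i; apply: le_trans (yx i) dd.
  apply: An_mono H1 => // [_|]; first by rewrite dd ltW.
  by rewrite lef_pV2// posrE// (lt_le_trans d'0).
have [r [C [r0 HF]]] := Fa s sab; have [d1 d10 H1] := ana_open (Fa s sab).
have C0 : 0 <= C by apply: An_ge0 HF => _; exact: ltW.
pose d := Num.min (Num.min (r / 2) d1) (C + 1)^-1.
have C1 : 0 < C + 1 by lra.
have d0 : 0 < d by rewrite !lt_min d10 invr_gt0 C1 divr_gt0.
have [[dr dd1] dC] : (d <= r / 2 /\ d <= d1) /\ d <= (C + 1)^-1.
  by rewrite /d; split; [split|]; rewrite !ge_min lexx ?orbT.
have Cd : C <= d^-1.
  apply: (@le_trans _ _ (C + 1)); first by lra.
  by rewrite -[C + 1]invrK lef_pV2 ?posrE// invr_gt0.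
exists d => // s' s's; split; last first.
  move=> y yx; apply: H1 => -[i|] /=; [by apply: le_trans (yx i) _|exact: le_trans s's _].
have H : An x (fun=> d) C (fun y => F (fun k => oext y s' k)).
  apply: (An_comp (g := fun k y => oext y s' k)) HF _ => [_|_|[i|]] /=; [exact: ltW|exact: ltW| |].
    apply: An_mono (@An_coord R I x (fun=> d) i) => // [_|]; last by lra.
    by rewrite lexx ltW.
  apply: An_mono (@An_const R I x (fun=> d) (s' - s)) => // [_|]; last by lra.
  by rewrite lexx ltW.
by apply: An_mono H => // _; rewrite lexx ltW.
Qed.

Lemma ana_NI F x : tube F x -> ana (fun y => NI a b (fun s => F (oext y s))) x.
Proof.
move=> /tube_An[d d0 H]; exists d, ((b - a) * d^-1); split=> //.
apply: An_NI => // [_|s sab|y yx]; [exact: ltW|by case: (H s sab)|].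
apply: tube_cton => s sab; by case: (H s sab) => _; exact.
Qed.

Lemma tube_pdr F x k : tube F x -> tube (pdr k F) x.
Proof. by move=> Fa s /Fa; exact: ana_pdr. Qed.

End ParametricIntegral.

(** The difference quotient is analytic jointly in the increment and in [s], so its integral [Q] is
    analytic in the increment; the integral grows by [t * Q t], hence its derivative is [Q 0]. *)
Lemma pdr_NI (R : realType) (I : finType) (a b : R) (F : (option I -> R) -> R) (x : I -> R) i :
  a < b -> tube a b F x ->
  pdr i (fun y => NI a b (fun s => F (oext y s))) x =
  NI a b (fun s => pdr (Some i) F (oext x s)).
Proof.
move=> ab Fa.
pose H (z : option unit -> R) := dq (Some i) F (oext (oext x (z None)) (z (Some tt))).
have Ha : tube a b H (fun=> 0).
  move=> s /Fa Fs.
  apply: (ana_comp (g := fun k z => oext (oext x (z None)) (z (Some tt)) k)) => /=.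
    exact: ana_dq.
  by move=> [[j|]|] /=; [exact: ana_const|exact: ana_coord|exact: ana_coord].
pose Q (t : R) := NI a b (fun s => H (oext (fun _ : unit => t) s)).
have Qa : ana1 Q 0.
  have E (z : unit -> R) : NI a b (fun s => H (oext z s)) = Q (z tt).
    by congr NI; apply: funext => s; congr H; apply: funext => -[[]|].
  exact: (ana_ext E (ana_NI ab Ha)).
have [d d0 Hd] := tube_An Fa.
have Q0 : Q 0 = NI a b (fun s => pdr (Some i) F (oext x s)).
  by congr NI; apply/funext => s; rewrite /H/= dq0.
have D1 : is_derive (0 : R) 1 (fun t => t * Q t) (Q 0).
  have := is_deriveM (is_derive_id (0 : R) 1) (ana1_is_derive Qa).
  by rewrite /GRing.scale/= mul0r add0r mulr1.
rewrite -Q0; apply: derive_val.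
have bd t : `|t| <= d -> box x (fun=> d) (shl x i t) by exact: box_shl.
have D2 : is_derive (0 : R) 1 (fun t => NI a b (fun s => F (oext (shl x i t) s)) - t * Q t) 0.
  apply: (@is_derive_sq _ _ _ _ 0 d) => // t td.
  rewrite !add0r shl0 !mul0r !subr0.
  have T1 : tube a b F (shl x i t) by move=> s sab; have [_] := Hd s sab; apply; exact: bd.
  have c1 := tube_cton T1; have c0 := tube_cton Fa.
  have E s : F (oext (shl x i t) s) = F (oext x s) + t * H (oext (fun=> t) s).
    have := dqE (Some i) F (oext (oext x s) t); rewrite /= -[oproj _]/(oext x s) => E.
    rewrite /H/= -[t * _]E addrC; have -> : shl (oext x s) (Some i) t = oext (shl x i t) s.
      by apply/funext => -[k|]//=; rewrite /shl/= mulr0 addr0.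
    by rewrite subrK.
  have [->|t0] := eqVneq t 0; first by rewrite shl0 mul0r subr0 subrr normr0.
  have cH : cton a b (fun s => H (oext (fun=> t) s)).
    move=> s sab.
    have -> : (fun s => H (oext (fun=> t) s)) = (fun s => t^-1 * (F (oext (shl x i t) s) - F (oext x s))).
      by apply/funext => s'; rewrite E [F _ + _]addrC addrK mulKf.
    apply: continuousM; first exact: cvg_cst.
    by apply: continuousB; [exact: c1|exact: c0].
  have -> : NI a b (fun s => F (oext (shl x i t) s)) = NI a b (fun s => F (oext x s)) + t * Q t.
    rewrite /Q -NIZ// -NID//; last by apply: ctonM => //; exact: cton_const.
    by congr NI; apply/funext => s; exact: E.
  by rewrite addrK subrr normr0.
have := is_deriveD D2 D1; rewrite add0r; congr is_derive.
by apply/funext => t /=; rewrite subrK.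
Qed.

(** * Interlacing, and analytic dependence of simple real roots on a parameter *)

Section RealRootedPolynomials.
Variable (R : realType).
Implicit Types (p : {poly R}) (y z : nat -> R).

Definition incr (m : nat) (y : nat -> R) := forall i, (i.+1 < m)%N -> y i < y i.+1.

Lemma incr_lt m y i j : incr m y -> (i < j < m)%N -> y i < y j.
Proof.
move=> H /andP[ij jm]; elim: j ij jm => // j IH; rewrite ltnS leq_eqVlt => /predU1P[->|ij] jm.
  exact: H.
by apply: lt_trans (IH ij (ltnW jm)) (H _ jm).
Qed.

Lemma incr_le m y i j : incr m y -> (i <= j < m)%N -> y i <= y j.
Proof.
move=> H /andP[]; rewrite leq_eqVlt => /predU1P[->//|ij] jm.
by apply/ltW/(incr_lt H); rewrite ij.
Qed.

Lemma incr_inj m y i j : incr m y -> (i < m)%N -> (j < m)%N -> y i = y j -> i = j.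
Proof.
move=> H im jm E; case: (ltngtP i j) => // ij.
  by have := incr_lt H (_ : (i < j < m)%N); rewrite ij jm E ltxx => /(_ isT).
by have := incr_lt H (_ : (j < i < m)%N); rewrite ij im E ltxx => /(_ isT).
Qed.

Lemma ivt_sgn p (a b : R) : a < b -> p.[a] * p.[b] < 0 -> exists2 c, a < c < b & root p c.
Proof.
move=> ab pab.
have key q : q.[a] < 0 -> 0 < q.[b] -> exists2 c, a < c < b & root q c.
  move=> qa qb; have [|c /andP[ac cb] rc] := poly_ivt (p := q) (ltW ab).
    by rewrite (ltW qa) (ltW qb).
  exists c => //; rewrite !lt_neqAle ac cb !andbT; apply/andP; split.
    by apply/eqP => E; move: rc; rewrite -E rootE lt_eqF.
  by apply/eqP => E; move: rc; rewrite E rootE gt_eqF.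
have [pa|pa|pa] := ltgtP p.[a] 0; last by rewrite pa mul0r ltxx in pab.
  by apply: key => //; rewrite -(nmulr_rlt0 _ pa).
have [||c cab rc] := key (- p); rewrite ?hornerN ?oppr_lt0 ?oppr_gt0 ?pa//.
  by rewrite -(pmulr_rlt0 _ pa).
by exists c => //; rewrite -rootN.
Qed.

Lemma sign_alt k (a b : R) : 0 < (-1) ^+ k.+1 * a -> 0 < (-1) ^+ k * b -> a * b < 0.
Proof.
rewrite exprS mulN1r mulNr oppr_gt0 => H1 H2.
have : ((-1) ^+ k * a) * ((-1) ^+ k * b) < 0 by rewrite nmulr_rlt0.
by rewrite mulrACA -expr2 sqrr_sign mul1r.
Qed.

Lemma monic_pinfty p : p \is monic -> exists L, forall x, L <= x -> 0 < p.[x].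
Proof.
move=> /monicP pm.
have [|L H] := @polyrcf.poly_pinfty_gt_lc R p; first by rewrite pm ltr01.
by exists L => x /H; rewrite pm; exact: lt_le_trans.
Qed.

Lemma monic_ninfty p m : p \is monic -> size p = m.+1 ->
  exists L, forall x, x <= L -> 0 < (-1) ^+ m * p.[x].
Proof.
move=> pm sp.
have s2 : size (- 'X : {poly R}) = 2 by rewrite size_polyN size_polyX.
pose q := (-1) ^+ m *: (p \Po (- 'X)).
have qm : q \is monic.
  rewrite monicE /q lead_coefZ lead_coef_comp ?s2//= (monicP pm) sp lead_coefN lead_coefX/=.
  by rewrite mul1r -expr2 sqrr_sign.
have [L HL] := monic_pinfty qm; exists (- L) => x xL.
have := HL (- x); rewrite /q hornerZ horner_comp !hornerE opprK; apply.
by rewrite lerNr.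
Qed.

Lemma sgn_prod m y (x : R) j : (j <= m)%N -> (forall i, (i < j)%N -> y i < x) ->
  (forall i, (j <= i < m)%N -> x < y i) -> 0 < (-1) ^+ (m - j) * \prod_(0 <= i < m) (x - y i).
Proof.
move=> jm H1; elim: m jm => [|m IH] jm H2.
  by rewrite big_nil mulr1 expr0.
rewrite big_nat_recr//=; move: jm; rewrite leq_eqVlt => /predU1P[jE|jm].
  rewrite jE subnn mul1r mulr_gt0 ?subr_gt0 ?H1 ?jE// big_nat_cond prodr_gt0// => i.
  by rewrite andbT => /andP[_ im]; rewrite subr_gt0 H1// jE leqW.
have -> : (-1) ^+ (m.+1 - j) * (\prod_(0 <= i < m) (x - y i) * (x - y m)) =
    ((-1) ^+ (m - j) * \prod_(0 <= i < m) (x - y i)) * (y m - x).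
  by rewrite subSn// exprS; ring.
rewrite mulr_gt0//; first by apply: IH => // i /andP[ji im]; apply: H2; rewrite ji leqW.
by rewrite subr_gt0 H2// -ltnS jm ltnSn.
Qed.

Lemma monic_factor m p y : p \is monic -> size p = m.+1 -> incr m y ->
  (forall i, (i < m)%N -> root p (y i)) -> p = \prod_(0 <= i < m) ('X - (y i)%:P).
Proof.
move=> pm sp yi yr.
have := @all_roots_prod_XsubC R p (mkseq y m).
rewrite size_mkseq sp (monicP pm) scale1r => /(_ erefl).
rewrite /mkseq big_map /index_iota subn0; apply.
  by apply/allP => x /mapP[i]; rewrite mem_iota/= => im ->; exact: yr.
rewrite uniq_rootsE map_inj_in_uniq ?iota_uniq// => i j.
by rewrite !mem_iota/= => im jm; exact: incr_inj yi im jm.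
Qed.

Lemma horner_factor m y (x : R) :
  (\prod_(0 <= i < m) ('X - (y i)%:P)).[x] = \prod_(0 <= i < m) (x - y i).
Proof. by rewrite horner_prod; apply: eq_bigr => i _; rewrite !hornerE. Qed.

Lemma sorted_mkseq m y : incr m y -> sorted <%R (mkseq y m).
Proof.
move=> yi; rewrite sorted_pairwise; last exact: lt_trans.
apply/(pairwiseP 0) => i j; rewrite !inE !size_mkseq => im jm ij.
by rewrite !nth_mkseq//; apply: (incr_lt yi); rewrite ij.
Qed.

Lemma roots_unique m p y z : p \is monic -> size p = m.+1 -> incr m y -> incr m z ->
  (forall i, (i < m)%N -> root p (y i)) -> (forall i, (i < m)%N -> root p (z i)) ->
  forall i, (i < m)%N -> y i = z i.
Proof.
move=> pm sp yi zi yr zr.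
have E (u : nat -> R) : incr m u -> (forall i, (i < m)%N -> root p (u i)) ->
    forall x, (x \in mkseq u m) = root p x.
  move=> ui ur x; rewrite (monic_factor pm sp ui ur) /index_iota subn0.
  have -> : \prod_(i <- iota 0 m) ('X - (u i)%:P) = \prod_(t <- mkseq u m) ('X - t%:P).
    by rewrite /mkseq big_map.
  by rewrite root_prod_XsubC.
have : mkseq y m = mkseq z m.
  apply: lt_sorted_eq; [exact: sorted_mkseq|exact: sorted_mkseq|].
  by move=> x; rewrite !E.
by move=> H i im; have := congr1 (fun s => nth 0 s i) H; rewrite !nth_mkseq.
Qed.

Lemma interlace m p z : (0 < m)%N -> p \is monic -> size p = m.+1 -> incr m.-1 z ->
  (forall i, (i.+1 < m)%N -> 0 < (-1) ^+ (m - i.+1) * p.[z i]) ->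
  exists2 y : nat -> R, (forall i, (i < m)%N -> root p (y i)) &
    forall i, (i.+1 < m)%N -> y i < z i < y i.+1.
Proof.
move=> m0 pm sp zi zs.
have [L HL] := monic_pinfty pm; have [L' HL'] := monic_ninfty pm sp.
pose lo := Num.min L' (z 0%N - 1); pose hi := Num.max L (Num.max (lo + 1) (z m.-2 + 1)).
(* The test points [lo < z 0 < ... < z m.-2 < hi], numbered from 0 to [m]; the sign of [p]
   alternates along them. *)
pose e j := if j is j'.+1 then (if (j'.+1 < m)%N then z j' else hi) else lo.
have es j : (j <= m)%N -> 0 < (-1) ^+ (m - j) * p.[e j].
  case: j => [|j] jm; first by rewrite subn0; apply: HL'; rewrite /e ge_min lexx.
  rewrite /e; case: ltnP => [jm'|mj]; first exact: zs.
  have -> : j.+1 = m by apply/eqP; rewrite eqn_leq jm.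
  by rewrite subnn mul1r; apply: HL; rewrite le_max lexx.
have ei j : (j < m)%N -> e j < e j.+1.
  case: j => [|j] jm; rewrite /e.
    case: ltnP => _.
      have : lo <= z 0%N - 1 by rewrite ge_min lexx orbT.
      by lra.
    have : lo + 1 <= hi by rewrite !le_max lexx orbT.
    by lra.
  rewrite jm; case: ltnP => jm'; first by apply: zi; rewrite -ltnS prednK.
  have -> : j = m.-2 by move: jm jm'; clear; lia.
  have : z m.-2 + 1 <= hi by rewrite !le_max lexx !orbT.
  by lra.
have /choice [y Hy] : forall j, exists c, (j < m)%N -> e j < c < e j.+1 /\ root p c.
  move=> j; have [jm|_] := ltnP j m; last by exists 0.
  have [|c cab rc] := @ivt_sgn p _ _ (ei j jm); last by exists c.
  have := es j (ltnW jm); rewrite -(subnSK jm) => H1; exact: sign_alt H1 (es j.+1 jm).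
exists y => [i im|i im]; first by case: (Hy i im).
have [/andP[_ H1] _] := Hy i (ltnW im); have [/andP[H2 _] _] := Hy i.+1 im.
by move: H1 H2; rewrite /e im => -> ->.
Qed.

Lemma root_deriv_neq0 m p y i : p \is monic -> size p = m.+1 -> incr m y ->
  (forall i, (i < m)%N -> root p (y i)) -> (i < m)%N -> p^`().[y i] != 0.
Proof.
move=> pm sp yi yr im.
rewrite (monic_factor pm sp yi yr) (bigD1_seq i) ?iota_uniq ?mem_iota ?subn0//=.
rewrite derivM derivXsubC mul1r hornerD hornerM !hornerE subrr mul0r addr0.
rewrite horner_prod prodf_seq_neq0; apply/allP => j; rewrite mem_iota subn0/= => jm.
apply/implyP => ji; rewrite !hornerE subr_eq0; apply/eqP => E.
by case/eqP: ji; apply/esym; exact: incr_inj yi im jm E.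
Qed.

End RealRootedPolynomials.

Lemma is_derive_horner (R : realType) (p : {poly R}) (x : R) : is_derive x 1 (horner p) p^`().[x].
Proof.
have H : forall p : {poly R}, is_derive x 1 (horner p) p^`().[x].
2: exact: H.
elim/poly_ind => [|q c IH].
  rewrite deriv0 horner0; have -> : horner (0 : {poly R}) = cst 0.
    by apply/funext => y; rewrite horner0.
  exact: is_derive_cst.
have -> : horner (q * 'X + c%:P) = (fun y => q.[y] * y) + cst c.
  by apply/funext => y; rewrite !hornerE.
rewrite derivD derivM derivX derivC !hornerE -[X in is_derive _ _ _ X]addr0.
apply: is_deriveD; have := is_deriveM IH (is_derive_id x 1).
by rewrite /GRing.scale/= mulr1 addrC [x * _]mulrC.
Qed.

Section AnalyticRoots.
Variables (R : realType) (I : finType).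

Definition polyana (P : (I -> R) -> {poly R}) (x : I -> R) :=
  forall j, ana (fun w => (P w)`_j) x.

Lemma polyanaC f (x : I -> R) : ana f x -> polyana (fun w => (f w)%:P) x.
Proof.
move=> fx j; case: j => [|j]; first by apply: ana_ext fx => w; rewrite coefC.
by apply: ana_ext (ana_const 0 x) => w; rewrite coefC.
Qed.

Lemma polyana_cst p (x : I -> R) : polyana (fun=> p) x.
Proof. by move=> j; exact: ana_const. Qed.

Lemma polyanaD P Q (x : I -> R) : polyana P x -> polyana Q x -> polyana (fun w => P w + Q w) x.
Proof. by move=> Px Qx j; apply: ana_ext (anaD (Px j) (Qx j)) => w; rewrite coefD. Qed.

Lemma polyanaN P (x : I -> R) : polyana P x -> polyana (fun w => - P w) x.
Proof. by move=> Px j; apply: ana_ext (anaN (Px j)) => w; rewrite coefN. Qed.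

Lemma polyanaM P Q (x : I -> R) : polyana P x -> polyana Q x -> polyana (fun w => P w * Q w) x.
Proof.
move=> Px Qx j.
apply: ana_ext (_ : ana (fun w => \sum_(i < j.+1) (P w)`_i * (Q w)`_(j - i)) x).
  by move=> w; rewrite coefM.
by apply: ana_sum => i _; exact: anaM.
Qed.

Lemma ana_horner P m (z : option I -> R) : polyana P (oproj z) ->
  (forall w, size (P w) <= m)%N -> ana (fun z => (P (oproj z)).[z None]) z.
Proof.
move=> Pz sP.
apply: ana_ext (_ : ana (fun z => \sum_(i < m) (P (oproj z))`_i * z None ^+ i) z).
  by move=> y; rewrite (horner_coef_wide _ (sP _)).
apply: ana_sum => i _; apply: anaM; last by apply: anaX; exact: ana_coord.
exact: (ana_oproj (f := fun w => (P w)`_i)).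
Qed.

Lemma pdr_horner P m (w : I -> R) (x : R) : polyana P w ->
  (forall w, size (P w) <= m)%N ->
  pdr None (fun z : option I -> R => (P (oproj z)).[z None]) (oext w x) = (P w)^`().[x].
Proof.
move=> Pw sP; have H := ana_slice (ana_horner (z := oext w x) Pw sP).
rewrite -(@derive_val _ _ _ _ _ _ _ H) -(@derive_val _ _ _ _ _ _ _ (is_derive_horner (P w) x)).
by [].
Qed.

(** [Y] is not assumed continuous. The implicit function theorem gives analytic local branches of
    roots, which stay increasing nearby, and an increasing enumeration of all roots is unique. This
    is why roots may be picked pointwise by choice throughout. *)
Lemma ana_root P (Y : (I -> R) -> nat -> R) m (x : I -> R) : polyana P x ->
  (forall w, P w \is monic) -> (forall w, size (P w) = m.+1) ->
  (forall w, incr m (Y w)) -> (forall w i, (i < m)%N -> root (P w) (Y w i)) ->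
  forall i, (i < m)%N -> ana (fun w => Y w i) x.
Proof.
move=> Px Pm sP Yi Yr i im.
have sP' w : (size (P w) <= m.+1)%N by rewrite sP.
have /choice [Z HZ] : forall j, exists Z : (I -> R) -> R, (j < m)%N ->
    [/\ ana Z x, Z x = Y x j & nearby x (fun w => root (P w) (Z w))].
  move=> j; have [jm|_] := ltnP j m; last by exists (fun=> 0).
  have [||| Z [Za Z0 Zr _]] := @implicit_function1 R I (fun z => (P (oproj z)).[z None]) x (Y x j).
  - exact: ana_horner sP'.
  - by apply/eqP; rewrite -rootE; exact: Yr.
  - by rewrite (pdr_horner _ Px sP'); exact: root_deriv_neq0 (Pm x) (sP x) (Yi x) (Yr x) jm.
  by exists Z => _; split=> //; apply: nearbyS Zr => w /eqP.
have near_root : nearby x (fun w => forall j : 'I_m, root (P w) (Z j w)).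
  by apply: nearby_all => j; case: (HZ j (ltn_ord j)).
have near_incr : nearby x (fun w => forall j : 'I_m, (j.+1 < m)%N -> Z j w < Z j.+1 w).
  apply: nearby_all => j; case: (ltnP j.+1 m) => jm; last by exists 1.
  have [Za Z0 _] := HZ j (ltn_ord j); have [Za' Z0' _] := HZ j.+1 jm.
  have H : 0 < Z j.+1 x - Z j x by rewrite Z0 Z0' subr_gt0; exact: Yi.
  by apply: nearbyS (ana_gt0 (anaB Za' Za) H) => w; rewrite subr_gt0.
have [Za _ _] := HZ i im; apply: ana_near Za _.
apply: nearbyS (nearbyI near_root near_incr) => w [Hr Hi].
apply: (roots_unique (y := fun j => Z j w) (Pm w) (sP w)) im => //.
  by move=> j jm; exact: (Hi (Ordinal (ltnW jm))).
by move=> j jm; exact: (Hr (Ordinal jm)).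
exact: Yr.
Qed.

End AnalyticRoots.

(** * The doubled Toda chain *)

Section TransferProducts.
Variable (T : comNzRingType).
Implicit Types (x : T) (u v p : nat -> T) (e : T * T).

(* Right multiplication of the row [e] by the Lax matrix
   [[x - p, - u], [v, 0]], [u = e^q], [v = e^-q], of one site. *)
Definition stp x (u v p : T) e : T * T := ((x - p) * e.1 + v * e.2, - (u * e.1)).

Fixpoint row x u v p e N : T * T :=
  if N is N'.+1 then stp x (u N') (v N') (p N') (row x u v p e N') else e.

Fixpoint rowr x u v p e N : T * T :=
  if N is N'.+1 then rowr x u v p (stp x (v N') (u N') (- p N') e) N' else e.

(** Every site matrix has determinant [u v = 1]. *)
Lemma row_det x u v p e e' N : (forall k, u k * v k = 1) ->
  (row x u v p e N).1 * (row x u v p e' N).2 - (row x u v p e N).2 * (row x u v p e' N).1 =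
  e.1 * e'.2 - e.2 * e'.1.
Proof.
move=> uv; elim: N => [|N IH] //=; rewrite -IH.
set a := row _ _ _ _ e N; set b := row _ _ _ _ e' N.
transitivity ((u N * v N) * (a.1 * b.2 - a.2 * b.1)); first by ring.
by rewrite uv mul1r.
Qed.

(** The mirror image of a site, at spectral parameter [x], is minus the transpose of the site matrix
    at [- x]. Reversing the order of sites also reverses products, so the mirrored half is
    [(-1) ^+ N] times the transpose of the transfer matrix of the first [N] sites at [- x]. *)
Lemma rowrE x u v p e N :
  rowr x u v p e N =
  ((-1) ^+ N * (e.1 * (row (- x) u v p (1, 0) N).1 + e.2 * (row (- x) u v p (1, 0) N).2),
   (-1) ^+ N * (e.1 * (row (- x) u v p (0, 1) N).1 + e.2 * (row (- x) u v p (0, 1) N).2)).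
Proof.
elim: N e => [|N IH] e /=.
  by rewrite expr0 !mul1r !mulr1 !mulr0 addr0 add0r; case: e.
rewrite IH /= exprS; congr pair; ring.
Qed.

Lemma row_eq x u v p u' v' p' e N :
  (forall k, (k < N)%N -> [/\ u k = u' k, v k = v' k & p k = p' k]) ->
  row x u v p e N = row x u' v' p' e N.
Proof.
elim: N => [//|N IH] H /=; rewrite IH; first by case: (H N (ltnSn N)) => -> -> ->.
by move=> k kN; apply: H; exact: ltnW.
Qed.

(* The Dirichlet conditions double the chain: it is followed by a site with
   [p = q = 0] and by its mirror image. *)
Definition mirror n (c : T) (u v : nat -> T) k :=
  if (k < n)%N then u k else if k == n then c else v (n + n - k)%N.

Lemma row_mirror x u v p e n :
  row x (mirror n 1 u v) (mirror n 1 v u) (mirror n 0 p (fun k => - p k)) e (n.+1 + n) =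
  rowr x u v p (stp x 1 1 0 (row x u v p e n)) n.
Proof.
set U := mirror n 1 u v; set V := mirror n 1 v u; set P := mirror n 0 p _.
have H m : (m <= n)%N -> rowr x u v p (row x U V P e (n.+1 + m)) (n - m) =
    rowr x u v p (row x U V P e n.+1) n.
  elim: m => [|m IH] mn; first by rewrite subn0 addn0.
  rewrite -IH; last exact: ltnW.
  rewrite -(subnSK mn) addnS /=; congr (rowr _ _ _ _ (stp _ _ _ _ _) _).
  - rewrite /U /mirror; have -> : (n.+1 + m < n)%N = false by apply/negbTE; lia.
    have -> : (n.+1 + m == n) = false by apply/negbTE; lia.
    by congr v; lia.
  - rewrite /V /mirror; have -> : (n.+1 + m < n)%N = false by apply/negbTE; lia.
    have -> : (n.+1 + m == n) = false by apply/negbTE; lia.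
    by congr u; lia.
  - rewrite /P /mirror; have -> : (n.+1 + m < n)%N = false by apply/negbTE; lia.
    have -> : (n.+1 + m == n) = false by apply/negbTE; lia.
    by congr (- p _); lia.
have := H n (leqnn n); rewrite subnn /= => ->.
have -> : row x U V P e n = row x u v p e n.
  by apply: row_eq => k kn; rewrite /U /V /P /mirror kn.
by rewrite /U /V /P /mirror ltnn eqxx.
Qed.

End TransferProducts.

Section SturmSequence.
Variable (R : realType).
Variables (u v p : nat -> R).
Hypothesis u0 : forall k, 0 < u k.
Hypothesis v0 : forall k, 0 < v k.

Definition rowp (e : {poly R} * {poly R}) N : {poly R} * {poly R} :=
  row 'X (fun k => (u k)%:P) (fun k => (v k)%:P) (fun k => (p k)%:P) e N.

Lemma rowp_horner (e : {poly R} * {poly R}) (x : R) N :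
  ((rowp e N).1.[x], (rowp e N).2.[x]) = row x u v p (e.1.[x], e.2.[x]) N.
Proof.
by elim: N => [|N IH] //=; rewrite -IH /stp/= !hornerE.
Qed.

Lemma rowp_monic N : [/\ (rowp (1%R, 0%R) N).1 \is monic, size (rowp (1%R, 0%R) N).1 = N.+1 &
  (size (rowp (1%R, 0%R) N).2 <= N)%N].
Proof.
elim: N => [|N [IH1 IH2 IH3]]; first by rewrite /= monic1 size_poly1 size_poly0.
rewrite /=; set a := (row _ _ _ _ _ N).1 in IH1 IH2 *; set b := (row _ _ _ _ _ N).2 in IH3 *.
have sa : size (('X - (p N)%:P) * a) = N.+2.
  by rewrite size_monicM ?monicXsubC ?monic_neq0// size_XsubC IH2.
have sb : (size ((v N)%:P * b)%R < N.+2)%N.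
  apply: leq_ltn_trans (size_polyMleq _ _) _; rewrite size_polyC.
  have := IH3; case: (v N != 0) => /=; lia.
split.
- rewrite monicE lead_coefDl ?sa//.
  by have := monicMl a (monicXsubC (p N)); rewrite IH1 monicE.
- by rewrite size_polyDl ?sa.
- rewrite size_polyN; apply: leq_trans (size_polyMleq _ _) _.
  by rewrite size_polyC IH2; case: (_ != 0).
Qed.

(** Roots and signs are carried together. At a root of the first component at level [N], the one at
    level [N.+1] equals [v N] times the second component, whose sign alternates, so the new roots
    interlace the old ones. The new second component is [- u N] times the old first one, and
    interlacing determines its sign at the new roots. *)
Lemma sturm N : exists y : nat -> R, [/\ incr N y,
  forall i, (i < N)%N -> root (rowp (1%R, 0%R) N).1 (y i) &
  forall i, (i < N)%N -> 0 < (-1) ^+ (N - i) * (rowp (1%R, 0%R) N).2.[y i]].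
Proof.
elim: N => [|N [z [zi zr zs]]]; first by exists (fun=> 0); split.
have [m1 s1 _] := rowp_monic N; have [m2 s2 _] := rowp_monic N.+1.
have E (x : R) : (rowp (1%R, 0%R) N.+1).1.[x] = (x - p N) * (rowp (1%R, 0%R) N).1.[x] + v N * (rowp (1%R, 0%R) N).2.[x].
  by rewrite /= !hornerE.
have E2 (x : R) : (rowp (1%R, 0%R) N.+1).2.[x] = - (u N * (rowp (1%R, 0%R) N).1.[x]).
  by rewrite /= !hornerE.
have zs2 i : (i.+1 < N.+1)%N -> 0 < (-1) ^+ (N.+1 - i.+1) * (rowp (1%R, 0%R) N.+1).1.[z i].
  move=> im; rewrite E.
  have /eqP -> : (rowp (1%R, 0%R) N).1.[z i] == 0 by exact: zr.
  by rewrite mulr0 add0r subSS mulrCA mulr_gt0 ?zs.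
have [y yr yz] := @interlace R N.+1 _ z isT m2 s2 zi zs2.
exists y; split=> //.
- by move=> i im; have /andP[] := yz i im; exact: lt_trans.
- have yi : incr N.+1 y by move=> j jm; have /andP[] := yz j jm; exact: lt_trans.
  move=> i im; rewrite E2 (monic_factor m1 s1 zi zr) horner_factor.
  rewrite subSn// exprS mulN1r mulNr mulrN opprK mulrCA mulr_gt0//.
  apply: sgn_prod => // k.
    move=> ki; have kN : (k.+1 < N.+1)%N by lia.
    have /andP[_ H] := yz k kN; apply: lt_le_trans H _.
    by apply: (incr_le yi); rewrite ki im.
  move=> /andP[ik kN]; have /andP[H _] := yz k kN; apply: le_lt_trans H.
  by apply: (incr_le yi); rewrite ik ltnW.
Qed.

(** The coefficients from which [hc_Ht] reads off the energy. The last two clauses serve to run the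
    recursion of the first two. *)
Lemma rowp_coef N :
  [/\ (1 <= N)%N -> (rowp (1%R, 0%R) N).1`_N.-1 = - \sum_(0 <= k < N) p k,
      (2 <= N)%N -> (rowp (1%R, 0%R) N).1`_N.-2 =
        ((\sum_(0 <= k < N) p k) ^+ 2 - \sum_(0 <= k < N) p k ^+ 2) / 2 - \sum_(0 <= k < N.-1) u k * v k.+1,
      (1 <= N)%N -> (rowp (1%R, 0%R) N).2`_N.-1 = - u N.-1 &
      (2 <= N)%N -> (rowp (1%R, 0%R) N).2`_N.-2 = u N.-1 * \sum_(0 <= k < N.-1) p k].
Proof.
elim: N => [|N IH]; first by split.
have [m1 s1 sb1] := rowp_monic N.
have lc : (rowp (1%R, 0%R) N).1`_N = 1 by have /monicP := m1; rewrite /lead_coef s1.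
have c1 j : (rowp (1%R, 0%R) N.+1).1`_j = (if j is j'.+1 then (rowp (1%R, 0%R) N).1`_j' else 0) -
    p N * (rowp (1%R, 0%R) N).1`_j + v N * (rowp (1%R, 0%R) N).2`_j.
  by rewrite /= coefD mulrBl coefB coefXM !coefCM; case: j.
have c2 j : (rowp (1%R, 0%R) N.+1).2`_j = - (u N * (rowp (1%R, 0%R) N).1`_j).
  by rewrite /= coefN coefCM.
case: N IH m1 s1 sb1 lc c1 c2 => [|N] IH m1 s1 sb1 lc c1 c2.
  split=> // _; first by rewrite c1/= coefC coef0/= big_nat1; ring.
  by rewrite c2/= coefC/= mulr1.
have [/(_ isT) I1 I2 /(_ isT) I3 I4] := IH.
have bN : (rowp (1%R, 0%R) N.+1).2`_N.+1 = 0 by apply: nth_default.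
split=> _.
- by rewrite c1 /= I1 lc bN [in RHS]big_nat_recr//=; ring.
- case: N IH m1 s1 sb1 lc c1 c2 I1 I2 I3 I4 bN => [|N] IH m1 s1 sb1 lc c1 c2 I1 I2 I3 I4 bN.
    by rewrite c1 /= I1 I3 !big_nat_recr//= !big_nil; field.
  have I1' : (rowp (1%R, 0%R) N.+2).1`_N.+1 = _ := I1.
  have I2' : (rowp (1%R, 0%R) N.+2).1`_N = _ := I2 isT.
  have I3' : (rowp (1%R, 0%R) N.+2).2`_N.+1 = _ := I3.
  have -> : (rowp (1%R, 0%R) N.+3).1`_(N.+3.-2) = _ := c1 N.+1.
  rewrite I1' I2' I3' /=.
  rewrite [\sum_(0 <= k < N.+3) p k]big_nat_recr//= [\sum_(0 <= k < N.+3) p k ^+ 2]big_nat_recr//=.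
  rewrite [\sum_(0 <= k < N.+2) u k * _]big_nat_recr//=.
  by field.
- by rewrite c2 lc mulr1.
- by rewrite c2 /= I1; ring.
Qed.

End SturmSequence.

(** * Poisson brackets of the entries of the transfer matrix *)

Section PoissonBracket.
Variables (R : realType) (n : nat).
Local Notation P := ('I_(n + n) -> R).
Implicit Types (f g h : P -> R) (w : P).

Definition qi (i : 'I_n) : 'I_(n + n) := lshift n i.
Definition pi' (i : 'I_n) : 'I_(n + n) := rshift n i.

Definition br f g w : R :=
  \sum_(i < n) (pdr (qi i) f w * pdr (pi' i) g w - pdr (pi' i) f w * pdr (qi i) g w).

Definition anaE f := forall w, ana f w.

Lemma brC f g w : br f g w = - br g f w.
Proof. by rewrite /br -sumrN; apply: eq_bigr => i _; ring. Qed.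

Lemma brD f g h w : anaE f -> anaE g -> br (fun w => f w + g w) h w = br f h w + br g h w.
Proof.
move=> fa ga; rewrite /br -big_split; apply: eq_bigr => i _ /=.
by rewrite !pdrD//; ring.
Qed.

Lemma brM f g h w : anaE f -> anaE g ->
  br (fun w => f w * g w) h w = f w * br g h w + g w * br f h w.
Proof.
move=> fa ga; rewrite /br !mulr_sumr -big_split; apply: eq_bigr => i _ /=.
by rewrite !pdrM//; ring.
Qed.

Lemma br_cst c h w : br (fun=> c) h w = 0.
Proof. by rewrite /br big1// => i _; rewrite !pdr_cst !mul0r subr0. Qed.

Lemma brN f h w : anaE f -> br (fun w => - f w) h w = - br f h w.
Proof.
by move=> fa; rewrite /br -sumrN; apply: eq_bigr => i _; rewrite !pdrN//; ring.
Qed.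

Lemma brB f g h w : anaE f -> anaE g -> br (fun w => f w - g w) h w = br f h w - br g h w.
Proof. by move=> fa ga; rewrite brD ?brN// => ?; exact: anaN. Qed.

Lemma br_ext f f' g g' w : f =1 f' -> g =1 g' -> br f g w = br f' g' w.
Proof. by move=> /funext -> /funext ->. Qed.

End PoissonBracket.

Section TodaBrackets.
Variables (R : realType) (n : nat).
Local Notation P := ('I_(n + n) -> R).
Implicit Types (w : P) (e : R * R).

(* The default value is meaningful: [qn w n = 0] is the Dirichlet end point. *)
Definition qn w (k : nat) : R := if insub k is Some i then w (qi i) else 0.
Definition pn w (k : nat) : R := if insub k is Some i then w (pi' i) else 0.

Lemma qnE w (i : 'I_n) : qn w i = w (qi i).
Proof. by rewrite /qn valK. Qed.

Lemma pnE w (i : 'I_n) : pn w i = w (pi' i).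
Proof. by rewrite /pn valK. Qed.

Lemma ana_qn k : anaE (fun w => qn w k).
Proof. by move=> w; rewrite /qn; case: insubP => [i _ _|_]; [exact: ana_coord|exact: ana_const]. Qed.

Lemma ana_pn k : anaE (fun w => pn w k).
Proof. by move=> w; rewrite /pn; case: insubP => [i _ _|_]; [exact: ana_coord|exact: ana_const]. Qed.

Definition uw w k := expR (qn w k).
Definition vw w k := expR (- qn w k).

Lemma uvw w k : uw w k * vw w k = 1.
Proof. by rewrite /uw /vw -expRD subrr expR0. Qed.

Lemma ana_uw k : anaE (fun w => uw w k).
Proof. by move=> w; apply: ana_expR; exact: ana_qn. Qed.

Lemma ana_vw k : anaE (fun w => vw w k).
Proof. by move=> w; apply: ana_expR; apply: anaN; exact: ana_qn. Qed.

Definition rw x e k w : R * R := row x (uw w) (vw w) (pn w) e k.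

Lemma ana_rw x e k : anaE (fun w => (rw x e k w).1) /\ anaE (fun w => (rw x e k w).2).
Proof.
elim: k => [|k [IH1 IH2]]; first by split=> w; exact: ana_const.
split=> w; rewrite /rw/=.
  apply: anaD; apply: anaM.
  - by apply: anaB; [exact: ana_const|exact: ana_pn].
  - exact: IH1.
  - exact: ana_vw.
  - exact: IH2.
by apply: anaN; apply: anaM; [exact: ana_uw|exact: IH1].
Qed.

Lemma ana_rw1 x e k : anaE (fun w => (rw x e k w).1).
Proof. by case: (ana_rw x e k). Qed.

Lemma ana_rw2 x e k : anaE (fun w => (rw x e k w).2).
Proof. by case: (ana_rw x e k). Qed.

Lemma qn_shl w i t k : qn (shl w (qi i) t) k = qn w k + t * (k == i :> nat)%:R.
Proof.
rewrite /qn; case: insubP => [j _ <-|kn]; rewrite ?/shl.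
  by rewrite /qi (inj_eq (@lshift_inj n n)).
suff -> : (k == i) = false by rewrite mulr0 addr0.
by apply/negbTE; apply: contraNneq kn => ->.
Qed.

Lemma qn_shlp w i t k : qn (shl w (pi' i) t) k = qn w k.
Proof.
by rewrite /qn; case: insubP => [j _ _|//]; rewrite /shl /qi /pi' eq_lrshift mulr0 addr0.
Qed.

Lemma pn_shl w i t k : pn (shl w (pi' i) t) k = pn w k + t * (k == i :> nat)%:R.
Proof.
rewrite /pn; case: insubP => [j _ <-|kn]; rewrite ?/shl.
  by rewrite /pi' (inj_eq (@rshift_inj n n)).
suff -> : (k == i) = false by rewrite mulr0 addr0.
by apply/negbTE; apply: contraNneq kn => ->.
Qed.

Lemma pn_shlq w i t k : pn (shl w (qi i) t) k = pn w k.
Proof.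
by rewrite /pn; case: insubP => [j _ _|//]; rewrite /shl /qi /pi' eq_rlshift mulr0 addr0.
Qed.

Lemma pdr_const_line (I : finType) (f : (I -> R) -> R) i x :
  (forall t, f (shl x i t) = f x) -> pdr i f x = 0.
Proof. by move=> H; rewrite /pdr (_ : (fun t => _) = cst (f x)) ?derive_cst//; apply/funext. Qed.

(** The row after [k] sites involves only the sites below [k], while [f] lives on the site [k]
    alone. This is the ultralocality behind the induction in [br_rows]. *)
Lemma br_rw k (j : bool) x e f w : (k < n)%N -> anaE f -> (forall w (i : 'I_n) t, i != k :> nat ->
    f (shl w (qi i) t) = f w /\ f (shl w (pi' i) t) = f w) ->
  br (fun w => if j then (rw x e k w).1 else (rw x e k w).2) f w = 0.
Proof.
move=> kn fa Hf; rewrite /br big1// => i _.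
have [ik|ik] := eqVneq (i : nat) k; last first.
  rewrite [pdr (pi' i) f w]pdr_const_line; last by move=> t; case: (Hf w i t ik).
  rewrite [pdr (qi i) f w]pdr_const_line; last by move=> t; case: (Hf w i t ik).
  by rewrite !mulr0 subrr.
have E t : rw x e k (shl w (qi i) t) = rw x e k w.
  apply: row_eq => m mk; rewrite /uw /vw qn_shl pn_shlq.
  by rewrite -ik in mk; rewrite (ltn_eqF mk) mulr0 addr0.
have E' t : rw x e k (shl w (pi' i) t) = rw x e k w.
  apply: row_eq => m mk; rewrite /uw /vw qn_shlp pn_shl.
  by rewrite -ik in mk; rewrite (ltn_eqF mk) mulr0 addr0.
rewrite (@pdr_const_line _ _ (qi i)); last by move=> t; rewrite E.
by rewrite (@pdr_const_line _ (fun w => if j then (rw x e k w).1 else (rw x e k w).2) (pi' i)) ?mul0r ?subrr// => t; rewrite E'.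
Qed.

Lemma br_uw k f w : (k < n)%N -> br (fun w => uw w k) f w = uw w k * br (fun w => qn w k) f w.
Proof.
move=> kn; rewrite /br mulr_sumr; apply: eq_bigr => i _.
by rewrite !(@pdr_comp1 _ _ expR _ _ _ _ (is_derive_expR _)); [rewrite /uw; ring|exact: ana_qn..].
Qed.

Lemma br_vw k f w : (k < n)%N -> br (fun w => vw w k) f w = - (vw w k * br (fun w => qn w k) f w).
Proof.
move=> kn; rewrite /br mulr_sumr -sumrN; apply: eq_bigr => i _.
rewrite !(@pdr_comp1 _ _ expR (fun w => - qn w k) _ _ _ (is_derive_expR _)); [|by apply: anaN; exact: ana_qn..].
by rewrite !pdrN; [rewrite /vw; ring|exact: ana_qn..].
Qed.

Lemma br_qp k w : (k < n)%N -> br (fun w => qn w k) (fun w => pn w k) w = 1.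
Proof.
move=> kn; rewrite /br (bigD1 (Ordinal kn))//= big1 ?addr0 => [|i ik].
  have -> : (fun w => qn w k) = (fun w => w (qi (Ordinal kn))).
    by apply/funext => z; rewrite -[k]/(nat_of_ord (Ordinal kn)) qnE.
  have -> : (fun w => pn w k) = (fun w => w (pi' (Ordinal kn))).
    by apply/funext => z; rewrite -[k]/(nat_of_ord (Ordinal kn)) pnE.
  by rewrite !pdr_coord !eqxx /qi /pi' eq_lrshift eq_rlshift mul0r subr0 mulr1.
have ki : (k == i :> nat) = false.
  by apply/negbTE; apply: contraNneq ik => E; apply/eqP/val_inj.
have -> : pdr (pi' i) (fun w => pn w k) w = 0.
  by apply: pdr_const_line => t; rewrite pn_shl ki mulr0 addr0.
have -> : pdr (pi' i) (fun w => qn w k) w = 0.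
  by apply: pdr_const_line => t; rewrite qn_shlp.
by rewrite mulr0 mul0r subrr.
Qed.

Lemma br_qq k l w : br (fun w => qn w k) (fun w => qn w l) w = 0.
Proof.
rewrite /br big1// => i _.
rewrite (@pdr_const_line _ (fun w => qn w k) (pi' i)); last by move=> t; rewrite qn_shlp.
rewrite (@pdr_const_line _ (fun w => qn w l) (pi' i)); last by move=> t; rewrite qn_shlp.
by rewrite mulr0 mul0r subrr.
Qed.

Lemma br_pp k l w : br (fun w => pn w k) (fun w => pn w l) w = 0.
Proof.
rewrite /br big1// => i _.
rewrite (@pdr_const_line _ (fun w => pn w k) (qi i)); last by move=> t; rewrite pn_shlq.
rewrite (@pdr_const_line _ (fun w => pn w l) (qi i)); last by move=> t; rewrite pn_shlq.
by rewrite mulr0 mul0r subrr.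
Qed.

Let F x e k w := (rw x e k w).1.
Let G x e k w := (rw x e k w).2.

(* The fundamental r-matrix relation
   (x - y) {M_ij(x), M_kl(y)} = M_kj(x) M_il(y) - M_kj(y) M_il(x). *)
Lemma br_rows k : (k <= n)%N -> forall x y e e' w,
  [/\ (x - y) * br (F x e k) (F y e' k) w = F x e' k w * F y e k w - F y e' k w * F x e k w,
      (x - y) * br (F x e k) (G y e' k) w = F x e' k w * G y e k w - F y e' k w * G x e k w,
      (x - y) * br (G x e k) (F y e' k) w = G x e' k w * F y e k w - G y e' k w * F x e k w &
      (x - y) * br (G x e k) (G y e' k) w = G x e' k w * G y e k w - G y e' k w * G x e k w].
Proof.
elim: k => [|k IH] kn x y e e' w.
  by rewrite /F /G /rw /= !br_cst; split; ring.
have [H1 H2 H3 H4] := IH (ltnW kn) x y e e' w.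
have aF z d := ana_rw1 z d k : anaE (F z d k).
have aG z d := ana_rw2 z d k : anaE (G z d k).
have aL z : anaE (fun w => z - pn w k) by move=> ?; apply: anaB; [exact: ana_const|exact: ana_pn].
have av := @ana_vw k; have au := @ana_uw k.
have amu : anaE (fun w => - uw w k) by move=> ?; apply: anaN; exact: au.
have EF z d : F z d k.+1 = fun w => (z - pn w k) * F z d k w + vw w k * G z d k w by [].
have EG z d : G z d k.+1 = fun w => - uw w k * F z d k w.
  by apply/funext => v; rewrite /G/= mulNr.
have sep f : (f = (fun w => uw w k) \/ f = (fun w => vw w k)) \/ f = (fun w => pn w k) ->
   forall w (i : 'I_n) t, i != k :> nat -> f (shl w (qi i) t) = f w /\ f (shl w (pi' i) t) = f w.
  move=> ff v i t ik; have ki : (k == i :> nat) = false by rewrite eq_sym; exact/negbTE.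
  by case: ff => [[->|->]|->]; rewrite /uw /vw ?qn_shl ?qn_shlp ?pn_shl ?pn_shlq ki !mulr0 !addr0.
have Z f : anaE f -> (f = (fun w => uw w k) \/ f = (fun w => vw w k)) \/ f = (fun w => pn w k) ->
   forall z d v, br (F z d k) f v = 0 /\ br (G z d k) f v = 0.
  move=> fa ff z d v; split.
    exact: (@br_rw k true z d f v kn fa (sep f ff)).
  exact: (@br_rw k false z d f v kn fa (sep f ff)).
have ZL t z d v : br (F z d k) (fun w => t - pn w k) v = 0 /\ br (G z d k) (fun w => t - pn w k) v = 0.
  have [P1 P2] := Z _ (@ana_pn k) (or_intror erefl) z d v.
  have ac : anaE (fun _ : P => t) by move=> ?; exact: ana_const.
  have ap := @ana_pn k.
  by split; rewrite brC brB// br_cst brC ?P1 ?P2 opprK add0r oppr0.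
have ZU := Z _ au (or_introl (or_introl erefl)).
have ZV := Z _ av (or_introl (or_intror erefl)).
have brmu f v : br (fun w => - uw w k) f v = - (uw v k * br (fun w => qn w k) f v).
  by rewrite brN// br_uw.
have brL z f v : br (fun w => z - pn w k) f v = - br (fun w => pn w k) f v.
  by rewrite brB ?br_cst ?sub0r//; [move=> ?; exact: ana_const|exact: ana_pn].
have pq v : br (fun w => pn w k) (fun w => qn w k) v = -1 by rewrite brC br_qp.
have LL z t v : br (fun w => z - pn w k) (fun w => t - pn w k) v = 0.
  by rewrite brL brC brL br_pp !oppr0.
have LV z v : br (fun w => z - pn w k) (fun w => vw w k) v = - vw v k.
  by rewrite brL brC br_vw// br_qp// mulr1 !opprK.
have VL z v : br (fun w => vw w k) (fun w => z - pn w k) v = vw v k by rewrite brC LV opprK.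
have LU z v : br (fun w => z - pn w k) (fun w => - uw w k) v = - uw v k.
  by rewrite brL brC brmu br_qp// mulr1 !opprK.
have UL z v : br (fun w => - uw w k) (fun w => z - pn w k) v = uw v k by rewrite brC LU opprK.
have VV v : br (fun w => vw w k) (fun w => vw w k) v = 0.
  by rewrite br_vw// brC br_vw// br_qq !mulr0 !oppr0 mulr0 oppr0.
have VU v : br (fun w => vw w k) (fun w => - uw w k) v = 0.
  by rewrite br_vw// brC brmu br_qq !mulr0 !oppr0 mulr0 oppr0.
have UV v : br (fun w => - uw w k) (fun w => vw w k) v = 0 by rewrite brC VU oppr0.
have UU v : br (fun w => - uw w k) (fun w => - uw w k) v = 0.
  by rewrite brmu brC brmu br_qq !mulr0 !oppr0 mulr0 oppr0.
have ZmU z d v : br (F z d k) (fun w => - uw w k) v = 0 /\ br (G z d k) (fun w => - uw w k) v = 0.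
  have [P1 P2] := ZU z d v.
  by split; rewrite brC brN// brC ?P1 ?P2 !oppr0.
have Zs f z d v : br (F z d k) f v = 0 /\ br (G z d k) f v = 0 ->
    br f (F z d k) v = 0 /\ br f (G z d k) v = 0.
  by move=> [E1 E2]; split; rewrite brC ?E1 ?E2 oppr0.
have lin2 (f1 g1 f2 g2 h : P -> R) v : anaE f1 -> anaE g1 -> anaE f2 -> anaE g2 ->
    br (fun w => f1 w * g1 w + f2 w * g2 w) h v =
    f1 v * br g1 h v + g1 v * br f1 h v + (f2 v * br g2 h v + g2 v * br f2 h v).
  by move=> *; rewrite brD ?brM// => ?; exact: anaM.
have lin2r (f1 g1 f2 g2 h : P -> R) v : anaE f1 -> anaE g1 -> anaE f2 -> anaE g2 ->
    br h (fun w => f1 w * g1 w + f2 w * g2 w) v =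
    f1 v * br h g1 v + g1 v * br h f1 v + (f2 v * br h g2 v + g2 v * br h f2 v).
  by move=> *; rewrite brC lin2// ![br _ h v]brC; ring.
have linr (f1 g1 h : P -> R) v : anaE f1 -> anaE g1 ->
    br h (fun w => f1 w * g1 w) v = f1 v * br h g1 v + g1 v * br h f1 v.
  by move=> *; rewrite brC brM// ![br _ h v]brC; ring.
have uv := uvw w k.
rewrite !EF !EG; split.
- rewrite lin2// !lin2r//.
  rewrite LL LV VL VV !(ZL _ _ _ _).1 !(ZL _ _ _ _).2 !(ZV _ _ _).1 !(ZV _ _ _).2.
  rewrite !(Zs _ _ _ _ (ZL _ _ _ _)).1 !(Zs _ _ _ _ (ZL _ _ _ _)).2 !(Zs _ _ _ _ (ZV _ _ _)).1 !(Zs _ _ _ _ (ZV _ _ _)).2.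
  set L := pn w k; set V := vw w k.
  transitivity ((x - L) * (y - L) * ((x - y) * br (F x e k) (F y e' k) w) + (x - L) * V * ((x - y) * br (F x e k) (G y e' k) w)
    + V * (y - L) * ((x - y) * br (G x e k) (F y e' k) w) + V * V * ((x - y) * br (G x e k) (G y e' k) w)
    + (x - y) * (V * (G x e k w * F y e' k w - F x e k w * G y e' k w))); first by ring.
  by rewrite H1 H2 H3 H4; ring.
- rewrite lin2// !linr//.
  rewrite LU VU !(ZmU _ _ _).1 !(ZmU _ _ _).2 !(Zs _ _ _ _ (ZL _ _ _ _)).1 !(Zs _ _ _ _ (ZV _ _ _)).1.
  set L := pn w k; set V := vw w k; set U := uw w k.
  transitivity (- (x - L) * U * ((x - y) * br (F x e k) (F y e' k) w)
    - V * U * ((x - y) * br (G x e k) (F y e' k) w) - (x - y) * (U * (F x e k w * F y e' k w))); first by ring.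
  by rewrite H1 H3; ring.
- rewrite brM// !lin2r//.
  rewrite UL UV !(ZL _ _ _ _).1 !(ZV _ _ _).1 !(Zs _ _ _ _ (ZmU _ _ _)).1 !(Zs _ _ _ _ (ZmU _ _ _)).2.
  set L := pn w k; set V := vw w k; set U := uw w k.
  transitivity (- (y - L) * U * ((x - y) * br (F x e k) (F y e' k) w)
    - V * U * ((x - y) * br (F x e k) (G y e' k) w) + (x - y) * (U * (F x e k w * F y e' k w))); first by ring.
  by rewrite H1 H2; ring.
- rewrite brM// !linr//.
  rewrite UU !(ZmU _ _ _).1 !(Zs _ _ _ _ (ZmU _ _ _)).1.
  set U := uw w k.
  transitivity (U * U * ((x - y) * br (F x e k) (F y e' k) w)); first by ring.
  by rewrite H1; ring.
Qed.

End TodaBrackets.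

Section MirrorChainBrackets.
Variables (R : realType) (n : nat).
Local Notation P := ('I_(n + n) -> R).
Implicit Types (f g : P -> R) (w : P) (e d : R * R).

(** The bilinear form [e M e'^T] of the transfer matrix [M] of the doubled chain: the row [e] passes
    the first half and the site at rest, and the mirrored half is folded back by [rowrE]. Reading
    the chain from the other end gives [pat_anti]. *)
Definition pat x e e' w : R := (-1) ^+ n *
  ((x * (rw x e n w).1 + (rw x e n w).2) * (rw (- x) e' n w).1 - (rw x e n w).1 * (rw (- x) e' n w).2).

Lemma pat_anti x e e' w : pat (- x) e e' w = - pat x e' e w.
Proof. by rewrite /pat opprK; ring. Qed.

(** The determinant of the doubled chain is 1, and by mirror symmetry its lower left entry is
    [- b(- x)]. At a root of [a] this reads [b(x) b(- x) = 1]. *)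
Lemma pat_det x w : pat x (1, 0) (1, 0) w * pat x (0, 1) (0, 1) w +
  pat x (1, 0) (0, 1) w * pat (- x) (1, 0) (0, 1) w = 1.
Proof.
rewrite pat_anti /pat.
have H y : (rw y (1, 0) n w).1 * (rw y (0, 1) n w).2 - (rw y (1, 0) n w).2 * (rw y (0, 1) n w).1 = 1.
  rewrite /rw row_det; last by move=> k; exact: uvw.
  by rewrite /= mulr1 mul0r subr0.
have := H x; have := H (- x).
set A := (rw x (1, 0) n w).1; set B := (rw x (1, 0) n w).2.
set C := (rw x (0, 1) n w).1; set D := (rw x (0, 1) n w).2.
set A' := (rw (- x) (1, 0) n w).1; set B' := (rw (- x) (1, 0) n w).2.
set C' := (rw (- x) (0, 1) n w).1; set D' := (rw (- x) (0, 1) n w).2 => E' E.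
have s2 : (-1) ^+ n * (-1) ^+ n = 1 :> R by rewrite -expr2 sqrr_sign.
transitivity (((-1) ^+ n * (-1) ^+ n) * ((A * D - B * C) * (A' * D' - B' * C'))); first by ring.
by rewrite s2 E E'; ring.
Qed.

Lemma pdr_pat_form (s x : R) f1 f2 g1 g2 i w : anaE f1 -> anaE f2 -> anaE g1 -> anaE g2 ->
  pdr i (fun w => s * ((x * f1 w + f2 w) * g1 w - f1 w * g2 w)) w =
  s * ((x * g1 w - g2 w) * pdr i f1 w + g1 w * pdr i f2 w + (x * f1 w + f2 w) * pdr i g1 w
       - f1 w * pdr i g2 w).
Proof.
move=> a1 a2 b1 b2.
have c1 : ana (fun w => x * f1 w) w by exact: anaZ.
have c2 : ana (fun w => x * f1 w + f2 w) w by exact: anaD.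
have c3 : ana (fun w => (x * f1 w + f2 w) * g1 w) w by exact: anaM.
have c4 : ana (fun w => f1 w * g2 w) w by exact: anaM.
rewrite pdrZ; last exact: anaB.
by rewrite pdrB// !pdrM// pdrD// pdrZ//; ring.
Qed.

Lemma br_lin4 f g f1 f2 f3 f4 (c1 c2 c3 c4 : R) w :
  (forall i, pdr i f w = c1 * pdr i f1 w + c2 * pdr i f2 w + c3 * pdr i f3 w + c4 * pdr i f4 w) ->
  br f g w = c1 * br f1 g w + c2 * br f2 g w + c3 * br f3 g w + c4 * br f4 g w.
Proof.
move=> H; rewrite /br !mulr_sumr -!big_split; apply: eq_bigr => i _ /=.
by rewrite !H; ring.
Qed.

Lemma pdr_pat x e e' w i : pdr i (pat x e e') w =
  (-1) ^+ n * (x * (rw (- x) e' n w).1 - (rw (- x) e' n w).2) * pdr i (fun w => (rw x e n w).1) w +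
  (-1) ^+ n * (rw (- x) e' n w).1 * pdr i (fun w => (rw x e n w).2) w +
  (-1) ^+ n * (x * (rw x e n w).1 + (rw x e n w).2) * pdr i (fun w => (rw (- x) e' n w).1) w +
  (-1) ^+ n * - (rw x e n w).1 * pdr i (fun w => (rw (- x) e' n w).2) w.
Proof.
rewrite /pat (@pdr_pat_form _ x (fun w => (rw x e n w).1) (fun w => (rw x e n w).2)
  (fun w => (rw (- x) e' n w).1) (fun w => (rw (- x) e' n w).2));
  [by ring|exact: ana_rw1|exact: ana_rw2|exact: ana_rw1|exact: ana_rw2].
Qed.

Let F x e w := (rw x e n w).1.
Let G x e w := (rw x e n w).2.

(** Each entry is quadratic in rows at [x] and at [- x], so the Leibniz rule calls [br_rows] for the
    pairs formed by [x, - x] and [y, - y]. Its factors are, up to sign, [x - y] and [x + y];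
    multiplication by [x ^+ 2 - y ^+ 2] clears them all. *)
Lemma br_pat x y e e' d d' w :
  (x ^+ 2 - y ^+ 2) * br (pat x e e') (pat y d d') w =
  let rel z t a b (k k' l l' : R) :=
    k * l * (F z b w * F t a w - F t b w * F z a w) +
    k * l' * (F z b w * G t a w - F t b w * G z a w) +
    k' * l * (G z b w * F t a w - G t b w * F z a w) +
    k' * l' * (G z b w * G t a w - G t b w * G z a w) in
  let k1 := x * F (- x) e' w - G (- x) e' w in let k2 := F (- x) e' w in
  let k3 := x * F x e w + G x e w in let k4 := - F x e w in
  let l1 := y * F (- y) d' w - G (- y) d' w in let l2 := F (- y) d' w in
  let l3 := y * F y d w + G y d w in let l4 := - F y d w in
  (x + y) * rel x y e d k1 k2 l1 l2 + (x - y) * rel x (- y) e d' k1 k2 l3 l4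
  - (x - y) * rel (- x) y e' d k3 k4 l1 l2 - (x + y) * rel (- x) (- y) e' d' k3 k4 l3 l4.
Proof.
have H z t a b := @br_rows R n n (leqnn n) z t a b w.
have [A1 A2 A3 A4] := H x y e d.
have [B1 B2 B3 B4] := H x (- y) e d'.
have [C1 C2 C3 C4] := H (- x) y e' d.
have [D1 D2 D3 D4] := H (- x) (- y) e' d'.
rewrite (br_lin4 _ (pdr_pat x e e' w)).
rewrite ![br _ (pat y d d') w]brC !(br_lin4 _ (pdr_pat y d d' w)).
rewrite ![br (fun w => (rw y _ n w).1) _ w]brC ![br (fun w => (rw y _ n w).2) _ w]brC.
rewrite ![br (fun w => (rw (- y) _ n w).1) _ w]brC ![br (fun w => (rw (- y) _ n w).2) _ w]brC.
move: A1 A2 A3 A4 B1 B2 B3 B4 C1 C2 C3 C4 D1 D2 D3 D4; rewrite -/(F _ _ _).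
set a1 := br _ _ w; set a2 := br _ _ w; set a3 := br _ _ w; set a4 := br _ _ w.
set b1 := br _ _ w; set b2 := br _ _ w; set b3 := br _ _ w; set b4 := br _ _ w.
set c1 := br _ _ w; set c2 := br _ _ w; set c3 := br _ _ w; set c4 := br _ _ w.
set d1 := br _ _ w; set d2 := br _ _ w; set d3 := br _ _ w; set d4 := br _ _ w.
move=> A1 A2 A3 A4 B1 B2 B3 B4 C1 C2 C3 C4 D1 D2 D3 D4 /=.
rewrite /F /G -A1 -A2 -A3 -A4 -B1 -B2 -B3 -B4 -C1 -C2 -C3 -C4 -D1 -D2 -D3 -D4.
have s2 : (-1) ^+ n * (-1) ^+ n = 1 :> R by rewrite -expr2 sqrr_sign.
move: s2; set s := (-1) ^+ n => s2.
move: (rw x e n w) (rw (- x) e' n w) (rw y d n w) (rw (- y) d' n w) => X X' Y Y'.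
rewrite -[RHS]mul1r -s2.
ring.
Qed.

Lemma br_aa x y w : x ^+ 2 != y ^+ 2 -> br (pat x (1, 0) (1, 0)) (pat y (1, 0) (1, 0)) w = 0.
Proof.
move=> xy; apply: (@mulfI _ (x ^+ 2 - y ^+ 2)); first by rewrite subr_eq0.
rewrite br_pat /= mulr0; ring.
Qed.

Lemma br_ab x y w : (x ^+ 2 - y ^+ 2) * br (pat x (1, 0) (1, 0)) (pat y (1, 0) (0, 1)) w =
  (x + y) * (pat x (1, 0) (1, 0) w * pat y (1, 0) (0, 1) w - pat y (1, 0) (1, 0) w * pat x (1, 0) (0, 1) w)
  - (x - y) * (pat y (1, 0) (1, 0) w * pat (- x) (1, 0) (0, 1) w + pat x (1, 0) (1, 0) w * pat y (1, 0) (0, 1) w).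
Proof.
rewrite br_pat pat_anti /pat /F /G /=.
have s2 : (-1) ^+ n * (-1) ^+ n = 1 :> R by rewrite -expr2 sqrr_sign.
move: s2; set s := (-1) ^+ n => s2.
move: (rw x (1, 0) n w) (rw (- x) (1, 0) n w) (rw y (1, 0) n w) (rw (- y) (1, 0) n w)
  (rw x (0, 1) n w) (rw (- x) (0, 1) n w) (rw y (0, 1) n w) (rw (- y) (0, 1) n w) => A A' B B' C C' D D'.
rewrite -[LHS]mul1r -s2; ring.
Qed.

Lemma br_bb x y w : x ^+ 2 != y ^+ 2 ->
  (x + y) * br (pat x (1, 0) (0, 1)) (pat y (1, 0) (0, 1)) w =
  pat y (1, 0) (1, 0) w * pat x (0, 1) (0, 1) w - pat x (1, 0) (1, 0) w * pat y (0, 1) (0, 1) w.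
Proof.
move=> xy; apply: (@mulfI _ (x - y)); first by apply: contraNneq xy => /eqP; rewrite subr_eq0 => /eqP ->.
have -> : (x - y) * ((x + y) * br (pat x (1, 0) (0, 1)) (pat y (1, 0) (0, 1)) w) =
  (x ^+ 2 - y ^+ 2) * br (pat x (1, 0) (0, 1)) (pat y (1, 0) (0, 1)) w by ring.
rewrite br_pat /pat /F /G /=.
have s2 : (-1) ^+ n * (-1) ^+ n = 1 :> R by rewrite -expr2 sqrr_sign.
move: s2; set s := (-1) ^+ n => s2.
move: (rw x (1, 0) n w) (rw (- x) (1, 0) n w) (rw y (1, 0) n w) (rw (- y) (1, 0) n w)
  (rw x (0, 1) n w) (rw (- x) (0, 1) n w) (rw y (0, 1) n w) (rw (- y) (0, 1) n w) => A A' B B' C C' D D'.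
rewrite -[LHS]mul1r -s2; ring.
Qed.

End MirrorChainBrackets.

(** * Separated variables *)

Section SeparatedVariables.
Variables (R : realType) (n : nat).
Local Notation P := ('I_(n + n) -> R).
Implicit Types (f g : P -> R) (w : P) (e d : R * R).

Definition mu w := mirror n 1 (uw w) (vw w).
Definition mv w := mirror n 1 (vw w) (uw w).
Definition mp w := mirror n 0 (pn w) (fun k => - pn w k).

Lemma mu_gt0 w k : 0 < mu w k.
Proof. by rewrite /mu /mirror; case: ifP => _; [|case: ifP => _]; rewrite ?ltr01 ?expR_gt0. Qed.

Lemma mv_gt0 w k : 0 < mv w k.
Proof. by rewrite /mv /mirror; case: ifP => _; [|case: ifP => _]; rewrite ?ltr01 ?expR_gt0. Qed.

Lemma ana_mu k : anaE (fun w => mu w k).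
Proof.
move=> w; rewrite /mu /mirror; case: (k < n)%N; first exact: ana_uw.
by case: (k == n); [exact: ana_const|exact: ana_vw].
Qed.

Lemma ana_mv k : anaE (fun w => mv w k).
Proof.
move=> w; rewrite /mv /mirror; case: (k < n)%N; first exact: ana_vw.
by case: (k == n); [exact: ana_const|exact: ana_uw].
Qed.

Lemma ana_mp k : anaE (fun w => mp w k).
Proof.
move=> w; rewrite /mp /mirror; case: (k < n)%N; first exact: ana_pn.
by case: (k == n); [exact: ana_const|apply: anaN; exact: ana_pn].
Qed.

Definition chp w : {poly R} * {poly R} := rowp (mu w) (mv w) (mp w) (1%R, 0%R) (n.+1 + n).
Definition pa w := (chp w).1.
Definition pb w := (chp w).2.

Lemma chpE w x : (pa w).[x] = pat x (1, 0) (1, 0) w /\ (pb w).[x] = pat x (1, 0) (0, 1) w.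
Proof.
have := rowp_horner (mu w) (mv w) (mp w) (1%R, 0%R) x (n.+1 + n).
rewrite /= !hornerE [RHS](row_mirror x (uw w) (vw w) (pn w) (1, 0) n) rowrE /= => -[E1 E2].
by split; [rewrite [LHS]E1|rewrite [LHS]E2]; rewrite /pat /rw; ring.
Qed.

Lemma paE w x : (pa w).[x] = pat x (1, 0) (1, 0) w. Proof. by case: (chpE w x). Qed.
Lemma pbE w x : (pb w).[x] = pat x (1, 0) (0, 1) w. Proof. by case: (chpE w x). Qed.

Lemma pa_odd w x : (pa w).[- x] = - (pa w).[x].
Proof. by rewrite !paE pat_anti. Qed.

Lemma pa_monic w : pa w \is monic.
Proof. by case: (rowp_monic (mu w) (mv w) (mp w) (n.+1 + n)). Qed.

Lemma pa_size w : size (pa w) = (n.+1 + n).+1.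
Proof. by case: (rowp_monic (mu w) (mv w) (mp w) (n.+1 + n)). Qed.

Lemma pb_size w : (size (pb w) <= n.+1 + n)%N.
Proof. by case: (rowp_monic (mu w) (mv w) (mp w) (n.+1 + n)). Qed.

Lemma polyana_rowp (U V Q : P -> nat -> R) (e : {poly R} * {poly R}) N w :
  (forall k, ana (fun w => U w k) w) -> (forall k, ana (fun w => V w k) w) ->
  (forall k, ana (fun w => Q w k) w) ->
  polyana (fun w => (rowp (U w) (V w) (Q w) e N).1) w /\
  polyana (fun w => (rowp (U w) (V w) (Q w) e N).2) w.
Proof.
move=> aU aV aQ; elim: N => [|N [IH1 IH2]]; first by split; exact: polyana_cst.
split=> /=.
  apply: polyanaD; apply: polyanaM => //; last exact: polyanaC.
  by apply: polyanaD; [exact: polyana_cst|apply: polyanaN; exact: polyanaC].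
by apply: polyanaN; apply: polyanaM => //; exact: polyanaC.
Qed.

Lemma polyana_pa w : polyana pa w.
Proof. by case: (@polyana_rowp mu mv mp (1%R, 0%R) (n.+1 + n) w) => // k; [exact: ana_mu|exact: ana_mv|exact: ana_mp]. Qed.

Lemma polyana_pb w : polyana pb w.
Proof. by case: (@polyana_rowp mu mv mp (1%R, 0%R) (n.+1 + n) w) => // k; [exact: ana_mu|exact: ana_mv|exact: ana_mp]. Qed.

Lemma roots_ex w : exists y : nat -> R, [/\ incr (n.+1 + n) y,
  forall i, (i < n.+1 + n)%N -> root (pa w) (y i) &
  forall i, (i < n.+1 + n)%N -> 0 < (-1) ^+ (n.+1 + n - i) * (pb w).[y i]].
Proof. exact: (sturm (mp w) (mu_gt0 w) (mv_gt0 w)). Qed.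

(** The choice is harmless below [n.+1 + n]: an increasing list of all roots of a monic polynomial
    is determined by it. *)
Definition rts w : nat -> R := sval (cid (roots_ex w)).
Lemma rtsP w : [/\ incr (n.+1 + n) (rts w),
  forall i, (i < n.+1 + n)%N -> root (pa w) (rts w i) &
  forall i, (i < n.+1 + n)%N -> 0 < (-1) ^+ (n.+1 + n - i) * (pb w).[rts w i]].
Proof. exact: (svalP (cid (roots_ex w))). Qed.

(** Since [a] is odd, negating the roots and reversing their order gives again an increasing list of
    all roots. In particular the middle root is 0. *)
Lemma rts_odd w i : (i < n.+1 + n)%N -> rts w i = - rts w (n + n - i)%N.
Proof.
have [ri rr _] := rtsP w.
apply: (@roots_unique R (n.+1 + n) (pa w) (rts w) (fun i => - rts w (n + n - i)%N)) => //.
- exact: pa_monic.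
- exact: pa_size.
- move=> j jm; rewrite ltrN2; have <- : (n + n - j.+1).+1 = (n + n - j)%N by lia.
  by apply: ri; lia.
- move=> j jm; rewrite rootE pa_odd oppr_eq0; have := rr (n + n - j)%N; rewrite rootE; apply; lia.
Qed.

(** The index [n] belongs to the root 0, hence the offset [n.+1]. *)
Definition lam w k : R := rts w (n.+1 + k).

Lemma rts_mid w : rts w n = 0.
Proof. by have := @rts_odd w n; rewrite addnK => /(_ (leq_addr n n.+1)) E; lra. Qed.

Lemma lam_incr w : incr n (lam w).
Proof. by move=> i im; rewrite /lam addnS; have [ri _ _] := rtsP w; apply: ri; rewrite -addnS ltn_add2l. Qed.

Lemma lam_gt0 w k : (k < n)%N -> 0 < lam w k.
Proof.
by move=> kn; rewrite -(rts_mid w); have [ri _ _] := rtsP w; apply: (incr_lt ri); lia.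
Qed.

Lemma lam_root w k : (k < n)%N -> (pa w).[lam w k] = 0.
Proof. by move=> kn; apply/eqP; have [_ + _] := rtsP w; apply; lia. Qed.

(** The Sturm sign of [b] at the root of index [n.+1 + k] among [n.+1 + n] roots. *)
Definition eps k : R := (-1) ^+ (n - k).

Lemma epsK k : eps k * eps k = 1.
Proof. by rewrite /eps -expr2 sqrr_sign. Qed.

Definition bet w k := eps k * (pb w).[lam w k].

Lemma bet_gt0 w k : (k < n)%N -> 0 < bet w k.
Proof.
move=> kn; have [_ _ /(_ (n.+1 + k)%N)] := rtsP w; rewrite ltn_add2l => /(_ kn).
by rewrite subnDl.
Qed.

Lemma pa_deriv_neq0 w k : (k < n)%N -> (pa w)^`().[lam w k] != 0.
Proof.
move=> kn; have [ri rr _] := rtsP w.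
by apply: (root_deriv_neq0 (pa_monic w) (pa_size w) ri rr); rewrite ltn_add2l.
Qed.

Lemma ana_lam k : (k < n)%N -> anaE (fun w => lam w k).
Proof.
move=> kn w; apply: (@ana_root R _ pa rts (n.+1 + n)).
- exact: polyana_pa.
- exact: pa_monic.
- exact: pa_size.
- by move=> v; case: (rtsP v).
- by move=> v; case: (rtsP v).
- by rewrite ltn_add2l.
Qed.

Lemma ana_horner_at (I : finType) (Q : (I -> R) -> {poly R}) m (y : (I -> R) -> R) (x : I -> R) :
  polyana Q x -> (forall v, size (Q v) <= m)%N -> ana y x -> ana (fun v => (Q v).[y v]) x.
Proof.
move=> aQ sQ ay.
have := @ana_comp R I (option I) (fun z => (Q (oproj z)).[z None])
  (fun j v => oext v (y v) j) x; apply.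
  exact: (@ana_horner R I Q m).
by case=> [j|] //=; exact: ana_coord.
Qed.

Lemma pdr_horner_at (I : finType) (Q : (I -> R) -> {poly R}) m (y : (I -> R) -> R) (x : I -> R) i :
  polyana Q x -> (forall v, size (Q v) <= m)%N -> ana y x ->
  pdr i (fun v => (Q v).[y v]) x =
  pdr i (fun v => (Q v).[y x]) x + (Q x)^`().[y x] * pdr i y x.
Proof.
move=> aQ sQ ay.
have aF : ana (fun z => (Q (oproj z)).[z None]) (oext x (y x)) by apply: (ana_horner _ sQ).
have ag j : ana (fun v => oext v (y v) j) x by case: j => [j|] //=; exact: ana_coord.
rewrite (@pdr_comp R I (option I) (fun z => (Q (oproj z)).[z None]) (fun j v => oext v (y v) j) x i)//.
rewrite (bigD1 None)//= addrC; congr (_ + _); last by rewrite (pdr_horner _ aQ sQ).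
rewrite (bigD1 (Some i))//= big1 ?addr0.
  by rewrite pdr_coord eqxx mulr1 -pdr_oext.
move=> [j|] /andP[nz ji]; last by rewrite eqxx in nz.
rewrite [X in _ * X](pdr_coord x i j).
suff -> : (j == i) = false by rewrite mulr0.
by apply/negbTE; apply: contraNneq ji => ->.
Qed.

Lemma br_lin2 f f1 f2 (c1 c2 : R) g w :
  (forall i, pdr i f w = c1 * pdr i f1 w + c2 * pdr i f2 w) ->
  br f g w = c1 * br f1 g w + c2 * br f2 g w.
Proof.
move=> H; rewrite /br !mulr_sumr -!big_split; apply: eq_bigr => i _ /=.
rewrite !H; move: (pdr (qi i) f1 w) (pdr (qi i) f2 w) (pdr (pi' i) f1 w) (pdr (pi' i) f2 w).
by move: (pdr (qi i) g w) (pdr (pi' i) g w) => *; ring.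
Qed.

Lemma br_horner_at (Q : P -> {poly R}) m y f w :
  polyana Q w -> (forall w, size (Q w) <= m)%N -> ana y w ->
  br (fun w => (Q w).[y w]) f w =
  br (fun w' => (Q w').[y w]) f w + (Q w)^`().[y w] * br y f w.
Proof.
move=> aQ sQ ay; rewrite -[X in X + _]mul1r; apply: br_lin2 => i.
by rewrite (pdr_horner_at i aQ sQ ay) mul1r.
Qed.

(** Being polynomial in [x], the bracket can be differentiated in [x]; this is what gives the
    diagonal value in [br_ab_diag], where the r-matrix relation degenerates. *)
Lemma br_horner_poly (Q : P -> {poly R}) m f w :
  polyana Q w -> (forall w, size (Q w) <= m)%N ->
  exists q : {poly R}, forall x, br (fun w' => (Q w').[x]) f w = q.[x].
Proof.
move=> aQ sQ; exists (\poly_(j < m) br (fun w => (Q w)`_j) f w) => x.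
rewrite horner_poly /br; under [RHS]eq_bigr do rewrite mulr_suml.
rewrite exchange_big; apply: eq_bigr => i _ /=.
have E k : pdr k (fun w' => (Q w').[x]) w = \sum_(j < m) x ^+ j * pdr k (fun w => (Q w)`_j) w.
  have -> : (fun w' => (Q w').[x]) = (fun w' => \sum_(j < m) x ^+ j * (Q w')`_j).
    by apply/funext => v; rewrite (horner_coef_wide _ (sQ v)); apply: eq_bigr => j _; rewrite mulrC.
  by rewrite pdr_sum; [apply: eq_bigr => j _; rewrite pdrZ|move=> j _; exact: anaZ].
by rewrite !E !mulr_suml -sumrB; apply: eq_bigr => j _; ring.
Qed.

Lemma horner_eq_deriv (p q : {poly R}) x : (forall y, p.[y] = q.[y]) -> p^`().[x] = q^`().[x].
Proof.
move=> /funext E; have H := is_derive_horner p x; rewrite E in H.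
by have := @derive_val _ _ _ _ _ _ _ H; rewrite (@derive_val _ _ _ _ _ _ _ (is_derive_horner q x)).
Qed.

(** Differentiation of the identity [a(lam_k) = 0]. *)
Lemma br_lam f k w : (k < n)%N ->
  (pa w)^`().[lam w k] * br (fun w => lam w k) f w = - br (fun w' => (pa w').[lam w k]) f w.
Proof.
move=> kn.
have sa v : (size (pa v) <= (n.+1 + n).+1)%N by rewrite pa_size.
have := br_horner_at f (@polyana_pa w) sa (ana_lam kn w).
have -> : (fun w => (pa w).[lam w k]) = fun=> 0 by apply/funext => v; rewrite lam_root.
by rewrite br_cst => /esym/eqP; rewrite addr_eq0 => /eqP ->; rewrite opprK.
Qed.

Lemma lam_sqr_neq j k w : (j < n)%N -> (k < n)%N -> j != k -> lam w j ^+ 2 != lam w k ^+ 2.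
Proof.
move=> jn kn; apply: contraNneq => /eqP.
rewrite eqrXn2 ?ltW ?lam_gt0// => /eqP E.
by apply/eqP; apply: (incr_inj (@lam_incr w)).
Qed.

Lemma paE' x : (fun w => (pa w).[x]) = pat x (1, 0) (1, 0). Proof. by apply/funext => w; rewrite paE. Qed.
Lemma pbE' x : (fun w => (pb w).[x]) = pat x (1, 0) (0, 1). Proof. by apply/funext => w; rewrite pbE. Qed.

Lemma br_lam_lam j k w : (j < n)%N -> (k < n)%N -> br (fun w => lam w j) (fun w => lam w k) w = 0.
Proof.
move=> jn kn; have [->|jk] := eqVneq j k.
  by have := brC (fun w => lam w k) (fun w => lam w k) w; lra.
apply: (mulfI (pa_deriv_neq0 w jn)); rewrite mulr0 br_lam// brC opprK.
apply: (mulfI (pa_deriv_neq0 w kn)); rewrite mulr0 br_lam// !paE' br_aa ?oppr0//.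
by apply: lam_sqr_neq; rewrite // eq_sym.
Qed.

(* On the diagonal the bracket is found by differentiating the relation
   [br_ab] in [y] at [y = x]. *)
Lemma br_ab_diag x w : x != 0 -> (pa w).[x] = 0 ->
  br (fun w => (pa w).[x]) (fun w => (pb w).[x]) w = (pa w)^`().[x] * (pb w).[x].
Proof.
move=> x0 ax; have sb v := pb_size v.
have [q Hq] := br_horner_poly (fun w => (pa w).[x]) (@polyana_pb w) sb.
rewrite brC Hq.
have H y : (('X ^+ 2 - (x ^+ 2)%:P) * q).[y] =
    (- (pa w * ((pb w).[x] *: (x%:P + 'X) + (pb w).[- x] *: (x%:P - 'X)))).[y].
  have hE (p r : {poly R}) (c : R) : (('X ^+ 2 - (x ^+ 2)%:P) * p).[y] = (y ^+ 2 - x ^+ 2) * p.[y] /\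
      (- (r * (c *: (x%:P + 'X) + (pb w).[- x] *: (x%:P - 'X)))).[y] =
      - (r.[y] * (c * (x + y) + (pb w).[- x] * (x - y))).
    by move: (pb w).[- x] => c'; split; rewrite !hornerE.
  rewrite (hE q 0 0).1 (hE 0 _ _).2 -Hq brC mulrN.
  have := br_ab x y w; rewrite -paE' -pbE' -!paE -!pbE ax mul0r sub0r addr0 => E.
  transitivity ((x ^+ 2 - y ^+ 2) * br (fun w0 => (pa w0).[x]) (fun w0 => (pb w0).[y]) w); first by ring.
  by rewrite E; ring.
have := horner_eq_deriv x H.
have dE (p r : {poly R}) (c c' : R) : r.[x] = 0 -> (('X ^+ 2 - (x ^+ 2)%:P) * p)^`().[x] = 2 * x * p.[x] /\
    (- (r * (c *: (x%:P + 'X) + c' *: (x%:P - 'X))))^`().[x] = - (r^`().[x] * (c * (2 * x))).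
  move=> r0; split.
    rewrite derivM hornerD !hornerM derivB derivXn derivC subr0 hornerMn hornerXn hornerD hornerN hornerXn hornerC.
    by rewrite subrr expr1; ring.
  rewrite derivN derivM hornerN hornerD !hornerM r0 mul0r addr0 hornerD !hornerZ !hornerD hornerN hornerC hornerX.
  by rewrite subrr; ring.
rewrite (dE q 0 0 0 (horner0 _)).1 (dE 0 _ _ _ ax).2 => E.
apply: (@mulfI _ (2 * x)); first by rewrite mulf_neq0.
by move: E; rewrite ?mulrN; lra.
Qed.

Lemma br_lam_pb j k w : (j < n)%N -> (k < n)%N ->
  br (fun w => lam w j) (fun w' => (pb w').[lam w k]) w = - (j == k)%:R * (pb w).[lam w k].
Proof.
move=> jn kn; apply: (mulfI (pa_deriv_neq0 w jn)); rewrite br_lam//.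
have [->|jk] := eqVneq j k.
  by rewrite br_ab_diag ?lam_root ?gt_eqF ?lam_gt0// mulr1n mulN1r mulrN.
have := br_ab (lam w j) (lam w k) w.
rewrite -paE' -pbE' -!paE -!pbE !lam_root// !mul0r subrr addr0 !mulr0 subrr.
move=> /eqP; rewrite mulf_eq0 subr_eq0 (negbTE (lam_sqr_neq w jn kn jk)) /= => /eqP ->.
by rewrite !mulr0n oppr0 mul0r mulr0.
Qed.

Definition nu w k := ln (bet w k).

Lemma ana_bet k : (k < n)%N -> anaE (fun w => bet w k).
Proof.
move=> kn w; apply: anaZ; apply: (ana_horner_at (m := n.+1 + n)); [exact: polyana_pb|exact: pb_size|exact: ana_lam].
Qed.

Lemma ana_nu k : (k < n)%N -> anaE (fun w => nu w k).
Proof. by move=> kn w; apply: ana_ln; [exact: ana_bet|exact: bet_gt0]. Qed.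

Lemma br_nu f k w : (k < n)%N -> br (fun w => nu w k) f w = (pb w).[lam w k]^-1 * br (fun w => (pb w).[lam w k]) f w.
Proof.
move=> kn; have b0 := bet_gt0 w kn.
have ab : anaE (fun w => (pb w).[lam w k]).
  move=> v; apply: (ana_horner_at (m := n.+1 + n)); [exact: polyana_pb|exact: pb_size|exact: ana_lam].
have e0 : eps k != 0 by rewrite /eps signr_eq0.
have p0 : (pb w).[lam w k] != 0 by apply: contraTneq b0; rewrite /bet => ->; rewrite mulr0 ltxx.
have E j : pdr j (fun w => nu w k) w = (pb w).[lam w k]^-1 * pdr j (fun w => (pb w).[lam w k]) w.
  have := @pdr_comp1 R _ (@ln R) (fun w => bet w k) w j _ (is_derive1_ln b0) (ana_bet kn w).
  rewrite /nu => ->; rewrite /bet pdrZ ?invfM; last exact: ab.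
  by field; rewrite e0 p0.
by rewrite (br_lin2 (c2 := 0) (f2 := fun=> 0) f (f1 := fun w => (pb w).[lam w k]) (c1 := (pb w).[lam w k]^-1)) ?mul0r ?addr0// => i; rewrite E mul0r addr0.
Qed.

(** [nu] depends on the point through the coefficients of [b] and through the place of evaluation.
    The first part is [br_lam_pb], where that place is frozen; the second is a multiple of the
    bracket of two [lam], which is 0. *)
Lemma br_lam_nu j k w : (j < n)%N -> (k < n)%N ->
  br (fun w => lam w j) (fun w => nu w k) w = - (j == k)%:R.
Proof.
move=> jn kn; rewrite brC br_nu// (br_horner_at _ (@polyana_pb w) (@pb_size) (ana_lam kn w)).
rewrite br_lam_lam// mulr0 addr0 brC br_lam_pb//.
have b0 := bet_gt0 w kn.
have p0 : (pb w).[lam w k] != 0 by apply: contraTneq b0; rewrite /bet => ->; rewrite mulr0 ltxx.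
by field.
Qed.

Lemma br_nu_nu j k w : (j < n)%N -> (k < n)%N -> br (fun w => nu w j) (fun w => nu w k) w = 0.
Proof.
move=> jn kn; have [->|jk] := eqVneq j k.
  by have := brC (fun w => nu w k) (fun w => nu w k) w; lra.
rewrite br_nu// (br_horner_at _ (@polyana_pb w) (@pb_size) (ana_lam jn w)).
rewrite br_lam_nu// (negbTE jk) mulr0n oppr0 mulr0 addr0.
rewrite brC br_nu// (br_horner_at _ (@polyana_pb w) (@pb_size) (ana_lam kn w)).
rewrite [br (fun w => lam w k) _ w]br_lam_pb// eq_sym (negbTE jk) mulr0n oppr0 mul0r mulr0 addr0.
rewrite !pbE'.
have := br_bb (x := lam w k) (y := lam w j) w (lam_sqr_neq w kn jn _); rewrite eq_sym => /(_ jk).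
rewrite -!paE !lam_root// !mul0r subrr => /eqP; rewrite mulf_eq0 => /orP[|/eqP ->].
  by rewrite gt_eqF// addr_gt0 ?lam_gt0.
by rewrite mulr0 oppr0 mulr0.
Qed.

End SeparatedVariables.

Section Discriminant.
Variables (R : realType) (n : nat).
Local Notation P := ('I_(n + n) -> R).
Implicit Types (f g : P -> R) (w : P).

(* The discriminant [x a(x) + b(x) + b(-x)] as a polynomial in [t = x^2]. *)
Definition pD w : {poly R} := even_poly ('X * pa w + 2%:P * pb w).

Lemma even_polyE2 (p : {poly R}) x : (even_poly p).[x ^+ 2] = (p.[x] + p.[- x]) / 2.
Proof.
have E y : p.[y] = (even_poly p).[y ^+ 2] + (odd_poly p).[y ^+ 2] * y.
  by rewrite -[p in LHS]poly_even_odd !hornerE !horner_comp !hornerE.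
by rewrite (E x) (E (- x)) sqrrN; field.
Qed.

Lemma pD_sqr w x : (pD w).[x ^+ 2] = x * (pa w).[x] + (pb w).[x] + (pb w).[- x].
Proof.
rewrite even_polyE2.
have E y : ('X * pa w + 2%:P * pb w).[y] = y * (pa w).[y] + 2 * (pb w).[y].
  by move: (pa w) (pb w) => p q; rewrite !hornerE.
by rewrite !E pa_odd; field.
Qed.

Lemma pD_coef w j : (pD w)`_j = (if j is j'.+1 then (pa w)`_(j'.*2.+1) else 0) + 2 * (pb w)`_(j.*2).
Proof. by rewrite coef_even_poly coefD coefCM coefXM; case: j. Qed.

Lemma pD_size w : size (pD w) = n.+2.
Proof.
have c1 : (pD w)`_n.+1 = 1.
  rewrite pD_coef [(pb w)`__]nth_default ?mulr0 ?addr0; last by apply: leq_trans (pb_size w) _; lia.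
  have /monicP := pa_monic w; rewrite /lead_coef pa_size /= => <-; congr (_`__); lia.
apply/eqP; rewrite eqn_leq; apply/andP; split.
  apply/leq_sizeP => j jn; rewrite pD_coef; case: j jn => // j jn.
  rewrite !nth_default ?mulr0 ?addr0 ?pa_size//; first by apply: leq_trans (pb_size w) _; lia.
  by lia.
by rewrite ltnNge; apply/negP => /leq_sizeP/(_ _ (leqnn _)); rewrite c1 => /eqP; rewrite oner_eq0.
Qed.

Lemma pD_monic w : pD w \is monic.
Proof.
apply/monicP; rewrite /lead_coef pD_size /= pD_coef.
rewrite [(pb w)`__]nth_default ?mulr0 ?addr0; last by apply: leq_trans (pb_size w) _; lia.
by have /monicP := pa_monic w; rewrite /lead_coef pa_size /= => <-; congr (_`__); lia.
Qed.

Lemma polyana_pD w : polyana (@pD) w.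
Proof.
move=> j; apply: (ana_ext (f := fun w => (if j is j'.+1 then (pa w)`_(j'.*2.+1) else 0) + 2 * (pb w)`_(j.*2))).
  by move=> v; rewrite pD_coef.
apply: anaD; last by apply: anaZ; exact: polyana_pb.
by case: j => [|j]; [exact: ana_const|exact: polyana_pa].
Qed.

(** At [x = 0] the determinant relation reads [b(0)^2 = 1], and the Sturm sign at the middle root
    selects the square root. *)
Lemma pb0 w : (pb w).[0] = (-1) ^+ n.+1.
Proof.
have [_ _ /(_ n)] := rtsP w; rewrite rts_mid => /(_ (leq_addr n n.+1)).
have -> : (n.+1 + n - n)%N = n.+1 by lia.
move=> b0.
have := pat_det 0 w; rewrite oppr0 -paE -pbE.
have -> : (pa w).[0] = 0 by have := pa_odd w 0; rewrite oppr0; lra.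
rewrite mul0r add0r -expr2 => E; apply/eqP.
have := E; rewrite -{1}[1](sqrr_sign R n.+1) => /eqP; rewrite eqf_sqr => /orP[//|/eqP E2].
by move: b0; rewrite E2 mulrN -expr2 sqrr_sign; lra.
Qed.

Lemma pD0 w : (pD w).[0] = 2 * (-1) ^+ n.+1.
Proof. by have := pD_sqr w 0; rewrite expr0n /= mul0r oppr0 pb0 => ->; ring. Qed.

(** At a root of [a] the determinant relation makes [b(- lam)] the inverse of [b(lam)]. *)
Lemma pD_lam w k : (k < n)%N -> eps R n k * (pD w).[lam w k ^+ 2] = bet w k + (bet w k)^-1.
Proof.
move=> kn; rewrite pD_sqr lam_root// mulr0 add0r /bet invfM.
have e2 := epsK R n k.
have e0 : eps R n k != 0 by rewrite /eps signr_eq0.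
have := pat_det (lam w k) w; rewrite -!paE -!pbE lam_root// mul0r add0r => E.
have b0 := bet_gt0 w kn.
have p0 : (pb w).[lam w k] != 0 by apply: contraTneq b0; rewrite /bet => ->; rewrite mulr0 ltxx.
have -> : (eps R n k)^-1 = eps R n k by apply: (mulfI e0); rewrite mulfV// e2.
have -> : (pb w).[lam w k]^-1 = (pb w).[- lam w k] by apply: (mulfI p0); rewrite mulfV// E.
by ring.
Qed.

End Discriminant.

(** * Gaps and rotation loops *)

Section Gaps.
Variables (R : realType) (n : nat).
Local Notation P := ('I_(n + n) -> R).
Local Notation e_ := (eps R n).
Implicit Types (f g : P -> R) (w : P).

Lemma rolle_poly (p : {poly R}) a b : a < b -> p.[a] = p.[b] -> exists2 c, a < c < b & p^`().[c] = 0.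
Proof.
move=> ab E; have [|c cab] := @prim_MVT R a b (horner p^`()) (horner p) ab.
  by move=> t _; exact: is_derive_horner.
move=> H; exists c => //; move: H; rewrite E subrr => /esym/eqP.
by rewrite mulf_eq0 subr_eq0 (gt_eqF ab) orbF => /eqP.
Qed.

Lemma pD_lam_ge2 w k : (k < n)%N -> 2 <= e_ k * (pD w).[lam w k ^+ 2].
Proof.
move=> kn; rewrite pD_lam//; have b0 := bet_gt0 w kn.
rewrite -subr_ge0 -(pmulr_rge0 _ b0).
have -> : bet w k * (bet w k + (bet w k)^-1 - 2) = (bet w k - 1) ^+ 2 by field; rewrite gt_eqF.
exact: sqr_ge0.
Qed.

(** At the points [lam_k^2] the values of [D] alternate in sign, with modulus at least 2, which
    separates the roots. That the lowest root is positive follows from the sign of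
    [D(0) = 2 (-1)^(n+1)]. *)
Lemma gap_ex w : exists y : nat -> R, [/\ forall i, (i < n.+1)%N -> root (pD w) (y i),
  forall k, (k < n)%N -> y k < lam w k ^+ 2 < y k.+1 & 0 < y 0%N].
Proof.
have ti : incr n (fun k => lam w k ^+ 2).
  by move=> i im; rewrite ltrXn2r// ?ltW ?lam_gt0 ?lam_incr// ltnW.
have tD i : (i.+1 < n.+1)%N -> 0 < (-1) ^+ (n.+1 - i.+1) * (pD w).[lam w i ^+ 2].
  by move=> im; rewrite subSS; apply: lt_le_trans (pD_lam_ge2 w im); rewrite ltr0n.
have [y yr yz] := interlace (ltn0Sn n) (pD_monic w) (pD_size w) ti tD.
exists y; split => //; rewrite ltNge; apply/negP => y0.
have yi : incr n.+1 y by move=> j jm; have /andP[] := yz j jm; exact: lt_trans.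
have D0 := pD0 w; have y0' : y 0%N < 0.
  rewrite lt_neqAle y0 andbT; apply: contraTneq (yr 0%N isT) => ->.
  by rewrite rootE D0 mulf_neq0// signr_eq0.
have := @sgn_prod R n.+1 y 0 1 isT; rewrite -horner_factor -(monic_factor (pD_monic w) (pD_size w) yi yr) D0.
rewrite subSS subn0 exprS => H.
have : 0 < (-1) ^+ n * (2 * ((-1) * (-1) ^+ n)) :> R.
  apply: H => [[]//|i /andP[i1 im]].
  case: i i1 im => // i _ im; have /andP[_ H] := yz i im; apply: lt_trans H.
  by rewrite exprn_gt0 ?lam_gt0.
have -> : (-1) ^+ n * (2 * ((-1) * (-1) ^+ n)) = - 2 * ((-1) ^+ n * (-1) ^+ n) :> R by ring.
by rewrite -expr2 sqrr_sign; lra.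
Qed.

(** The gaps are bounded by roots of [D], not by solutions of [|D| = 2]: the former stay distinct,
    hence analytic, when a spectral gap closes. *)
Definition gr w : nat -> R := sval (cid (gap_ex w)).
Lemma grP w : [/\ forall i, (i < n.+1)%N -> root (pD w) (gr w i),
  forall k, (k < n)%N -> gr w k < lam w k ^+ 2 < gr w k.+1 & 0 < gr w 0%N].
Proof. exact: (svalP (cid (gap_ex w))). Qed.

Lemma gr_incr w : incr n.+1 (gr w).
Proof. by have [_ H _] := grP w; move=> j jm; have /andP[] := H j jm; exact: lt_trans. Qed.

Lemma gr_gt0 w k : (k <= n)%N -> 0 < gr w k.
Proof.
by move=> kn; have [_ _ H] := grP w; apply: lt_le_trans H _; exact: (incr_le (@gr_incr w)).
Qed.

Lemma pD_factor w t : (pD w).[t] = \prod_(0 <= i < n.+1) (t - gr w i).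
Proof.
have [H _ _] := grP w.
by rewrite {1}(monic_factor (pD_monic w) (pD_size w) (@gr_incr w) H) horner_factor.
Qed.

Lemma ana_gr k w : (k <= n)%N -> ana (fun w => gr w k) w.
Proof.
move=> kn; apply: (@ana_root R _ (@pD R n) gr n.+1) => //.
- exact: polyana_pD.
- exact: pD_monic.
- exact: pD_size.
- by move=> v; exact: gr_incr.
- by move=> v; case: (grP v).
Qed.

Lemma pD_gr w k : (k <= n)%N -> (pD w).[gr w k] = 0.
Proof. by move=> kn; apply/eqP; have [H _ _] := grP w; exact: H. Qed.

Lemma pD_gt0 w k t : (k < n)%N -> gr w k < t < gr w k.+1 -> 0 < e_ k * (pD w).[t].
Proof.
move=> kn /andP[t1 t2]; rewrite pD_factor.
have := @sgn_prod R n.+1 (gr w) t k.+1; rewrite subSS; apply => //; first exact: ltnW.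
  move=> i ik; apply: le_lt_trans t1; apply: (incr_le (@gr_incr w)).
  by rewrite -ltnS ik ltnS ltnW.
move=> i /andP[ki im]; apply: lt_le_trans t2 _; apply: (incr_le (@gr_incr w)).
by rewrite ki im.
Qed.

(** Scaled to be monic, so that the critical points of [D] fall under [ana_root]. *)
Definition pE w : {poly R} := (n.+1%:R)^-1 *: (pD w)^`().

Lemma pD'E w t : (pD w)^`().[t] = n.+1%:R * (pE w).[t].
Proof. by rewrite /pE hornerZ mulVKf// pnatr_eq0. Qed.

Lemma pE_size w : size (pE w) = n.+1.
Proof.
rewrite size_scale ?invr_eq0 ?pnatr_eq0//.
by rewrite polyorder.size_deriv pD_size.
Qed.

Lemma pE_monic w : pE w \is monic.
Proof.
apply/monicP; rewrite /lead_coef pE_size /= coefZ coef_deriv.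
by have /monicP := pD_monic w; rewrite /lead_coef pD_size /= => ->; rewrite mulVf// pnatr_eq0.
Qed.

Lemma crit_ex w : exists y : nat -> R, forall k, (k < n)%N -> gr w k < y k < gr w k.+1 /\ root (pE w) (y k).
Proof.
have H k : exists y, (k < n)%N -> gr w k < y < gr w k.+1 /\ root (pE w) y.
  have [kn|_] := ltnP k n; last by exists 0.
  have [|c cab Hc] := @rolle_poly (pD w) _ _ (@gr_incr w k kn); first by rewrite !pD_gr// ltnW.
  by exists c => _; split=> //; rewrite /pE rootE hornerZ Hc mulr0.
by have [y Hy] := choice H; exists y.
Qed.

Definition cr w : nat -> R := sval (cid (crit_ex w)).
Lemma crP w k : (k < n)%N -> gr w k < cr w k < gr w k.+1.
Proof. by move=> kn; case: (svalP (cid (crit_ex w)) k kn). Qed.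
Lemma cr_root w k : (k < n)%N -> root (pE w) (cr w k).
Proof. by move=> kn; case: (svalP (cid (crit_ex w)) k kn). Qed.

Lemma cr_incr w : incr n (cr w).
Proof.
move=> i im; have /andP[_ H1] := crP w (ltnW im); have /andP[H2 _] := crP w im.
exact: lt_trans H2.
Qed.

Lemma ana_cr k w : (k < n)%N -> ana (fun w => cr w k) w.
Proof.
move=> kn; apply: (@ana_root R _ pE cr n) => //.
- move=> j; apply: (ana_ext (f := fun w => (n.+1%:R)^-1 * ((j.+1)%:R * (pD w)`_j.+1))).
    by move=> v; rewrite /pE coefZ coef_deriv mulr_natl.
  by do 2!apply: anaZ; exact: polyana_pD.
- exact: pE_monic.
- exact: pE_size.
- by move=> v; exact: cr_incr.
- by move=> v i im; exact: cr_root.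
Qed.

(** The sign makes this factor positive on the k-th gap: [eps k * D] has there a single critical
    point, a maximum at [cr w k]. *)
Definition cof_ w k t := - e_ k * (n.+1%:R * \prod_(0 <= i < n | i != k) (t - cr w i)).

Lemma cofE w k t : (k < n)%N -> e_ k * (pD w)^`().[t] = - ((t - cr w k) * cof_ w k t).
Proof.
move=> kn; rewrite pD'E (monic_factor (pE_monic w) (pE_size w) (@cr_incr w) (@cr_root w)) horner_factor.
by rewrite (bigD1_seq k) ?mem_index_iota ?iota_uniq//= /cof_; ring.
Qed.

Lemma cof_gt0 w k t : (k < n)%N -> gr w k <= t <= gr w k.+1 -> 0 < cof_ w k t.
Proof.
move=> kn /andP[t1 t2]; rewrite /cof_.
rewrite mulrCA mulr_gt0 ?ltr0n// (big_cat_nat (n := k)) ?(ltnW kn)//=.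
rewrite [X in 0 < _ * (_ * X)]big_ltn_cond ?kn// eqxx /=.
have L i : (i < k)%N -> 0 < t - cr w i.
  move=> ik; rewrite subr_gt0; have /andP[_ H] := crP w (ltn_trans ik kn).
  apply: lt_le_trans H (le_trans _ t1); apply: (incr_le (@gr_incr w)).
  by rewrite ik /= ltnS ltnW.
have U i : (k < i < n)%N -> 0 < - (t - cr w i).
  move=> /andP[ki im]; rewrite oppr_gt0 subr_lt0; have /andP[H _] := crP w im.
  apply: le_lt_trans (le_trans t2 _) H; apply: (incr_le (@gr_incr w)).
  by rewrite ki /= ltnS ltnW.
(* The [n - k.+1] factors with index above [k] are negative; reversing all of them costs the sign
   [(-1) ^+ (n - k.+1) = - e_ k]. *)
have -> : \prod_(k.+1 <= i < n | i != k) (t - cr w i) = - e_ k * \prod_(k.+1 <= i < n | i != k) - (t - cr w i).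
  have -> : \prod_(k.+1 <= i < n | i != k) (t - cr w i) = \prod_(k.+1 <= i < n) (t - cr w i).
    by rewrite big_nat_cond [RHS]big_nat_cond; apply: eq_bigl => i; case: ltngtP; rewrite ?andbF ?andbT//= .
  have -> : \prod_(k.+1 <= i < n | i != k) - (t - cr w i) = \prod_(k.+1 <= i < n) - (t - cr w i).
    by rewrite big_nat_cond [RHS]big_nat_cond; apply: eq_bigl => i; case: ltngtP; rewrite ?andbF ?andbT//= .
  under [in RHS]eq_bigr do rewrite -mulN1r.
  rewrite big_split /= prodr_const_nat mulrA /eps.
  rewrite -(subnSK kn) exprS mulN1r opprK -expr2 sqrr_sign mul1r//.
set p1 := \prod_(_ <= _ < _ | _) _; set p2 := \prod_(_ <= _ < _ | _) _.
have -> : - e_ k * (p2 * (- e_ k * p1)) = (e_ k * e_ k) * (p1 * p2) by ring.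
rewrite epsK mul1r mulr_gt0//.
  by rewrite /p1 big_nat_cond prodr_gt0// => i /andP[ik _]; exact: U.
by rewrite /p2 big_nat_cond prodr_gt0// => i /andP[/andP[_ ik] _]; exact: L.
Qed.

Lemma ana_cof k (z : option 'I_(n + n) -> R) : (k < n)%N ->
  ana (fun z => cof_ (oproj z) k (z None)) z.
Proof.
move=> kn; do 2!apply: anaZ.
apply: (ana_ext (f := fun z => \prod_(i < n | i != k :> nat) (z None - cr (oproj z) i))).
  by move=> v; rewrite big_mkord.
apply: ana_prod => i _; apply: anaB; first exact: ana_coord.
exact: (@ana_oproj R _ (fun w => cr w i) z (ana_cr (oproj z) (ltn_ord i))).
Qed.

End Gaps.

Section OptionCoordinates.
Variables (R : realType) (I K : finType).

Lemma big_opt (f : option I -> R) : \sum_(o : option I) f o = f None + \sum_i f (Some i).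
Proof.
rewrite (bigD1 None)//=; congr (_ + _).
rewrite (reindex_omap Some id)/=; last by case.
by apply: eq_bigl => i; rewrite eqxx.
Qed.

Lemma ana_osub (F : (option I -> R) -> R) (g : I -> (K -> R) -> R) (h : (K -> R) -> R) z :
  ana F (oext (fun i => g i z) (h z)) -> (forall i, ana (g i) z) -> ana h z ->
  ana (fun z => F (oext (fun i => g i z) (h z))) z.
Proof.
move=> aF ag ah.
apply: (@ana_comp R K (option I) F (fun o v => oext (fun i => g i v) (h v) o) z aF).
by case.
Qed.

Lemma pdr_osub (F : (option I -> R) -> R) (g : I -> (K -> R) -> R) (h : (K -> R) -> R) z k :
  ana F (oext (fun i => g i z) (h z)) -> (forall i, ana (g i) z) -> ana h z ->
  pdr k (fun z => F (oext (fun i => g i z) (h z))) z =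
  pdr None F (oext (fun i => g i z) (h z)) * pdr k h z +
  \sum_i pdr (Some i) F (oext (fun i => g i z) (h z)) * pdr k (g i) z.
Proof.
move=> aF ag ah.
rewrite (@pdr_comp R K (option I) F (fun o v => oext (fun i => g i v) (h v) o) z k aF); last by case.
by rewrite big_opt.
Qed.

End OptionCoordinates.

(** * An analytic coordinate on each gap *)

Section GapUniformization.
Variables (R : realType) (n : nat).
Local Notation P := ('I_(n + n) -> R).
Local Notation Z := (option 'I_(n + n) -> R).
Local Notation e_ := (eps R n).
Implicit Types (f g : P -> R) (w : P) (z : Z).

Definition cgap w k t := (k < n)%N /\ gr w k <= t <= gr w k.+1.
Definition ogap w k t := (k < n)%N /\ gr w k < t < gr w k.+1.

Lemma ogapW w k t : ogap w k t -> cgap w k t.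
Proof. by move=> [kn /andP[a b]]; split=> //; rewrite !ltW. Qed.

Lemma cr_gap w k : (k < n)%N -> ogap w k (cr w k).
Proof. by move=> kn; split=> //; exact: crP. Qed.

Lemma cgap_conv w k t t' s : cgap w k t -> cgap w k t' -> 0 <= s <= 1 -> cgap w k (t + s * (t' - t)).
Proof.
move=> [kn /andP[a b]] [_ /andP[a' b']] /andP[s0 s1]; split=> //.
have -> : t + s * (t' - t) = (1 - s) * t + s * t' by ring.
apply/andP; split.
  have -> : gr w k = (1 - s) * gr w k + s * gr w k by ring.
  by apply: lerD; apply: ler_wpM2l => //; rewrite subr_ge0.
have -> : gr w k.+1 = (1 - s) * gr w k.+1 + s * gr w k.+1 by ring.
by apply: lerD; apply: ler_wpM2l => //; rewrite subr_ge0.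
Qed.

(** The second-order Taylor remainder at the maximum, in integral form. This is the Morse lemma with
    parameters: [gG] is positive on the closed gap, so [gY] is an analytic signed square root of a
    quarter of the drop of [eps k * D] below its maximum. *)
Definition gG k z : R := NI 0 1 (fun s =>
  s * cof_ (oproj z) k (cr (oproj z) k + s * (z None - cr (oproj z) k))).

Definition gF k (v : option (option 'I_(n + n)) -> R) : R :=
  v None * cof_ (oproj (oproj v)) k
    (cr (oproj (oproj v)) k + v None * (v (Some None) - cr (oproj (oproj v)) k)).

Lemma tube_gF k z : (k < n)%N -> tube 0 1 (gF k) z.
Proof.
move=> kn s _; apply: anaM; first exact: ana_coord.
have ac : ana (fun v : option (option 'I_(n + n)) -> R => cr (oproj (oproj v)) k) (oext z s).
  apply: (@ana_oproj R _ (fun z : Z => cr (oproj z) k)).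
  by apply: (@ana_oproj R _ (fun w => cr w k)); exact: ana_cr.
apply: (@ana_osub R _ _ (fun z : Z => cof_ (oproj z) k (z None)) (fun i v => v (Some (Some i)))
   (fun v => cr (oproj (oproj v)) k + v None * (v (Some None) - cr (oproj (oproj v)) k))).
- exact: ana_cof.
- by move=> i; exact: ana_coord.
- by apply: anaD => //; apply: anaM; [exact: ana_coord|apply: anaB => //; exact: ana_coord].
Qed.

Lemma gG_gt0 w k t : cgap w k t -> 0 < gG k (oext w t).
Proof.
move=> ct; have [kn _] := ct; rewrite /gG /=.
have [||s /andP[s0 s1] ->] := @NI_MVT R 0 1 (fun s => s * cof_ w k (cr w k + s * (t - cr w k))).
- exact: ltr01.
- exact: (tube_cton (tube_gF (k := k) (oext w t) kn)).
rewrite subr0 mulr1 mulr_gt0//; apply: cof_gt0 => //.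
have [] := @cgap_conv w k (cr w k) t s (ogapW (cr_gap w kn)) ct => //.
by rewrite !ltW.
Qed.

Lemma ana_gG k z : (k < n)%N -> ana (gG k) z.
Proof. by move=> kn; exact: (ana_NI ltr01 (tube_gF z kn)). Qed.

Lemma gG_eq w k t : (k < n)%N ->
  (t - cr w k) ^+ 2 * gG k (oext w t) = e_ k * (pD w).[cr w k] - e_ k * (pD w).[t].
Proof.
move=> kn; rewrite /gG -NIZ; [|exact: ltr01|exact: (tube_cton (tube_gF (k := k) (oext w t) kn))].
rewrite /= (@NIE _ _ _ _ (fun s => - e_ k * (pD w).[cr w k + s * (t - cr w k)])); [|exact: ltr01|].
  by rewrite mul1r mul0r addr0 addrC [cr w k + _]addrC subrK; ring.
move=> s _.
have -> : (t - cr w k) ^+ 2 * (s * cof_ w k (cr w k + s * (t - cr w k))) =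
    - e_ k * ((pD w)^`().[cr w k + s * (t - cr w k)] * (t - cr w k)).
  have := @cofE R n w k (cr w k + s * (t - cr w k)) kn.
  rewrite [cr w k + _]addrC addrK => E.
  transitivity (- (t - cr w k) * - (s * (t - cr w k) * cof_ w k (s * (t - cr w k) + cr w k))); first by ring.
  by rewrite -E; ring.
have H := is_derive_horner (pD w) (cr w k + s * (t - cr w k)).
have L : is_derive s 1 (fun s : R => cr w k + s * (t - cr w k)) (t - cr w k).
  have := is_deriveD (is_derive_cst (cr w k) s 1) (is_deriveM (is_derive_id s 1) (is_derive_cst (t - cr w k) s 1)).
  by rewrite /GRing.scale/= mulr0 mulr1 !add0r.
have C := @is_derive1_comp _ (horner (pD w)) (fun s : R => cr w k + s * (t - cr w k)) s _ _ H L.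
by have := is_deriveZ (- e_ k) C; rewrite /GRing.scale/=.
Qed.

Definition gY k z : R := (z None - cr (oproj z) k) * (Num.sqrt (gG k z) / 2).

Lemma gY_sqr w k t : cgap w k t -> 4 * gY k (oext w t) ^+ 2 = e_ k * (pD w).[cr w k] - e_ k * (pD w).[t].
Proof.
move=> ct; have [kn _] := ct; rewrite -gG_eq// /gY exprMn exprMn sqr_sqrtr; last by apply: ltW; exact: gG_gt0.
by rewrite -/(oproj _) /=; field.
Qed.

Lemma ana_gY w k t : cgap w k t -> ana (gY k) (oext w t).
Proof.
move=> ct; have [kn _] := ct; apply: anaM.
  by apply: anaB; [exact: ana_coord|apply: (@ana_oproj R _ (fun w => cr w k)); exact: ana_cr].
by apply: anaM; [apply: ana_sqrt; [exact: ana_gG|exact: gG_gt0]|exact: ana_const].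
Qed.

Lemma gY_sgn w k t : cgap w k t -> (0 < gY k (oext w t)) = (cr w k < t) /\ (gY k (oext w t) < 0) = (t < cr w k).
Proof.
move=> ct; have G0 := gG_gt0 ct; have s0 : 0 < Num.sqrt (gG k (oext w t)) / 2 by rewrite divr_gt0// sqrtr_gt0.
by rewrite /gY -[oproj _]/w /= pmulr_lgt0// pmulr_llt0// subr_gt0 subr_lt0.
Qed.

Lemma gap_open w k t : ogap w k t -> nearby (oext w t) (fun z => ogap (oproj z) k (z None)).
Proof.
move=> [kn /andP[a b]].
have H m : (m <= n)%N -> ana (fun z : Z => gr (oproj z) m) (oext w t).
  by move=> mn; apply: (@ana_oproj R _ (fun w => gr w m)); exact: ana_gr.
have N1 : nearby (oext w t) (fun z => 0 < z None - gr (oproj z) k).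
  by apply: ana_gt0; [apply: anaB; [exact: ana_coord|apply: H; exact: ltnW]|rewrite subr_gt0].
have N2 : nearby (oext w t) (fun z => 0 < gr (oproj z) k.+1 - z None).
  by apply: ana_gt0; [apply: anaB; [exact: H|exact: ana_coord]|rewrite subr_gt0].
by apply: nearbyS (nearbyI N1 N2) => z [z1 z2]; split=> //; rewrite -subr_gt0 z1 -subr_gt0.
Qed.

(** At the maximum the factor [t - cr] is differentiated directly. Elsewhere the square relation
    [gY_sqr] is differentiated, and the common factor [t - cr] cancelled. *)
Lemma pdr_gY_gt0 w k t : ogap w k t -> 0 < pdr None (gY k) (oext w t).
Proof.
move=> ot; have ct := ogapW ot; have [kn _] := ot.
have G0 := gG_gt0 ct; have s0 : 0 < Num.sqrt (gG k (oext w t)) / 2 by rewrite divr_gt0// sqrtr_gt0.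
have [tc|tc] := eqVneq t (cr w k).
  rewrite /gY pdrM; last first.
  - by apply: anaM; [apply: ana_sqrt; [exact: ana_gG|]|exact: ana_const].
  - by apply: anaB; [exact: ana_coord|apply: (@ana_oproj R _ (fun w => cr w k)); exact: ana_cr].
  rewrite [X in _ + X * _](_ : _ = 0) ?mul0r ?addr0; last by rewrite /= -[oproj _]/w tc subrr.
  rewrite pdrB; [|exact: ana_coord|apply: (@ana_oproj R _ (fun w => cr w k)); exact: ana_cr].
  rewrite pdr_coord eqxx (@pdr_const_line R _ (fun z => cr (oproj z) k)) ?subr0 ?mul1r//.
  move=> h; congr cr; apply/funext => i; rewrite /oproj /shl /=.
  by rewrite mulr0 addr0.
have E : pdr None (fun z => 4 * gY k z ^+ 2) (oext w t) = (t - cr w k) * cof_ w k t.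
  transitivity (pdr None (fun z => e_ k * (pD (oproj z)).[cr (oproj z) k] - e_ k * (pD (oproj z)).[z None]) (oext w t)).
    apply: pdr_near.
      have ad : ana (fun z : Z => z None) (oext w t) by exact: ana_coord.
      have ac : ana (fun z : Z => cr (oproj z) k) (oext w t) by apply: (@ana_oproj R _ (fun w => cr w k)); exact: ana_cr.
      have aP : polyana (fun z : Z => pD (oproj z)) (oext w t).
        by move=> j; apply: (@ana_oproj R _ (fun w => (pD w)`_j)); exact: polyana_pD.
      have sP (v : Z) : (size (pD (oproj v)) <= n.+2)%N by rewrite pD_size.
      by apply: anaB; apply: anaZ; apply: ana_horner_at aP sP _.
    by apply: nearbyS (gap_open ot) => z /ogapW cz; rewrite -[in RHS](oextK z) gY_sqr.
  rewrite /pdr.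
  have -> : (fun h : R => e_ k * (pD (oproj (shl (oext w t) None h))).[cr (oproj (shl (oext w t) None h)) k] -
      e_ k * (pD (oproj (shl (oext w t) None h))).[shl (oext w t) None h None]) =
      (fun h : R => e_ k * (pD w).[cr w k] - e_ k * (pD w).[h + t]).
    apply/funext => h; have -> : oproj (shl (oext w t) None h) = w.
      by apply/funext => i; rewrite /oproj /shl /= mulr0 addr0.
    by rewrite /shl /= mulr1 addrC [t + h]addrC addrC.
  apply: derive_val.
  have H := is_derive_horner (pD w) (0 + t).
  have L : is_derive (0 : R) 1 (fun s : R => s + t) 1 by apply: is_derive_eq; rewrite addr0.
  have C := @is_derive1_comp _ (horner (pD w)) (fun s : R => s + t) 0 _ _ H L.
  have C' := is_deriveB (is_derive_cst (e_ k * (pD w).[cr w k]) (0:R) 1) (is_deriveZ (e_ k) C).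
  apply: (is_derive_eq C'); have := cofE w t kn.
  by rewrite -[_ *: _]/(e_ k * ((pD w)^`().[0 + t] * 1)) [0 + t]add0r mulr1 => ->; ring.
have aY := ana_gY ct.
have := E; rewrite pdrZ; last exact: anaX.
have -> : (fun z => gY k z ^+ 2) = (fun z => gY k z * gY k z) by apply/funext => z; rewrite expr2.
rewrite pdrM//.
have -> : 4 * (pdr None (gY k) (oext w t) * gY k (oext w t) + gY k (oext w t) * pdr None (gY k) (oext w t)) =
   (t - cr w k) * (8 * (Num.sqrt (gG k (oext w t)) / 2) * pdr None (gY k) (oext w t)).
  have EY : gY k (oext w t) = (t - cr w k) * (Num.sqrt (gG k (oext w t)) / 2) by [].
  by rewrite EY; ring.
move=> /mulfI => /(_ (ltac:(by rewrite subr_eq0))) E2.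
have : 0 < cof_ w k t by apply: cof_gt0 => //; case: ct.
by rewrite -E2 pmulr_rgt0// mulr_gt0// ltr0n.
Qed.

(** Normalized by [eps k * D(lam_k^2) = 2 cosh nu_k = 2 + 4 sinh^2 (nu_k / 2)], so that
    [Uf ^+ 2 + Vf ^+ 2 = rho2] in [UV_rho]. *)
Definition rho2 w k := (e_ k * (pD w).[cr w k] - 2) / 4.
(** [rho2 + 1/2] is a quarter of the maximum of [eps k * D], so these are exactly the values of [gY]
    on the open gap. The slack [1/2] keeps the loop of radius [sqrt rho2] inside, also when
    [rho2 = 0]. *)
Definition gdom k z := (k < n)%N /\ z None ^+ 2 < rho2 (oproj z) k + 2^-1.

(** Equal values of [gY] give equal values of [D], so by Rolle the maximum lies strictly between the
    two points; but [gY] has opposite signs on its two sides. *)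
Lemma gY_inj w k t t' : ogap w k t -> ogap w k t' -> gY k (oext w t) = gY k (oext w t') -> t = t'.
Proof.
wlog tt : t t' / t < t'.
  move=> W o1 o2 E; have [tt|tt|//] := ltgtP t t'; first exact: W.
  by apply/esym; apply: W.
move=> o1 o2 E; exfalso; have [kn /andP[_ _]] := o1.
have E1 := gY_sqr (ogapW o1); rewrite E (gY_sqr (ogapW o2)) in E1.
have e0 : e_ k != 0 by rewrite /eps signr_eq0.
have ED : (pD w).[t] = (pD w).[t'] by apply: (mulfI e0); lra.
have [c /andP[c1 c2] Hc] := rolle_poly tt ED.
have cc : cgap w k c.
  have [_ /andP[a _]] := o1; have [_ /andP[_ b]] := o2.
  by split=> //; rewrite !ltW//; [apply: lt_trans b|apply: lt_trans c1].
have := cofE w c kn; rewrite Hc mulr0 => /esym/eqP; rewrite oppr_eq0 mulf_eq0 subr_eq0.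
have c3 : 0 < cof_ w k c by apply: cof_gt0; case: cc.
rewrite (gt_eqF c3) orbF => /eqP Ec; rewrite Ec in c1 c2.
have [_ s1] := gY_sgn (ogapW o1); have [s2 _] := gY_sgn (ogapW o2).
by move: s1 s2; rewrite c1 c2 E; lra.
Qed.

(** From the maximum [eps k * D] falls to 0 at either end of the gap. The sign of the prescribed
    value tells on which side the intermediate value theorem is applied. *)
Lemma gY_surj k z : gdom k z -> exists t, ogap (oproj z) k t /\ gY k (oext (oproj z) t) = z None.
Proof.
move=> [kn]; set w := oproj z; set U := z None => HU.
have D4 : 4 * U ^+ 2 < e_ k * (pD w).[cr w k] by move: HU; rewrite /rho2; lra.
have [_ /andP[c1 c2]] := cr_gap w kn.
have key t : ogap w k t -> e_ k * (pD w).[t] = e_ k * (pD w).[cr w k] - 4 * U ^+ 2 ->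
    (0 < U -> cr w k < t) -> (U < 0 -> t < cr w k) -> gY k (oext w t) = U.
  move=> ot E h1 h2; have ct := ogapW ot.
  have := gY_sqr ct; rewrite E opprB addrCA subrr addr0 => /(mulfI (ltac:(by rewrite pnatr_eq0) : (4 : R) != 0)) /eqP.
  rewrite eqf_sqr => /orP[/eqP//|/eqP E2]; have [s1 s2] := gY_sgn ct.
  have [U0|U0|U0] := ltgtP U 0; last by rewrite E2 U0 oppr0.
    by move: (h2 U0) s2 s1; rewrite E2; lra.
  by move: (h1 U0) s2 s1; rewrite E2; lra.
pose p := (e_ k) *: pD w - (e_ k * (pD w).[cr w k] - 4 * U ^+ 2)%:P.
have pE_ t : p.[t] = e_ k * (pD w).[t] - (e_ k * (pD w).[cr w k] - 4 * U ^+ 2).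
  by rewrite /p; move: (pD w) (_ - 4 * _) => q c; rewrite !hornerE.
have [U0|U0|U0] := ltgtP U 0.
- have U2 : 0 < U ^+ 2 by rewrite -sqrrN exprn_gt0// oppr_gt0.
  have [|t /andP[t1 t2]] := @ivt_sgn R p _ _ c1.
    by rewrite !pE_ pD_gr 1?ltnW// nmulr_rlt0; lra.
  rewrite rootE pE_ subr_eq0 => /eqP E.
  have ot : ogap w k t by split=> //; rewrite t1 (lt_trans t2).
  by exists t; split=> //; apply: key => //; lra.
- have U2 : 0 < U ^+ 2 by rewrite exprn_gt0.
  have [|t /andP[t1 t2]] := @ivt_sgn R p _ _ c2.
    by rewrite !pE_ pD_gr// pmulr_rlt0; lra.
  rewrite rootE pE_ subr_eq0 => /eqP E.
  have ot : ogap w k t by split=> //; rewrite t2 (lt_trans c1).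
  by exists t; split=> //; apply: key => //; lra.
- by exists (cr w k); split; [exact: cr_gap|rewrite /gY -[oproj _]/w /= subrr mul0r].
Qed.

Definition gT k z : R := xget 0 [set t | ogap (oproj z) k t /\ gY k (oext (oproj z) t) = z None].

Lemma gTP k z : gdom k z -> ogap (oproj z) k (gT k z) /\ gY k (oext (oproj z) (gT k z)) = z None.
Proof. move=> /gY_surj [t Ht].
by have := @xgetI _ 0 [set t | ogap (oproj z) k t /\ gY k (oext (oproj z) t) = z None] t Ht. Qed.

Lemma gT_uniq w k t : ogap w k t -> gdom k (oext w (gY k (oext w t))) /\ gT k (oext w (gY k (oext w t))) = t.
Proof.
move=> ot; have [kn _] := ot; have d : gdom k (oext w (gY k (oext w t))).
  split=> //=; have := gY_sqr (ogapW ot); rewrite /rho2 -[oproj _]/w.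
  have : 0 < e_ k * (pD w).[t] by apply: pD_gt0 => //; case: ot.
  lra.
split=> //.
by have [od Ed] := gTP d; apply: (gY_inj od ot Ed).
Qed.

Lemma ana_rho2 w k : (k < n)%N -> ana (fun w => rho2 w k) w.
Proof.
move=> kn; apply: anaM; last exact: ana_const.
apply: anaB; last exact: ana_const.
apply: anaZ; apply: (ana_horner_at (m := n.+2)); [exact: polyana_pD|by move=> v; rewrite pD_size|exact: ana_cr].
Qed.

Lemma gdom_open k z : gdom k z -> nearby z (gdom k).
Proof.
move=> [kn H]; have : 0 < rho2 (oproj z) k + 2^-1 - z None ^+ 2 by rewrite subr_gt0.
move=> /(@ana_gt0 R _ (fun z : Z => rho2 (oproj z) k + 2^-1 - z None ^+ 2) z) N.
apply: nearbyS (N _); first by move=> v; rewrite subr_gt0.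
apply: anaB; last by apply: anaX; exact: ana_coord.
apply: anaD; last exact: ana_const.
by apply: (@ana_oproj R _ (fun w => rho2 w k)); exact: ana_rho2.
Qed.

Lemma ana_gT k z : gdom k z -> ana (gT k) z.
Proof.
move=> dz; have [ot Et] := gTP dz; have [kn _] := dz.
(* The unknown [t] is the outer [None], the prescribed value of [gY] the coordinate [Some None];
   [sg] forgets the latter. *)
pose sg (o : option 'I_(n + n)) : option (option 'I_(n + n)) := if o is Some i then Some (Some i) else None.
pose F (v : option (option 'I_(n + n)) -> R) := gY k (fun o => v (sg o)) - v (Some None).
have sgE t : (fun o => oext z t (sg o)) = oext (oproj z) t by apply/funext => -[i|].
have aY1 : ana (fun v => gY k (fun o => v (sg o))) (oext z (gT k z)).
  apply: (@ana_comp R _ _ (gY k) (fun o v => v (sg o))); last by move=> j; exact: ana_coord.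
  by rewrite sgE; apply: ana_gY; exact: ogapW.
have [|||Y [aY Y0 Yn _]] := @implicit_function1 R (option 'I_(n + n)) F z (gT k z).
- by apply: anaB => //; exact: ana_coord.
- by rewrite /F sgE Et subrr.
- rewrite /F pdrB//; last exact: ana_coord.
  rewrite pdr_coord /= subr0.
  have -> : pdr None (fun v => gY k (fun o => v (sg o))) (oext z (gT k z)) =
      pdr None (gY k) (oext (oproj z) (gT k z)).
    rewrite /pdr.
    suff -> : (fun h : R => gY k (fun o => shl (oext z (gT k z)) None h (sg o))) =
        (fun h => gY k (shl (oext (oproj z) (gT k z)) None h)) by [].
    by apply/funext => h; congr gY; apply/funext => -[i|].
  by rewrite gt_eqF// pdr_gY_gt0.
apply: ana_near (aY) _.
have N : nearby z (fun v => ogap (oproj v) k (Y v)).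
  have [d d0 Hd] := gap_open ot.
  have [d' d'0 Hd'] := ana_cts aY d0.
  exists (Num.min d d'); first by rewrite lt_min d0.
  move=> v bv; apply: (Hd (oext (oproj v) (Y v))) => -[i|] /=.
    by apply: le_trans (bv (Some i)) _; rewrite ge_min lexx.
  by rewrite -Y0; apply: Hd' => i; apply: le_trans (bv i) _; rewrite ge_min lexx orbT.
apply: nearbyS (nearbyI N (nearbyI Yn (gdom_open dz))) => v [ov [Fv dv]].
have [od Ed] := gTP dv; apply: (gY_inj ov od); rewrite Ed.
have : F (oext v (Y v)) = 0 by exact: Fv.
rewrite /F; have -> : (fun o => oext v (Y v) (sg o)) = oext (oproj v) (Y v) by apply/funext => -[i|].
by move=> /eqP; rewrite subr_eq0 => /eqP.
Qed.

End GapUniformization.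

Section PeriodicMeans.
Variables (R : realType).
Local Notation twopi := (2 * (pi : R)).

Lemma twopi_gt0 : 0 < twopi. Proof. by rewrite mulr_gt0 ?pi_gt0. Qed.

Lemma prim_zero (a b : R) P : a <= b -> prim_on a b (fun=> 0) P -> P a = P b.
Proof.
rewrite le_eqVlt => /orP[/eqP -> //|ab] HP.
by have [c _] := prim_MVT ab HP; rewrite mul0r => /eqP; rewrite subr_eq0 => /eqP.
Qed.

Lemma prim_all (g : R -> R) (M : R) : (forall t : R, {for t, continuous g}) -> 0 < M ->
  exists P, prim_on (- M) M g P.
Proof. by move=> cg M0; apply: prim_ex => [|t _]; [rewrite gtrN|exact: cg]. Qed.

Lemma is_derive_refl_shift (P : R -> R) (m s d t : R) : is_derive (m + s * t) 1 P d ->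
  is_derive t 1 (fun t => P (m + s * t)) (d * s).
Proof.
move=> H; have L : is_derive t 1 (fun t : R => m + s * t) s.
  have := is_deriveD (is_derive_cst m t 1) (is_deriveZ s (is_derive_id t 1)).
  by rewrite /GRing.scale/= mulr1 add0r.
exact: (@is_derive1_comp _ P (fun t : R => m + s * t) t _ _ H L).
Qed.

Lemma NI_shift (g : R -> R) (th : R) : (forall t : R, {for t, continuous g}) ->
  (forall t, g (t + twopi) = g t) ->
  NI 0 twopi (fun t => g (th + t)) = NI 0 twopi g.
Proof.
move=> cg pg; have t0 := twopi_gt0.
pose M := `|th| + 2 * twopi; have M0 : 0 < M by rewrite /M; have := normr_ge0 th; lra.
have [P HP] := prim_all cg M0.
have D t : - M <= t <= M -> is_derive (t : R) 1 P (g t) by exact: HP.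
have := ler_norm th; have := ler_norm (- th); rewrite normrN => n1 n2.
have in1 t : 0 <= t <= twopi -> - M <= t <= M by move=> /andP[a b]; rewrite /M; apply/andP; split; lra.
have in2 t : 0 <= t <= twopi -> - M <= th + t <= M by move=> /andP[a b]; rewrite /M; apply/andP; split; lra.
have H1 : prim_on 0 twopi g P by move=> t /in1; exact: D.
rewrite (NIE t0 H1).
have H2 : prim_on 0 twopi (fun t => g (th + t)) (fun t => P (th + 1 * t)).
  move=> t tt; have := @is_derive_refl_shift P th 1 (g (th + t)) t; rewrite mulr1 mul1r; apply; exact: D (in2 t tt).
rewrite (NIE t0 H2) !mul1r addr0.
pose Q t := P (twopi + 1 * t) - P t.
have Q0 t : - M <= t <= M -> - M <= twopi + 1 * t <= M -> is_derive (t : R) 1 Q 0.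
  move=> h1 h2; have E1 := is_derive_refl_shift (D _ h2).
  apply: (is_derive_eq (is_deriveB E1 (D _ h1))).
  by rewrite mul1r [twopi + t]addrC pg mulr1 subrr.
have QE : Q th = Q 0.
  have [th0|th0] := leP th 0.
    apply: prim_zero => // t /andP[a b]; apply: Q0; rewrite /M; apply/andP; split; lra.
  apply/esym; apply: prim_zero (ltW th0) _ => t /andP[a b]; apply: Q0; rewrite /M; apply/andP; split; lra.
by move: QE; rewrite /Q !mul1r addr0 addrC; rewrite [twopi + th]addrC; lra.
Qed.

(** Reflection preserves the integral over a period, and here it also reverses its sign. *)
Lemma NI_refl0 (g : R -> R) (m : R) : (forall t : R, {for t, continuous g}) ->
  (forall t, g (t + twopi) = g t) -> (forall t, g (m - t) = - g t) -> NI 0 twopi g = 0.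
Proof.
move=> cg pg og; have t0 := twopi_gt0.
have E : NI 0 twopi (fun t => g (m - t)) = - NI 0 twopi g.
  transitivity (NI 0 twopi (fun t => -1 * g t)).
    by apply: NI_eq => t _; rewrite og mulN1r.
  by rewrite NIZ ?mulN1r// => t _; exact: cg.
have E2 : NI 0 twopi (fun t => g (m - t)) = NI 0 twopi g.
  pose h t := g (- t).
  have ch t : {for t, continuous h}.
    by apply: (@continuous_comp _ _ _ (fun t : R => - t) g); [exact: opp_continuous|exact: cg].
  have ph t : h (t + twopi) = h t.
    by rewrite /h -[in RHS](subrK twopi (- t)) pg opprD.
  transitivity (NI 0 twopi h).
    rewrite -(NI_shift (- m) ch ph); apply: NI_eq => t _; rewrite /h; congr g; ring.
  have [P HP] := prim_all cg t0.
  have D t : - twopi <= t <= twopi -> is_derive (t : R) 1 P (g t) by exact: HP.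
  have hD t : 0 <= t <= twopi -> is_derive (t : R) 1 (fun t => - P (0 + (-1) * t)) (h t).
    move=> /andP[a b]; have H : - twopi <= 0 + (-1) * t <= twopi by apply/andP; split; lra.
    have := is_deriveN (is_derive_refl_shift (D _ H)).
    by rewrite mulrN1 opprK add0r mulN1r.
  rewrite (NIE t0 hD) (@NIE _ _ _ _ P t0); last by move=> t /andP[a b]; apply: D; apply/andP; split; lra.
  rewrite !add0r mulr0 mulN1r.
  pose k t := g (- twopi + t).
  have kE : NI 0 twopi k = NI 0 twopi g by exact: NI_shift.
  have kD t : 0 <= t <= twopi -> is_derive (t : R) 1 (fun t => P (- twopi + 1 * t)) (k t).
    move=> /andP[a b]; have H : - twopi <= - twopi + 1 * t <= twopi by apply/andP; split; lra.
    by have := is_derive_refl_shift (D _ H); rewrite mulr1 mul1r.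
  move: kE; rewrite (NIE t0 kD) (@NIE _ _ _ _ P t0); last by move=> t /andP[a b]; apply: D; apply/andP; split; lra.
  rewrite mul1r mulr0 addr0 addNr; lra.
by move: E; rewrite E2; lra.
Qed.

Lemma polar (U V : R) : exists r th, [/\ 0 <= r, U = r * sin th & V = r * cos th].
Proof.
pose r := Num.sqrt (U ^+ 2 + V ^+ 2).
have r2 : r ^+ 2 = U ^+ 2 + V ^+ 2 by rewrite sqr_sqrtr// addr_ge0 ?sqr_ge0.
have r0 : 0 <= r by exact: sqrtr_ge0.
have [r00|rn0] := eqVneq r 0.
  exists 0, 0; move: r2; rewrite r00 expr0n /= => /esym/eqP.
  by rewrite paddr_eq0 ?sqr_ge0// !sqrf_eq0 => /andP[/eqP -> /eqP ->]; rewrite !mul0r.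
have rp : 0 < r by rewrite lt_neqAle eq_sym rn0.
have c1 : -1 <= V / r <= 1.
  rewrite -ler_norml normrM normfV (ger0_norm r0) ler_pdivrMr// mul1r.
  by rewrite -(@ler_pXn2r _ 2) ?nnegrE// real_normK ?num_real// r2 lerDr sqr_ge0.
have Vr : V = r * cos (acos (V / r)) by rewrite acosK// mulrC divfK.
have sE : (r * sin (acos (V / r))) ^+ 2 = U ^+ 2.
  rewrite exprMn sin2cos2 acosK// mulrBr mulr1 expr_div_n mulrCA divff ?expf_neq0// mulr1 r2; ring.
move/eqP: sE; rewrite eqf_sqr => /orP[/eqP E|/eqP E].
  by exists r, (acos (V / r)); split=> //.
by exists r, (- acos (V / r)); rewrite cosN sinN; split=> //; rewrite mulrN E opprK.
Qed.

End PeriodicMeans.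

Section LoopDerivative.
Variables (R : realType) (K : finType).
Local Notation twopi := (2 * (pi : R)).
Implicit Types (f g : (option K -> R) -> R) (y : K -> R).

(* Integration by parts in the second mixed derivative. *)
Lemma pdr_loop f g y k (a b : R) : tube 0 twopi f y -> tube 0 twopi g y ->
  f (oext y twopi) = f (oext y 0) ->
  pdr (Some k) g (oext y twopi) = pdr (Some k) g (oext y 0) ->
  pdr k (fun y => NI 0 twopi (fun s => (a + b * s) * (f (oext y s) * pdr None g (oext y s)))) y =
  NI 0 twopi (fun s => (a + b * s) * (pdr (Some k) f (oext y s) * pdr None g (oext y s) -
                                      pdr None f (oext y s) * pdr (Some k) g (oext y s)))
  + b * twopi * (f (oext y 0) * pdr (Some k) g (oext y 0))
  - b * NI 0 twopi (fun s => f (oext y s) * pdr (Some k) g (oext y s)).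
Proof.
move=> tf tg pf pg; have t0 := twopi_gt0 R.
have tgN := tube_pdr None tg; have tgk := tube_pdr (Some k) tg.
have tfN := tube_pdr None tf; have tfk := tube_pdr (Some k) tf.
pose F (z : option K -> R) := (a + b * z None) * (f z * pdr None g z).
have aw (z : option K -> R) : ana (fun z : option K -> R => a + b * z None) z.
  by apply: anaD; [exact: ana_const|apply: anaZ; exact: ana_coord].
have tF : tube 0 twopi F y.
  by move=> s hs; apply: anaM => //; apply: anaM; [exact: tf|exact: tgN].
have E1 : pdr k (fun y => NI 0 twopi (fun s => (a + b * s) * (f (oext y s) * pdr None g (oext y s)))) y =
  NI 0 twopi (fun s => pdr (Some k) F (oext y s)) := pdr_NI k t0 tF.
rewrite E1.
pose br_ s := (a + b * s) * (pdr (Some k) f (oext y s) * pdr None g (oext y s) -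
                                      pdr None f (oext y s) * pdr (Some k) g (oext y s)).
pose G (z : option K -> R) := (a + b * z None) * (f z * pdr (Some k) g z).
have tfg : tube 0 twopi (fun z => f z * pdr (Some k) g z) y.
  by move=> s hs; apply: anaM; [exact: tf|exact: tgk].
have tG : tube 0 twopi G y.
  by move=> s hs; apply: anaM => //; exact: tfg.
have cfg := tube_cton tfg; have cG' := tube_cton (tube_pdr None tG).
have tbr : tube 0 twopi (fun z => (a + b * z None) * (pdr (Some k) f z * pdr None g z - pdr None f z * pdr (Some k) g z)) y.
  move=> s hs; apply: anaM => //; apply: anaB; apply: anaM; [exact: tfk|exact: tgN|exact: tfN|exact: tgk].
have cbr : cton 0 twopi br_ := tube_cton tbr.
have pw i s : pdr i (fun z : option K -> R => a + b * z None) (oext y s) = b * (None == i)%:R.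
  rewrite pdrD; [|exact: ana_const|by apply: anaZ; exact: ana_coord].
  by rewrite pdr_cst add0r pdrZ ?pdr_coord//; exact: ana_coord.
have pt s : 0 <= s <= twopi -> pdr (Some k) F (oext y s) =
    br_ s + (pdr None G (oext y s) + - b * (f (oext y s) * pdr (Some k) g (oext y s))).
  move=> hs; rewrite /F /G /br_ pdrM//; last by apply: anaM; [exact: tf|exact: tgN].
  rewrite [in RHS]pdrM//; last exact: tfg.
  rewrite !pw /= pdrM; [|exact: tf|exact: tgN].
  rewrite [in RHS]pdrM; [|exact: tf|exact: tgk].
  by rewrite (pdrC (Some k) None (tg s hs)); ring.
rewrite (NI_eq pt) NID//; last by apply: ctonD => //; apply: ctonM => //; exact: cton_const.
rewrite NID//; last by apply: ctonM => //; exact: cton_const.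
rewrite NIZ// -addrA; congr (_ + _); rewrite mulNr; congr (_ - _).
have HG : prim_on 0 twopi (fun s => pdr None G (oext y s)) (fun s => G (oext y s)).
  by move=> s hs; exact: ana_slice (tG s hs).
rewrite (NIE t0 HG) /G /= pf pg.
move: (f _) (pdr _ _ _) => X Y; ring.
Qed.

End LoopDerivative.

Section LogSinh.
Variable (R : realType).
Implicit Types (x y : R).

(** This is [2 arsinh], the inverse of [nu |-> sinh (nu / 2)], which recovers [nu] from the
    coordinate [V]. *)
Definition asnh x : R := 2 * ln (x + Num.sqrt (1 + x ^+ 2)).
Definition dasnh x : R := 2 / Num.sqrt (1 + x ^+ 2).

Lemma sq1_gt0 x : 0 < 1 + x ^+ 2. Proof. by rewrite ltr_pwDl ?sqr_ge0. Qed.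

Lemma asnh_arg x : 0 < x + Num.sqrt (1 + x ^+ 2).
Proof.
have s0 : 0 <= Num.sqrt (1 + x ^+ 2) by exact: sqrtr_ge0.
have E : Num.sqrt (1 + x ^+ 2) ^+ 2 = 1 + x ^+ 2 by rewrite sqr_sqrtr ?ltW ?sq1_gt0.
rewrite ltNge; apply/negP => H; nra.
Qed.

Lemma ana_asnh (I : finType) f (v : I -> R) : ana f v -> ana (fun v => asnh (f v)) v.
Proof.
move=> af; apply: anaZ; apply: ana_ln; last exact: asnh_arg.
apply: anaD => //; apply: ana_sqrt; last exact: sq1_gt0.
by apply: anaD; [exact: ana_const|exact: anaX].
Qed.

Lemma ana_dasnh (I : finType) f (v : I -> R) : ana f v -> ana (fun v => dasnh (f v)) v.
Proof.
move=> af; apply: ana_div; [exact: ana_const| |by rewrite gt_eqF// sqrtr_gt0 sq1_gt0].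
apply: ana_sqrt; last exact: sq1_gt0.
by apply: anaD; [exact: ana_const|exact: anaX].
Qed.

Lemma dasnh_gt0 x : 0 < dasnh x.
Proof. by rewrite divr_gt0// sqrtr_gt0 sq1_gt0. Qed.

Lemma is_derive_asnh x : is_derive x 1 asnh (dasnh x).
Proof.
have s0 : 0 < Num.sqrt (1 + x ^+ 2) by rewrite sqrtr_gt0 sq1_gt0.
have D1 : is_derive x 1 (fun y : R => 1 + y ^+ 2) (2 * x).
  have := is_deriveD (is_derive_cst (1:R) x 1) (is_deriveM (is_derive_id x 1) (is_derive_id x 1)).
  rewrite /GRing.scale/= mulr1 add0r => H; rewrite mulr_natl mulr2n; exact: H.
have Es : Num.sqrt (1 + x ^+ 2) ^+ 2 = 1 + x ^+ 2 by rewrite sqr_sqrtr ?ltW ?sq1_gt0.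
have D2 := @is_derive1_comp _ Num.sqrt (fun y : R => 1 + y ^+ 2) x _ _ (is_derive1_sqrt (sq1_gt0 x)) D1.
have D3 := is_deriveD (is_derive_id x 1) D2.
have D4 := @is_derive1_comp _ (@ln R) (fun y : R => y + Num.sqrt (1 + y ^+ 2)) x _ _ (is_derive1_ln (asnh_arg x)) D3.
have D5 := is_deriveZ 2 D4; apply: (is_derive_eq D5).
rewrite /GRing.scale/= /dasnh.
have a0 := asnh_arg x; move: (Num.sqrt (1 + x ^+ 2)) s0 a0 => s s0 a0.
by field; rewrite !gt_eqF.
Qed.

Lemma asnhN x : asnh (- x) = - asnh x.
Proof.
rewrite /asnh sqrrN -mulrN -lnV; last exact: asnh_arg.
have a0 := asnh_arg x.
congr (2 * ln _); apply: (mulfI (lt0r_neq0 a0)); rewrite mulfV ?gt_eqF//.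
have Es : Num.sqrt (1 + x ^+ 2) ^+ 2 = 1 + x ^+ 2 by rewrite sqr_sqrtr ?ltW ?sq1_gt0.
transitivity (Num.sqrt (1 + x ^+ 2) ^+ 2 - x ^+ 2); first by ring.
by rewrite Es; ring.
Qed.

Lemma asnh_sinh x : asnh ((expR (x / 2) - expR (- (x / 2))) / 2) = x.
Proof.
have e0 := expR_gt0 (x / 2); have e1 := expR_gt0 (- (x / 2)).
have e2 : expR (x / 2) * expR (- (x / 2)) = 1 by rewrite -expRD subrr expR0.
rewrite /asnh.
have -> : 1 + ((expR (x / 2) - expR (- (x / 2))) / 2) ^+ 2 = ((expR (x / 2) + expR (- (x / 2))) / 2) ^+ 2.
  by rewrite -{1}e2; move: (expR _) (expR _) => a b; field.
rewrite sqrtr_sqr ger0_norm; last by rewrite divr_ge0// addr_ge0// ltW.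
have -> : (expR (x / 2) - expR (- (x / 2))) / 2 + (expR (x / 2) + expR (- (x / 2))) / 2 = expR (x / 2) by field.
by rewrite expRK; field.
Qed.

Lemma asnh_ge0 x : 0 <= x -> 0 <= asnh x.
Proof.
move=> x0; rewrite /asnh mulr_ge0// ln_ge0//.
have : 1 <= Num.sqrt (1 + x ^+ 2).
  by rewrite -[X in X <= _]sqrtr1 ler_wsqrtr// lerDl sqr_ge0.
lra.
Qed.

Lemma asnh_ge1 x : 1 <= x ^+ 2 -> 0 <= x -> 1 <= asnh x.
Proof.
move=> x1 x0; rewrite /asnh.
have s0 : 0 <= Num.sqrt (1 + x ^+ 2) by exact: sqrtr_ge0.
have Es : Num.sqrt (1 + x ^+ 2) ^+ 2 = 1 + x ^+ 2 by rewrite sqr_sqrtr ?ltW ?sq1_gt0.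
suff : expR (1 / 2) <= x + Num.sqrt (1 + x ^+ 2).
  move=> H; have : 1 / 2 <= ln (x + Num.sqrt (1 + x ^+ 2)).
    by rewrite -[X in X <= _]expRK ler_ln ?posrE ?expR_gt0 ?asnh_arg.
  lra.
have E2 : expR (1 / 2 : R) <= 2.
  have := expR_ge1Dx (- (1 / 2) : R); rewrite expRN => H.
  have e0 := expR_gt0 (1 / 2 : R).
  rewrite -(ler_pM2r (x := (expR (1 / 2))^-1)) ?invr_gt0// mulfV ?gt_eqF//; lra.
have s1 : 1 <= Num.sqrt (1 + x ^+ 2).
  by rewrite -[X in X <= _]sqrtr1 ler_wsqrtr// lerDl sqr_ge0.
have x1' : 1 <= x by rewrite -(@ler_pXn2r _ 2) ?nnegrE// expr1n.
by apply: le_trans E2 _; lra.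
Qed.

End LogSinh.

Section GapFunctions.
Variables (R : realType) (n : nat).
Local Notation P := ('I_(n + n) -> R).
Local Notation Z := (option 'I_(n + n) -> R).
Local Notation e_ := (eps R n).
Implicit Types (f g : P -> R) (w : P) (z : Z).

Lemma pdr_oproj (I : finType) (f : (I -> R) -> R) (v : option I -> R) i :
  pdr (Some i) (fun u => f (oproj u)) v = pdr i f (oproj v).
Proof.
rewrite /pdr; suff -> : (fun t => f (oproj (shl v (Some i) t))) = (fun t => f (shl (oproj v) i t)) by [].
by apply/funext => t; congr f; apply/funext => k.
Qed.

Lemma pdr_oprojN (I : finType) (f : (I -> R) -> R) (v : option I -> R) :
  pdr None (fun u => f (oproj u)) v = 0.
Proof.
by apply: pdr_const_line => t; congr f; apply/funext => k; rewrite /oproj /shl /= mulr0 addr0.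
Qed.

(* The spectral parameter [x = sqrt t] on the gap, as a function of [gY k]. *)
Definition gs k z := Num.sqrt (gT k z).
Definition gL k z := pdr None (gs k) z.

Lemma gT_gt0 k z : gdom k z -> 0 < gT k z.
Proof.
move=> dz; have [[kn /andP[H _]] _] := gTP dz; apply: lt_trans H; exact: gr_gt0 (ltnW kn).
Qed.

Lemma gs_gt0 k z : gdom k z -> 0 < gs k z.
Proof. by move=> dz; rewrite sqrtr_gt0 gT_gt0. Qed.

Lemma gs_sqr k z : gdom k z -> gs k z ^+ 2 = gT k z.
Proof. by move=> dz; rewrite sqr_sqrtr// ltW// gT_gt0. Qed.

Lemma ana_gs k z : gdom k z -> ana (gs k) z.
Proof. by move=> dz; apply: ana_sqrt; [exact: ana_gT|exact: gT_gt0]. Qed.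

Lemma gs_disc k z : gdom k z ->
  4 * (rho2 (oproj z) k - z None ^+ 2) + 2 = e_ k * (pD (oproj z)).[gs k z ^+ 2].
Proof.
move=> dz; have [ot Et] := gTP dz; rewrite gs_sqr//.
have := gY_sqr (ogapW ot); rewrite Et /rho2; lra.
Qed.

Lemma pdr_gT_gt0 k z : gdom k z -> 0 < pdr None (gT k) z.
Proof.
move=> dz; have [ot Et] := gTP dz.
have aY := ana_gY (ogapW ot); have aT := ana_gT dz.
have ac i : ana (fun z : Z => oproj z i) z by exact: ana_coord.
have E1 : pdr None (fun z => gY k (oext (fun i => oproj z i) (gT k z))) z = 1.
  have : pdr None (fun z : Z => z None) z = 1 by rewrite pdr_coord eqxx.
  move=> <-; apply: pdr_near; first exact: ana_coord.
  by apply: nearbyS (gdom_open dz) => v /gTP[_ ->].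
move: E1; rewrite (@pdr_osub R _ _ (gY k) (fun i z => oproj z i) (gT k) z None aY ac aT).
rewrite [X in _ + X]big1 ?addr0; last by move=> i _; rewrite [pdr None _ z](pdr_coord z None (Some i)) mulr0.
have p0 := pdr_gY_gt0 ot => E.
by rewrite -(pmulr_rgt0 _ p0) E.
Qed.

Lemma gL_gt0 k z : gdom k z -> 0 < gL k z.
Proof.
move=> dz; have as_ := ana_gs dz; have s0 := gs_gt0 dz.
have : pdr None (fun z => gs k z * gs k z) z = pdr None (gT k) z.
  apply: pdr_near; first exact: ana_gT.
  by apply: nearbyS (gdom_open dz) => v dv; rewrite -gs_sqr// expr2.
rewrite pdrM// -/(gL k z) => E.
have := pdr_gT_gt0 dz; rewrite -E mulrC -mulr2n -mulr_natl => H.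
by move: H; rewrite pmulr_rgt0 ?ltr0n// pmulr_rgt0.
Qed.

Lemma ana_gL k z : gdom k z -> ana (gL k) z.
Proof. by move=> dz; apply: ana_pdr; exact: ana_gs. Qed.

(** The constant term of [D] is fixed by [pD0] and its leading coefficient is 1, so for [j < n]
    these are all the coefficients that vary with [w]. *)
Definition hc w (j : nat) := (pD w)`_j.+1.

Lemma ana_hc j w : ana (fun w => hc w j) w.
Proof. exact: polyana_pD. Qed.

Lemma pdr_pD i t w : pdr i (fun w => (pD w).[t]) w = \sum_(j < n) pdr i (fun w => hc w j) w * t ^+ j.+1.
Proof.
have aj j : ana (fun w => t ^+ j * (pD w)`_j) w by apply: anaZ; exact: polyana_pD.
transitivity (pdr i (fun w => \sum_(j < n.+2) t ^+ j * (pD w)`_j) w).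
  apply: pdr_ext => v; rewrite (horner_coef_wide _ (n := n.+2)) ?pD_size//.
  by apply: eq_bigr => j _; rewrite mulrC.
rewrite pdr_sum; last by move=> j _; exact: aj.
rewrite big_ord_recl big_ord_recr /=.
have cst0 j (c : R) : (forall v : P, (pD v)`_j = c) -> pdr i (fun w => t ^+ j * (pD w)`_j) w = 0.
  move=> H; have -> : (fun w => t ^+ j * (pD w)`_j) = fun=> t ^+ j * c by apply/funext => v; rewrite H.
  exact: pdr_cst.
rewrite (cst0 0%N (2 * (-1) ^+ n.+1)); last by move=> v; rewrite -horner_coef0 pD0.
rewrite add0r [X in _ + X](cst0 n.+1 1); last first.
  by move=> v; have /monicP := pD_monic v; rewrite /lead_coef pD_size.
rewrite addr0; apply: eq_bigr => j _.
rewrite -[bump 0 j]/(j.+1) (@pdrZ R _ (t ^+ j.+1) (fun w => hc w j)); first exact: mulrC.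
exact: ana_hc.
Qed.

(* Differentiate [gs_disc] and eliminate [D']. *)
Lemma gap_relation k z i : gdom k z ->
  gL k z * (2^-1 * pdr i (fun w => rho2 w k) (oproj z)) + z None * pdr (Some i) (gs k) z =
  (e_ k / 8) * (gL k z * \sum_(j < n) pdr i (fun w => hc w j) (oproj z) * gT k z ^+ j.+1).
Proof.
move=> dz; have [kn _] := dz; have as_ := ana_gs dz; have as2 : ana (fun z => gs k z ^+ 2) z by exact: anaX.
have aP : polyana (fun z : Z => pD (oproj z)) z.
  by move=> j; apply: (@ana_oproj R _ (fun w => (pD w)`_j)); exact: polyana_pD.
have sP (v : Z) : (size (pD (oproj v)) <= n.+2)%N by rewrite pD_size.
have arho : ana (fun z : Z => rho2 (oproj z) k) z.
  by apply: (@ana_oproj R _ (fun w => rho2 w k)); exact: ana_rho2.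
have aN : ana (fun z : Z => z None) z by exact: ana_coord.
have aN2 : ana (fun z : Z => z None * z None) z by exact: anaM.
have E o : pdr o (fun z : Z => 4 * (rho2 (oproj z) k - z None * z None)) z =
  e_ k * pdr o (fun z => (pD (oproj z)).[gs k z ^+ 2]) z.
  rewrite -pdrZ; last exact: ana_horner_at aP sP as2.
  transitivity (pdr o (fun z : Z => 4 * (rho2 (oproj z) k - z None * z None) + 2) z).
    rewrite [RHS]pdrD ?pdr_cst ?addr0//; last exact: ana_const.
    by apply: anaZ; exact: anaB.
  apply/esym/pdr_near.
    by apply: anaD; [apply: anaZ; exact: anaB|exact: ana_const].
  by apply: nearbyS (gdom_open dz) => v dv; rewrite -gs_disc// expr2.
have L o : pdr o (fun z : Z => 4 * (rho2 (oproj z) k - z None * z None)) z =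
   4 * (pdr o (fun z : Z => rho2 (oproj z) k) z - 2 * (pdr o (fun z : Z => z None) z * z None)).
  rewrite pdrZ; last exact: anaB.
  by rewrite pdrB// pdrM//; ring.
have Rr o : pdr o (fun z => (pD (oproj z)).[gs k z ^+ 2]) z =
   pdr o (fun v : Z => (pD (oproj v)).[gs k z ^+ 2]) z + (pD (oproj z))^`().[gs k z ^+ 2] * (2 * (pdr o (gs k) z * gs k z)).
  rewrite (pdr_horner_at o aP sP as2); congr (_ + _ * _).
  rewrite (pdr_ext (g := fun z => gs k z * gs k z)); last by move=> v; rewrite expr2.
  by rewrite pdrM//; ring.
have := E None; have := E (Some i); rewrite !L !Rr.
rewrite !pdr_coord eqxx /= (pdr_oprojN (fun w => rho2 w k)) (pdr_oproj (fun w => rho2 w k)).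
rewrite (pdr_oprojN (fun w => (pD w).[gs k z ^+ 2])) (pdr_oproj (fun w => (pD w).[gs k z ^+ 2])).
rewrite pdr_pD -/(gL k z) -gs_sqr//.
set S := \sum_(j < n) _; set Dp := (pD _)^`().[_]; move: (pdr i _ (oproj z)) (pdr (Some i) (gs k) z) (gL k z) (gs k z) (z None).
move=> r l L_ s U E1 E2.
have E1' : 4 * r = e_ k * S + e_ k * Dp * 2 * (l * s) by rewrite -[RHS]/(_ + _); move: E1; rewrite mul0r mulr0 subr0 => ->; ring.
have E2' : - (8 * U) = e_ k * Dp * 2 * (L_ * s) by move: E2; rewrite mul1r sub0r add0r => H; transitivity (4 * - (2 * U)); [ring|rewrite H; ring].
apply: (@mulfI _ 8); first by rewrite pnatr_eq0.
transitivity (L_ * (4 * r) - - (8 * U) * l); first by field.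
by rewrite E1' E2'; field.
Qed.

End GapFunctions.

(** * Rotation loops and their derivatives *)

Section RotationLoop.
Variables (R : realType) (n : nat) (K : finType) (k : nat).
Local Notation Z := (option 'I_(n + n) -> R).
Variables (gw : 'I_(n + n) -> (K -> R) -> R) (U V : (K -> R) -> R).
Implicit Types (v : option K -> R) (y : K -> R).

(** The base space [K] and the maps [gw], [U], [V] are kept general because the loop is used twice:
    over the phase space itself, and over the one-point index [unit] for the scaled loops
    [(t U, t V)] at a fixed point. *)
Definition lU v := U (oproj v) * cos (v None) + V (oproj v) * sin (v None).
Definition lV v := V (oproj v) * cos (v None) - U (oproj v) * sin (v None).
Definition lf v := asnh (lV v).
Definition lz v : Z := oext (fun i => gw i (oproj v)) (lU v).
Definition lg v := gs k (lz v).

Lemma lUV v : lU v ^+ 2 + lV v ^+ 2 = U (oproj v) ^+ 2 + V (oproj v) ^+ 2.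
Proof.
rewrite /lU /lV; have := cos2Dsin2 (v None).
move: (cos _) (sin _) (U _) (V _) => c s u u' H.
by transitivity ((u ^+ 2 + u' ^+ 2) * (c ^+ 2 + s ^+ 2)); [ring|rewrite H mulr1].
Qed.

Section AtPoint.
Variable (y : K -> R).
Hypothesis kn : (k < n)%N.
Hypothesis aw : forall i, ana (gw i) y.
Hypothesis aU : ana U y.
Hypothesis aV : ana V y.
Hypothesis UV : U y ^+ 2 + V y ^+ 2 < rho2 (fun i => gw i y) k + 2^-1.

Lemma ldom s : gdom k (lz (oext y s)).
Proof.
split=> //; apply: le_lt_trans UV; have := lUV (oext y s); rewrite -[oproj (oext y s)]/y => <-.
by rewrite lerDl sqr_ge0.
Qed.

Let aUo s : ana (fun v : option K -> R => U (oproj v)) (oext y s).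
Proof. exact: ana_oproj. Qed.
Let aVo s : ana (fun v : option K -> R => V (oproj v)) (oext y s).
Proof. exact: ana_oproj. Qed.
Let ac s : ana (fun v : option K -> R => cos (v None)) (oext y s).
Proof. by apply: ana_cos; exact: ana_coord. Qed.
Let as_ s : ana (fun v : option K -> R => sin (v None)) (oext y s).
Proof. by apply: ana_sin; exact: ana_coord. Qed.

Lemma ana_lU s : ana lU (oext y s).
Proof. by apply: anaD; exact: anaM. Qed.

Lemma ana_lV s : ana lV (oext y s).
Proof. by apply: anaB; exact: anaM. Qed.

Lemma ana_lf s : ana lf (oext y s).
Proof. by apply: ana_asnh; exact: ana_lV. Qed.

Lemma ana_lz F s : ana F (lz (oext y s)) -> ana (fun v => F (lz v)) (oext y s).
Proof.
move=> aF; apply: (@ana_osub R _ _ F (fun i v => gw i (oproj v)) lU) => //.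
  by move=> i; exact: ana_oproj.
exact: ana_lU.
Qed.

Lemma ana_lg s : ana lg (oext y s).
Proof. by apply: ana_lz; apply: ana_gs; exact: ldom. Qed.

Lemma pdr_cosN o s : pdr o (fun v : option K -> R => cos (v None)) (oext y s) = - sin s * (None == o)%:R.
Proof.
have aN : ana (fun v : option K -> R => v None) (oext y s) by exact: ana_coord.
by rewrite (pdr_comp1 o (is_derive_cos s) aN) pdr_coord.
Qed.

Lemma pdr_sinN o s : pdr o (fun v : option K -> R => sin (v None)) (oext y s) = cos s * (None == o)%:R.
Proof.
have aN : ana (fun v : option K -> R => v None) (oext y s) by exact: ana_coord.
by rewrite (pdr_comp1 o (is_derive_sin s) aN) pdr_coord.
Qed.

Lemma pdr_lU i s : pdr (Some i) lU (oext y s) = pdr i U y * cos s + pdr i V y * sin s.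
Proof.
rewrite pdrD; [|exact: anaM|exact: anaM].
rewrite pdrM// pdrM// pdr_cosN pdr_sinN /= !mulr0 !addr0.
by rewrite (pdr_oproj U) (pdr_oproj V).
Qed.

Lemma pdr_lV i s : pdr (Some i) lV (oext y s) = pdr i V y * cos s - pdr i U y * sin s.
Proof.
rewrite pdrB; [|exact: anaM|exact: anaM].
rewrite pdrM// pdrM// pdr_cosN pdr_sinN /= !mulr0 !addr0.
by rewrite (pdr_oproj U) (pdr_oproj V).
Qed.

Lemma pdr_lUN s : pdr None lU (oext y s) = lV (oext y s).
Proof.
rewrite pdrD; [|exact: anaM|exact: anaM].
rewrite pdrM// pdrM// pdr_cosN pdr_sinN /= (pdr_oprojN U) (pdr_oprojN V) !mul0r !add0r !mulr1.
by rewrite /lV /=; ring.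
Qed.

Lemma pdr_lVN s : pdr None lV (oext y s) = - lU (oext y s).
Proof.
rewrite pdrB; [|exact: anaM|exact: anaM].
rewrite pdrM// pdrM// pdr_cosN pdr_sinN /= (pdr_oprojN U) (pdr_oprojN V) !mul0r !add0r !mulr1.
by rewrite /lU /=; ring.
Qed.

Lemma pdr_lf o s : pdr o lf (oext y s) = dasnh (lV (oext y s)) * pdr o lV (oext y s).
Proof. exact: (pdr_comp1 o (is_derive_asnh _) (ana_lV s)). Qed.

Lemma pdr_lgN s : pdr None lg (oext y s) = gL k (lz (oext y s)) * lV (oext y s).
Proof.
have awo i : ana (fun v : option K -> R => gw i (oproj v)) (oext y s) by exact: ana_oproj.
rewrite (@pdr_osub R _ _ (gs k) (fun i v => gw i (oproj v)) lU _ None (ana_gs (ldom s)) awo (ana_lU s)).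
rewrite pdr_lUN big1 ?addr0// => i _.
by rewrite (pdr_oprojN (gw i)) mulr0.
Qed.

Lemma pdr_lg i s : pdr (Some i) lg (oext y s) =
  gL k (lz (oext y s)) * (pdr i U y * cos s + pdr i V y * sin s) +
  \sum_j pdr (Some j) (gs k) (lz (oext y s)) * pdr i (gw j) y.
Proof.
have awo j : ana (fun v : option K -> R => gw j (oproj v)) (oext y s) by exact: ana_oproj.
rewrite (@pdr_osub R _ _ (gs k) (fun i v => gw i (oproj v)) lU _ (Some i) (ana_gs (ldom s)) awo (ana_lU s)).
by rewrite pdr_lU; congr (_ + _); apply: eq_bigr.
Qed.

(** The trigonometric factors recombine by [cos^2 + sin^2 = 1], because rotations are isometries:
    what remains of the motion of [(U, V)] is half the derivative of its squared radius. *)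
Lemma loop_bracket i s :
  pdr (Some i) lf (oext y s) * pdr None lg (oext y s) - pdr None lf (oext y s) * pdr (Some i) lg (oext y s) =
  dasnh (lV (oext y s)) * (gL k (lz (oext y s)) * (U y * pdr i U y + V y * pdr i V y) +
    lU (oext y s) * \sum_j pdr (Some j) (gs k) (lz (oext y s)) * pdr i (gw j) y).
Proof.
rewrite !pdr_lf pdr_lgN pdr_lg pdr_lVN pdr_lV.
set S := \sum_j _; have := cos2Dsin2 s.
rewrite /lU /lV -[oproj _]/y /=.
set d0 := dasnh _; set l0 := gL k _.
move: d0 l0 (cos s) (sin s) (U y) (V y) (pdr i U y) (pdr i V y) => d l c t u u' du du' H.
transitivity (d * (l * ((u * du + u' * du') * (c ^+ 2 + t ^+ 2)) + (u * c + u' * t) * S)); first by ring.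
by rewrite H mulr1.
Qed.

Lemma lz_per : lz (oext y (2 * pi)) = lz (oext y 0).
Proof.
by rewrite /lz /lU /= cos0 sin0 -[2 * pi]add0r mulr_natl cosD2pi cos0 sinD2pi sin0.
Qed.

Lemma lf_per : lf (oext y (2 * pi)) = lf (oext y 0).
Proof. by rewrite /lf /lV /= cos0 sin0 -[2 * pi]add0r mulr_natl cosD2pi cos0 sinD2pi sin0. Qed.

Lemma pdr_lg_per i : pdr (Some i) lg (oext y (2 * pi)) = pdr (Some i) lg (oext y 0).
Proof. by rewrite !pdr_lg lz_per cos0 sin0 -[2 * pi]add0r mulr_natl cosD2pi cos0 sinD2pi sin0. Qed.

Lemma tube_lf : tube 0 (2 * pi) lf y.
Proof. by move=> s _; exact: ana_lf. Qed.

Lemma tube_lg : tube 0 (2 * pi) lg y.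
Proof. by move=> s _; exact: ana_lg. Qed.

Lemma pdr_loop_lfg i (a b : R) :
  pdr i (fun y => NI 0 (2 * pi) (fun s => (a + b * s) * (lf (oext y s) * pdr None lg (oext y s)))) y =
  NI 0 (2 * pi) (fun s => (a + b * s) * (dasnh (lV (oext y s)) * (gL k (lz (oext y s)) * (U y * pdr i U y + V y * pdr i V y) +
    lU (oext y s) * \sum_j pdr (Some j) (gs k) (lz (oext y s)) * pdr i (gw j) y)))
  + b * (2 * pi) * (lf (oext y 0) * pdr (Some i) lg (oext y 0))
  - b * NI 0 (2 * pi) (fun s => lf (oext y s) * pdr (Some i) lg (oext y s)).
Proof.
rewrite (pdr_loop (k := i) a b tube_lf tube_lg lf_per (pdr_lg_per i)); congr (_ + _ - _).
by apply: NI_eq => s _; rewrite loop_bracket.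
Qed.

Lemma ana_loop_lfg (a b : R) :
  ana (fun y => NI 0 (2 * pi) (fun s => (a + b * s) * (lf (oext y s) * pdr None lg (oext y s)))) y.
Proof.
have t0 := twopi_gt0 R.
pose F v := (a + b * v None) * (lf v * pdr None lg v).
have tF : tube 0 (2 * pi) F y.
  move=> s hs; apply: anaM; last by apply: anaM; [exact: ana_lf|apply: ana_pdr; exact: ana_lg].
  by apply: anaD; [exact: ana_const|apply: anaZ; exact: ana_coord].
exact: (ana_NI t0 tF).
Qed.

End AtPoint.

End RotationLoop.

Section GapCoordinates.
Variables (R : realType) (n : nat).
Local Notation P := ('I_(n + n) -> R).
Local Notation Z := (option 'I_(n + n) -> R).
Implicit Types (w : P) (z : Z).

Definition Uf k w := gY k (oext w (lam w k ^+ 2)).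
Definition Vf k w := (expR (nu w k / 2) - expR (- (nu w k / 2))) / 2.

Lemma lam_gap w k : (k < n)%N -> ogap w k (lam w k ^+ 2).
Proof. by move=> kn; split=> //; have [_ + _] := grP w; apply. Qed.

Lemma ana_Uf k w : (k < n)%N -> ana (Uf k) w.
Proof.
move=> kn; apply: (@ana_osub R _ _ (gY k) (fun i w => w i) (fun w => lam w k ^+ 2)).
- by apply: ana_gY; apply: ogapW; exact: lam_gap.
- by move=> i; exact: ana_coord.
- by apply: anaX; exact: ana_lam.
Qed.

Lemma ana_Vf k w : (k < n)%N -> ana (Vf k) w.
Proof.
move=> kn; apply: anaM; last exact: ana_const.
have an : ana (fun w => nu w k / 2) w by apply: anaM; [exact: ana_nu|exact: ana_const].
by apply: anaB; apply: ana_expR => //; exact: anaN.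
Qed.

(** Compare the square relation of [gY] at [t = lam^2] with [eps k * D(lam^2) = e^nu + e^(- nu)],
    which is [2 + 4 Vf ^+ 2]. *)
Lemma UV_rho k w : (k < n)%N -> Uf k w ^+ 2 + Vf k w ^+ 2 = rho2 w k.
Proof.
move=> kn; have H := gY_sqr (ogapW (lam_gap w kn)); rewrite pD_lam// -/(Uf k w) in H.
have b0 := bet_gt0 w kn.
have E1 : expR (nu w k / 2) * expR (- (nu w k / 2)) = 1 by rewrite -expRD subrr expR0.
have E2 : expR (nu w k / 2) ^+ 2 = bet w k.
  by rewrite expr2 -expRD (_ : nu w k / 2 + nu w k / 2 = nu w k) ?lnK//; field.
have E3 : expR (- (nu w k / 2)) ^+ 2 = (bet w k)^-1.
  apply: (mulfI (lt0r_neq0 b0)); rewrite mulfV ?gt_eqF// -E2 -exprMn E1 expr1n//.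
have E4 : 4 * Vf k w ^+ 2 = bet w k + (bet w k)^-1 - 2.
  rewrite -E3 -E2 /Vf; move: E1; move: (expR _) (expR _) => a b ab.
  transitivity (a ^+ 2 + b ^+ 2 - 2 * (b * a)); first by field.
  by rewrite ab mulr1 [a ^+ 2 + _]addrC.
by rewrite /rho2; lra.
Qed.

Lemma rho2_ge0 k w : (k < n)%N -> 0 <= rho2 w k.
Proof. by move=> kn; rewrite -UV_rho// addr_ge0 ?sqr_ge0. Qed.

Lemma gs_lam k w : (k < n)%N -> gs k (oext w (Uf k w)) = lam w k.
Proof.
move=> kn; have [_ E] := gT_uniq (lam_gap w kn).
by rewrite /gs E sqrtr_sqr ger0_norm// ltW// lam_gt0.
Qed.

Lemma asnh_Vf k w : asnh (Vf k w) = nu w k.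
Proof. exact: asnh_sinh. Qed.

End GapCoordinates.

Section LoopMeans.
Variables (R : realType) (n : nat).
Local Notation P := ('I_(n + n) -> R).
Local Notation Z := (option 'I_(n + n) -> R).
Local Notation e_ := (eps R n).
Local Notation twopi := (2 * (pi : R)).
Implicit Types (w : P) (z v : Z).

Definition cw (i : 'I_(n + n)) w : R := w i.
Definition wU k v := lU (Uf k) (Vf k) v.
Definition wV k v := lV (Uf k) (Vf k) v.
Definition wz k v := lz cw (Uf k) (Vf k) v.
Definition wf k v := lf (Uf k) (Vf k) v.
Definition wg k v := lg k cw (Uf k) (Vf k) v.

Lemma sum_delta (I : finType) (F : I -> R) i : \sum_j F j * (j == i)%:R = F i.
Proof.
rewrite (bigD1 i)//= eqxx mulr1 big1 ?addr0// => j /negbTE ->.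
by rewrite mulr0.
Qed.

Lemma acw w i : ana (cw i) w. Proof. exact: ana_coord. Qed.

Lemma UV_lt k w : (k < n)%N -> Uf k w ^+ 2 + Vf k w ^+ 2 < rho2 (fun i => cw i w) k + 2^-1.
Proof. by move=> kn; rewrite UV_rho// ltrDl invr_gt0. Qed.

Lemma wdom k w s : (k < n)%N -> gdom k (wz k (oext w s)).
Proof. by move=> kn; apply: (@ldom R n _ k cw (Uf k) (Vf k) w kn); exact: UV_lt. Qed.

(** The density along the loop of the derivative of the action with respect to [hc j]. Its shape,
    including the factor [1/8], comes from [gap_relation]. *)
Definition phi k j v := (e_ k / 8) * (dasnh (wV k v) * (gL k (wz k v) * gT k (wz k v) ^+ j.+1)).

Lemma ana_wF k F w s : (k < n)%N -> ana F (wz k (oext w s)) -> ana (fun v => F (wz k v)) (oext w s).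
Proof.
move=> kn aF; apply: (@ana_lz R n _ cw (Uf k) (Vf k) w) => //.
- exact: acw.
- exact: ana_Uf.
- exact: ana_Vf.
Qed.

Lemma ana_wV k w s : (k < n)%N -> ana (wV k) (oext w s).
Proof. by move=> kn; apply: ana_lV; [exact: ana_Uf|exact: ana_Vf]. Qed.

Lemma ana_wU k w s : (k < n)%N -> ana (wU k) (oext w s).
Proof. by move=> kn; apply: ana_lU; [exact: ana_Uf|exact: ana_Vf]. Qed.

Lemma ana_wf k w s : (k < n)%N -> ana (wf k) (oext w s).
Proof. by move=> kn; apply: ana_lf; [exact: ana_Uf|exact: ana_Vf]. Qed.

Lemma ana_wg k w s : (k < n)%N -> ana (wg k) (oext w s).
Proof. by move=> kn; apply: ana_wF => //; apply: ana_gs; exact: wdom. Qed.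

Lemma ana_phi k j w s : (k < n)%N -> ana (phi k j) (oext w s).
Proof.
move=> kn; apply: anaZ; apply: anaM; first by apply: ana_dasnh; exact: ana_wV.
apply: anaM; first by apply: ana_wF => //; apply: ana_gL; exact: wdom.
by apply: anaX; apply: ana_wF => //; apply: ana_gT; exact: wdom.
Qed.

Lemma tube_phi k j w : (k < n)%N -> tube 0 twopi (phi k j) w.
Proof. by move=> kn s _; exact: ana_phi. Qed.

(** The derivative of the radius and that of the base point enter in exactly the combination of
    [gap_relation], so the loop bracket sees the variation of [w] only through the coefficients of
    [D]. *)
Lemma loop_phi k i w s : (k < n)%N ->
  dasnh (wV k (oext w s)) * (gL k (wz k (oext w s)) * (Uf k w * pdr i (Uf k) w + Vf k w * pdr i (Vf k) w) +
    wU k (oext w s) * \sum_j pdr (Some j) (gs k) (wz k (oext w s)) * pdr i (cw j) w) =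
  \sum_(j < n) pdr i (fun w => hc w j) w * phi k j (oext w s).
Proof.
move=> kn; have dz := wdom w s kn.
have E1 : Uf k w * pdr i (Uf k) w + Vf k w * pdr i (Vf k) w = 2^-1 * pdr i (fun w => rho2 w k) w.
  have aU := ana_Uf w kn; have aV := ana_Vf w kn.
  rewrite (pdr_ext (f := fun w => rho2 w k) (g := fun w => Uf k w * Uf k w + Vf k w * Vf k w)); last first.
    by move=> u; rewrite -!expr2 UV_rho.
  rewrite pdrD; [|exact: anaM|exact: anaM].
  rewrite (pdrM i aU aU) (pdrM i aV aV).
  move: (Uf k w) (Vf k w) (pdr i (Uf k) w) (pdr i (Vf k) w) => a b c d; by field.
have E2 : \sum_j pdr (Some j) (gs k) (wz k (oext w s)) * pdr i (cw j) w = pdr (Some i) (gs k) (wz k (oext w s)).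
  have pc j : pdr i (cw j) w = (j == i)%:R by exact: pdr_coord.
  rewrite -(sum_delta (fun j => pdr (Some j) (gs k) (wz k (oext w s))) i).
  by apply: eq_bigr => j _; rewrite pc.
rewrite E1 E2; have := gap_relation i dz; rewrite -[oproj _]/w -[wz k _ None]/(wU k (oext w s)) => ->.
rewrite !mulr_sumr; apply: eq_bigr => j _; rewrite /phi.
move: (dasnh _) (gL _ _) (gT _ _ ^+ _) (pdr _ _ _) => a b c d; ring.
Qed.

Definition mean (f : R -> R) : R := twopi^-1 * NI 0 twopi f.

Definition acn k w := mean (fun s => wf k (oext w s) * pdr None (wg k) (oext w s)).
Definition Am k j w := mean (fun s => phi k j (oext w s)).
(** The weight grows by [2 pi] along the loop, which produces the boundary term in [pdr_gen]. The
    offset [- pi] only normalizes the angles: another constant would shift every [om k] by the same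
    amount, that is, rotate all pairs [(Xf k, Yf k)] by one fixed angle. *)
Definition gen k w := mean (fun s => (- pi + 1 * s) * (wf k (oext w s) * pdr None (wg k) (oext w s))).
Definition Aph k j w := mean (fun s => (- pi + 1 * s) * phi k j (oext w s)).

Lemma twopi_neq0 : twopi != 0. Proof. by rewrite gt_eqF// twopi_gt0. Qed.

Lemma ana_acn k w : (k < n)%N -> ana (acn k) w.
Proof.
move=> kn; apply: anaZ.
have H := ana_loop_lfg kn (@acw w) (ana_Uf w kn) (ana_Vf w kn) (UV_lt w kn) 1 0.
by apply: ana_ext H => y; apply: NI_eq => s _; rewrite mul0r addr0 mul1r.
Qed.

Lemma ana_gen k w : (k < n)%N -> ana (gen k) w.
Proof.
move=> kn; apply: anaZ.
exact: (ana_loop_lfg kn (@acw w) (ana_Uf w kn) (ana_Vf w kn) (UV_lt w kn) (- pi) 1).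
Qed.

Lemma ana_Am k j w : (k < n)%N -> ana (Am k j) w.
Proof. move=> kn; apply: anaZ.
by apply: (@ana_NI R _ _ _ (twopi_gt0 R) (phi k j)); exact: tube_phi. Qed.

Lemma ana_Aph k j w : (k < n)%N -> ana (Aph k j) w.
Proof.
move=> kn; apply: anaZ.
apply: (@ana_NI R _ _ _ (twopi_gt0 R) (fun v => (- pi + 1 * v None) * phi k j v)) => s hs.
apply: anaM; last exact: ana_phi.
by apply: anaD; [exact: ana_const|apply: anaZ; exact: ana_coord].
Qed.

Lemma mean_sum (J : finType) (f : J -> R -> R) : (forall j, cton 0 twopi (f j)) ->
  mean (fun s => \sum_j f j s) = \sum_j mean (f j).
Proof.
move=> cf; rewrite /mean; have [-> _] := @NI_sum R 0 twopi J (index_enum J) xpredT f (twopi_gt0 R) cf.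
by rewrite mulr_sumr.
Qed.

Lemma meanZ c (f : R -> R) : cton 0 twopi f -> mean (fun s => c * f s) = c * mean f.
Proof. by move=> cf; rewrite /mean (NIZ c (twopi_gt0 R) cf) mulrCA. Qed.

Lemma pdr_acn k i w : (k < n)%N -> pdr i (acn k) w = \sum_(j < n) Am k j w * pdr i (fun w => hc w j) w.
Proof.
move=> kn; have H := pdr_loop_lfg kn (@acw w) (ana_Uf w kn) (ana_Vf w kn) (UV_lt w kn) i 1 0.
have aL := ana_loop_lfg kn (@acw w) (ana_Uf w kn) (ana_Vf w kn) (UV_lt w kn) 1 0.
rewrite (pdr_ext (g := fun y => twopi^-1 * NI 0 twopi (fun s => (1 + 0 * s) * (lf (Uf k) (Vf k) (oext y s) * pdr None (lg k cw (Uf k) (Vf k)) (oext y s))))); last first.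
  by move=> y; rewrite /acn /mean; congr (_ * _); apply: NI_eq => s _; rewrite mul0r addr0 mul1r.
rewrite pdrZ// H !mul0r addr0 subr0.
transitivity (mean (fun s => \sum_(j < n) pdr i (fun w => hc w j) w * phi k j (oext w s))).
  by rewrite /mean; congr (_ * _); apply: NI_eq => s _; rewrite mul0r addr0 mul1r -loop_phi.
have cp j : cton 0 twopi (fun s => phi k j (oext w s)) by exact: tube_cton (tube_phi j w kn).
rewrite mean_sum; last by move=> j; apply: ctonM => //; exact: cton_const.
by apply: eq_bigr => j _; rewrite meanZ// mulrC.
Qed.

Lemma wg0 k w : (k < n)%N -> wg k (oext w 0) = lam w k.
Proof.
move=> kn; rewrite /wg /lg -(gs_lam w kn); congr gs.
by rewrite /lz /lU /= cos0 sin0 mulr1 mulr0 addr0.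
Qed.

Lemma wf0 k w : wf k (oext w 0) = nu w k.
Proof. by rewrite /wf /lf /lV /= cos0 sin0 mulr1 mulr0 subr0 -[oproj _]/w asnh_Vf. Qed.

(** At angle 0 the loop passes through the actual point, where its coordinates are [lam] and [nu]
    ([wg0], [wf0]). Hence the boundary term of the integration by parts is [nu dlam] itself. *)
Lemma pdr_gen k i w : (k < n)%N -> pdr i (gen k) w =
  \sum_(j < n) Aph k j w * pdr i (fun w => hc w j) w + nu w k * pdr i (fun w => lam w k) w -
  mean (fun s => wf k (oext w s) * pdr (Some i) (wg k) (oext w s)).
Proof.
move=> kn; have H := pdr_loop_lfg kn (@acw w) (ana_Uf w kn) (ana_Vf w kn) (UV_lt w kn) i (- pi) 1.
have aL := ana_loop_lfg kn (@acw w) (ana_Uf w kn) (ana_Vf w kn) (UV_lt w kn) (- pi) 1.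
rewrite /gen /mean pdrZ// H !mul1r mulrBr mulrDr; congr (_ + _ - _); last first.
  have tp := twopi_neq0.
  rewrite (mulKf tp) -wf0; congr (_ * _).
  rewrite -pdr_oext; apply: pdr_ext => y; exact: wg0.
transitivity (mean (fun s => \sum_(j < n) pdr i (fun w => hc w j) w * ((- pi + 1 * s) * phi k j (oext w s)))).
  rewrite /mean; congr (_ * _); apply: NI_eq => s _; rewrite loop_phi// mulr_sumr.
  by apply: eq_bigr => j _; rewrite mulrCA.
have cp j : cton 0 twopi (fun s => (- pi + 1 * s) * phi k j (oext w s)).
  apply: (tube_cton (F := fun v => (- pi + 1 * v None) * phi k j v)) => s hs.
  apply: anaM; last exact: ana_phi.
  by apply: anaD; [exact: ana_const|apply: anaZ; exact: ana_coord].
rewrite mean_sum; last by move=> j; apply: ctonM => //; exact: cton_const.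
by apply: eq_bigr => j _; rewrite meanZ// mulrC.
Qed.

(* A combination of the columns of [Am] that vanishes yields a polynomial of
   degree at most [n] with a zero at [0] and in each of the [n] gaps. *)
Lemma Am_inj w (c : 'I_n -> R) : (forall k : 'I_n, \sum_(j < n) Am k j w * c j = 0) -> forall j, c j = 0.
Proof.
move=> H.
pose p : {poly R} := 'X * \poly_(j < n) (if insub j is Some i then c i else 0).
have pE t : p.[t] = \sum_(j < n) c j * t ^+ j.+1.
  rewrite /p hornerM hornerX horner_poly mulr_sumr; apply: eq_bigr => j _.
  by rewrite valK exprS mulrCA.
have rk k : exists t, (k < n)%N -> gr w k < t < gr w k.+1 /\ root p t.
  have [kn|_] := ltnP k n; last by exists 0.
  have := H (Ordinal kn) => /=.
  have cp j : cton 0 twopi (fun s => phi k j (oext w s)) by exact: tube_cton (tube_phi j w kn).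
  have -> : \sum_(j < n) Am k j w * c j = mean (fun s => \sum_(j < n) c j * phi k j (oext w s)).
    rewrite mean_sum; last by move=> j; apply: ctonM => //; exact: cton_const.
    by apply: eq_bigr => j _; rewrite meanZ// mulrC.
  have [_ cs] := @NI_sum R 0 twopi 'I_n (index_enum 'I_n) xpredT (fun j s => c j * phi k j (oext w s)) (twopi_gt0 R)
     (fun j => ctonM (@cton_const R _ _ (c j)) (cp j)).
  rewrite /mean; have [s hs ->] := NI_MVT (twopi_gt0 R) cs.
  move=> /eqP; rewrite !mulf_eq0 invr_eq0 subr0 (negbTE twopi_neq0) /= orbF => /eqP E.
  exists (gT k (wz k (oext w s))) => _; have dz := wdom w s kn.
  split; first by have [[_]] := gTP dz.
  rewrite rootE pE.
  have ph0 : e_ k / 8 * (dasnh (wV k (oext w s)) * gL k (wz k (oext w s))) != 0.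
    have e0 : e_ k != 0 by rewrite /eps signr_eq0.
    apply: mulf_neq0; first by apply: mulf_neq0 => //; rewrite invr_eq0 pnatr_eq0.
    by rewrite gt_eqF// mulr_gt0 ?dasnh_gt0 ?gL_gt0.
  apply/eqP; apply: (mulfI ph0); rewrite mulr0 -[RHS]E mulr_sumr; apply: eq_bigr => j _.
  by rewrite /phi; ring.
have [y Hy] := choice rk.
have p0 : p = 0.
  apply/eqP; apply: contraT => pn0.
  pose rs := 0 :: mkseq y n.
  have := @max_poly_roots R p rs pn0.
  have ra : all (root p) rs.
    rewrite /= rootE /p hornerM hornerX mul0r eqxx /=.
    by apply/allP => x /mapP[k]; rewrite mem_iota add0n => /andP[_ kn] ->; case: (Hy k kn).
  have yi : incr n y.
    move=> j jn; have [/andP[_ a] _] := Hy j (ltnW jn); have [/andP[b _] _] := Hy j.+1 jn.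
    exact: lt_trans b.
  have ru : uniq rs.
    rewrite /= (sorted_uniq lt_trans ltxx) ?sorted_mkseq// andbT.
    apply/negP => /mapP[k]; rewrite mem_iota add0n => /andP[_ kn] E.
    have [/andP[a _] _] := Hy k kn; move: a; rewrite -E; have := gr_gt0 w (ltnW kn); lra.
  move=> /(_ ra ru); rewrite /= size_mkseq => sp.
  have : (size p <= n.+1)%N.
    rewrite /p; apply: leq_trans (size_polyMleq _ _) _; rewrite size_polyX /=.
    exact: size_poly.
  by rewrite leqNgt sp.
move=> j; have := congr1 (fun q : {poly R} => q`_(j.+1)) p0.
by rewrite /p coefXM /= coef_poly ltn_ord valK coef0.
Qed.

End LoopMeans.

(** * The action as squared radius times a positive analytic factor *)

Section RadialFactor.
Variables (R : realType) (n : nat).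
Local Notation P := ('I_(n + n) -> R).
Local Notation Z := (option 'I_(n + n) -> R).
Local Notation Z2 := (option (option 'I_(n + n)) -> R).
Local Notation twopi := (2 * (pi : R)).
Implicit Types (w : P) (z v : Z).

(** The derivative in [t] of the integral of [nu dlam] over the loop shrunk to [(t U, t V)] is
    [rho2] times the integral of this positive density; the factor [t] comes from differentiating
    the squared radius [t^2 rho2]. Integration over [t] from 0 to 1 gives [acn_rho]. *)
Definition Jin k w t s : R :=
  t * (dasnh (t * wV k (oext w s)) * gL k (oext w (t * wU k (oext w s)))).

Definition Jf k w := twopi^-1 * NI 0 1 (fun t => NI 0 twopi (Jin k w t)).

Lemma wUV k w s : (k < n)%N -> wU k (oext w s) ^+ 2 + wV k (oext w s) ^+ 2 = rho2 w k.
Proof. by move=> kn; rewrite (lUV (Uf k) (Vf k) (oext w s)) -[oproj _]/w UV_rho. Qed.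

Lemma Jdom k w t s : (k < n)%N -> 0 <= t <= 1 -> gdom k (oext w (t * wU k (oext w s))).
Proof.
move=> kn /andP[t0 t1]; split=> //=; rewrite -[oproj _]/w exprMn.
have H := wUV w s kn.
have t2 : t ^+ 2 <= 1 by rewrite expr_le1.
have := sqr_ge0 (wU k (oext w s)); have := sqr_ge0 (wV k (oext w s)) => h1 h2.
have : t ^+ 2 * wU k (oext w s) ^+ 2 <= 1 * wU k (oext w s) ^+ 2 by exact: ler_wpM2r.
have hp : (0:R) < 2^-1 by rewrite invr_gt0.
by rewrite mul1r => h3; lra.
Qed.

Definition J2 k (v : Z2) : R :=
  Jin k (fun i => v (Some (Some i))) (v (Some None)) (v None).

Lemma ana_J2 k (w : P) t s : (k < n)%N -> 0 <= t <= 1 -> ana (J2 k) (oext (oext w t) s).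
Proof.
move=> kn t01; set x : Z2 := oext (oext w t) s.
have cT : ana (fun v : Z2 => v (Some None)) x by exact: ana_coord.
have cW i : ana (fun v : Z2 => v (Some (Some i))) x by exact: ana_coord.
have cS : ana (fun v : Z2 => v None) x by exact: ana_coord.
have aU : ana (fun v : Z2 => wU k (oext (fun i => v (Some (Some i))) (v None))) x.
  exact: (@ana_osub R 'I_(n + n) (option (option 'I_(n + n))) (wU k) (fun i u => u (Some (Some i))) (fun u => u None) x (ana_wU w s kn) cW cS).
have aV : ana (fun v : Z2 => wV k (oext (fun i => v (Some (Some i))) (v None))) x.
  exact: (@ana_osub R 'I_(n + n) (option (option 'I_(n + n))) (wV k) (fun i u => u (Some (Some i))) (fun u => u None) x (ana_wV w s kn) cW cS).
apply: anaM => //; apply: anaM; first by apply: ana_dasnh; exact: anaM.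
apply: (@ana_osub R _ _ (gL k) (fun i (v : Z2) => v (Some (Some i)))
   (fun v : Z2 => v (Some None) * wU k (oext (fun i => v (Some (Some i))) (v None)))) => //.
  by apply: ana_gL; exact: Jdom.
exact: anaM.
Qed.

Definition J1 k z : R := NI 0 twopi (fun s => J2 k (oext z s)).

Lemma ana_J1 k w t : (k < n)%N -> 0 <= t <= 1 -> ana (J1 k) (oext w t).
Proof.
move=> kn t01; apply: (@ana_NI R _ _ _ (twopi_gt0 R) (J2 k)) => s _; exact: ana_J2.
Qed.

Lemma cton_J2 k w t : (k < n)%N -> 0 <= t <= 1 -> cton 0 twopi (Jin k w t).
Proof.
move=> kn t01; apply: (@tube_cton R _ 0 twopi (J2 k) (oext w t)) => s _; exact: ana_J2.
Qed.

Lemma cton_J1 k w : (k < n)%N -> cton 0 1 (fun t => NI 0 twopi (Jin k w t)).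
Proof.
by move=> kn; apply: (@tube_cton R _ 0 1 (J1 k) w) => s hs; exact: ana_J1.
Qed.

Lemma ana_Jf k w : (k < n)%N -> ana (Jf k) w.
Proof.
move=> kn; apply: anaZ.
by apply: (@ana_NI R _ _ _ ltr01 (J1 k)) => t ht; exact: ana_J1.
Qed.

Lemma Jf_gt0 k w : (k < n)%N -> 0 < Jf k w.
Proof.
move=> kn; rewrite mulr_gt0 ?invr_gt0 ?twopi_gt0//.
have [t /andP[t0 t1] ->] := NI_MVT ltr01 (@cton_J1 k w kn).
have t01 : 0 <= t <= 1 by rewrite !ltW.
rewrite subr0 mulr1; have [s _ ->] := NI_MVT (twopi_gt0 R) (@cton_J2 k w t kn t01).
rewrite subr0 mulr_gt0 ?twopi_gt0// mulr_gt0// mulr_gt0 ?dasnh_gt0// gL_gt0//.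
exact: Jdom.
Qed.

Lemma asnh0 : asnh (0 : R) = 0.
Proof. by rewrite /asnh expr0n addr0 sqrtr1 add0r ln1 mulr0. Qed.

Section Scaling.
Variables (k : nat) (w : P).
Hypothesis kn : (k < n)%N.
Let gwc (i : 'I_(n + n)) (y : unit -> R) : R := w i.
Let Us (y : unit -> R) := y tt * Uf k w.
Let Vs (y : unit -> R) := y tt * Vf k w.
Let L (y : unit -> R) := NI 0 twopi (fun s => (1 + 0 * s) *
  (lf Us Vs (oext y s) * pdr None (lg k gwc Us Vs) (oext y s))).

Lemma scale_hyps (t : R) : 0 <= t <= 1 -> [/\ forall i, ana (gwc i) (fun=> t), ana Us (fun=> t), ana Vs (fun=> t) &
  Us (fun=> t) ^+ 2 + Vs (fun=> t) ^+ 2 < rho2 (fun i => gwc i (fun=> t)) k + 2^-1].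
Proof.
move=> /andP[t0 t1].
have ct : ana (fun y : unit -> R => y tt) (fun=> t) by exact: ana_coord.
split; [by move=> i; exact: ana_const|by apply: anaM => //; exact: ana_const|by apply: anaM => //; exact: ana_const|].
have E : Us (fun=> t) ^+ 2 + Vs (fun=> t) ^+ 2 = t ^+ 2 * (Uf k w ^+ 2 + Vf k w ^+ 2) by rewrite /Us /Vs; ring.
rewrite E UV_rho// -[fun i => gwc i _]/w.
have t2 : t ^+ 2 <= 1 by rewrite expr_le1.
have r0 := rho2_ge0 w kn.
have : t ^+ 2 * rho2 w k <= 1 * rho2 w k by exact: ler_wpM2r.
have hp : (0:R) < 2^-1 by rewrite invr_gt0.
by rewrite mul1r => h3; lra.
Qed.

Lemma lV_scale t s : lV Us Vs (oext (fun=> t) s) = t * wV k (oext w s).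
Proof. by rewrite /wV /lV /Us /Vs /= -[oproj (oext w s)]/w /oproj /=; ring. Qed.

Lemma lU_scale t s : lU Us Vs (oext (fun=> t) s) = t * wU k (oext w s).
Proof. by rewrite /wU /lU /Us /Vs /= -[oproj (oext w s)]/w /oproj /=; ring. Qed.

Lemma lz_scale t s : lz gwc Us Vs (oext (fun=> t) s) = oext w (t * wU k (oext w s)).
Proof. by rewrite /lz lU_scale. Qed.

(** The base point does not move with [t], so only the radial term of the loop bracket is left. *)
Lemma scale_derive (t : R) : 0 <= t <= 1 ->
  is_derive (t : R) 1 (fun t => L (fun=> t)) (rho2 w k * NI 0 twopi (Jin k w t)).
Proof.
move=> t01; have [H1 H2 H3 H4] := scale_hyps t01.
have aL := ana_loop_lfg kn H1 H2 H3 H4 1 0.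
have E1 := pdr_loop_lfg kn H1 H2 H3 H4 tt 1 0.
have Esh (u : R) : shl (fun _ : unit => 0 : R) tt u = fun=> u.
  by apply/funext => -[]; rewrite /shl /= mulr1 add0r.
have D := @ana_derive_at R _ L (fun=> 0) tt t; rewrite Esh in D.
have Esh2 : (fun u : R => L (shl (fun=> 0) tt u)) = (fun u : R => L (fun=> u)).
  by apply/funext => u; rewrite Esh.
rewrite Esh2 in D; apply: (is_derive_eq (D aL)); rewrite [LHS]E1 !mul0r addr0 subr0.
suff -> : rho2 w k * NI 0 twopi (Jin k w t) =
  NI 0 twopi (fun s : R => (1 + 0 * s) *
     (dasnh (lV Us Vs (oext (fun=> t) s)) * (gL k (lz gwc Us Vs (oext (fun=> t) s)) *
         (Us (fun=> t) * pdr tt Us (fun=> t) + Vs (fun=> t) * pdr tt Vs (fun=> t)) +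
         lU Us Vs (oext (fun=> t) s) * \sum_j pdr (Some j) (gs k) (lz gwc Us Vs (oext (fun=> t) s)) * pdr tt (gwc j) (fun=> t)))) by [].
rewrite -(NIZ _ (twopi_gt0 R) (@cton_J2 k w t kn t01)); apply: NI_eq => s _.
rewrite mul0r addr0 mul1r lV_scale lz_scale.
have ct : ana (fun y : unit -> R => y tt) (fun=> t) by exact: ana_coord.
have cc (c : R) : ana (fun=> c) (fun _ : unit => t) by exact: ana_const.
have pU c : pdr tt (fun y : unit -> R => y tt * c) (fun=> t) = c.
  by rewrite (pdrM tt ct (cc c)) pdr_coord pdr_cst eqxx mul1r mulr0 addr0.
rewrite (pU (Uf k w)) (pU (Vf k w)).
rewrite [X in _ + _ * X]big1; last by move=> j _; rewrite (pdr_cst (w j)) mulr0.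
rewrite mulr0 addr0 -(UV_rho w kn) /Jin /Us /Vs.
by move: (dasnh _) (gL k _) => a b; ring.
Qed.

Lemma acn_rho : acn k w = rho2 w k * Jf k w.
Proof.
have t0 := twopi_gt0 R.
have L1 : L (fun=> 1) = NI 0 twopi (fun s => wf k (oext w s) * pdr None (wg k) (oext w s)).
  have h1 : 0 <= (1:R) <= 1 by rewrite ler01 lexx.
  have [H1 H2 H3 H4] := scale_hyps h1.
  apply: NI_eq => s _; rewrite mul0r addr0 mul1r.
  rewrite (pdr_lgN kn H1 H2 H3 H4) (pdr_lgN kn (@acw _ _ w) (ana_Uf w kn) (ana_Vf w kn) (UV_lt w kn)).
  by rewrite /lf lz_scale lV_scale !mul1r /wf /lf /lz -[oproj _]/w.
have L0 : L (fun=> 0) = 0.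
  transitivity (NI 0 twopi (fun=> 0)); last exact: NI0.
  apply: NI_eq => s _.
  by rewrite /lf lV_scale !mul0r asnh0 mul0r mulr0.
have D : prim_on 0 1 (fun t => rho2 w k * NI 0 twopi (Jin k w t)) (fun t => L (fun=> t)).
  by move=> t /scale_derive.
have := NIE ltr01 D; rewrite L0 subr0 L1 (NIZ _ ltr01 (@cton_J1 k w kn)) => E.
by rewrite /acn /mean -E /Jf mulrCA.
Qed.

End Scaling.

Lemma ana_slice_cts (I : finType) (F : (option I -> R) -> R) (x : I -> R) :
  (forall s, ana F (oext x s)) -> forall t : R, {for t, continuous (fun s => F (oext x s))}.
Proof. by move=> aF t; apply: is_derive_continuous; exact: ana_slice (aF t). Qed.

(* The part of the integrand that is even in [wV] drops out: [wV] changes sign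
   under a reflection of the angle which fixes [wU]. *)
Lemma mean_odd k w (F : R -> R) : (k < n)%N ->
  (forall s : R, {for s, continuous (fun s => wf k (oext w s) * F (wU k (oext w s)))}) ->
  mean (fun s => wf k (oext w s) * F (wU k (oext w s))) = 0.
Proof.
move=> kn cF; have [r [th [r0 EU EV]]] := polar (Uf k w) (Vf k w).
have HU s : wU k (oext w s) = r * sin (th + s).
  by rewrite /wU /lU -[oproj _]/w /= EU EV sinD; ring.
have HV s : wV k (oext w s) = r * cos (th + s).
  by rewrite /wV /lV -[oproj _]/w /= EU EV cosD; ring.
have pe : pi *+ 2 = twopi by rewrite mulr_natl.
rewrite /mean (@NI_refl0 R _ (pi - 2 * th)) ?mulr0//.
  move=> s; rewrite /wf /lf -/(wV k _) -/(wV k _) !HU !HV addrA -pe cosD2pi sinD2pi//.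
move=> s; rewrite /wf /lf -/(wV k _) -/(wV k _) !HU !HV.
have -> : th + (pi - 2 * th - s) = - (th + s) + pi by ring.
by rewrite sinDpi sinN opprK cosDpi cosN mulrN asnhN mulNr.
Qed.

(** Multiplied by [rho2], the variation of [(U, V)] splits into a radial part [dd] and a rotation
    [cc]. The radial part and the variation of the base point depend on the loop through [wU] alone
    and drop out by [mean_odd]. The rotation part is [cc] times the derivative along the loop, whose
    mean is the action [rho2 * Jf]. *)
Lemma mean_fgi k i w : (k < n)%N ->
  mean (fun s => wf k (oext w s) * pdr (Some i) (wg k) (oext w s)) =
  Jf k w * (Vf k w * pdr i (Uf k) w - Uf k w * pdr i (Vf k) w).
Proof.
move=> kn; have t0 := twopi_gt0 R.
have Eg s := pdr_lg kn (@acw _ _ w) (ana_Uf w kn) (ana_Vf w kn) (UV_lt w kn) i s.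
have EgN s := pdr_lgN kn (@acw _ _ w) (ana_Uf w kn) (ana_Vf w kn) (UV_lt w kn) s.
(* On a constant loop both sides vanish, since [Uf], [Vf] and hence [wf] are 0; otherwise one may
   cancel [rho2]. *)
have [r0|rn0] := eqVneq (rho2 w k) 0.
  have := UV_rho w kn; rewrite r0 => /eqP; rewrite paddr_eq0 ?sqr_ge0// !sqrf_eq0 => /andP[/eqP U0 /eqP V0].
  rewrite U0 V0 !mul0r subrr mulr0 /mean.
  transitivity (twopi^-1 * NI 0 twopi (fun=> 0)); last by rewrite NI0// mulr0.
  congr (_ * _); apply: NI_eq => s _.
  by rewrite /wf /lf /lV -[oproj _]/w U0 V0 !mul0r subrr asnh0 mul0r.
apply: (mulfI rn0).
pose dd := Uf k w * pdr i (Uf k) w + Vf k w * pdr i (Vf k) w.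
pose cc := Vf k w * pdr i (Uf k) w - Uf k w * pdr i (Vf k) w.
pose G z := rho2 w k * pdr (Some i) (gs k) z + gL k z * (dd * z None).
have aG z : gdom k z -> ana G z.
  move=> dz; apply: anaD; first by apply: anaZ; apply: ana_pdr; exact: ana_gs.
  apply: anaM; first exact: ana_gL.
  by apply: anaZ; exact: ana_coord.
have awG s : ana (fun v => G (wz k v)) (oext w s) by apply: ana_wF => //; apply: aG; exact: wdom.
have af1 s : ana (fun v => wf k v * G (wz k v)) (oext w s) by apply: anaM => //; exact: ana_wf.
have af2 s : ana (fun v => wf k v * pdr None (wg k) v) (oext w s).
  by apply: anaM; [exact: ana_wf|apply: ana_pdr; exact: ana_wg].
have af3 s : ana (fun v => wf k v * pdr (Some i) (wg k) v) (oext w s).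
  by apply: anaM; [exact: ana_wf|apply: ana_pdr; exact: ana_wg].
have c1 : cton 0 twopi (fun s => wf k (oext w s) * G (wz k (oext w s))).
  by move=> s _; exact: (ana_slice_cts af1).
have c2 : cton 0 twopi (fun s => wf k (oext w s) * pdr None (wg k) (oext w s)).
  by move=> s _; exact: (ana_slice_cts af2).
have c3 : cton 0 twopi (fun s => wf k (oext w s) * pdr (Some i) (wg k) (oext w s)).
  by move=> s _; exact: (ana_slice_cts af3).
have Z0 : mean (fun s => wf k (oext w s) * G (wz k (oext w s))) = 0.
  exact: (@mean_odd k w (fun u => G (oext w u)) kn (ana_slice_cts af1)).
transitivity (mean (fun s => wf k (oext w s) * G (wz k (oext w s)) + cc * (wf k (oext w s) * pdr None (wg k) (oext w s)))).
  rewrite -meanZ//; rewrite /mean; congr (_ * _); apply: NI_eq => s _.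
  have -> : pdr (Some i) (wg k) (oext w s) = gL k (wz k (oext w s)) * (pdr i (Uf k) w * cos s + pdr i (Vf k) w * sin s) +
      pdr (Some i) (gs k) (wz k (oext w s)).
    rewrite [LHS]Eg; congr (_ + _).
    rewrite -[RHS](sum_delta (fun j => pdr (Some j) (gs k) (wz k (oext w s))) i).
    by apply: eq_bigr => j _; congr (_ * _); exact: pdr_coord.
  have -> : pdr None (wg k) (oext w s) = gL k (wz k (oext w s)) * wV k (oext w s) by exact: EgN.
  rewrite /G -[wz k _ None]/(wU k (oext w s)) /wU /wV /lU /lV -[oproj _]/w /= /cc /dd -(UV_rho w kn).
  move: (wf k _) (gL k _) (pdr (Some i) (gs k) _) (cos s) (sin s) (Uf k w) (Vf k w) (pdr i (Uf k) w) (pdr i (Vf k) w).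
  by move=> f l g c t u v u' v'; ring.
rewrite /mean NID//; last by apply: ctonM => //; exact: cton_const.
rewrite mulrDr -/(mean _) Z0 add0r -/(mean _) meanZ// -/(acn k w) acn_rho//.
by rewrite /cc; ring.
Qed.

End RadialFactor.

Section AnalyticMatrices.
Variables (R : realType) (I : finType).

Lemma ana_det m (A : (I -> R) -> 'M[R]_m) x : (forall i j, ana (fun w => A w i j) x) ->
  ana (fun w => \det (A w)) x.
Proof.
move=> aA; apply: ana_sum => s _; apply: anaM; first exact: ana_const.
by apply: ana_prod => i _; exact: aA.
Qed.

Lemma ana_invmx m (A : (I -> R) -> 'M[R]_m) x i j : (forall i j, ana (fun w => A w i j) x) ->
  (forall w, A w \in unitmx) -> ana (fun w => invmx (A w) i j) x.
Proof.
move=> aA uA; apply: (ana_ext (f := fun w => (\det (A w))^-1 * cofactor (A w) j i)).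
  by move=> w; rewrite /invmx uA mxE mxE.
apply: anaM.
  by apply: anaV; [exact: ana_det|rewrite -unitfE -unitmxE].
apply: anaZ; apply: ana_det => k l.
by apply: ana_ext (aA (lift j k) (lift i l)) => w; rewrite !mxE.
Qed.

End AnalyticMatrices.

(** * Birkhoff coordinates *)

Section SymplecticMatrices.
Variables (R : realType) (n : nat).

Definition symJ : 'M[R]_(n + n) := block_mx 0 1%:M (- 1%:M) 0.

Lemma symJJ : symJ *m symJ = - 1%:M.
Proof.
rewrite /symJ mulmx_block !mul0mx !mulmx0 !add0r !addr0 mulmx1 mul1mx.
rewrite (scalar_mx_block n n) opp_block_mx !oppr0.
by congr block_mx.
Qed.

(** The hypothesis exhibits a one-sided inverse of [N *m symJ]; for square matrices it is
    two-sided. *)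
Lemma sym_trmx (N : 'M[R]_(n + n)) : N *m symJ *m N^T = symJ -> N^T *m symJ *m N = symJ.
Proof.
move=> H.
have H1 : (N *m symJ) *m (- (N^T *m symJ)) = 1%:M.
  by rewrite mulmxN mulmxA H symJJ opprK.
have H2 := mulmx1C H1.
have H3 : N^T *m symJ *m N *m symJ = - 1%:M by rewrite -H2 mulNmx opprK !mulmxA.
have : N^T *m symJ *m N *m symJ *m symJ = - 1%:M *m symJ by rewrite H3.
by rewrite -mulmxA symJJ mulmxN mulmx1 mulNmx mul1mx => /oppr_inj.
Qed.

Lemma sum_n2 (F : 'I_(n + n) -> R) : \sum_i F i = \sum_(i < n) (F (lshift n i) + F (rshift n i)).
Proof. by rewrite big_split_ord big_split. Qed.

Lemma symJ_form (A B : 'M[R]_(n + n)) i j :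
  (A *m symJ *m B) i j = \sum_(k < n) (A i (lshift n k) * B (rshift n k) j - A i (rshift n k) * B (lshift n k) j).
Proof.
have AJl k : (A *m symJ) i (lshift n k) = - A i (rshift n k).
  rewrite /symJ mxE sum_n2; under eq_bigr do rewrite block_mxEul block_mxEdl !mxE mulr0 add0r mulrN.
  rewrite sumrN (bigD1 k)//= eqxx mulr1 big1 ?addr0// => l lk.
  by rewrite (negbTE lk) mulr0.
have AJr k : (A *m symJ) i (rshift n k) = A i (lshift n k).
  rewrite /symJ mxE sum_n2; under eq_bigr do rewrite block_mxEur block_mxEdr !mxE mulr0 addr0.
  rewrite (bigD1 k)//= eqxx mulr1 big1 ?addr0// => l lk.
  by rewrite (negbTE lk) mulr0.
rewrite mxE sum_n2; apply: eq_bigr => k _.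
by rewrite AJl AJr; ring.
Qed.

End SymplecticMatrices.

Section BirkhoffMap.
Variables (R : realType) (n : nat).
Local Notation P := ('I_(n + n) -> R).
Implicit Types (w : P).

Definition AM w : 'M[R]_n := \matrix_(k, j) Am k j w.

Lemma AM_unit w : AM w \in unitmx.
Proof.
rewrite -unitmx_tr unitmxE unitfE; apply/negP => /det0P[v v0 vA].
case/negP: v0; apply/eqP/rowP => j; rewrite mxE.
apply: (@Am_inj R n w (fun j => v 0 j)) => k.
have := congr1 (fun m : 'rV[R]_n => m 0 k) vA; rewrite !mxE => E.
by rewrite -[RHS]E; apply: eq_bigr => l _; rewrite !mxE mulrC.
Qed.

(** Chosen so that [sum om dI = sum Aph dH] ([om_dI]): these angles absorb the terms of the
    differential of [gen] along the coefficients of [D]. They are analytic even where the polar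
    angle of [(V, U)] is undefined. *)
Definition om (k : 'I_n) w : R := \sum_(l < n) \sum_(j < n) Aph l j w * invmx (AM w) j k.

Lemma ana_om k w : ana (om k) w.
Proof.
apply: ana_sum => l _; apply: ana_sum => j _; apply: anaM; first exact: ana_Aph.
apply: ana_invmx; last exact: AM_unit.
by move=> a b; apply: (ana_ext (f := Am a b)); [by move=> v; rewrite mxE|exact: ana_Am].
Qed.

Lemma dH_dI i w (j : 'I_n) : pdr i (fun w => hc w j) w = \sum_(k < n) invmx (AM w) j k * pdr i (acn k) w.
Proof.
pose dH : 'cV[R]_n := \col_j pdr i (fun w => hc w j) w.
pose dI : 'cV[R]_n := \col_k pdr i (acn k) w.
have E : AM w *m dH = dI.
  by apply/colP => k; rewrite !mxE pdr_acn//; apply: eq_bigr => l _; rewrite !mxE.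
have : dH = invmx (AM w) *m dI by rewrite -E mulKmx// AM_unit.
move=> /colP/(_ j); rewrite !mxE => ->; apply: eq_bigr => k _; by rewrite mxE.
Qed.

Lemma om_dI i w : \sum_(k < n) om k w * pdr i (acn k) w =
  \sum_(l < n) \sum_(j < n) Aph l j w * pdr i (fun w => hc w j) w.
Proof.
transitivity (\sum_(l < n) \sum_(k < n) \sum_(j < n) Aph l j w * invmx (AM w) j k * pdr i (acn k) w).
  rewrite exchange_big; apply: eq_bigr => k _; rewrite /om mulr_suml; apply: eq_bigr => l _.
  by rewrite mulr_suml.
apply: eq_bigr => l _; rewrite exchange_big; apply: eq_bigr => j _.
by rewrite dH_dI mulr_sumr; apply: eq_bigr => k _; rewrite mulrA.
Qed.

Definition am k w : R := Num.sqrt (2 * Jf k w).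

Lemma am_sqr k w : (k < n)%N -> am k w ^+ 2 = 2 * Jf k w.
Proof. by move=> kn; rewrite sqr_sqrtr// mulr_ge0// ltW// Jf_gt0. Qed.

Lemma ana_am k w : (k < n)%N -> ana (am k) w.
Proof.
move=> kn; apply: ana_sqrt; first by apply: anaZ; exact: ana_Jf.
by rewrite mulr_gt0// Jf_gt0.
Qed.

Definition Xf (k : 'I_n) w : R := am k w * (Vf k w * cos (om k w) - Uf k w * sin (om k w)).
Definition Yf (k : 'I_n) w : R := am k w * (Uf k w * cos (om k w) + Vf k w * sin (om k w)).

Lemma ana_Xf k w : ana (Xf k) w.
Proof.
apply: anaM; first exact: ana_am.
apply: anaB; apply: anaM; [exact: ana_Vf|apply: ana_cos; exact: ana_om|exact: ana_Uf|apply: ana_sin; exact: ana_om].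
Qed.

Lemma ana_Yf k w : ana (Yf k) w.
Proof.
apply: anaM; first exact: ana_am.
apply: anaD; apply: anaM; [exact: ana_Uf|apply: ana_cos; exact: ana_om|exact: ana_Vf|apply: ana_sin; exact: ana_om].
Qed.

Lemma XY_acn (k : 'I_n) w : Xf k w ^+ 2 + Yf k w ^+ 2 = 2 * acn k w.
Proof.
rewrite acn_rho// -UV_rho// /Xf /Yf; have := cos2Dsin2 (om k w); have := am_sqr w (ltn_ord k).
move: (cos _) (sin _) (Uf _ _) (Vf _ _) (Jf _ _) (am k w) => c s u v J m Em H.
transitivity (m ^+ 2 * (u ^+ 2 + v ^+ 2) * (c ^+ 2 + s ^+ 2)); first by ring.
by rewrite Em H; ring.
Qed.

(** For a rotated and scaled vector the form [X dY - Y dX] does not see the derivative of the scale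
    [am]; it is [am^2] times that of [(V, U)] plus the squared length times the differential of the
    rotation angle. *)
Lemma XdY (k : 'I_n) i w : Xf k w * pdr i (Yf k) w - Yf k w * pdr i (Xf k) w =
  2 * (Jf k w * (Vf k w * pdr i (Uf k) w - Uf k w * pdr i (Vf k) w) + acn k w * pdr i (om k) w).
Proof.
have aU := ana_Uf w (ltn_ord k); have aV := ana_Vf w (ltn_ord k); have ao := ana_om k w.
have aa := ana_am w (ltn_ord k).
have ac : ana (fun w => cos (om k w)) w by exact: ana_cos.
have as_ : ana (fun w => sin (om k w)) w by exact: ana_sin.
have dc : pdr i (fun w => cos (om k w)) w = - sin (om k w) * pdr i (om k) w := pdr_comp1 i (is_derive_cos _) ao.
have ds : pdr i (fun w => sin (om k w)) w = cos (om k w) * pdr i (om k) w := pdr_comp1 i (is_derive_sin _) ao.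
have a1 : ana (fun w => Vf k w * cos (om k w)) w by exact: anaM.
have a2 : ana (fun w => Uf k w * sin (om k w)) w by exact: anaM.
have a3 : ana (fun w => Uf k w * cos (om k w)) w by exact: anaM.
have a4 : ana (fun w => Vf k w * sin (om k w)) w by exact: anaM.
have dX : pdr i (Xf k) w = pdr i (am k) w * (Vf k w * cos (om k w) - Uf k w * sin (om k w)) +
   am k w * (pdr i (Vf k) w * cos (om k w) + Vf k w * (- sin (om k w) * pdr i (om k) w)
    - (pdr i (Uf k) w * sin (om k w) + Uf k w * (cos (om k w) * pdr i (om k) w))).
  by rewrite -dc -ds -(pdrM i aV ac) -(pdrM i aU as_) -(pdrB i a1 a2) -(pdrM i aa (anaB a1 a2)).
have dY : pdr i (Yf k) w = pdr i (am k) w * (Uf k w * cos (om k w) + Vf k w * sin (om k w)) +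
   am k w * (pdr i (Uf k) w * cos (om k w) + Uf k w * (- sin (om k w) * pdr i (om k) w)
    + (pdr i (Vf k) w * sin (om k w) + Vf k w * (cos (om k w) * pdr i (om k) w))).
  by rewrite -dc -ds -(pdrM i aU ac) -(pdrM i aV as_) -(pdrD i a3 a4) -(pdrM i aa (anaD a3 a4)).
rewrite dX dY acn_rho// -UV_rho// /Xf /Yf; have := cos2Dsin2 (om k w); have := am_sqr w (ltn_ord k).
move: (cos _) (sin _) (Uf _ _) (Vf _ _) (Jf _ _) (am k w) (pdr i (am k) w) (pdr i (Uf k) w) (pdr i (Vf k) w) (pdr i (om k) w).
move=> c s u v J m dm du dv dom Em H.
transitivity (m ^+ 2 * (c ^+ 2 + s ^+ 2) * (v * du - u * dv + (u ^+ 2 + v ^+ 2) * dom)); first by ring.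
by rewrite Em H; ring.
Qed.

(* The generating function of the transition from [(lam, nu)] to [(Xf, Yf)]. *)
Definition Sg w : R := \sum_(k < n) gen k w - \sum_(k < n) acn k w * om k w.

Lemma ana_Sg w : ana Sg w.
Proof.
apply: anaB; apply: ana_sum => k _; first exact: ana_gen.
by apply: anaM; [exact: ana_acn|exact: ana_om].
Qed.

(** By [pdr_gen] and [mean_fgi] the differential of [gen] is
    [sum Aph dH + nu dlam - J (V dU - U dV)]. Subtracting [d(I om)] cancels the first sum through
    [om_dI] and completes the last term, by [XdY], to half of [X dY - Y dX]. *)
Lemma pdr_Sg i w : pdr i Sg w = \sum_(k < n) (nu w k * pdr i (fun w => lam w k) w -
  2^-1 * (Xf k w * pdr i (Yf k) w - Yf k w * pdr i (Xf k) w)).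
Proof.
have ag (k : 'I_n) : ana (gen k) w by exact: ana_gen.
have ai (k : 'I_n) : ana (acn k) w by exact: ana_acn.
have ao (k : 'I_n) : ana (om k) w by exact: ana_om.
have aio (k : 'I_n) : ana (fun w => acn k w * om k w) w by exact: anaM.
rewrite /Sg pdrB; [|by apply: ana_sum => k _; exact: ag|by apply: ana_sum => k _; exact: aio].
rewrite !pdr_sum; [|by move=> k _; exact: aio|by move=> k _; exact: ag].
transitivity (\sum_(k < n) (\sum_(j < n) Aph k j w * pdr i (fun w => hc w j) w)
   + \sum_(k < n) (nu w k * pdr i (fun w => lam w k) w - Jf k w * (Vf k w * pdr i (Uf k) w - Uf k w * pdr i (Vf k) w))
   - (\sum_(k < n) om k w * pdr i (acn k) w + \sum_(k < n) acn k w * pdr i (om k) w)).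
  congr (_ - _).
    rewrite -big_split; apply: eq_bigr => k _ /=.
    by rewrite pdr_gen// mean_fgi// addrA.
  rewrite -big_split; apply: eq_bigr => k _ /=.
  by rewrite pdrM//= [om k w * _]mulrC.
rewrite om_dI opprD addrACA addrA subrr add0r addrC -sumrN -big_split; apply: eq_bigr => k _ /=.
rewrite XdY mulKf ?pnatr_eq0//; ring.
Qed.

(** Second derivatives of [Sg] are symmetric, that is, its differential is closed; the mixed second
    derivatives of [lam], [Xf] and [Yf] cancel for the same reason. *)
Lemma two_form i j w :
  \sum_(k < n) (pdr i (fun w => nu w k) w * pdr j (fun w => lam w k) w - pdr i (fun w => lam w k) w * pdr j (fun w => nu w k) w) =
  \sum_(k < n) (pdr i (Xf k) w * pdr j (Yf k) w - pdr i (Yf k) w * pdr j (Xf k) w).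
Proof.
have an (k : 'I_n) v : ana (fun w => nu w k) v by exact: ana_nu.
have al (k : 'I_n) v : ana (fun w => lam w k) v by exact: ana_lam.
have aX (k : 'I_n) v : ana (Xf k) v := ana_Xf k v.
have aY (k : 'I_n) v : ana (Yf k) v := ana_Yf k v.
have mixed a b v : pdr a (pdr b Sg) v = \sum_(k < n) (
    pdr a (fun w => nu w k) v * pdr b (fun w => lam w k) v + nu v k * pdr a (pdr b (fun w => lam w k)) v
    - 2^-1 * (pdr a (Xf k) v * pdr b (Yf k) v + Xf k v * pdr a (pdr b (Yf k)) v
       - (pdr a (Yf k) v * pdr b (Xf k) v + Yf k v * pdr a (pdr b (Xf k)) v))).
  rewrite (pdr_ext (g := fun w => \sum_(k < n) (nu w k * pdr b (fun w => lam w k) w -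
    2^-1 * (Xf k w * pdr b (Yf k) w - Yf k w * pdr b (Xf k) w)))); last by move=> u; exact: pdr_Sg.
  have b1 (k : 'I_n) : ana (pdr b (fun w => lam w k)) v by exact: ana_pdr.
  have b2 (k : 'I_n) : ana (pdr b (Xf k)) v by exact: ana_pdr.
  have b3 (k : 'I_n) : ana (pdr b (Yf k)) v by exact: ana_pdr.
  have c1 (k : 'I_n) : ana (fun w => nu w k * pdr b (fun w => lam w k) w) v by exact: anaM.
  have c2 (k : 'I_n) : ana (fun w => Xf k w * pdr b (Yf k) w) v by exact: anaM.
  have c3 (k : 'I_n) : ana (fun w => Yf k w * pdr b (Xf k) w) v by exact: anaM.
  have c4 (k : 'I_n) : ana (fun w => Xf k w * pdr b (Yf k) w - Yf k w * pdr b (Xf k) w) v by exact: anaB.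
  have c5 (k : 'I_n) : ana (fun w => 2^-1 * (Xf k w * pdr b (Yf k) w - Yf k w * pdr b (Xf k) w)) v by exact: anaZ.
  rewrite pdr_sum; last by move=> k _; exact: anaB.
  apply: eq_bigr => k _.
  rewrite (pdrB a (c1 k) (c5 k)) (pdrM a (an k v) (b1 k)) (pdrZ _ a (c4 k)) (pdrB a (c2 k) (c3 k)).
  by rewrite (pdrM a (aX k v) (b3 k)) (pdrM a (aY k v) (b2 k)).
have E0 := pdrC i j (ana_Sg w); rewrite (mixed i j w) (mixed j i w) in E0.
move/eqP: E0.
rewrite -subr_eq0 -sumrB => /eqP E.
apply/eqP; rewrite -subr_eq0 -sumrB -[X in _ == X]E; apply/eqP; apply: eq_bigr => k _.
rewrite (pdrC j i (al k w)) (pdrC j i (aX k w)) (pdrC j i (aY k w)).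
move: (pdr i (pdr j (fun w => lam w k)) w) (pdr i (pdr j (Xf k)) w) (pdr i (pdr j (Yf k)) w) => p1 p2 p3.
move: (pdr i (fun w => nu w k) w) (pdr j (fun w => nu w k) w) (pdr i (fun w => lam w k) w) (pdr j (fun w => lam w k) w) => n1 n2 l1 l2.
move: (pdr i (Xf k) w) (pdr j (Xf k) w) (pdr i (Yf k) w) (pdr j (Yf k) w) (Xf k w) (Yf k w) (nu w k) => x1 x2 y1 y2 x y nn.
by field.
Qed.

Definition jac (f g : 'I_n -> P -> R) w : 'M[R]_(n + n) :=
  \matrix_(a < n + n, i < n + n) match fintype.split a with inl k => pdr i (f k) w | inr k => pdr i (g k) w end.

Lemma jacl f g w k i : jac f g w (lshift n k) i = pdr i (f k) w.
Proof. by rewrite mxE (unsplitK (inl k : 'I_n + 'I_n)%type). Qed.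

Lemma jacr f g w k i : jac f g w (rshift n k) i = pdr i (g k) w.
Proof. by rewrite mxE (unsplitK (inr k : 'I_n + 'I_n)%type). Qed.

Lemma jac_br (f g : P -> R) w i j (M : 'M[R]_(n + n)) :
  (forall l, M i l = pdr l f w) -> (forall l, M j l = pdr l g w) -> (M *m symJ R n *m M^T) i j = br f g w.
Proof.
move=> H1 H2; rewrite symJ_form; apply: eq_bigr => k _.
by rewrite ![M^T _ _]mxE !H1 !H2.
Qed.

Lemma jac_form f g w i j : ((jac f g w)^T *m symJ R n *m jac f g w) i j =
  \sum_(k < n) (pdr i (f k) w * pdr j (g k) w - pdr i (g k) w * pdr j (f k) w).
Proof.
rewrite symJ_form; apply: eq_bigr => k _.
by rewrite ![_^T _ _]mxE !jacl !jacr.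
Qed.

Lemma mx_split2 (A B : 'M[R]_(n + n)) :
  (forall k l, A (lshift n k) (lshift n l) = B (lshift n k) (lshift n l)) ->
  (forall k l, A (lshift n k) (rshift n l) = B (lshift n k) (rshift n l)) ->
  (forall k l, A (rshift n k) (lshift n l) = B (rshift n k) (lshift n l)) ->
  (forall k l, A (rshift n k) (rshift n l) = B (rshift n k) (rshift n l)) -> A = B.
Proof.
move=> H1 H2 H3 H4; apply/matrixP => i j.
by case: (split_ordP i) => k ->; case: (split_ordP j) => l ->.
Qed.

Lemma jac_nulam w : jac (fun k w => nu w k) (fun k w => lam w k) w *m symJ R n *m
  (jac (fun k w => nu w k) (fun k w => lam w k) w)^T = symJ R n.
Proof.
apply: mx_split2 => k l.
- rewrite (jac_br (w := w) (f := fun w => nu w k) (g := fun w => nu w l)); try by move=> i; rewrite jacl.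
  by rewrite br_nu_nu// /symJ block_mxEul mxE.
- rewrite (jac_br (w := w) (f := fun w => nu w k) (g := fun w => lam w l)); [|by move=> i; rewrite jacl|by move=> i; rewrite jacr].
  by rewrite brC br_lam_nu// opprK /symJ block_mxEur mxE eq_sym.
- rewrite (jac_br (w := w) (f := fun w => lam w k) (g := fun w => nu w l)); [|by move=> i; rewrite jacr|by move=> i; rewrite jacl].
  by rewrite br_lam_nu// /symJ block_mxEdl !mxE.
- rewrite (jac_br (w := w) (f := fun w => lam w k) (g := fun w => lam w l)); try by move=> i; rewrite jacr.
  by rewrite br_lam_lam// /symJ block_mxEdr mxE.
Qed.

(** By [two_form] the Jacobians of [(nu, lam)] and of [(Xf, Yf)] pull the standard form back to the
    same form, and the former is symplectic by the brackets of the separated variables. *)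
Theorem jac_XY w : jac Xf Yf w *m symJ R n *m (jac Xf Yf w)^T = symJ R n.
Proof.
have E : (jac Xf Yf w)^T *m symJ R n *m jac Xf Yf w = symJ R n.
  rewrite -[RHS](sym_trmx (jac_nulam w)); apply/matrixP => i j; rewrite !jac_form.
  by rewrite -two_form.
by have := @sym_trmx R n (jac Xf Yf w)^T; rewrite trmxK; exact.
Qed.

Lemma br_XX k l w : br (Xf k) (Xf l) w = 0.
Proof.
rewrite -(jac_br (w := w) (i := lshift n k) (j := lshift n l) (M := jac Xf Yf w)); try by move=> i; rewrite jacl.
by rewrite jac_XY /symJ block_mxEul mxE.
Qed.

Lemma br_YY k l w : br (Yf k) (Yf l) w = 0.
Proof.
rewrite -(jac_br (w := w) (i := rshift n k) (j := rshift n l) (M := jac Xf Yf w)); try by move=> i; rewrite jacr.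
by rewrite jac_XY /symJ block_mxEdr mxE.
Qed.

Lemma br_XY k l w : br (Xf k) (Yf l) w = (k == l)%:R.
Proof.
rewrite -(jac_br (w := w) (i := lshift n k) (j := rshift n l) (M := jac Xf Yf w)); [|by move=> i; rewrite jacl|by move=> i; rewrite jacr].
by rewrite jac_XY /symJ block_mxEur mxE.
Qed.

End BirkhoffMap.

(** * Global inversion *)

Section ProperLocalDiffeo.
Variables (R : realType).

(** Bolzano-Weierstrass for a property that tightens with [d], phrased with filters so that no
    sequence has to be chosen. *)
Lemma box_cluster (I : finType) (B : R) (P : R -> (I -> R) -> Prop) :
  (forall d d' y, d' <= d -> P d' y -> P d y) ->
  (forall d, 0 < d -> exists2 y, box (fun=> 0) (fun=> B) y & P d y) ->
  exists y0, forall d, 0 < d -> exists2 y, box y0 (fun=> d) y & P d y.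
Proof.
move=> Pm HP.
pose D : set R := [set d | 0 < d].
pose E (d : R) : set (I -> R) := [set y | box (fun=> 0) (fun=> B) y /\ P d y].
have FF : ProperFilter (filter_from D E).
  apply: filter_from_proper; last by move=> d /HP[y]; exists y.
  apply: filter_from_filter; first by exists 1; rewrite /D/=.
  move=> d1 d2 d10 d20; exists (Num.min d1 d2); first by rewrite /D/= lt_min; apply/andP.
  by move=> y [yb yP]; split; split=> //; apply: Pm yP; rewrite ge_min lexx ?orbT.
have cA := @tychonoff I (fun=> R : topologicalType) (fun=> `[- B, B]%classic)
  (fun i => @segment_compact R _ _).
have FA : filter_from D E [set c | forall i, `[- B, B]%classic (c i)].
  exists 1; first exact: ltr01.
  by move=> y [yb _] i; have := yb i; rewrite subr0 /= in_itv /= ler_norml.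
have [a [_ clF]] := cA _ FF FA.
exists a => d d0.
have FE : filter_from D E (E d) by exists d.
have [c [[_ cP] ca]] := clF _ _ FE (nbhs_ptws id a d0).
by exists c => // i; rewrite distrC; exact: ca.
Qed.

(** Connectedness of the unit segment, read off from the supremum of the parameters where [P]
    holds. *)
Lemma segment_induction (P : R -> Prop) : P 0 ->
  (forall t, 0 <= t <= 1 -> P t -> exists2 d, 0 < d & forall s, 0 <= s <= 1 -> `|s - t| <= d -> P s) ->
  (forall t, 0 <= t <= 1 -> (forall d, 0 < d -> exists2 s, 0 <= s <= 1 & `|s - t| <= d /\ P s) -> P t) ->
  P 1.
Proof.
move=> P0 Po Pc.
pose A : set R := [set t | 0 <= t <= 1 /\ P t].
have A0 : A 0 by split=> //; rewrite lexx ler01.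
have hsA : has_sup A by split; [exists 0|exists 1 => t [/andP[]]].
pose t := sup A.
have tU s : A s -> s <= t by move=> As; exact: sup_upper_bound hsA _ As.
have t01 : 0 <= t <= 1.
  by rewrite tU//=; apply: (ge_sup (ex_intro _ 0 A0)) => s [/andP[]].
have Pt : P t.
  apply: Pc => // d d0.
  have [s [s01 Ps] ts] := sup_adherent d0 hsA; exists s => //; split=> //.
  by have := tU s (conj s01 Ps); rewrite ler_norml -/t in ts *; move=> h; apply/andP; split; lra.
have [d d0 Hd] := Po t t01 Pt.
have [t1|t1] := leP 1 t.
  by have -> : 1 = t by apply/eqP; rewrite eq_le t1; case/andP: t01.
have s1 : Num.min 1 (t + d) <= t.
  have h : 0 <= Num.min 1 (t + d) <= 1.
    apply/andP; split; last by rewrite ge_min lexx.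
    by rewrite le_min ler01 /=; case/andP: t01 => t0 _; lra.
  apply: tU; split=> //; apply: Hd => //; rewrite ler_norml; apply/andP; split.
    by rewrite lerBrDl le_min; apply/andP; split; lra.
  by rewrite lerBlDl ge_min lexx orbT.
have : t < Num.min 1 (t + d) by rewrite lt_min t1 ltrDl.
by rewrite ltNge s1.
Qed.

Variables (I : finType).
Implicit Types (x y w : I -> R).

Lemma ana_vec_cts (Y : (I -> R) -> I -> R) y0 d : (forall j, ana (fun y => Y y j) y0) -> 0 < d ->
  exists2 d', 0 < d' & forall y, box y0 (fun=> d') y -> box (Y y0) (fun=> d) (Y y).
Proof. by move=> aY d0; apply: (nearby_all (fun j => ana_cts (aY j) d0)). Qed.

Definition seg (a b : I -> R) (t : R) : I -> R := fun i => a i + t * (b i - a i).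

Lemma seg_near a b : exists2 K : R, 0 < K & forall t s d, `|s - t| <= d -> box (seg a b t) (fun=> K * d) (seg a b s).
Proof.
exists (1 + \sum_i `|b i - a i|); first by rewrite ltr_wpDr// sumr_ge0.
move=> t s d sd i; rewrite /seg.
have -> : a i + s * (b i - a i) - (a i + t * (b i - a i)) = (b i - a i) * (s - t) by ring.
rewrite normrM ler_pM//; rewrite (bigD1 i)//= addrCA lerDl addr_ge0//; exact: sumr_ge0.
Qed.

Lemma box_sub x (d d' : R) y : d <= d' -> box x (fun=> d) y -> box x (fun=> d') y.
Proof. by move=> dd H i; exact: le_trans (H i) dd. Qed.

Variable Ph : (I -> R) -> I -> R.
Hypothesis aPh : forall j w, ana (fun w => Ph w j) w.
Hypothesis loc : forall w0, exists Y : (I -> R) -> I -> R, [/\ forall j, ana (fun y => Y y j) (Ph w0),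
  Y (Ph w0) = w0, nearby (Ph w0) (fun y => Ph (Y y) = y) &
  nearby w0 (fun w => w = Y (Ph w))].
Hypothesis proper : forall M, exists B, forall w, box (fun=> 0) (fun=> M) (Ph w) -> box (fun=> 0) (fun=> B) w.
Hypothesis one0 : forall w w', (forall i, Ph w i = 0) -> (forall i, Ph w' i = 0) -> w = w'.

Lemma Ph_lim w (y : I -> R) : (forall d, 0 < d -> exists2 w', box w (fun=> d) w' & box y (fun=> d) (Ph w')) -> Ph w = y.
Proof.
move=> H; apply/funext => i; apply/eqP; rewrite -subr_eq0 -normr_le0; apply/ler_addgt0Pr => e e0.
rewrite add0r; have e2 : 0 < e / 2 by rewrite divr_gt0.
have [d d0 Hd] := ana_vec_cts (fun j => aPh j w) e2.
have m0 : 0 < Num.min d (e / 2) by rewrite lt_min d0.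
have [w' ww yw] := H _ m0.
have h1 : `|Ph w' i - Ph w i| <= e / 2 by apply: Hd; apply: box_sub ww; rewrite ge_min lexx.
have h2 : `|Ph w' i - y i| <= e / 2 by apply: le_trans (yw i) _; rewrite ge_min lexx orbT.
have -> : Ph w i - y i = (Ph w' i - y i) - (Ph w' i - Ph w i) by ring.
by apply: le_trans (ler_normB _ _) _; lra.
Qed.

Lemma seg_bounded a b : exists M : R, forall t (y : I -> R), 0 <= t <= 1 -> box (seg a b t) (fun=> 1) y -> box (fun=> 0) (fun=> M) y.
Proof.
exists (1 + \sum_i (`|a i| + `|b i - a i|)) => t y /andP[t0 t1] yb i; rewrite subr0.
have := yb i; rewrite /seg => h.
have -> : y i = (y i - (a i + t * (b i - a i))) + (a i + t * (b i - a i)) by ring.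
apply: le_trans (ler_normD _ _) _; apply: lerD => //.
apply: le_trans (ler_normD _ _) _; rewrite (bigD1 i)//=.
have hs : 0 <= \sum_(j | j != i) (`|a j| + `|b j - a j|) by apply: sumr_ge0 => j _; exact: addr_ge0.
apply: le_trans (_ : _ <= `|a i| + `|b i - a i|) _; last by rewrite lerDl.
rewrite lerD2l normrM (ger0_norm t0); exact: ler_piMl.
Qed.

(** Continuation along the segment from a value that is attained to [y]: attained parameters form an
    open set by the local inverses, and a closed one because properness makes preimages cluster. *)
Lemma Ph_surj y : exists w, Ph w = y.
Proof.
pose a := Ph (fun=> 0).
have [K K0 HK] := seg_near a y; have [M HM] := seg_bounded a y; have [B HB] := proper M.
have E1 : seg a y 1 = y by apply/funext => i; rewrite /seg mul1r addrC subrK.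
rewrite -E1; apply: (@segment_induction (fun t => exists w, Ph w = seg a y t)).
- by exists (fun=> 0); apply/funext => i; rewrite /seg mul0r addr0.
- move=> t _ [w Hw]; have [Y [_ _ [d d0 Hd] _]] := loc w.
  exists (d / K); first exact: divr_gt0.
  move=> s _ st; exists (Y (seg a y s)); apply: Hd; rewrite Hw.
  by have := HK _ _ _ st; rewrite mulrCA divff ?gt_eqF// mulr1.
- move=> t t01 H.
  have [|d d0|w Hw] := @box_cluster I B (fun d w => box (seg a y t) (fun=> K * d) (Ph w) /\ box (seg a y t) (fun=> 1) (Ph w)).
  + move=> d d' w dd [h1 h2]; split=> //; apply: box_sub h1; rewrite ler_pM2l//.
  + have m0 : 0 < Num.min d K^-1 by rewrite lt_min d0 invr_gt0.
    have [s s01 [st [w Hw]]] := H _ m0.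
    have h1 : box (seg a y t) (fun=> 1) (Ph w).
      rewrite Hw; apply: box_sub (HK _ _ _ st); apply: (@le_trans _ _ (K * K^-1)); last by rewrite mulfV ?gt_eqF.
      by rewrite ler_pM2l// ge_min lexx orbT.
    exists w; first by apply: HB; apply: HM h1.
    by split=> //; rewrite Hw; apply: box_sub (HK _ _ _ st); rewrite ler_pM2l// ge_min lexx.
  exists w; apply: Ph_lim => d d0.
  have m0 : 0 < Num.min d (d / K) by rewrite lt_min d0 divr_gt0.
  have [w' h1 [h2 _]] := Hw _ m0; exists w'.
    by apply: box_sub h1; rewrite ge_min lexx.
  apply: box_sub h2; apply: (@le_trans _ _ (K * (d / K))); last by rewrite mulrCA divff ?gt_eqF// mulr1.
  by rewrite ler_pM2l// ge_min lexx orbT.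
Qed.

(** Uniqueness of preimages is continued along the segment from the origin to the common value.
    Closedness: two different preimages would persist under the local inverses. Openness: otherwise
    pairs of different points with equal images would cluster, by properness, at preimages of one
    parameter where these coincide, against local injectivity. *)
Lemma Ph_inj w w' : Ph w = Ph w' -> w = w'.
Proof.
pose y := Ph w; pose a : I -> R := fun=> 0.
have [K K0 HK] := seg_near a y; have [M HM] := seg_bounded a y; have [B HB] := proper M.
have E1 : seg a y 1 = y by apply/funext => i; rewrite /seg mul1r addrC subrK.
suff : forall w1 w2, Ph w1 = seg a y 1 -> Ph w2 = seg a y 1 -> w1 = w2.
  by move=> H E; apply: H; rewrite E1 /y.
apply: (@segment_induction (fun t => forall w1 w2, Ph w1 = seg a y t -> Ph w2 = seg a y t -> w1 = w2)).
- have E0 : seg a y 0 = fun=> 0 by apply/funext => i; rewrite /seg mul0r addr0.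
  by rewrite E0 => w1 w2 h1 h2; apply: one0 => i; rewrite ?h1 ?h2.
- move=> t t01 Pt; apply: contrapT => nH.
  have bad d : 0 < d -> exists s w1 w2, [/\ 0 <= s <= 1, `|s - t| <= d, Ph w1 = seg a y s, Ph w2 = seg a y s & w1 <> w2].
    move=> d0; apply: contrapT => nb; apply: nH; exists d => // s s01 st w1 w2 h1 h2.
    by apply: contrapT => ne; apply: nb; exists s, w1, w2.
  (* A pair of points is one point over the doubled index type, so that both cluster together. *)
  pose lft (z : I + I -> R) i := z (inl i); pose rgt (z : I + I -> R) i := z (inr i).
  have [|d d0|z Hz] := @box_cluster (I + I)%type B (fun d z => [/\ box (seg a y t) (fun=> K * d) (Ph (lft z)), Ph (lft z) = Ph (rgt z) & lft z <> rgt z]).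
  + move=> d d' z dd [h1 h2 h3]; split=> //; apply: box_sub h1; rewrite ler_pM2l//.
  + have m0 : 0 < Num.min d K^-1 by rewrite lt_min d0 invr_gt0.
    have [s [w1 [w2 [s01 st h1 h2 ne]]]] := bad _ m0.
    have hb : box (seg a y t) (fun=> 1) (seg a y s).
      apply: box_sub (HK _ _ _ st); apply: (@le_trans _ _ (K * K^-1)); last by rewrite mulfV ?gt_eqF.
      by rewrite ler_pM2l// ge_min lexx orbT.
    exists (sext w1 w2).
      by case=> i; apply: HB; [rewrite h1|rewrite h2]; exact: HM hb.
    split=> //; last by rewrite -[lft _]/w1 -[rgt _]/w2 h1 h2.
    by rewrite -[lft _]/w1 h1; apply: box_sub (HK _ _ _ st); rewrite ler_pM2l// ge_min lexx.
  have small d : 0 < d -> exists2 d', 0 < d' & d' <= d /\ K * d' <= d.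
    move=> d0; exists (Num.min d (d / K)); first by rewrite lt_min d0 divr_gt0.
    split; first by rewrite ge_min lexx.
    apply: (@le_trans _ _ (K * (d / K))); last by rewrite mulrCA divff ?gt_eqF// mulr1.
    by rewrite ler_pM2l// ge_min lexx orbT.
  have EL : Ph (lft z) = seg a y t.
    apply: Ph_lim => d d0; have [d' d'0 [dd Kd]] := small d d0.
    have [z' bz [h1 _ _]] := Hz _ d'0; exists (lft z'); last exact: box_sub h1.
    by move=> i; apply: le_trans (bz (inl i)) dd.
  have ER : Ph (rgt z) = seg a y t.
    apply: Ph_lim => d d0; have [d' d'0 [dd Kd]] := small d d0.
    have [z' bz [h1 h2 _]] := Hz _ d'0; exists (rgt z'); last by rewrite -h2; exact: box_sub h1.
    by move=> i; apply: le_trans (bz (inr i)) dd.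
  have LR := Pt _ _ EL ER.
  have [Y [_ _ _ [d d0 Hd]]] := loc (lft z).
  have [z' bz [_ h2 h3]] := Hz _ d0; apply: h3.
  rewrite (Hd (lft z')); last by move=> i; exact: (bz (inl i)).
  rewrite [RHS](Hd (rgt z')) ?h2//.
  by rewrite LR => i; exact: (bz (inr i)).
- move=> t t01 H w1 w2 h1 h2.
  have [Y1 [aY1 Y1w [d1 d10 Hd1] _]] := loc w1.
  have [Y2 [aY2 Y2w [d2 d20 Hd2] _]] := loc w2.
  apply/funext => i; apply/eqP; rewrite -subr_eq0 -normr_le0; apply/ler_addgt0Pr => e e0.
  rewrite add0r; have e2 : 0 < e / 2 by rewrite divr_gt0.
  have [d3 d30 Hd3] := ana_vec_cts aY1 e2; have [d4 d40 Hd4] := ana_vec_cts aY2 e2.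
  pose d := Num.min (Num.min d1 d2) (Num.min d3 d4).
  have d0 : 0 < d by rewrite !lt_min d10 d20 d30 d40.
  have [s s01 [st Ps]] := H (d / K) (divr_gt0 d0 K0).
  have sb : box (seg a y t) (fun=> d) (seg a y s).
    by have := HK _ _ _ st; rewrite mulrCA divff ?gt_eqF// mulr1.
  have EY : Y1 (seg a y s) = Y2 (seg a y s).
    apply: Ps; [apply: Hd1; rewrite h1|apply: Hd2; rewrite h2]; apply: box_sub sb; rewrite /d !ge_min lexx ?orbT//.
  have n1 : `|Y1 (seg a y s) i - w1 i| <= e / 2.
    by rewrite Y1w in Hd3; apply: Hd3; rewrite h1; apply: box_sub sb; rewrite /d !ge_min lexx ?orbT.
  have n2 : `|Y2 (seg a y s) i - w2 i| <= e / 2.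
    by rewrite Y2w in Hd4; apply: Hd4; rewrite h2; apply: box_sub sb; rewrite /d !ge_min lexx ?orbT.
  have -> : w1 i - w2 i = (Y2 (seg a y s) i - w2 i) - (Y1 (seg a y s) i - w1 i) by rewrite EY; ring.
  by apply: le_trans (ler_normB _ _) _; lra.
Qed.

Theorem proper_local_diffeo : exists Ps : (I -> R) -> I -> R, [/\ forall w, Ps (Ph w) = w,
  forall y, Ph (Ps y) = y & forall j y, ana (fun y => Ps y j) y].
Proof.
have [Ps HPs] := choice Ph_surj; exists Ps.
have K w : Ps (Ph w) = w by apply: Ph_inj; exact: HPs.
split=> // j y; have [Y [aY Yw Hn _]] := loc (Ps y); rewrite HPs in aY Yw Hn.
by apply: ana_near (aY j) _; apply: nearbyS Hn => z Hz; rewrite -{2}Hz K.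
Qed.

End ProperLocalDiffeo.

(** * Energy and the roots of the discriminant *)

Section TodaEnergy.
Variables (R : realType) (n : nat).
Local Notation P := ('I_(n + n) -> R).
Implicit Types (w : P).

(** The bonds [k = 0, ..., n] of the chain with both ends fixed at 0: the left end is the case
    [k = 0], the right end is the default value of [qn] at [n]. *)
Definition ek k w : R := (if k is k'.+1 then qn w k' else 0) - qn w k.
Definition Ht w : R := 2^-1 * \sum_(k < n) pn w k ^+ 2 + \sum_(k < n.+1) expR (ek k w).

Lemma sum_sym2 (g : nat -> R) : \sum_(0 <= k < n + n) g k = \sum_(k < n) (g k + g (n + n - k.+1)%N).
Proof.
rewrite (big_cat_nat (n := n)) ?leq_addr//= big_split -[X in _ = X + _](big_mkord xpredT g).
congr (_ + _); rewrite big_nat_rev -{1}[n]add0n big_addn addnK big_mkord.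
by apply: eq_bigr => i _; congr g; lia.
Qed.

Lemma sum_sym (f : nat -> R) : \sum_(0 <= k < n.+1 + n) f k = \sum_(k < n) (f k + f (n + n - k)%N) + f n.
Proof.
rewrite (big_cat_nat (n := n.+1)) ?leq_addr//= big_nat_recr//= big_split /= -[X in _ = X + _ + _](big_mkord xpredT f).
rewrite -!addrA; congr (_ + _); rewrite addrC; congr (_ + _).
rewrite big_nat_rev -{1}[n.+1]add0n big_addn [(n.+1 + n - n.+1)%N]addKn big_mkord.
by apply: eq_bigr => i _; congr f; lia.
Qed.

Lemma mu_mirror w j : (j <= n + n)%N -> mu w (n + n - j) = mv w j.
Proof.
move=> jn; rewrite /mu /mv /mirror.
have -> : (n + n - j < n)%N = (n < j)%N by apply/idP/idP; lia.
have -> : (n + n - j == n)%N = (j == n) by apply/eqP/eqP; lia.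
by case: (ltngtP j n) => // jn'; congr vw; lia.
Qed.

Lemma sum_mp w : \sum_(0 <= k < n.+1 + n) mp w k = 0.
Proof.
rewrite sum_sym big1 ?add0r; first by rewrite /mp /mirror ltnn eqxx.
move=> k _; rewrite /mp /mirror ltn_ord.
have kn := ltn_ord k.
have -> : (n + n - k < n)%N = false by apply/negbTE; lia.
have -> : (n + n - k == n)%N = false by apply/negbTE; lia.
by have -> : (n + n - (n + n - k))%N = k by [lia]; rewrite subrr.
Qed.

Lemma sum_mp2 w : \sum_(0 <= k < n.+1 + n) mp w k ^+ 2 = 2 * \sum_(k < n) pn w k ^+ 2.
Proof.
rewrite sum_sym /mp /mirror ltnn eqxx expr0n addr0 mulr_sumr; apply: eq_bigr => k _.
rewrite ltn_ord; have kn := ltn_ord k.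
have -> : (n + n - k < n)%N = false by apply/negbTE; lia.
have -> : (n + n - k == n)%N = false by apply/negbTE; lia.
by have -> : (n + n - (n + n - k))%N = k by [lia]; rewrite sqrrN; ring.
Qed.

Lemma vw_n w : vw w n = 1.
Proof. by rewrite /vw /qn insubF ?ltnn// oppr0 expR0. Qed.

Lemma sum_muv w : \sum_(0 <= k < n + n) mu w k * mv w k.+1 = 2 * \sum_(k < n) expR (ek k.+1 w).
Proof.
rewrite sum_sym2 mulr_sumr; apply: eq_bigr => k _; have kn := ltn_ord k.
have -> : (n + n - k.+1).+1 = (n + n - k)%N by lia.
rewrite mu_mirror; last by lia.
have -> : mv w (n + n - k) = mu w k by rewrite -mu_mirror ?leq_subr//; congr mu; lia.
have H : mu w k * mv w k.+1 = expR (ek k.+1 w).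
  rewrite /ek expRD -/(uw w k) -/(vw w k.+1) /mu /mv /mirror kn; congr (_ * _).
  case: ltngtP => [//|h|->]; [lia|by rewrite vw_n].
by rewrite H [mv _ _ * _]mulrC H; ring.
Qed.

Hypothesis n0 : (0 < n)%N.

(** The momenta of the doubled chain cancel in pairs, which kills the square of their sum. The
    coefficient from [a] contains each bond [k >= 1] twice; the bond 0, which closes the chain
    periodically, comes from [b] through [mu w (n + n)]. *)
Lemma hc_Ht w : hc w n.-1 = - (2 * Ht w).
Proof.
have [_ C1 C2 _] := rowp_coef (mu w) (mv w) (mp w) (n.+1 + n).
have h2 : (2 <= n.+1 + n)%N by lia.
have h1 : (1 <= n.+1 + n)%N by lia.
rewrite /hc pD_coef.
have -> : (n.-1.*2.+1 = (n.+1 + n).-2)%N by lia.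
have -> : (n.-1.+1.*2 = (n.+1 + n).-1)%N by lia.
rewrite [(pa w)`__](C1 h2) [(pb w)`__](C2 h1) sum_mp sum_mp2 /= sum_muv.
have -> : mu w (n + n) = expR (ek 0 w).
  rewrite -[(n + n)%N]subn0 mu_mirror// /mv /mirror n0 /ek sub0r//.
by rewrite /Ht big_ord_recl /=; field.
Qed.

Lemma sum_gr w : \sum_(0 <= k < n.+1) gr w k = 2 * Ht w.
Proof.
have [H _ _] := grP w.
have E := monic_factor (pD_monic w) (pD_size w) (@gr_incr R n w) H.
have := hc_Ht w; rewrite /hc prednK// E.
pose rs := [seq gr w i | i <- index_iota 0 n.+1].
have -> : \prod_(0 <= i < n.+1) ('X - (gr w i)%:P) = \prod_(z <- rs) ('X - z%:P) by rewrite big_map.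
have sr : size rs = n.+1 by rewrite size_map size_iota subn0.
have := @coefPn_prod_XsubC R rs; rewrite sr => /(_ isT) /= => ->.
by rewrite big_map => /oppr_inj.
Qed.

Lemma Ht_le w r : gr w n <= r -> 2 * Ht w <= n.+1%:R * r.
Proof.
move=> Hr; rewrite -sum_gr big_mkord mulr_natl.
have -> : r *+ n.+1 = \sum_(i < n.+1) r by rewrite sumr_const card_ord.
apply: ler_sum => i _.
by apply: le_trans Hr; apply: (incr_le (@gr_incr R n w)); rewrite -ltnS ltn_ord ltnSn.
Qed.

(** The product of the positive roots is [|D(0)| = 2], so they cannot all exceed 2. *)
Lemma gr0_le w : gr w 0 <= 2.
Proof.
have r0 := gr_gt0 w (leq0n n).
have : `|(pD w).[0]| = 2 by rewrite pD0 normrM normr_nat normr_sign mulr1.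
rewrite pD_factor big_mkord normr_prod => E.
rewrite leNgt; apply/negP => r2.
have h i : (i < n.+1)%N -> 2 < gr w i.
  move=> im; apply: lt_le_trans r2 _; apply: (incr_le (@gr_incr R n w)); exact: im.
have : 2 < \prod_(i < n.+1) `|0 - gr w i|.
  rewrite big_ord_recl; apply: (@lt_le_trans _ _ (`|0 - gr w 0| * 1)).
    by rewrite mulr1 sub0r normrN gtr0_norm.
  rewrite ler_wpM2l//; apply: (big_ind (fun x => 1 <= x)) => // [x y hx hy|i _]; first exact: mulr_ege1.
  rewrite sub0r normrN gtr0_norm; last by have := h (lift ord0 i) (ltn_ord _); lra.
  by have := h (lift ord0 i) (ltn_ord _); lra.
by rewrite E ltxx.
Qed.

End TodaEnergy.

(** * The actions bound the lengths of the gaps *)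

Section GapArea.
Variables (R : realType) (n : nat).
Local Notation P := ('I_(n + n) -> R).
Local Notation e_ := (eps R n).
Local Notation twopi := (2 * (pi : R)).
Implicit Types (w : P).

Lemma prim_le (a b : R) f F : a <= b -> prim_on a b f F -> (forall t, a <= t <= b -> 0 <= f t) -> F a <= F b.
Proof.
rewrite le_eqVlt => /orP[/eqP -> //|ab] HF f0.
have [c /andP[c1 c2] E] := prim_MVT ab HF.
rewrite -subr_ge0 E mulr_ge0 ?subr_ge0 ?(ltW ab)//.
by apply: f0; rewrite !ltW.
Qed.

Lemma prim_sub (a b a' b' : R) f F : a <= a' -> b' <= b -> prim_on a b f F -> prim_on a' b' f F.
Proof. by move=> h1 h2 H t /andP[t1 t2]; apply: H; rewrite (le_trans h1)// (le_trans t2). Qed.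

Lemma sqr_between (a x b : R) : 0 <= a -> a < x -> x < b -> a ^+ 2 < x ^+ 2 < b ^+ 2.
Proof.
move=> a0 ax xb; have x0 : 0 <= x by apply: le_trans a0 (ltW ax).
by rewrite !ltrXn2r.
Qed.

Lemma acn_ge0 k w : (k < n)%N -> 0 <= acn k w.
Proof. by move=> kn; rewrite acn_rho// mulr_ge0 ?rho2_ge0// ltW// Jf_gt0. Qed.

(** In the variable [x] every root is at distance at least [L / 4 >= 2], so each of the [n.+1 >= 2]
    factors has modulus at least 4. The value 6 is what [gs_disc] needs for [wV ^+ 2 >= 1] on the
    loop. *)
Lemma pD_large k w (x L : R) : (0 < n)%N -> (k < n)%N -> 8 <= L ->
  Num.sqrt (gr w k) + L / 4 <= x <= Num.sqrt (gr w k.+1) - L / 4 -> 6 <= e_ k * (pD w).[x ^+ 2].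
Proof.
move=> n0 kn L8 /andP[x1 x2]; have s0 j : 0 <= Num.sqrt (gr w j) by exact: sqrtr_ge0.
have sq j : (j <= n)%N -> Num.sqrt (gr w j) ^+ 2 = gr w j by move=> jn; rewrite sqr_sqrtr// ltW// gr_gt0.
have sm i j : (i <= j <= n)%N -> Num.sqrt (gr w i) <= Num.sqrt (gr w j).
  by move=> ij; apply: ler_wsqrtr; apply: (incr_le (@gr_incr R n w)).
have x0 : 0 <= x by have := s0 k; lra.
have xo : gr w k < x ^+ 2 < gr w k.+1.
  rewrite -(sq k (ltnW kn)) -(sq k.+1 kn); apply: sqr_between => //; lra.
have D0 := pD_gt0 kn xo.
have -> : e_ k * (pD w).[x ^+ 2] = `|(pD w).[x ^+ 2]|.
  by rewrite -[LHS]gtr0_norm// normrM /eps normr_sign mul1r.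
rewrite pD_factor big_mkord normr_prod.
have F4 (i : 'I_n.+1) : 4 <= `|x ^+ 2 - gr w i|.
  have im : (i <= n)%N by rewrite -ltnS.
  have -> : x ^+ 2 - gr w i = (x - Num.sqrt (gr w i)) * (x + Num.sqrt (gr w i)) by rewrite -{1}(sq i im); ring.
  rewrite normrM (_ : 4 = 2 * 2 :> R); last by ring.
  apply: ler_pM => //; last by rewrite ger0_norm ?addr_ge0//; have := s0 i; have := s0 k; lra.
  have [ik|ki] := leqP i k.
    have h : Num.sqrt (gr w i) <= Num.sqrt (gr w k) by apply: sm; rewrite ik ltnW.
    by rewrite ger0_norm; lra.
  have h : Num.sqrt (gr w k.+1) <= Num.sqrt (gr w i) by apply: sm; rewrite ki.
  by rewrite ler0_norm; lra.
apply: (@le_trans _ _ (\prod_(i < n.+1) 4)); last by apply: ler_prod => i _; rewrite F4 ler0n.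
rewrite prodr_const card_ord; apply: (@le_trans _ _ (4 ^+ 2)); first by rewrite expr2; lra.
by apply: ler_weXn2l; rewrite ?ler1n.
Qed.

(* Over an angle interval on which [wV] is at least 1 the loop encloses at
   least half of the gap. *)
Lemma acn_area k w : (0 < n)%N -> (k < n)%N ->
  Num.sqrt (gr w k.+1) - Num.sqrt (gr w k) <= 8 + 4 * pi * acn k w.
Proof.
move=> n0 kn; have a0 := acn_ge0 w kn; have p0 := pi_gt0 R.
set L := Num.sqrt (gr w k.+1) - Num.sqrt (gr w k).
have [L8|L8] := leP L 8.
  by apply: le_trans L8 _; rewrite lerDl; apply: mulr_ge0 => //; rewrite mulr_ge0// ltW.
have L8' := ltW L8.
(* The middle half of the gap, at the distance from both ends that [pD_large] requires. *)
pose x1 := Num.sqrt (gr w k) + L / 4; pose x2 := Num.sqrt (gr w k.+1) - L / 4.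
have s0 j : 0 <= Num.sqrt (gr w j) by exact: sqrtr_ge0.
have x21 : x2 - x1 = L / 2 by rewrite /x1 /x2 /L; field.
have big x : x1 <= x <= x2 -> 6 <= e_ k * (pD w).[x ^+ 2] by exact: pD_large.
have sq j : (j <= n)%N -> Num.sqrt (gr w j) ^+ 2 = gr w j by move=> jn; rewrite sqr_sqrtr// ltW// gr_gt0.
have og x : x1 <= x <= x2 -> ogap w k (x ^+ 2).
  move=> /andP[h1 h2]; split=> //; rewrite -{1}(sq k (ltnW kn)) -(sq k.+1 kn).
  by rewrite /x1 in h1; rewrite /x2 in h2; apply: sqr_between => //; lra.
pose u x := gY k (oext w (x ^+ 2)).
have gsu x : x1 <= x <= x2 -> gs k (oext w (u x)) = x.
  move=> hx; have [_ E] := gT_uniq (og x hx); rewrite /gs E sqrtr_sqr ger0_norm//.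
  by case/andP: hx => h _; rewrite /x1 in h; have := s0 k; lra.
have u2 x : x1 <= x <= x2 -> u x ^+ 2 <= rho2 w k - 1.
  move=> hx; have := gY_sqr (ogapW (og x hx)); have := big x hx; rewrite -/(u x) /rho2; lra.
have [r [th [r0 EU EV]]] := polar (Uf k w) (Vf k w).
have r2 : r ^+ 2 = rho2 w k.
  by rewrite -UV_rho// EU EV; have := cos2Dsin2 th => H; rewrite -[LHS]mulr1 -H; ring.
have hx1 : x1 <= x1 <= x2 by rewrite lexx -subr_ge0 x21 divr_ge0// (le_trans _ L8').
have hx2 : x1 <= x2 <= x2 by rewrite lexx andbT -subr_ge0 x21 divr_ge0// (le_trans _ L8').
have rp : 0 < r.
  rewrite lt_neqAle r0 andbT; apply/eqP => E; have := u2 _ hx1; rewrite -r2 -E expr0n /=.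
  by have := sqr_ge0 (u x1); lra.
have HU s : wU k (oext w s) = r * sin (th + s).
  by rewrite /wU /lU -[oproj _]/w /= EU EV sinD; ring.
have HV s : wV k (oext w s) = r * cos (th + s).
  by rewrite /wV /lV -[oproj _]/w /= EU EV cosD; ring.
have rdom s : gdom k (oext w (r * sin s)).
  split=> //=; rewrite -[oproj _]/w exprMn -r2.
  have : sin s ^+ 2 <= 1 by have := cos2Dsin2 s; have := sqr_ge0 (cos s); lra.
  move=> h; have : r ^+ 2 * sin s ^+ 2 <= r ^+ 2 * 1 by rewrite ler_wpM2l// sqr_ge0.
  have hp : (0:R) < 2^-1 by rewrite invr_gt0.
  by rewrite mulr1; lra.
pose H (v : option 'I_(n + n) -> R) := asnh (r * cos (v None)) * (gL k (oext (oproj v) (r * sin (v None))) * (r * cos (v None))).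
pose h s := H (oext w s).
have aw s (i : 'I_(n + n)) : ana (fun v : option 'I_(n + n) -> R => oproj v i) (oext w s) by exact: ana_coord.
have ars s : ana (fun v : option 'I_(n + n) -> R => r * sin (v None)) (oext w s).
  by apply: anaZ; apply: ana_sin; exact: ana_coord.
have arc s : ana (fun v : option 'I_(n + n) -> R => r * cos (v None)) (oext w s).
  by apply: anaZ; apply: ana_cos; exact: ana_coord.
have aH s : ana H (oext w s).
  apply: anaM; first exact: ana_asnh.
  apply: anaM => //.
  exact: (@ana_osub R _ _ (gL k) (fun i v => oproj v i) (fun v => r * sin (v None)) (oext w s) (ana_gL (rdom s)) (aw s) (ars s)).
have ch := ana_slice_cts aH; rewrite -/h in ch.
have pe : pi *+ 2 = twopi by rewrite mulr_natl.
have ph s : h (s + twopi) = h s by rewrite /h /H /= -[oproj (oext w s)]/w -pe cosD2pi sinD2pi.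
(* Turning the loop by its phase [th] and starting it at [- pi] puts the half turn with nonnegative
   cosine in the interior of the interval of integration. *)
have E1 : twopi * acn k w = NI 0 twopi (fun s => h (- pi + s)).
  rewrite NI_shift// -(NI_shift th ch ph) /acn /mean mulrA divff ?mul1r ?twopi_neq0//.
  apply: NI_eq => s _.
  rewrite (pdr_lgN kn (@acw _ _ w) (ana_Uf w kn) (ana_Vf w kn) (UV_lt w kn)).
  by rewrite /wf /lf /lz -/(wV k _) -/(wU k _) HU HV -[fun i => cw i _]/w /h /H /= -[oproj _]/w.
have [F HF] := prim_all ch p0.
have E2 : twopi * acn k w = F pi - F (- pi).
  rewrite E1 (@NIE _ 0 twopi _ (fun s => F (- pi + 1 * s))); [|exact: twopi_gt0|].
    by rewrite mul1r mulr0 addr0; congr (F _ - _); ring.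
  move=> s /andP[s1 s2]; have := @is_derive_refl_shift R F (- pi) 1 (h (- pi + s)) s.
  rewrite mulr1 mul1r; apply; apply: HF; apply/andP; split; lra.
have hge s : 0 <= h s.
  rewrite /h /H /=; have gp := gL_gt0 (rdom s); rewrite -[oproj _]/w.
  have [c0|c0] := leP 0 (cos s).
    have rc : 0 <= r * cos s by exact: mulr_ge0.
    by apply: mulr_ge0; [exact: asnh_ge0|apply: mulr_ge0 => //; exact: ltW].
  have rc : 0 <= - (r * cos s) by rewrite -mulrN mulr_ge0// oppr_ge0 ltW.
  have := asnh_ge0 rc; rewrite asnhN => hn.
  rewrite (_ : asnh _ * _ = - asnh (r * cos s) * (gL k (oext w (r * sin s)) * - (r * cos s))); last by ring.
  by apply: mulr_ge0 => //; apply: mulr_ge0 => //; exact: ltW.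
pose Q s := gs k (oext w (r * sin s)).
have DQ (s : R) : is_derive s 1 Q (gL k (oext w (r * sin s)) * (r * cos s)).
  have H1 := is_deriveZ r (is_derive_sin s).
  exact: (@is_derive1_comp _ (fun x => gs k (oext w x)) (fun s => r * sin s) s _ _ (ana_slice (ana_gs (rdom s))) H1).
have cpos s : - (pi / 2) <= s <= pi / 2 -> 0 <= gL k (oext w (r * sin s)) * (r * cos s).
  move=> hs; have gp := gL_gt0 (rdom s).
  by apply: mulr_ge0; [exact: ltW|apply: mulr_ge0 => //; exact: cos_ge0_pihalf].
have ux x : x1 <= x <= x2 -> -1 <= u x / r <= 1.
  move=> hx; have := u2 x hx; rewrite -r2 => h2.
  rewrite -ler_norml normrM normfV (ger0_norm r0) ler_pdivrMr// mul1r.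
  by rewrite -(@ler_pXn2r _ 2) ?nnegrE// real_normK ?num_real//; lra.
have Qa x : x1 <= x <= x2 -> Q (asin (u x / r)) = x.
  by move=> hx; rewrite /Q asinK ?in_itv/= ?ux// mulrC divfK ?gt_eqF// gsu.
(* The angles at which this half turn passes through [x1] and [x2]. On it [Q] is nondecreasing, so
   [Q] stays in the middle half of the gap between them. *)
pose a1 := asin (u x1 / r); pose b1 := asin (u x2 / r).
have ra : - (pi / 2) <= a1 <= pi / 2 by rewrite asin_geNpi2 ?asin_lepi2// ux.
have rb : - (pi / 2) <= b1 <= pi / 2 by rewrite asin_geNpi2 ?asin_lepi2// ux.
have Qmon a b : - (pi / 2) <= a -> b <= pi / 2 -> a <= b -> Q a <= Q b.
  move=> ha hb ab; apply: (@prim_le a b (fun s => gL k (oext w (r * sin s)) * (r * cos s))) => //.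
  by move=> t /andP[t1 t2]; apply: cpos; rewrite (le_trans ha)// (le_trans t2).
have ab : a1 <= b1.
  rewrite leNgt; apply/negP => ba.
  have : Q b1 <= Q a1 by apply: Qmon (ltW ba); [case/andP: rb|case/andP: ra].
  by rewrite !Qa//; lra.
have a1p : - pi <= a1 by case/andP: ra => h1 _; lra.
have b1p : b1 <= pi by case/andP: rb => _ h1; lra.
have I1 : F (- pi) <= F a1.
  apply: (@prim_le _ _ h) => //; apply: prim_sub HF => //; lra.
have I3 : F b1 <= F pi.
  apply: (@prim_le _ _ h) => //; apply: prim_sub HF => //; lra.
(* Between these angles [r cos s >= 1], so [nu >= 1] and [nu dlam] dominates [dlam]: the loop
   contributes at least [x2 - x1 = L / 2], whence the factor [4 pi] in the statement. *)
have I2 : F a1 - Q a1 <= F b1 - Q b1.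
  apply: (@prim_le a1 b1 (fun s => h s - gL k (oext w (r * sin s)) * (r * cos s)) (fun s => F s - Q s)) => //.
    move=> s /andP[s1 s2]; have hp : - pi <= s <= pi by apply/andP; split; lra.
    exact: (is_deriveB (HF s hp) (DQ s)).
  move=> s /andP[s1 s2].
  have hs : - (pi / 2) <= s <= pi / 2 by case/andP: ra => g1 _; case/andP: rb => _ g2; apply/andP; split; lra.
  have q1 : x1 <= Q s by rewrite -(Qa x1 hx1); apply: Qmon => //; [case/andP: ra|case/andP: hs].
  have q2 : Q s <= x2 by rewrite -(Qa x2 hx2); apply: Qmon => //; [case/andP: hs|case/andP: rb].
  have B6 : 6 <= e_ k * (pD w).[Q s ^+ 2] by apply: big; rewrite q1.
  have := gs_disc (rdom s); rewrite -/(Q s) -[oproj _]/w /= -r2 => E.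
  have rc : 0 <= r * cos s by apply: mulr_ge0 => //; exact: cos_ge0_pihalf.
  have c1 : 1 <= (r * cos s) ^+ 2.
    have -> : (r * cos s) ^+ 2 = r ^+ 2 - (r * sin s) ^+ 2.
      by have C := cos2Dsin2 s; rewrite -[r ^+ 2 in RHS]mulr1 -C; ring.
    by rewrite -E in B6; lra.
  have A1 := asnh_ge1 c1 rc.
  rewrite /h /H /= -[oproj _]/w subr_ge0; have := cpos s hs; set z := gL _ _ * _ => z0.
  by rewrite -[X in X <= _]mul1r; apply: ler_wpM2r.
rewrite !Qa// in I2.
have -> : 4 * pi * acn k w = 2 * (twopi * acn k w) by ring.
by rewrite E2; lra.
Qed.

End GapArea.

Section GlobalCoordinates.
Variables (R : realType) (n : nat).
Local Notation P := ('I_(n + n) -> R).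
Implicit Types (w : P).
Hypothesis n0 : (0 < n)%N.

Definition XY w (i : 'I_(n + n)) : R :=
  match fintype.split i with inl k => Xf k w | inr k => Yf k w end.

Lemma XYl w k : XY w (qi k) = Xf k w.
Proof. by rewrite /XY /qi (unsplitK (inl k : 'I_n + 'I_n)%type). Qed.

Lemma XYr w k : XY w (pi' k) = Yf k w.
Proof. by rewrite /XY /pi' (unsplitK (inr k : 'I_n + 'I_n)%type). Qed.

Lemma ana_XY j w : ana (fun w => XY w j) w.
Proof. by rewrite /XY; case: (fintype.split j) => k; [exact: ana_Xf|exact: ana_Yf]. Qed.

(** The actions are at most [M ^+ 2], so [S] bounds the length of each gap in the variable [x]. As
    the lowest root is at most 2, the highest is at most [r], and the energy, half the sum of the
    roots, is at most [C]. Bounded energy confines the chain between its fixed ends. *)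
Lemma XY_proper (M : R) : exists B, forall w, box (fun=> 0) (fun=> M) (XY w) -> box (fun=> 0) (fun=> B) w.
Proof.
pose S := 8 + 4 * pi * M ^+ 2 : R.
pose r := (2 + n%:R * S) ^+ 2 : R.
pose C := n.+1%:R * r : R.
have p0 := pi_gt0 R.
have S0 : 0 <= S by rewrite addr_ge0// mulr_ge0 ?sqr_ge0// mulr_ge0// ltW.
have C0 : 0 <= C by rewrite mulr_ge0// sqr_ge0.
exists (1 + C + n.+1%:R * C) => w wb.
have sqM (x : R) : `|x| <= M -> x ^+ 2 <= M ^+ 2.
  by move=> xM; rewrite -real_normK ?num_real//; apply: lerXn2r => //; rewrite nnegrE// (le_trans _ xM).
have aM k : (k < n)%N -> acn k w <= M ^+ 2.
  move=> kn; pose kk := Ordinal kn.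
  have h1 := sqM _ (wb (qi kk)); have h2 := sqM _ (wb (pi' kk)).
  by rewrite !subr0 XYl in h1; rewrite !subr0 XYr in h2; have := XY_acn kk w; rewrite /=; lra.
have sg k : (k <= n)%N -> Num.sqrt (gr w k) <= 2 + k%:R * S.
  elim: k => [|k IH] kn.
    have s0 : 0 <= Num.sqrt (gr w 0) by exact: sqrtr_ge0.
    have sE : Num.sqrt (gr w 0) ^+ 2 = gr w 0 by rewrite sqr_sqrtr// ltW// gr_gt0.
    have h := gr0_le w; rewrite mul0r addr0 -(@ler_pXn2r _ 2) ?nnegrE// sE.
    by apply: le_trans h _; rewrite expr2; lra.
  have := acn_area w n0 kn; have := aM k kn; have := IH (ltnW kn); rewrite -[k.+1]addn1 natrD => h1 h2 h3.
  have : 4 * pi * acn k w <= 4 * pi * M ^+ 2 by apply: ler_wpM2l => //; rewrite mulr_ge0// ltW.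
  by rewrite /S in h1 *; lra.
have HC : Ht w <= C.
  have gn : gr w n <= r.
    rewrite -[gr w n]sqr_sqrtr; last by apply: ltW; exact: gr_gt0.
    by apply: lerXn2r; rewrite ?nnegrE ?sqrtr_ge0// ?addr_ge0// ?mulr_ge0//; exact: sg.
  have := Ht_le n0 gn; rewrite -/C => h.
  have : 0 <= Ht w.
    apply: addr_ge0; last by apply: sumr_ge0 => i _; exact: expR_ge0.
    by rewrite mulr_ge0 ?invr_ge0// sumr_ge0// => i _; exact: sqr_ge0.
  lra.
have eC k : (k <= n)%N -> ek k w <= C.
  move=> kn; apply: le_trans HC; have := expR_ge1Dx (ek k w) => h.
  apply: (@le_trans _ _ (expR (ek k w))); first by lra.
  rewrite /Ht (bigD1 (Ordinal (kn : (k < n.+1)%N)))//= addrCA lerDl addr_ge0//.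
    by rewrite mulr_ge0 ?invr_ge0// sumr_ge0// => i _; exact: sqr_ge0.
  by apply: sumr_ge0 => i _; exact: expR_ge0.
have pC (k : 'I_n) : `|w (pi' k)| <= 1 + C.
  have : 2^-1 * w (pi' k) ^+ 2 <= C.
    apply: le_trans HC; rewrite /Ht (bigD1 k)//= pnE mulrDr -addrA lerDl addr_ge0//.
      by rewrite mulr_ge0 ?invr_ge0// sumr_ge0// => i _; exact: sqr_ge0.
    by apply: sumr_ge0 => i _; exact: expR_ge0.
  rewrite -(real_normK (num_real (w (pi' k)))) => h; have := sqr_ge0 (`|w (pi' k)| - 1); rewrite sqrrB1 => h2.
  by rewrite mulr2n in h2; lra.
(* The energy bounds every bond from above only; summing bonds from the left end bounds [q] from
   below, from the right end from above. *)
have qlo k : (k <= n)%N -> - qn w k <= k.+1%:R * C.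
  elim: k => [|k IH] kn; first by have := eC 0%N (leq0n n); rewrite /ek sub0r mul1r.
  have := eC k.+1 kn; have := IH (ltnW kn); rewrite /ek -[k.+2]addn1 natrD; lra.
have qhi m : (m <= n)%N -> qn w (n - m) <= m%:R * C.
  elim: m => [|m IH] mn; first by rewrite subn0 /qn insubF ?ltnn// mul0r.
  have h : (n - m = (n - m.+1).+1)%N by lia.
  have := eC (n - m.+1).+1; rewrite -h leq_subr => /(_ isT); rewrite h /ek.
  have E : m.+1%:R = m%:R + 1 :> R by rewrite -addn1 natrD.
  by have := IH (ltnW mn); rewrite h E; lra.
have nC (k m : nat) : (k <= m)%N -> k%:R * C <= m%:R * C by move=> km; rewrite ler_wpM2r// ler_nat.
have qC (k : 'I_n) : `|w (qi k)| <= n.+1%:R * C.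
  have kn := ltn_ord k.
  rewrite ler_norml -qnE; apply/andP; split.
    have := qlo k (ltnW kn); have := nC k.+1 n.+1; rewrite ltnS (ltnW kn) => /(_ isT); lra.
  have := qhi (n - k)%N (leq_subr _ _); rewrite subKn ?(ltnW kn)//.
  by have := nC (n - k)%N n.+1; rewrite leqW ?leq_subr// => /(_ isT); lra.
have nC0 : 0 <= n.+1%:R * C by rewrite mulr_ge0.
move=> i; rewrite subr0; case: (split_ordP i) => k ->.
  by have := qC k; rewrite /qi; lra.
by have := pC k; rewrite /pi'; lra.
Qed.

Lemma pdr_qn (k : nat) i w : pdr (qi i) (fun w => qn w k) w = (k == i :> nat)%:R.
Proof.
rewrite /qn; case: insubP => [j _ <-|kn]; first by rewrite pdr_coord (inj_eq (@lshift_inj n n)).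
rewrite pdr_cst; suff -> : (k == i) = false by [].
by apply/negbTE; apply: contraNneq kn => ->.
Qed.

Lemma ana_ek k w : ana (ek k) w.
Proof. by apply: anaB; last exact: ana_qn; case: k => [|k]; [exact: ana_const|exact: ana_qn]. Qed.

Lemma pdr_ek_q (k : nat) i w : pdr (qi i) (ek k) w = (k == i.+1 :> nat)%:R - (k == i :> nat)%:R.
Proof.
rewrite pdrB; [|by case: k => [|k]; [exact: ana_const|exact: ana_qn]|exact: ana_qn].
by rewrite pdr_qn; case: k => [|k]; rewrite ?pdr_cst// pdr_qn eqSS.
Qed.

Lemma pdr_Ht_q i w : pdr (qi i) (@Ht R n) w = expR (ek i.+1 w) - expR (ek i w).
Proof.
have ap (k : 'I_n) : ana (fun w : P => pn w k ^+ 2) w by apply: anaX; exact: ana_pn.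
have ae (k : 'I_n.+1) : ana (fun w => expR (ek k w)) w by apply: ana_expR; exact: ana_ek.
have as1 : ana (fun w : P => \sum_(k < n) pn w k ^+ 2) w by apply: ana_sum => k _; exact: ap.
rewrite pdrD; [|by apply: anaZ|by apply: ana_sum => k _; exact: ae].
rewrite pdrZ// pdr_sum; last by move=> k _; exact: ap.
rewrite big1 ?mulr0 ?add0r; last by move=> k _; apply: pdr_const_line => t; rewrite pn_shlq.
rewrite pdr_sum; last by move=> k _; exact: ae.
have pe (k : 'I_n.+1) : pdr (qi i) (fun w => expR (ek k w)) w = expR (ek k w) * ((k == i.+1 :> nat)%:R - (k == i :> nat)%:R).
  by rewrite (pdr_comp1 (qi i) (is_derive_expR _) (ana_ek k w)) pdr_ek_q.
have i1 : (i.+1 < n.+1)%N by rewrite ltnS.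
have i0 : (i < n.+1)%N by rewrite ltnW.
transitivity (\sum_(k < n.+1) (expR (ek k w) * (k == Ordinal i1)%:R - expR (ek k w) * (k == Ordinal i0)%:R)).
  by apply: eq_bigr => k _; rewrite pe mulrBr.
by rewrite sumrB !sum_delta.
Qed.

Lemma pdr_Ht_p i w : pdr (pi' i) (@Ht R n) w = pn w i.
Proof.
have ap (k : 'I_n) : ana (fun w : P => pn w k * pn w k) w by apply: anaM; exact: ana_pn.
have ae (k : 'I_n.+1) : ana (fun w => expR (ek k w)) w by apply: ana_expR; exact: ana_ek.
have as1 : ana (fun w : P => \sum_(k < n) pn w k * pn w k) w by apply: ana_sum => k _; exact: ap.
have E0 : pdr (pi' i) (@Ht R n) w = pdr (pi' i) (fun w => 2^-1 * (\sum_(k < n) pn w k * pn w k) + \sum_(k < n.+1) expR (ek k w)) w.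
  by apply: pdr_ext => v; rewrite /Ht; congr (_ * _ + _); apply: eq_bigr => k _; rewrite expr2.
rewrite E0 pdrD; [|by apply: anaZ|by apply: ana_sum => k _; exact: ae].
rewrite pdrZ// pdr_sum; last by move=> k _; exact: ap.
rewrite [X in _ + X]pdr_sum; last by move=> k _; exact: ae.
rewrite [X in _ + X]big1 ?addr0; last first.
  move=> k _; apply: pdr_const_line => t; congr expR; rewrite /ek qn_shlp.
  by case: (nat_of_ord k) => // m; rewrite qn_shlp.
have pp (k : 'I_n) : pdr (pi' i) (fun w : P => pn w k * pn w k) w = 2 * pn w k * (k == i)%:R.
  have Ep : pdr (pi' i) (fun w : P => pn w k) w = (k == i)%:R.
    rewrite (pdr_ext (g := fun w => w (pi' k))); last by move=> v; rewrite pnE.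
    by rewrite pdr_coord (inj_eq (@rshift_inj n n)).
  by rewrite pdrM ?Ep; [ring|exact: ana_pn|exact: ana_pn].
rewrite (eq_bigr (fun k : 'I_n => 2 * pn w k * (k == i)%:R)); last by move=> k _; rewrite pp.
by rewrite sum_delta; field.
Qed.

Lemma ana_Ht w : ana (@Ht R n) w.
Proof.
apply: anaD.
  by apply: anaZ; apply: ana_sum => k _; apply: anaX; exact: ana_pn.
by apply: ana_sum => k _; apply: ana_expR; exact: ana_ek.
Qed.

(** At a critical point the momenta vanish and all bonds are equal; since they add up to 0 between
    the fixed ends, each of them is 0. *)
Lemma crit_zero w : (forall i, pdr i (@Ht R n) w = 0) -> w = fun=> 0.
Proof.
move=> H.
have e1 k : (k <= n)%N -> ek k w = ek 0 w.
  elim: k => // k IH kn; rewrite -IH ?(ltnW kn)//.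
  have := H (qi (Ordinal kn)); rewrite pdr_Ht_q => /eqP; rewrite subr_eq0 => /eqP /expR_inj //.
have qE k : (k <= n)%N -> - qn w k = k.+1%:R * ek 0 w.
  elim: k => [|k IH] kn; first by rewrite mul1r /ek sub0r.
  have h := e1 k.+1 kn; rewrite {1}/ek in h.
  by have := IH (ltnW kn); rewrite -[k.+2]addn1 natrD; lra.
have c0 : ek 0 w = 0.
  have := qE n (leqnn n); rewrite /qn insubF ?ltnn// oppr0 => /esym/eqP.
  by rewrite mulf_eq0 pnatr_eq0 /= => /eqP.
apply/funext => i; case: (split_ordP i) => k ->.
  by have := qE k (ltnW (ltn_ord k)); rewrite c0 mulr0 qnE => /eqP; rewrite oppr_eq0 => /eqP.
by have := H (pi' k); rewrite pdr_Ht_p pnE.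
Qed.

(** Each action is half of [Xf^2 + Yf^2], hence critical where both vanish. By [dH_dI] all
    coefficients of [D] are then critical, the energy among them. *)
Lemma XY_zero w : (forall i, XY w i = 0) -> w = fun=> 0.
Proof.
move=> H; apply: crit_zero => i.
have dI (k : 'I_n) : pdr i (acn k) w = 0.
  have aX := ana_Xf k w; have aY := ana_Yf k w.
  have : pdr i (fun w => 2 * acn k w) w = pdr i (fun w => Xf k w * Xf k w + Yf k w * Yf k w) w.
    by apply: pdr_ext => v; rewrite -XY_acn !expr2.
  rewrite pdrZ; last exact: ana_acn.
  rewrite pdrD; [|exact: anaM|exact: anaM].
  rewrite (pdrM i aX aX) (pdrM i aY aY) -XYl -XYr !H !mulr0 !mul0r !addr0 => /eqP.
  by rewrite mulf_eq0 pnatr_eq0 /= => /eqP.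
have nn : (n.-1 < n)%N by rewrite ltn_predL.
have : pdr i (fun w => hc w (Ordinal nn)) w = 0.
  by rewrite dH_dI big1// => k _; rewrite dI mulr0.
rewrite (pdr_ext (g := fun w => - 2 * Ht w)); last by move=> v; rewrite /= hc_Ht// mulNr.
rewrite pdrZ; last exact: ana_Ht.
by move=> /eqP; rewrite mulf_eq0 oppr_eq0 pnatr_eq0 /= => /eqP.
Qed.

Lemma jac_inv w : exists M : 'M[R]_(n + n), jac (@Xf R n) (@Yf R n) w *m M = 1%:M /\ M *m jac (@Xf R n) (@Yf R n) w = 1%:M.
Proof.
pose J := jac (@Xf R n) (@Yf R n) w.
have H : J *m (- (symJ R n *m J^T *m symJ R n)) = 1%:M.
  by rewrite mulmxN !mulmxA jac_XY symJJ opprK.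
by exists (- (symJ R n *m J^T *m symJ R n)); split=> //; exact: mulmx1C.
Qed.

Lemma jacE w i j : jac (@Xf R n) (@Yf R n) w i j = pdr j (fun w => XY w i) w.
Proof. by rewrite mxE /XY; case: (fintype.split i). Qed.

(** The inverse of the Jacobian required by the implicit function theorem is explicit, because the
    Jacobian is symplectic. *)
Lemma XY_loc w0 : exists Y : P -> P, [/\ forall j, ana (fun y => Y y j) (XY w0),
  Y (XY w0) = w0, nearby (XY w0) (fun y => XY (Y y) = y) &
  nearby w0 (fun w => w = Y (XY w))].
Proof.
have [M [M1 M2]] := jac_inv w0.
pose F j (z : 'I_(n + n) + 'I_(n + n) -> R) := XY (fun i => z (inr i)) j - z (inl j).
have aR j (z : 'I_(n + n) + 'I_(n + n) -> R) : ana (fun z => XY (fun i => z (inr i)) j) z.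
  apply: (@ana_comp R _ _ (fun w => XY w j) (fun i z => z (inr i))); first exact: ana_XY.
  by move=> k; exact: ana_coord.
have pF j k : pdr (inr k) (F j) (sext (XY w0) w0) = jac (@Xf R n) (@Yf R n) w0 j k.
  rewrite pdrB//; last exact: ana_coord.
  rewrite pdr_coord /= subr0 jacE /pdr.
  suff -> : (fun t => XY (fun i => shl (sext (XY w0) w0) (inr k) t (inr i)) j) = (fun t => XY (shl w0 k t) j) by [].
  by apply/funext => t; congr (XY _ j); apply/funext => i.
have [||||Y [aY Y0 Yn Yu]] := @implicit_function R _ _ F (XY w0) w0 (fun i j => M i j).
- by move=> j; apply: anaB; [exact: aR|exact: ana_coord].
- by move=> j; rewrite /F /= subrr.
- move=> j k; have := congr1 (fun A : 'M[R]_(n + n) => A j k) M2; rewrite !mxE => <-.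
  by apply: eq_bigr => l _; rewrite pF.
- move=> j k; have := congr1 (fun A : 'M[R]_(n + n) => A j k) M1; rewrite !mxE => <-.
  by apply: eq_bigr => l _; rewrite pF.
exists Y; split=> //.
  by apply: nearbyS Yn => y Hy; apply/funext => i; have := Hy i => /eqP; rewrite /F subr_eq0 => /eqP.
have [d d0 Hd] := Yu.
have [d' d'0 Hd'] := ana_vec_cts (fun j => ana_XY j w0) d0.
exists (Num.min d d'); first by rewrite lt_min d0.
move=> w wb; apply: (Hd (sext (XY w) w)); last by move=> j; rewrite /F /= subrr.
case=> i /=; last by apply: le_trans (wb i) _; rewrite ge_min lexx.
by apply: Hd'; apply: box_sub wb; rewrite ge_min lexx orbT.
Qed.

Theorem XY_global : exists Ps : P -> P, [/\ forall w, Ps (XY w) = w,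
  forall y, XY (Ps y) = y & forall j y, ana (fun y => Ps y j) y].
Proof.
apply: (proper_local_diffeo ana_XY XY_loc XY_proper) => w w' h h'.
by rewrite (XY_zero h) (XY_zero h').
Qed.

End GlobalCoordinates.

(** * The energy as a function of the actions *)

Section EnergyOfActions.
Variables (R : realType) (n : nat).
Local Notation P := ('I_(n + n) -> R).
Implicit Types (w y : P).
Hypothesis n0 : (0 < n)%N.

Lemma br_linn (I : finType) (f : P -> R) (u : I -> P -> R) (c : I -> R) g w :
  (forall i, pdr i f w = \sum_m c m * pdr i (u m) w) -> br f g w = \sum_m c m * br (u m) g w.
Proof.
move=> H; rewrite /br; under [RHS]eq_bigr do rewrite mulr_sumr.
rewrite exchange_big; apply: eq_bigr => i _ /=.
by rewrite !H !mulr_suml -sumrB; apply: eq_bigr => m _; ring.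
Qed.

Lemma pdr_acnE (k : 'I_n) i w : pdr i (acn k) w = Xf k w * pdr i (Xf k) w + Yf k w * pdr i (Yf k) w.
Proof.
have aX := ana_Xf k w; have aY := ana_Yf k w.
have : pdr i (fun w => 2 * acn k w) w = pdr i (fun w => Xf k w * Xf k w + Yf k w * Yf k w) w.
  by apply: pdr_ext => v; rewrite -XY_acn !expr2.
rewrite pdrZ; last exact: ana_acn.
rewrite pdrD; [|exact: anaM|exact: anaM].
rewrite (pdrM i aX aX) (pdrM i aY aY) => E.
apply: (@mulfI _ 2); first by rewrite pnatr_eq0.
by rewrite E; ring.
Qed.

Lemma br_acn (k : 'I_n) f w : br f (acn k) w = Xf k w * br f (Xf k) w + Yf k w * br f (Yf k) w.
Proof.
rewrite brC (br_lin2 f (fun i => pdr_acnE k i w)) [br (Xf k) f w]brC [br (Yf k) f w]brC; ring.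
Qed.

Lemma br_acn_acn (k l : 'I_n) w : br (acn k) (acn l) w = 0.
Proof.
rewrite br_acn [br _ (Xf l) w]brC [br _ (Yf l) w]brC !br_acn br_XX br_YY br_XY [br (Yf l) _ w]brC br_XY.
by rewrite eq_sym; have [->|_] := eqVneq k l; rewrite /=; ring.
Qed.

(** The energy is a coefficient of [D] up to a factor, so by [dH_dI] its differential is a
    combination of those of the actions, which commute. *)
Lemma br_Ht_acn (k : 'I_n) w : br (@Ht R n) (acn k) w = 0.
Proof.
have nn : (n.-1 < n)%N by rewrite ltn_predL.
rewrite (@br_linn 'I_n _ (fun l : 'I_n => acn l) (fun l => - 2^-1 * invmx (AM w) (Ordinal nn) l)).
  by rewrite big1// => l _; rewrite br_acn_acn mulr0.
move=> i; transitivity (- 2^-1 * pdr i (fun w => hc w (Ordinal nn)) w).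
  rewrite -pdrZ; last exact: ana_hc.
  by apply: pdr_ext => v; rewrite /= hc_Ht//; field.
by rewrite dH_dI mulr_sumr; apply: eq_bigr => l _; rewrite mulrA.
Qed.

Variable Ps : P -> P.
Hypothesis PsK : forall w, Ps (XY w) = w.
Hypothesis XYK : forall y, XY (Ps y) = y.
Hypothesis aPs : forall j y, ana (fun y => Ps y j) y.

Let G y := Ht (Ps y).

Lemma ana_G y : ana G y.
Proof. by apply: (@ana_comp R _ _ (@Ht R n) (fun j y => Ps y j)) => //; exact: ana_Ht. Qed.

(** The flow of the k-th action rotates the k-th plane, so commuting with it is infinitesimal
    invariance under that rotation. *)
Lemma G_rot (k : 'I_n) y : y (qi k) * pdr (pi' k) G y = y (pi' k) * pdr (qi k) G y.
Proof.
pose w := Ps y.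
have E : br (@Ht R n) (acn k) w = \sum_m pdr m G (XY w) * br (fun w => XY w m) (acn k) w.
  apply: br_linn => i.
  rewrite -(@pdr_comp R _ _ G (fun m w => XY w m) w i); [|exact: ana_G|by move=> j; exact: ana_XY].
  by apply: pdr_ext => v; rewrite /G PsK.
have EX l : br (fun w => XY w (qi l)) (acn k) w = (l == k)%:R * Yf k w.
  rewrite (br_ext w (fun v => XYl v l) (fun v => erefl _)) br_acn br_XX br_XY; ring.
have EY l : br (fun w => XY w (pi' l)) (acn k) w = - (l == k)%:R * Xf k w.
  rewrite (br_ext w (fun v => XYr v l) (fun v => erefl _)) br_acn br_YY brC br_XY eq_sym; ring.
move: E; rewrite br_Ht_acn sum_n2 XYK.
rewrite (eq_bigr (fun l : 'I_n => (pdr (qi l) G y * Yf k w - pdr (pi' l) G y * Xf k w) * (l == k)%:R)); last first.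
  move=> l _; rewrite -[lshift n l]/(qi l) -[rshift n l]/(pi' l) (EX l) (EY l).
  by move: (pdr (qi l) G y) (pdr (pi' l) G y) (l == k)%:R (Yf k w) (Xf k w) => a1 a2 a3 a4 a5; ring.
rewrite sum_delta -XYl -XYr XYK => H.
by move: (pdr (qi k) G y) (pdr (pi' k) G y) H => a b H; lra.
Qed.

(** Rotating all planes at once carries [y] onto nonnegative first axes, and [G_rot] makes [G]
    constant along the way. The redundant looking [2 * (_ / 2)] displays the actions, as [HD_action]
    needs them. *)
Lemma G_action y : G y = G (fun i => match fintype.split i with
  | inl k => Num.sqrt (2 * ((y (qi k) ^+ 2 + y (pi' k) ^+ 2) / 2)) | inr k => 0 end).
Proof.
have /choice [r /choice [th H]] : forall k : 'I_n, exists r, exists th : R,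
   [/\ 0 <= r, y (pi' k) = r * sin th & y (qi k) = r * cos th].
  by move=> k; have [r [th H]] := polar (y (pi' k)) (y (qi k)); exists r, th.
(* At [t = 1] this is [y], at [t = 0] all angles are 0. *)
pose c (t : R) : P := fun i => match fintype.split i with
  | inl k => r k * cos (t * th k) | inr k => r k * sin (t * th k) end.
have cl t k : c t (qi k) = r k * cos (t * th k) by rewrite /c /qi (unsplitK (inl k : 'I_n + 'I_n)%type).
have cr_ t k : c t (pi' k) = r k * sin (t * th k) by rewrite /c /pi' (unsplitK (inr k : 'I_n + 'I_n)%type).
have E1 : c 1 = y.
  apply/funext => i; case: (split_ordP i) => k ->; have [_ h1 h2] := H k.
    by rewrite -[lshift n k]/(qi k) cl mul1r h2.
  by rewrite -[rshift n k]/(pi' k) cr_ mul1r h1.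
have E0 : c 0 = fun i => match fintype.split i with
  | inl k => Num.sqrt (2 * ((y (qi k) ^+ 2 + y (pi' k) ^+ 2) / 2)) | inr k => 0 end.
  apply/funext => i; rewrite /c; case: (fintype.split i) => k; rewrite mul0r ?cos0 ?sin0 ?mulr0// mulr1.
  have [rk -> ->] := H k.
  have -> : 2 * (((r k * cos (th k)) ^+ 2 + (r k * sin (th k)) ^+ 2) / 2) = r k ^+ 2.
    transitivity (r k ^+ 2 * (cos (th k) ^+ 2 + sin (th k) ^+ 2)); last by rewrite cos2Dsin2 mulr1.
    by move: (r k) (cos (th k)) (sin (th k)) => a b d; field.
  by rewrite sqrtr_sqr ger0_norm.
rewrite -{1}E1 -E0; apply/esym.
apply: (@prim_zero R 0 1 (fun t => G (c t))); first exact: ler01.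
move=> t _.
have dl (s a : R) : is_derive s 1 (fun s : R => s * a) a.
  have := is_deriveM (is_derive_id s 1) (is_derive_cst a s 1).
  by rewrite /GRing.scale/= mulr0 mulr1 add0r.
pose c' (i : 'I_(n + n)) : R := match fintype.split i with
  | inl k => - th k * c t (pi' k) | inr k => th k * c t (qi k) end.
have dc i : is_derive t 1 (fun s => c s i) (c' i).
  rewrite /c' /c; case: (fintype.split i) => k; rewrite -/(c t _) ?cl ?cr_.
    have D := is_deriveZ (r k) (@is_derive1_comp _ cos (fun s : R => s * th k) t _ _ (is_derive_cos _) (dl t (th k))).
    by apply: (is_derive_eq D); rewrite /GRing.scale/=; ring.
  have D := is_deriveZ (r k) (@is_derive1_comp _ sin (fun s : R => s * th k) t _ _ (is_derive_sin _) (dl t (th k))).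
  by apply: (is_derive_eq D); rewrite /GRing.scale/=; ring.
apply: (is_derive_eq (ana_curve (ana_G (c t)) (erefl _) dc)).
rewrite sum_n2 big1// => k _.
rewrite /c' (unsplitK (inl k : 'I_n + 'I_n)%type) (unsplitK (inr k : 'I_n + 'I_n)%type) -/(qi k) -/(pi' k).
have := G_rot k (c t) => E.
have Z (a b x z s : R) : x * b = z * a -> a * (- s * z) + b * (s * x) = 0.
  by move=> Hx; transitivity (s * (x * b - z * a)); [ring|rewrite Hx; ring].
exact: Z.
Qed.

End EnergyOfActions.

Section RowVectors.
Variable (R : realType).

Definition rv m (x : 'I_m -> R) : 'rV[R]_m := \row_i x i.
Definition vr m (z : 'rV[R]_m) : 'I_m -> R := fun i => z ord0 i.

Lemma vrK m (z : 'rV[R]_m) : rv (vr z) = z.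
Proof. by apply/rowP => i; rewrite mxE. Qed.

Lemma rvK m (x : 'I_m -> R) : vr (rv x) = x.
Proof. by apply/funext => i; rewrite /vr mxE. Qed.

(** On half the radius the truncation bound of [apx_series] holds with [t = 1/2], so the box sums
    converge geometrically. *)
Lemma ana_analytic_at m (f : 'rV[R]_m -> R) (z : 'rV[R]_m) :
  ana (fun x => f (rv x)) (vr z) -> analytic_at f z.
Proof.
move=> [r [C [r0 Hf]]].
have [a [a1 a2]] := apx_series (fun _ : 'I_m => r0) Hf.
exists (r / 2); split; first exact: divr_gt0.
exists a => y yz.
have yb i : `|vr y i - vr z i| <= 2^-1 * r by rewrite mulrC; apply: ltW; exact: yz.
have Y : box (vr z) (fun=> r) (vr y).
  by move=> i; apply: le_trans (yb i) _; rewrite ler_piMl ?ltW// invf_lt1// ltr1n.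
have mE al : monom y z al = mon (shf (vr z) (vr y)) al by [].
split.
  exists C => K; apply: le_trans (a1 K); apply: bs_le => al.
  rewrite normrM mE mon_norm ler_wpM2l//; apply: mon_le => i.
  by rewrite normr_ge0 /=; exact: Y.
have h12 : 0 <= (2^-1 : R) <= 1 by rewrite invr_ge0 ler0n invf_le1// ler1n.
have H K := a2 (vr y) 2^-1 Y h12 yb K; rewrite vrK in H.
have H12 : 0 <= (2^-1 : R) < 1 by rewrite invr_ge0 ler0n invf_lt1// ltr1n.
apply/cvgrPdist_le => e e0.
have [K HK] := exp_cvg0 C H12 e0.
exists K => // k /= Kk; rewrite distrC; apply: le_trans (H k) _.
by apply: HK; exact: leqW.
Qed.

Lemma pd_pdr m (f : 'rV[R]_m -> R) (z : 'rV[R]_m) i :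
  pd f z i = pdr i (fun x => f (rv x)) (vr z).
Proof.
rewrite /pd /pdr /derive.
suff E : (fun h : R => h^-1 *: ((f \o shift z) (h *: delta_mx ord0 i) - f z)) =
   (fun h : R => h^-1 *: (((fun t => f (rv (shl (vr z) i t))) \o shift 0) (h *: (1:R)) - f (rv (shl (vr z) i 0)))) by rewrite E.
apply/funext => h; rewrite shl0 vrK /= addr0; congr (_ *: (f _ - _)).
by apply/rowP => j; rewrite !mxE /shl /vr /GRing.scale/= mulr1 addrC.
Qed.

(** The test functions of the theorem are merely differentiable, so their chain rule goes through
    differentials instead of [ana_curve]. *)
Lemma is_derive_diff m (F : 'rV[R]_m -> R) (g : 'I_m -> R -> R) (g' : 'I_m -> R) (t : R) :
  differentiable F (\row_i g i t) -> (forall i, is_derive t 1 (g i) (g' i)) ->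
  is_derive t 1 (fun s => F (\row_i g i s)) (\sum_i g' i * pd F (\row_i g i t) i).
Proof.
move=> dF dg.
pose gv (s : R) : 'rV[R]_m := \sum_i g i s *: delta_mx ord0 i.
have gE s : \row_i g i s = gv s.
  rewrite [LHS]row_sum_delta; apply: eq_bigr => i _; by rewrite mxE.
have dgi i : differentiable (fun s => g i s *: (delta_mx ord0 i : 'rV[R]_m)) t.
  by apply: differentiableZl; apply/derivable1_diffP; exact: ex_derive.
have gvE : gv = \sum_i (fun s => g i s *: (delta_mx ord0 i : 'rV[R]_m)).
  by apply/funext => s; rewrite fct_sumE.
have dgv : differentiable gv t by rewrite gvE; exact: differentiable_sum.
have Dgv : 'd gv t (1 : R) = \sum_i g' i *: delta_mx ord0 i.
  rewrite -deriveE// gvE derive_sum; last by move=> i; exact/derivable1_diffP.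
  apply: eq_bigr => i _; rewrite deriveE//.
  have dgi1 : differentiable (g i) t by apply/derivable1_diffP; exact: ex_derive.
  rewrite diffZl//; congr (_ *: _).
  by rewrite -deriveE// (@derive_val _ _ _ _ _ _ _ (dg i)).
rewrite gE in dF *.
have -> : (fun s => F (\row_i g i s)) = F \o gv by apply/funext => s /=; rewrite gE.
have dC := differentiable_comp dgv dF.
have H : derivable (F \o gv) t 1 by apply/derivable1_diffP.
apply: DeriveDef => //.
rewrite deriveE// diff_comp//= Dgv linear_sum; apply: eq_bigr => i _.
by rewrite linearZ /= /pd -deriveE.
Qed.

Lemma pd_comp k m (Phi : 'rV[R]_k -> 'rV[R]_m) (F : 'rV[R]_m -> R) (z : 'rV[R]_k) i :
  differentiable F (Phi z) -> (forall a, ana (fun x => Phi (rv x) ord0 a) (vr z)) ->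
  pd (F \o Phi) z i = \sum_a pd F (Phi z) a * pd (fun z => Phi z ord0 a) z i.
Proof.
move=> dF aP; rewrite pd_pdr /pdr.
have dg a := ana_derive i (aP a).
have E (s : R) : \row_a Phi (rv (shl (vr z) i s)) ord0 a = Phi (rv (shl (vr z) i s)).
  by apply/rowP => a; rewrite mxE.
have E0 : \row_a Phi (rv (shl (vr z) i 0)) ord0 a = Phi z by rewrite E shl0 vrK.
have dF' : differentiable F (\row_a Phi (rv (shl (vr z) i 0)) ord0 a) by rewrite E0.
have := is_derive_diff dF' dg; rewrite E0.
have -> : (fun s => F (\row_a Phi (rv (shl (vr z) i s)) ord0 a)) = (fun t => (F \o Phi) (rv (shl (vr z) i t))).
  by apply/funext => s; rewrite E.
move=> D; rewrite (@derive_val _ _ _ _ _ _ _ D); apply: eq_bigr => a _.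
by rewrite mulrC; congr (_ * _); rewrite pd_pdr.
Qed.

End RowVectors.

(** * Flaschka variables *)

Section FlaschkaVariables.
Variables (R : realType) (n : nat).
Local Notation P := ('I_(n + n) -> R).
Local Notation K := 'I_(n.+1 + n.+1).
Local Notation zet := (K -> R).
Implicit Types (z : 'rV[R]_(n.+1 + n.+1)) (x : zet) (u v : zet) (w : P).

(** The Poisson structure as a bilinear form on covectors, so that gradients of compositions can be
    expanded by linearity. *)
Definition brv z u v : R :=
  \sum_(i < n.+1) \sum_(j < n.+1) u (dco i) * AD z i j * v (cco j)
  - \sum_(i < n.+1) \sum_(j < n.+1) u (cco i) * AD z j i * v (dco j).

(* The Poisson structure only involves these combinations of derivatives. *)
Definition Dd (u : zet) (k : 'I_n) : R := u (dco (lift ord0 k)).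
Definition Dl x (u : zet) (k : 'I_n) : R :=
  x (cco (lift ord0 k)) * u (cco (lift ord0 k)) -
  x (cco (widen_ord (leqnSn n) k)) * u (cco (widen_ord (leqnSn n) k)).

Lemma AD_row z i (f : 'I_n.+1 -> R) : \sum_(j < n.+1) AD z i j * f j =
  if unlift ord0 i is Some k then
    2^-1 * (cv z (lift ord0 k) * f (lift ord0 k)
          - cv z (widen_ord (leqnSn n) k) * f (widen_ord (leqnSn n) k)) else 0.
Proof.
case: unliftP => [k ->|->]; last by rewrite big1// => j _; rewrite mxE eqxx mul0r.
pose a := lift ord0 k; pose b := widen_ord (leqnSn n) k.
have ab : a != b by apply/eqP => /(congr1 val); rewrite /= /bump leq0n; lia.
rewrite (bigD1 a)//= (bigD1 b)//= ?[b == a]eq_sym// big1 ?addr0; last first.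
  move=> j /andP[ja jb]; rewrite mxE /= /bump leq0n add1n /=.
  have -> : (j == k :> nat) = false by apply/negbTE; apply: contraNneq jb => E; apply/eqP/val_inj.
  have -> : (j == k.+1 :> nat) = false.
    by apply/negbTE; apply: contraNneq ja => E; apply/eqP/val_inj; rewrite /= /bump leq0n add1n.
  by rewrite mul0r.
rewrite !mxE /= /bump leq0n add1n /= eqxx (_ : (k.+1 == k)%N = false); last by apply/negbTE; lia.
by rewrite -/a eqxx; field.
Qed.

Lemma brvE z u v : brv z u v = 2^-1 * \sum_(k < n) (Dd u k * Dl (vr z) v k - Dd v k * Dl (vr z) u k).
Proof.
have E u1 v1 : \sum_(i < n.+1) \sum_(j < n.+1) u1 (dco i) * AD z i j * v1 (cco j) =
    2^-1 * \sum_(k < n) Dd u1 k * Dl (vr z) v1 k.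
  have E1 (i : 'I_n.+1) : \sum_(j < n.+1) u1 (dco i) * AD z i j * v1 (cco j) =
      u1 (dco i) * \sum_(j < n.+1) AD z i j * v1 (cco j).
    by rewrite mulr_sumr; apply: eq_bigr => j _; rewrite mulrA.
  rewrite big_ord_recl /= E1 AD_row unlift_none mulr0 add0r mulr_sumr; apply: eq_bigr => k _.
  by rewrite E1 AD_row liftK /Dd /Dl mulrCA.
rewrite /brv E [X in _ - X](_ : _ = 2^-1 * \sum_(k < n) Dd v k * Dl (vr z) u k).
  by rewrite -mulrBr -sumrB.
rewrite -E exchange_big; apply: eq_bigr => i _; apply: eq_bigr => j _; ring.
Qed.

Lemma Dd_lin (I : finType) (c : I -> R) (U : I -> zet) k :
  Dd (fun m => \sum_a c a * U a m) k = \sum_a c a * Dd (U a) k.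
Proof. by []. Qed.

Lemma Dl_lin x (I : finType) (c : I -> R) (U : I -> zet) k :
  Dl x (fun m => \sum_a c a * U a m) k = \sum_a c a * Dl x (U a) k.
Proof.
rewrite /Dl !mulr_sumr -sumrB; apply: eq_bigr => a _; ring.
Qed.

Definition LG x : R := n.+1%:R^-1 * \sum_(j < n.+1) ln (x (cco j)).

(** The variables [(q, p)] rescaled to [gamma = 1], with [LG] the logarithm of [gamma]. The index
    [lift ord0 k] skips [d_0], which is the Casimir [E1]. *)
Definition Wz x : P := fun i => match fintype.split i with
  | inl k => - 2 * \sum_(j < n.+1 | (j <= k)%N) (ln (x (cco j)) - LG x)
  | inr k => - (x (dco (lift ord0 k)) * expR (- LG x)) end.

Lemma Wzl x k : Wz x (qi k) = - 2 * \sum_(j < n.+1 | (j <= k)%N) (ln (x (cco j)) - LG x).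
Proof. by rewrite /Wz /qi (unsplitK (inl k : 'I_n + 'I_n)%type). Qed.

Lemma Wzr x k : Wz x (pi' k) = - (x (dco (lift ord0 k)) * expR (- LG x)).
Proof. by rewrite /Wz /pi' (unsplitK (inr k : 'I_n + 'I_n)%type). Qed.

Lemma cco_inj : injective (@cco n). Proof. exact: rshift_inj. Qed.

Lemma dco_cco (i j : 'I_n.+1) : (dco i == cco j) = false. Proof. exact: eq_lrshift. Qed.
Lemma cco_dco (i j : 'I_n.+1) : (cco j == dco i) = false. Proof. exact: eq_rlshift. Qed.

Section AtPositive.
Variable x : zet.
Hypothesis xp : forall j, 0 < x (cco j).

Lemma ana_lnc j : ana (fun x : zet => ln (x (cco j))) x.
Proof. by apply: ana_ln; [exact: ana_coord|exact: xp]. Qed.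

Lemma ana_LG : ana LG x.
Proof. by apply: anaZ; apply: ana_sum => j _; exact: ana_lnc. Qed.

Lemma ana_Wz i : ana (fun x => Wz x i) x.
Proof.
rewrite /Wz; case: (fintype.split i) => k.
  by apply: anaZ; apply: ana_sum => j _; apply: anaB; [exact: ana_lnc|exact: ana_LG].
by apply: anaN; apply: anaM; [exact: ana_coord|apply: ana_expR; apply: anaN; exact: ana_LG].
Qed.

Lemma pdr_lnc j m : pdr m (fun x : zet => ln (x (cco j))) x = (x (cco j))^-1 * (cco j == m)%:R.
Proof. by rewrite (pdr_comp1 m (is_derive1_ln (xp j)) (ana_coord (cco j) x)) pdr_coord. Qed.

Lemma Dd_lnc j k : Dd (fun m => pdr m (fun x : zet => ln (x (cco j))) x) k = 0.
Proof. by rewrite /Dd pdr_lnc cco_dco mulr0. Qed.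

Lemma theta_lnc i j : x (cco i) * pdr (cco i) (fun x : zet => ln (x (cco j))) x = (i == j)%:R.
Proof.
rewrite pdr_lnc (inj_eq cco_inj) eq_sym; have [->|_] := eqVneq i j; last by rewrite !mulr0.
by rewrite mulr1 mulfV// gt_eqF.
Qed.

Lemma pdr_LG m : pdr m LG x = n.+1%:R^-1 * \sum_(j < n.+1) pdr m (fun x : zet => ln (x (cco j))) x.
Proof.
rewrite pdrZ; last by apply: ana_sum => j _; exact: ana_lnc.
by rewrite pdr_sum// => j _; exact: ana_lnc.
Qed.

Lemma Dd_LG k : Dd (fun m => pdr m LG x) k = 0.
Proof. by rewrite /Dd pdr_LG big1 ?mulr0// => j _; exact: Dd_lnc. Qed.

Lemma theta_LG i : x (cco i) * pdr (cco i) LG x = n.+1%:R^-1.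
Proof.
rewrite pdr_LG mulrCA mulr_sumr (eq_bigr (fun j => 1 * (j == i)%:R)); last first.
  by move=> j _; rewrite theta_lnc mul1r eq_sym.
by rewrite sum_delta mulr1.
Qed.

Lemma Dl_LG k : Dl x (fun m => pdr m LG x) k = 0.
Proof. by rewrite /Dl !theta_LG subrr. Qed.

Lemma pdr_Wzl l m : pdr m (fun x => Wz x (qi l)) x =
  - 2 * \sum_(j < n.+1 | (j <= l)%N) (pdr m (fun x : zet => ln (x (cco j))) x - pdr m LG x).
Proof.
have al j : ana (fun x : zet => ln (x (cco j)) - LG x) x by apply: anaB; [exact: ana_lnc|exact: ana_LG].
rewrite (pdr_ext (g := fun x => - 2 * \sum_(j < n.+1 | (j <= l)%N) (ln (x (cco j)) - LG x))); last first.
  by move=> y; rewrite Wzl.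
rewrite pdrZ; last by apply: ana_sum => j _; exact: al.
rewrite pdr_sum; last by move=> j _; exact: al.
by congr (_ * _); apply: eq_bigr => j _; rewrite pdrB//; [exact: ana_lnc|exact: ana_LG].
Qed.

Lemma pdr_Wzr l m : pdr m (fun x => Wz x (pi' l)) x =
  - ((dco (lift ord0 l) == m)%:R * expR (- LG x) - x (dco (lift ord0 l)) * expR (- LG x) * pdr m LG x).
Proof.
have aN : ana (fun x => - LG x) x by apply: anaN; exact: ana_LG.
have ae : ana (fun x => expR (- LG x)) x by exact: ana_expR.
have ac := ana_coord (dco (lift ord0 l)) x.
rewrite (pdr_ext (g := fun x => - (x (dco (lift ord0 l)) * expR (- LG x)))); last by move=> y; rewrite Wzr.
rewrite pdrN; last exact: anaM.
rewrite pdrM// pdr_coord (pdr_comp1 m (is_derive_expR _) aN) pdrN; last exact: ana_LG.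
by ring.
Qed.

Lemma Dd_Wzl l k : Dd (fun m => pdr m (fun x => Wz x (qi l)) x) k = 0.
Proof.
rewrite /Dd pdr_Wzl big1 ?mulr0// => j _.
by rewrite [pdr _ LG x]Dd_LG subr0; exact: Dd_lnc.
Qed.

Lemma Dd_Wzr l k : Dd (fun m => pdr m (fun x => Wz x (pi' l)) x) k = - (expR (- LG x) * (l == k)%:R).
Proof.
rewrite /Dd pdr_Wzr [pdr _ LG x]Dd_LG mulr0 subr0 mulrC.
by rewrite (inj_eq (@lshift_inj n.+1 n.+1)) (inj_eq (@lift_inj _ ord0)).
Qed.

Lemma theta_Wzl l i : x (cco i) * pdr (cco i) (fun x => Wz x (qi l)) x =
  - 2 * ((i <= l)%N%:R - \sum_(j < n.+1 | (j <= l)%N) n.+1%:R^-1).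
Proof.
rewrite pdr_Wzl mulrCA; congr (_ * _); rewrite mulr_sumr.
rewrite (eq_bigr (fun j : 'I_n.+1 => (i == j)%:R - n.+1%:R^-1)); last first.
  by move=> j _; rewrite mulrBr theta_lnc theta_LG.
rewrite sumrB; congr (_ - _); rewrite big_mkcond /=.
rewrite (eq_bigr (fun j : 'I_n.+1 => (j <= l)%N%:R * (j == i)%:R)); first by rewrite (sum_delta (fun j : 'I_n.+1 => (j <= l)%N%:R)).
by move=> j _; rewrite eq_sym; case: (j <= l)%N; rewrite ?mul1r ?mul0r.
Qed.

(** Of two neighbouring indices only [l] and [l.+1] are separated by the end of the partial sum, and
    the common contribution of [LG] cancels. *)
Lemma Dl_Wzl l k : Dl x (fun m => pdr m (fun x => Wz x (qi l)) x) k = 2 * (l == k)%:R.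
Proof.
rewrite /Dl !theta_Wzl /= /bump leq0n add1n.
have -> : (l == k) = (l == k :> nat) by [].
set S := \sum_(j < _ | _) _; case: (ltngtP k l) => h /=; rewrite ?mulr1n ?mulr0n; ring.
Qed.

Lemma Dl_Wzr l k : Dl x (fun m => pdr m (fun x => Wz x (pi' l)) x) k = 0.
Proof.
have th i : x (cco i) * pdr (cco i) (fun x => Wz x (pi' l)) x = x (dco (lift ord0 l)) * expR (- LG x) * n.+1%:R^-1.
  have := theta_LG i; rewrite pdr_Wzr dco_cco /= mul0r sub0r opprK => t.
  by rewrite mulrCA t.
by rewrite /Dl !th subrr.
Qed.

(* The factor [gamma^(1/2)] makes up for the bracket [{q, p} = 1 / gamma] of the
   rescaled variables [Wz]. *)
Variables (f : P -> R).
Hypothesis af : forall w, ana f w.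

Definition lft (f : P -> R) x := expR (LG x / 2) * f (Wz x).

Lemma ana_fW : ana (fun x => f (Wz x)) x.
Proof. by apply: (@ana_comp R _ _ f (fun i x => Wz x i)); [exact: af|exact: ana_Wz]. Qed.

Lemma ana_sg : ana (fun x => expR (LG x / 2)) x.
Proof. by apply: ana_expR; apply: anaM; [exact: ana_LG|exact: ana_const]. Qed.

Lemma ana_lft : ana (lft f) x.
Proof. by apply: anaM; [exact: ana_sg|exact: ana_fW]. Qed.

Lemma pdr_lft m : pdr m (lft f) x = expR (LG x / 2) *
  (\sum_a pdr a f (Wz x) * pdr m (fun x => Wz x a) x) + f (Wz x) * expR (LG x / 2) / 2 * pdr m LG x.
Proof.
have a2 : ana (fun x => LG x / 2) x by apply: anaM; [exact: ana_LG|exact: ana_const].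
rewrite pdrM; [|exact: ana_sg|exact: ana_fW].
rewrite (pdr_comp1 m (is_derive_expR _) a2) pdrM; [|exact: ana_LG|exact: ana_const].
rewrite pdr_cst mulr0 addr0 (@pdr_comp R _ _ f (fun i x => Wz x i)); [|exact: af|exact: ana_Wz].
by field.
Qed.

Lemma Dd_lft k : Dd (fun m => pdr m (lft f) x) k = - (expR (- (LG x / 2)) * pdr (pi' k) f (Wz x)).
Proof.
rewrite /Dd pdr_lft [pdr _ LG x]Dd_LG mulr0 addr0 sum_n2.
rewrite (eq_bigr (fun l : 'I_n => - (expR (- LG x) * pdr (pi' l) f (Wz x)) * (l == k)%:R)); last first.
  move=> l _; rewrite -[lshift n l]/(qi l) -[rshift n l]/(pi' l).
  rewrite [pdr _ (fun x => Wz x (qi l)) x]Dd_Wzl [pdr _ (fun x => Wz x (pi' l)) x]Dd_Wzr.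
  by move: (pdr (pi' l) f (Wz x)) (l == k)%:R (pdr (qi l) f (Wz x)) (expR _) => a b c e; ring.
rewrite (sum_delta (fun l => - (expR (- LG x) * pdr (pi' l) f (Wz x)))) mulrN mulrA -expRD.
by congr (- (expR _ * _)); field.
Qed.

Lemma Dl_lft k : Dl x (fun m => pdr m (lft f) x) k = 2 * expR (LG x / 2) * pdr (qi k) f (Wz x).
Proof.
have E m : pdr m (lft f) x = \sum_(o : option 'I_(n + n))
   (if o is Some a then expR (LG x / 2) * pdr a f (Wz x) else f (Wz x) * expR (LG x / 2) / 2) *
   (if o is Some a then pdr m (fun x => Wz x a) x else pdr m LG x).
  rewrite big_opt pdr_lft addrC; congr (_ + _); rewrite mulr_sumr; apply: eq_bigr => a _; ring.
rewrite (_ : (fun m => pdr m (lft f) x) = (fun m => \sum_(o : option 'I_(n + n))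
   (if o is Some a then expR (LG x / 2) * pdr a f (Wz x) else f (Wz x) * expR (LG x / 2) / 2) *
   (if o is Some a then pdr m (fun x => Wz x a) x else pdr m LG x))); last by apply/funext.
rewrite (Dl_lin x _ (fun (o : option 'I_(n + n)) m => if o is Some a then pdr m (fun x => Wz x a) x else pdr m LG x)).
rewrite big_opt Dl_LG mulr0 add0r sum_n2.
rewrite (eq_bigr (fun l : 'I_n => (expR (LG x / 2) * pdr (qi l) f (Wz x) * 2) * (l == k)%:R)); last first.
  move=> l _; rewrite -[lshift n l]/(qi l) -[rshift n l]/(pi' l) Dl_Wzl Dl_Wzr.
  by move: (pdr (pi' l) f (Wz x)) (l == k)%:R (pdr (qi l) f (Wz x)) (expR _) => a b c e; ring.
rewrite (sum_delta (fun l => expR (LG x / 2) * pdr (qi l) f (Wz x) * 2)); ring.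
Qed.

End AtPositive.

(** The two prefactors [gamma^(1/2)] compensate the [1 / gamma] of the rescaled bracket, and their
    own derivatives do not contribute because [LG] is a Casimir. *)
Lemma brv_lft z (f g : P -> R) : (forall j, 0 < vr z (cco j)) -> (forall w, ana f w) -> (forall w, ana g w) ->
  brv z (fun m => pdr m (lft f) (vr z)) (fun m => pdr m (lft g) (vr z)) = br f g (Wz (vr z)).
Proof.
move=> zp af ag; rewrite brvE mulr_sumr; apply: eq_bigr => k _.
rewrite !Dd_lft// !Dl_lft//.
have e1 : expR (- (LG (vr z) / 2)) * expR (LG (vr z) / 2) = 1 by rewrite -expRD addNr expR0.
move: e1; move: (expR _) (expR _) (pdr _ f _) (pdr _ f _) (pdr _ g _) (pdr _ g _) => a b f1 f2 g1 g2 E.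
transitivity ((b * a) * (f1 * g1 - f2 * g2)); first by field.
by rewrite E mul1r.
Qed.

Lemma brv0r z u v : (forall k, Dd v k = 0) -> (forall k, Dl (vr z) v k = 0) -> brv z u v = 0.
Proof. by move=> h1 h2; rewrite brvE big1 ?mulr0// => k _; rewrite h1 h2 mulr0 mul0r subrr. Qed.

Lemma brvC z u v : brv z u v = - brv z v u.
Proof. by rewrite !brvE -mulrN -sumrN; congr (_ * _); apply: eq_bigr => k _; ring. Qed.

Lemma brv_linl z (I : finType) (c : I -> R) (U : I -> zet) v :
  brv z (fun m => \sum_a c a * U a m) v = \sum_a c a * brv z (U a) v.
Proof.
rewrite brvE; under eq_bigr do rewrite Dl_lin Dd_lin.
under [RHS]eq_bigr do rewrite brvE mulrCA mulr_sumr.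
rewrite -mulr_sumr exchange_big; congr (_ * _); apply: eq_bigr => k _ /=.
rewrite mulr_suml mulr_sumr -sumrB; apply: eq_bigr => a _; ring.
Qed.

Lemma brv_linr z (I : finType) (c : I -> R) (U : I -> zet) v :
  brv z v (fun m => \sum_a c a * U a m) = \sum_a c a * brv z v (U a).
Proof. by rewrite brvC brv_linl -sumrN; apply: eq_bigr => a _; rewrite brvC mulrN opprK. Qed.

End FlaschkaVariables.

Section Transfer.
Variables (R : realType) (n : nat).
Local Notation P := ('I_(n + n) -> R).
Implicit Types (z : 'rV[R]_(n.+1 + n.+1)) (w y : P) (q : 'rV[R]_(n + n + 2)).

Lemma E2_LG z : MD z -> E2 z = expR (LG (vr z)).
Proof.
move=> zM; rewrite /E2 (_ : \prod_(k < n.+1) cv z k = expR (\sum_(k < n.+1) ln (cv z k))).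
  by rewrite -expRM mulrC.
by rewrite expR_sum; apply: eq_bigr => k _; rewrite lnK// posrE; exact: zM.
Qed.

Definition PhiD z : 'rV[R]_(n + n + 2) := \row_a match fintype.split a with
  | inl i => lft (fun w => XY w i) (vr z)
  | inr j => if j == 0 then E1 z else E2 z end.

Lemma PhiDl z i : PhiD z ord0 (lshift 2 i) = lft (fun w => XY w i) (vr z).
Proof. by rewrite mxE (unsplitK (inl i : 'I_(n + n) + 'I_2)%type). Qed.

Lemma PhiDd z : PhiD z ord0 (deltaco n) = E1 z.
Proof. by rewrite mxE (unsplitK (inr 0 : 'I_(n + n) + 'I_2)%type). Qed.

Lemma PhiDg z : PhiD z ord0 (gammaco n) = E2 z.
Proof. by rewrite mxE (unsplitK (inr 1 : 'I_(n + n) + 'I_2)%type). Qed.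

Variable Ps : P -> P.

Definition yq q : P := fun i => q ord0 (lshift 2 i) / Num.sqrt (q ord0 (gammaco n)).

Definition PsiD q : 'rV[R]_(n.+1 + n.+1) := \row_m match fintype.split m with
  | inl i => if unlift ord0 i is Some k then - (q ord0 (gammaco n) * Ps (yq q) (pi' k)) else q ord0 (deltaco n)
  | inr j => q ord0 (gammaco n) * expR (ek j (Ps (yq q)) / 2) end.

Lemma PsiDd q i : PsiD q ord0 (dco i) =
  if unlift ord0 i is Some k then - (q ord0 (gammaco n) * Ps (yq q) (pi' k)) else q ord0 (deltaco n).
Proof. by rewrite mxE (unsplitK (inl i : 'I_n.+1 + 'I_n.+1)%type). Qed.

Lemma PsiDc q j : PsiD q ord0 (cco j) = q ord0 (gammaco n) * expR (ek j (Ps (yq q)) / 2).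
Proof. by rewrite mxE (unsplitK (inr j : 'I_n.+1 + 'I_n.+1)%type). Qed.

Hypothesis n0 : (0 < n)%N.
Hypothesis PsK : forall w, Ps (XY w) = w.
Hypothesis XYK : forall y, XY (Ps y) = y.
Hypothesis aPs : forall j y, ana (fun y => Ps y j) y.

Lemma PsiD_MD q : PD q -> MD (PsiD q).
Proof. by move=> qP j; rewrite /cv PsiDc mulr_gt0 ?expR_gt0. Qed.

Lemma PhiD_PD z : MD z -> PD (PhiD z).
Proof. by move=> zM; rewrite /PD /= PhiDg E2_LG// expR_gt0. Qed.

Lemma sum_ek_le w (l : nat) : (l <= n)%N -> \sum_(j < n.+1 | (j <= l)%N) ek j w = - qn w l.
Proof.
move=> ln; have E : \sum_(j < n.+1 | (j <= l)%N) ek j w = \sum_(0 <= j < l.+1) ek j w.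
  by rewrite big_mkord (big_ord_widen_cond n.+1 xpredT (fun j => ek j w)).
rewrite E; elim: l {ln E} => [|l IH]; first by rewrite big_nat1 /ek sub0r.
by rewrite big_nat_recr//= IH /ek /=; ring.
Qed.

Lemma sum_ek w : \sum_(j < n.+1) ek j w = 0.
Proof.
transitivity (\sum_(j < n.+1 | (j <= n)%N) ek j w).
  by apply: eq_bigl => j; rewrite -ltnS ltn_ord.
by rewrite sum_ek_le// /qn insubF ?ltnn// oppr0.
Qed.

Lemma LG_ek x w (c : R) : (forall j, ln (x (cco j)) = c + ek j w / 2) -> @LG R n x = c.
Proof.
move=> H; rewrite /LG (eq_bigr _ (fun j _ => H j)) big_split /= sumr_const card_ord -mulr_suml sum_ek mul0r addr0.
by rewrite -[c *+ _]mulr_natl mulKf// pnatr_eq0.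
Qed.

Lemma sqrt_expR (c : R) : Num.sqrt (expR c) = expR (c / 2).
Proof.
have -> : expR c = expR (c / 2) ^+ 2 by rewrite expr2 -expRD; congr expR; field.
by rewrite sqrtr_sqr ger0_norm// expR_ge0.
Qed.

Lemma yq_PhiD z : MD z -> yq (PhiD z) = XY (Wz (vr z)).
Proof.
move=> zM; apply/funext => i; rewrite /yq PhiDl PhiDg E2_LG// sqrt_expR /lft mulrC mulKf//.
by rewrite gt_eqF// expR_gt0.
Qed.

Lemma ek_Wz z (j : 'I_n.+1) : MD z -> ek j (Wz (vr z)) = 2 * (ln (cv z j) - LG (vr z)).
Proof.
move=> zM; pose S l := \sum_(j < n.+1 | (j <= l)%N) (ln (cv z j) - LG (vr z)).
have S1 (l : nat) : (l <= n)%N -> qn (Wz (vr z)) l = - 2 * S l.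
  rewrite leq_eqVlt => /orP[/eqP ->|ln]; last by rewrite (qnE (Wz (vr z)) (Ordinal ln)) Wzl.
  (* At [l = n] the deviations from the mean add up to 0, in agreement with the default value
     [qn _ n = 0]. *)
  rewrite /qn insubF ?ltnn// /S (eq_bigl xpredT); last by move=> k; rewrite -ltnS ltn_ord.
  rewrite sumrB sumr_const card_ord -[X in _ - X]mulr_natl /LG mulrA mulfV ?pnatr_eq0// mul1r.
  by rewrite subrr mulr0.
have jn : (j <= n)%N by rewrite -ltnS.
have S2 (l : nat) (i : 'I_n.+1) : i = l :> nat -> S l = (if l is l'.+1 then S l' else 0) + (ln (cv z i) - LG (vr z)).
  move=> il; rewrite /S (bigD1 i) ?il//= addrC; congr (_ + _).
  case: l il => [|l'] il.
    by rewrite big1// => k /andP[]; rewrite leqn0 => /eqP k0 /eqP; case; apply: val_inj; rewrite /= k0 il.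
  apply: eq_bigl => k; rewrite -(inj_eq val_inj) /= il; apply/idP/idP; lia.
rewrite /ek S1//; have := S2 j j erefl.
by case: (nat_of_ord j) jn => [|l] ln; [|rewrite S1 ?(ltnW ln)//]; move=> ->; ring.
Qed.

Lemma PsiDK z : MD z -> PsiD (PhiD z) = z.
Proof.
move=> zM; have g0 : expR (LG (vr z)) != 0 by rewrite gt_eqF// expR_gt0.
apply/rowP => m; case: (split_ordP m) => i ->.
  rewrite -[lshift _ i]/(dco i) PsiDd PhiDg PhiDd yq_PhiD// PsK E2_LG//.
  case: unliftP => [k ->|->] //.
  rewrite Wzr mulrN opprK mulrCA -expRD subrr expR0 mulr1 //.
rewrite -[rshift _ i]/(cco i) PsiDc PhiDg yq_PhiD// PsK E2_LG// ek_Wz//.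
rewrite -expRD mulrC mulKf ?pnatr_eq0// addrC subrK lnK// posrE; exact: zM.
Qed.

Lemma LG_PsiD q : PD q -> LG (vr (PsiD q)) = ln (q ord0 (gammaco n)).
Proof.
move=> qP; apply: (@LG_ek _ (Ps (yq q))) => j.
by rewrite /vr PsiDc lnM ?posrE ?expR_gt0// expRK.
Qed.

Lemma Wz_PsiD q : PD q -> Wz (vr (PsiD q)) = Ps (yq q).
Proof.
move=> qP; have g0 : q ord0 (gammaco n) != 0 by rewrite gt_eqF.
apply/funext => i; case: (split_ordP i) => k ->.
  rewrite -[lshift n k]/(qi k) Wzl LG_PsiD// -qnE.
  have := sum_ek_le (Ps (yq q)) (ltnW (ltn_ord k)) => /(congr1 -%R); rewrite opprK => <-.
  rewrite mulr_sumr -sumrN; apply: eq_bigr => j _.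
  rewrite {1}/vr PsiDc lnM ?posrE ?expR_gt0// expRK; by field.
rewrite -[rshift n k]/(pi' k) Wzr LG_PsiD// {1}/vr PsiDd liftK expRN lnK ?posrE//.
by rewrite mulNr opprK mulrC mulKf.
Qed.

Lemma PhiDK q : PD q -> PhiD (PsiD q) = q.
Proof.
move=> qP; have s0 : Num.sqrt (q ord0 (gammaco n)) != 0 by rewrite gt_eqF// sqrtr_gt0.
apply/rowP => a; case: (split_ordP a) => i ->.
  rewrite PhiDl /lft Wz_PsiD// XYK LG_PsiD// -sqrt_expR lnK ?posrE//.
  by rewrite /yq mulrC divfK.
case: (unliftP 0 i) => [j|] ->; last by rewrite -[rshift _ _]/(deltaco n) PhiDd /E1 /dv PsiDd unlift_none.
have -> : lift 0 j = 1 :> 'I_2 by apply: val_inj; rewrite /= ord1.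
rewrite -[rshift _ _]/(gammaco n) PhiDg E2_LG; last exact: PsiD_MD.
by rewrite LG_PsiD// lnK// posrE.
Qed.

Lemma MD_near z : MD z -> nearby (vr z) (fun x => MD (rv x)).
Proof.
move=> zM; have N : nearby (vr z) (fun x => forall j : 'I_n.+1, 0 < x (cco j)).
  by apply: nearby_all => j; apply: ana_gt0; [exact: ana_coord|exact: zM].
by apply: nearbyS N => x Hx j; rewrite /cv mxE.
Qed.

Lemma ana_PhiD z a : MD z -> ana (fun x => PhiD (rv x) ord0 a) (vr z).
Proof.
move=> zM; case: (split_ordP a) => i ->.
  apply: (ana_ext (f := fun x => lft (fun w => XY w i) x)); first by move=> x; rewrite PhiDl rvK.
  by apply: ana_lft => // w; exact: ana_XY.
case: (unliftP 0 i) => [j|] ->; last first.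
  apply: (ana_ext (f := fun x => x (dco ord0))); last exact: ana_coord.
  by move=> x; rewrite -[rshift _ _]/(deltaco n) PhiDd /E1 /dv mxE.
have -> : lift 0 j = 1 :> 'I_2 by apply: val_inj; rewrite /= ord1.
apply: (ana_near (f := fun x => expR (LG x))); first by apply: ana_expR; exact: ana_LG.
by apply: nearbyS (MD_near zM) => x Hx; rewrite -[rshift _ _]/(gammaco n) PhiDg E2_LG// rvK.
Qed.

Lemma ana_PsiD q a : PD q -> ana (fun x => PsiD (rv x) ord0 a) (vr q).
Proof.
move=> qP.
have ag : ana (fun x : 'I_(n + n + 2) -> R => x (gammaco n)) (vr q) by exact: ana_coord.
have ay i : ana (fun x : 'I_(n + n + 2) -> R => x (lshift 2 i) / Num.sqrt (x (gammaco n))) (vr q).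
  apply: ana_div; [exact: ana_coord|by apply: ana_sqrt|by rewrite gt_eqF// sqrtr_gt0].
pose yx (x : 'I_(n + n + 2) -> R) : P := fun i => x (lshift 2 i) / Num.sqrt (x (gammaco n)).
have yE x : yq (rv x) = yx x by apply/funext => i; rewrite /yq /yx !mxE.
have aw (f : P -> R) : (forall w, ana f w) -> ana (fun x => f (Ps (yx x))) (vr q).
  move=> af; apply: (@ana_comp R _ _ (fun y => f (Ps y)) (fun i x => yx x i)); last by move=> j; exact: ay.
  by apply: (@ana_comp R _ _ f (fun i y => Ps y i)); [exact: af|move=> j; exact: aPs].
case: (split_ordP a) => i ->.
  case: (unliftP ord0 i) => [k|] ->.
    apply: (ana_ext (f := fun x => - (x (gammaco n) * Ps (yx x) (pi' k)))).
      by move=> x; rewrite -[lshift _ _]/(dco _) PsiDd liftK yE mxE.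
    apply: anaN; apply: anaM => //; apply: (aw (fun w => w (pi' k))) => w; exact: ana_coord.
  apply: (ana_ext (f := fun x => x (deltaco n))); last exact: ana_coord.
  by move=> x; rewrite -[lshift _ _]/(dco _) PsiDd unlift_none mxE.
apply: (ana_ext (f := fun x => x (gammaco n) * expR (ek i (Ps (yx x)) / 2))).
  by move=> x; rewrite -[rshift _ _]/(cco _) PsiDc yE mxE.
apply: anaM => //; apply: (aw (fun w => expR (ek i w / 2))) => w.
by apply: ana_expR; apply: anaM; [exact: ana_ek|exact: ana_const].
Qed.

Definition gPhi z (a : 'I_(n + n + 2)) : 'I_(n.+1 + n.+1) -> R := fun m => pd (fun z => PhiD z ord0 a) z m.

Lemma gPhiE z i : gPhi z (lshift 2 i) = fun m => pdr m (lft (fun w => XY w i)) (vr z).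
Proof.
apply/funext => m; rewrite /gPhi pd_pdr; apply: pdr_ext => x; by rewrite PhiDl rvK.
Qed.

Lemma gPhi_cas z (j : 'I_2) : MD z -> (forall k, Dd (gPhi z (rshift (n + n) j)) k = 0) /\
  (forall k, Dl (vr z) (gPhi z (rshift (n + n) j)) k = 0).
Proof.
move=> zM; case: (unliftP 0 j) => [j'|] ->.
  have -> : lift 0 j' = 1 :> 'I_2 by apply: val_inj; rewrite /= ord1.
  have aL : ana (@LG R n) (vr z) by exact: ana_LG.
  have E m : gPhi z (rshift (n + n) 1) m = expR (LG (vr z)) * pdr m (@LG R n) (vr z).
    rewrite /gPhi pd_pdr -(pdr_comp1 m (is_derive_expR _) aL).
    apply: pdr_near; first exact: ana_expR.
    by apply: nearbyS (MD_near zM) => x Hx; rewrite -[rshift _ _]/(gammaco n) PhiDg E2_LG// rvK.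
  split=> k; first by rewrite /Dd E [pdr _ _ _](Dd_LG zM) mulr0.
  have := Dl_LG zM k; rewrite /Dl !E => H.
  by rewrite mulrCA [X in _ - X]mulrCA -mulrBr H mulr0.
have E m : gPhi z (rshift (n + n) 0) m = (dco ord0 == m)%:R.
  rewrite /gPhi pd_pdr -(pdr_coord (vr z)); apply: pdr_ext => x.
  by rewrite -[rshift _ _]/(deltaco n) PhiDd /E1 /dv mxE.
split=> k; first by rewrite /Dd E (inj_eq (@lshift_inj n.+1 n.+1)).
by rewrite /Dl !E !dco_cco !mulr0 subrr.
Qed.

(** Chain rule and bilinearity reduce the claim to brackets of the components. The last two are
    Casimirs, and [bracket0] has no term in their directions; for the others [brv_lft] leads back to
    the canonical brackets of [Xf] and [Yf]. *)
Lemma PhiD_canonical (F G : 'rV[R]_(n + n + 2) -> R) z : MD z ->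
  differentiable F (PhiD z) -> differentiable G (PhiD z) ->
  bracketD (F \o PhiD) (G \o PhiD) z = bracket0 F G (PhiD z).
Proof.
move=> zM dF dG.
have gF (H : 'rV[R]_(n + n + 2) -> R) : differentiable H (PhiD z) ->
    (fun m => pd (H \o PhiD) z m) = fun m => \sum_a pd H (PhiD z) a * gPhi z a m.
  by move=> dH; apply/funext => m; rewrite pd_comp// => a; exact: ana_PhiD.
transitivity (brv z (fun m => pd (F \o PhiD) z m) (fun m => pd (G \o PhiD) z m)); first by [].
rewrite (gF F dF) (gF G dG) brv_linl.
have Z1 (j : 'I_2) u : brv z u (gPhi z (rshift (n + n) j)) = 0.
  by have [h1 h2] := gPhi_cas j zM; exact: brv0r.
have Z2 (j : 'I_2) u : brv z (gPhi z (rshift (n + n) j)) u = 0 by rewrite brvC Z1 oppr0.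
have B i j : brv z (gPhi z (lshift 2 i)) (gPhi z (lshift 2 j)) = br (fun w => XY w i) (fun w => XY w j) (Wz (vr z)).
  by rewrite !gPhiE; apply: brv_lft => // w; exact: ana_XY.
have X k : (fun w : P => XY w (qi k)) = Xf k by apply/funext => w; exact: XYl.
have Y k : (fun w : P => XY w (pi' k)) = Yf k by apply/funext => w; exact: XYr.
have inner i : brv z (gPhi z (lshift 2 i)) (fun m => \sum_a pd G (PhiD z) a * gPhi z a m) =
    \sum_j pd G (PhiD z) (lshift 2 j) * br (fun w => XY w i) (fun w => XY w j) (Wz (vr z)).
  rewrite brv_linr big_split_ord /= [X in _ + X]big1 ?addr0; last by move=> j _; rewrite Z1 mulr0.
  by apply: eq_bigr => j _; rewrite B.
rewrite big_split_ord /= [X in _ + X]big1 ?addr0; last by move=> j _; rewrite Z2 mulr0.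
rewrite sum_n2 /bracket0; apply: eq_bigr => k _.
rewrite -[lshift n k]/(qi k) -[rshift n k]/(pi' k) !inner !sum_n2.
rewrite (eq_bigr (fun l : 'I_n => pd G (PhiD z) (yco l) * (l == k)%:R)); last first.
  move=> l _; rewrite -[lshift n l]/(qi l) -[rshift n l]/(pi' l) !X !Y br_XX br_XY mulr0 add0r.
  by rewrite eq_sym.
rewrite [X in _ + _ * X](eq_bigr (fun l : 'I_n => - pd G (PhiD z) (xco l) * (l == k)%:R)); last first.
  move=> l _; rewrite -[lshift n l]/(qi l) -[rshift n l]/(pi' l) !X !Y br_YY mulr0 addr0 brC br_XY.
  by rewrite mulrN mulNr.
rewrite (sum_delta (fun l => pd G (PhiD z) (yco l))) (sum_delta (fun l => - pd G (PhiD z) (xco l))).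
by rewrite mulrN.
Qed.

Lemma HD_PsiD q : PD q -> HD (PsiD q) = q ord0 (gammaco n) ^+ 2 * Ht (Ps (yq q)).
Proof.
move=> qP; rewrite /HD /Ht mulrDr; congr (_ + _).
  rewrite big_mkcond big_ord_recl /= add0r mulrCA; congr (_ * _); rewrite mulr_sumr.
  apply: eq_bigr => k _; rewrite /dv PsiDd liftK pnE /=.
  by rewrite sqrrN exprMn.
rewrite mulr_sumr; apply: eq_bigr => j _; rewrite /cv PsiDc exprMn; congr (_ * _).
by rewrite expr2 -expRD; congr expR; field.
Qed.

Lemma HD_action : exists h : ('I_n -> R) -> R -> R -> R, forall q, PD q ->
  HD (PsiD q) = h (action q) (q ord0 (deltaco n)) (q ord0 (gammaco n)).
Proof.
(* The energy scales with [gamma^2], and the actions with [gamma] because the coordinates carry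
   [gamma^(1/2)]; so [Ht] is taken at the actions divided by [g]. *)
exists (fun J _ g => g ^+ 2 * Ht (Ps (fun i => match fintype.split i with
  | inl k => Num.sqrt (2 * (J k / g)) | inr k => 0 end))) => q qP.
rewrite HD_PsiD// (G_action n0 PsK XYK aPs); congr (_ * Ht (Ps _)).
apply/funext => i; case: (fintype.split i) => k //; congr (Num.sqrt (2 * _)).
have g0 : q ord0 (gammaco n) != 0 by rewrite gt_eqF.
rewrite /action /yq -[lshift 2 (qi k)]/(xco k) -[lshift 2 (pi' k)]/(yco k) !expr_div_n sqr_sqrtr ?ltW//.
by field.
Qed.

End Transfer.

Theorem theorem5p1 (R : realType) (n : nat) (hn : (2 <= n)%N) :
  exists (Phi : 'rV[R]_(n.+1 + n.+1) -> 'rV[R]_(n + n + 2))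
         (Psi : 'rV[R]_(n + n + 2) -> 'rV[R]_(n.+1 + n.+1)),
    (* Phi is a real analytic diffeomorphism M^(D) -> P^(D) with inverse Psi *)
    ((forall z, MD z -> PD (Phi z)) /\
     (forall q, PD q -> MD (Psi q)) /\
     (forall z, MD z -> Psi (Phi z) = z) /\
     (forall q, PD q -> Phi (Psi q) = q) /\
     analytic_on (@MD R n) Phi /\
     analytic_on (@PD R n) Psi) /\
    (* the last two components of Phi are the Casimirs E1, E2 *)
    (forall z, MD z -> Phi z ord0 (deltaco n) = E1 z /\ Phi z ord0 (gammaco n) = E2 z) /\
    (* Phi is canonical: it preserves Poisson brackets *)
    (forall F G : 'rV[R]_(n + n + 2) -> R,
        (forall q, PD q -> differentiable F q) ->
        (forall q, PD q -> differentiable G q) ->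
        forall z, MD z ->
          bracketD (F \o Phi) (G \o Phi) z = bracket0 F G (Phi z)) /\
    (* H o Phi^{-1} depends only on the actions and on E1, E2 *)
    (exists h : ('I_n -> R) -> R -> R -> R,
        forall q, PD q ->
          HD (Psi q) = h (action q) (q ord0 (deltaco n)) (q ord0 (gammaco n))).
Proof.
have n0 : (0 < n)%N by exact: ltnW.
have [Ps [PsK XYK aPs]] := @XY_global R n n0.
exists (@PhiD R n), (PsiD Ps); split; [|split; [|split]].
- split; first exact: PhiD_PD.
  split; first exact: PsiD_MD.
  split; first exact: PsiDK.
  split; first exact: PhiDK.
  by split=> x Hx j; apply: ana_analytic_at; [exact: ana_PhiD|exact: ana_PsiD].
- by move=> z _; rewrite PhiDd PhiDg.
- by move=> F G dF dG z zM; apply: PhiD_canonical => //; [apply: dF|apply: dG]; exact: PhiD_PD.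
- exact: HD_action.
Qed.
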